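(* Let $X$ be the branching Markov process of the context. Assume the spectral assumption and that $\gamma$ is bounded. Let $q\ge2$ be an even integer, suppose that $\sup_{y\in E}\mathcal E_y[N^q]<\infty$, and let $f\in B(E)$. Then, for any $x\in E$, as $t\to\infty$, $$\mathrm e^{-\mathrm{Re}\lambda_{m_L}t}\Big(X_t[f]-\sum_{i=1}^{m_L}\sum_{j=1}^{p_i}\sum_{k=1}^{k_{i,j}}\tilde\varphi^{(k)}_{i,j}\big[\mathrm e^{(\lambda_i+\mathcal N)t}f\big]\,W^{(k)}_{i,j}(x)\Big)\to 0\quad\text{in }L^q(\mathbb P_{\delta_x}),$$ where $W^{(k)}_{i,j}(x)$ is the $\mathbb P_{\delta_x}$-almost sure limit as $t\to\infty$ of the martingale $M^{(k)}_{i,j,t}:=X_t[\mathrm e^{-(\lambda_i+\mathcal N)t}\varphi^{(k)}_{i,j}]$, $t\ge0$.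
   Context: Process. $E$ is a Polish space, $\dagger\notin E$ a cemetery (absorbing) state. $B(E)$ is the set of bounded measurable $f:E\to\mathbb C$, extended by $f(\dagger)=0$; $B_1(E)=\{f\in B(E):\|f\|_\infty\le 1\}$; $\mu[f]=\int f\,d\mu$. $(\xi,\mathbf P_x)$ is a càdlàg Markov process in $E\cup\{\dagger\}$ with expectation $\mathbf E_x$; $\gamma:E\to[0,\infty)$ is measurable; for $y\in E$, $\mathcal Z=\sum_{i=1}^N\delta_{x_i}$ is, under $\mathcal P_y$ (expectation $\mathcal E_y$), a random finite point measure on $E$. $X_t=\sum_{i=1}^{N_t}\delta_{x_i(t)}$ is the branching Markov process in which particles move independently as $\xi$, a particle at $y$ branches at rate $\gamma(y)$ and is then replaced by offspring at the atoms of a copy of $\mathcal Z$ under $\mathcal P_y$, which evolve independently in the same way. $\mathbb P_{\delta_x},\mathbb E_{\delta_x}$ are the law and expectation of $X$ started from one particle at $x$; $\psi_t[f](x)=\mathbb E_{\delta_x}[X_t[f]]$. Eigenvalues. $\lambda\in\mathbb C$ is an eigenvalue of $\psi$ with finite-dimensional generalised eigenspace $A_\lambda\subset B(E)$ if there is a bounded (in sup norm) projection $\Pi_\lambda:B(E)\to A_\lambda$ such that, with $K_\lambda=\ker\Pi_\lambda$, $B(E)=A_\lambda\oplus K_\lambda$, both $A_\lambda,K_\lambda$ are invariant under every $\psi_t$, and $\psi_t|_{A_\lambda}=\mathrm e^{(\lambda+\mathcal N_\lambda)t}$ with $\mathcal N_\lambda:A_\lambda\to A_\lambda$ nilpotent.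 For eigenvalues $\lambda_1,\dots,\lambda_m$ fix Jordan bases $\varphi^{(k)}_{i,j}$ ($1\le j\le p_i$, $1\le k\le k_{i,j}$) of $A_{\lambda_i}$: $\mathcal N_{\lambda_i}\varphi^{(k)}_{i,1}=0$, $\mathcal N_{\lambda_i}\varphi^{(k)}_{i,j}=\varphi^{(k)}_{i,j-1}$ for $j\ge2$. $\tilde\varphi^{(k)}_{i,j}:B(E)\to\mathbb C$ are the bounded linear coordinate maps: $\tilde\varphi^{(k)}_{i,j}[\varphi^{(k)}_{i,j}]=1$, and $\tilde\varphi^{(k)}_{i,j}$ vanishes on all other basis functions (also those of the other eigenspaces) and on $K_{\lambda_i}$. $\Phi_{i,j}[f]=\sum_{k=1}^{k_{i,j}}\tilde\varphi^{(k)}_{i,j}[f]\varphi^{(k)}_{i,j}$, $\Phi_i=\sum_{j=1}^{p_i}\Phi_{i,j}$. For $f=\sum_i f_{\lambda_i}+f_0$ with $f_{\lambda_i}\in A_{\lambda_i}$, $f_0\in\bigcap_iK_{\lambda_i}$, set $\mathcal Nf=\sum_i\mathcal N_{\lambda_i}f_{\lambda_i}$; $\mathcal N^0$ is the identity and $\mathrm e^{(\lambda+\mathcal N)t}f=\mathrm e^{\lambda t}\sum_{l\ge0}t^l\mathcal N^lf/l!$. Spectral assumption. There exist $m\ge1$, a real $\lambda_1>0$ and $\lambda_2,\dots,\lambda_m\in\mathbb C$ with $\lambda_1>\mathrm{Re}\lambda_2\ge\dots\ge\mathrm{Re}\lambda_m$, all eigenvalues of $\psi$ with finite-dimensional generalised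 eigenspaces $A_{\lambda_i}$ (that is, for each $i$ there is a bounded projection $\Pi_{\lambda_i}:B(E)\to A_{\lambda_i}$ with kernel $K_{\lambda_i}$ such that $B(E)=A_{\lambda_i}\oplus K_{\lambda_i}$, both $A_{\lambda_i},K_{\lambda_i}$ are invariant under every $\psi_t$, and $\psi_t|_{A_{\lambda_i}}=\mathrm e^{(\lambda_i+\mathcal N_{\lambda_i})t}$ with $\mathcal N_{\lambda_i}$ nilpotent), such that $$\sup_{x\in E,f\in B_1(E)}\mathrm e^{-\mathrm{Re}\lambda_mt}\,t\,\Big|\psi_t[f](x)-\sum_{i=1}^m\mathrm e^{(\lambda_i+\mathcal N)t}\Phi_i[f](x)\Big|\to0,\quad t\to\infty.$$ The list $\lambda_1,\dots,\lambda_m$ is closed under complex conjugation and the Jordan bases are chosen so that the conjugate of each basis function is a basis function. $m_L=\max\{1\le i\le m:2\mathrm{Re}\lambda_i>\lambda_1\}$.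
   Formalization: Since the a.s. limit of M over all real t can fail to exist, W is shown to exist as the a.s. limit of M along every sequence of times tending to infinity; the L^q convergence is proved for this W, and also for any W that is the a.s. limit of M as t→∞. *)

(* Defs.v *)
From HB Require Import structures.
From mathcomp Require Import all_boot all_order all_algebra.
From mathcomp Require Import all_classical all_reals all_analysis.
From mathcomp Require Import complex.

Set Implicit Arguments.
Unset Strict Implicit.
Unset Printing Implicit Defensive.
Import Order.TTheory GRing.Theory Num.Theory.
Import numFieldNormedType.Exports.
Local Open Scope classical_set_scope.
Local Open Scope ring_scope.

Notation creal := (@complex.Re _).
Notation cimag := (@complex.Im _).
Notation cnorm := (@ComplexField.Normc.normc _).
Local Open Scope complex_scope.

Definition cexp (R : realType) (z : R[i]) : R[i] :=
  (expR (creal z) * cos (cimag z)) +i* (expR (creal z) * sin (cimag z)).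

Definition cmeasurable (R : realType) d (T : measurableType d) (f : T -> R[i]) :=
  measurable_fun setT (fun x => creal (f x)) /\
  measurable_fun setT (fun x => cimag (f x)).

Definition cexpectation (R : realType) d (T : measurableType d)
    (P : probability T R) (Z : T -> R[i]) : R[i] :=
  (\int[P]_w creal (Z w)) +i* (\int[P]_w cimag (Z w)).

(* The metric of [E] only serves to express complete metrizability: nothing
   else below depends on more than the topology of [E] and its Borel sets. *)
Definition polish (R : realType) (E : completePseudoMetricType R) :=
  hausdorff_space E /\ exists2 S : set E, countable S & dense S.

Notation borel E := (g_sigma_algebraType (@open E)).

Section BoundedMeasurable.
Context (R : realType) (E : completePseudoMetricType R).

Definition BE : set (E -> R[i]) :=
  [set f | @cmeasurable R _ (borel E) f /\ exists M, forall x, cnorm (f x) <= M].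

Definition BE1 : set (E -> R[i]) :=
  [set f | BE f /\ forall x, cnorm (f x) <= 1].

(* The state space with cemetery is [option E], [None] being the cemetery;
   functions on [E] are extended by 0. *)
Definition at_dagger (V : nmodType) (f : E -> V) (o : option E) : V :=
  if o is Some y then f y else 0.

End BoundedMeasurable.

Section Ingredients.
Context (R : realType) (E : completePseudoMetricType R).

(* Only the topology of [E] enters in the two path conditions: right-continuity
   at the cemetery follows from absorption, and no left limit is required at the
   killing time, so that every usual choice of the topology of E + {cemetery}
   (isolated cemetery, one-point compactification) is covered. *)
Record markov_process d (Path : measurableType d) := MarkovProcess {
  xi_law : R.-pker borel E ~> Path;
  xi : R -> Path -> option E;
  xi_measurable : forall t (B : set (borel E)), 0 <= t -> measurable B ->
    measurable (xi t @^-1` (Some @` B));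
  xi_start : forall y : E, {ae xi_law y, forall w, xi 0 w = Some y};
  xi_absorbed : forall w s t, 0 <= s <= t -> xi s w = None -> xi t w = None;
  xi_right_continuous : forall w t y, 0 <= t -> xi t w = Some y ->
    forall U, nbhs y U -> \forall s \near t^'+, (Some @` U) (xi s w);
  xi_left_limit : forall w t y, 0 < t -> xi t w = Some y ->
    exists z : E, forall U, nbhs z U -> \forall s \near t^'-, (Some @` U) (xi s w);
  xi_markov : forall (y : E) s t (A : set Path) (B : set (borel E)),
    0 <= s -> 0 <= t -> measurable B ->
    <<s [set C | exists r (D : set (borel E)),
           [/\ 0 <= r <= s, measurable D & C = xi r @^-1` (Some @` D)]] >> A ->
    xi_law y (A `&` xi (s + t) @^-1` (Some @` B)) =
    (\int[xi_law y]_(w in A)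
       if xi s w is Some z then xi_law z (xi t @^-1` (Some @` B)) else 0)%E }.

(* The point measure is the sum of the Dirac masses at [off_pos i], for
   [i < off_num]; the positions of larger index are irrelevant. *)
Record offspring d (Off : measurableType d) := Offspring {
  off_law : R.-pker borel E ~> Off;
  off_num : Off -> nat;
  off_pos : nat -> Off -> E;
  off_num_measurable : measurable_fun setT off_num;
  off_pos_measurable : forall i,
    measurable_fun setT (off_pos i : Off -> borel E) }.

End Ingredients.

Section BranchingProcess.
Context (R : realType) (E : completePseudoMetricType R).
Context dP (Path : measurableType dP) (X : markov_process E Path).
Context (gamma : E -> R).
Context dO (Off : measurableType dO) (Z : offspring E Off).

(* The life of a particle: its motion, an exponential clock, its offspring. *)
Definition life := (Path * measurableTypeR R * Off)%type.

(* A particle branches when the rate integrated along its path exceeds the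
   clock, that is, at rate [gamma]; +oo means that it never branches. *)
Definition lifetime (w : Path) (c : R) : \bar R :=
  ereal_inf [set t%:E | t in [set t : R | 0 <= t /\
    (c%:E < \int[@lebesgue_measure R]_(s in `[0%R, t])
              (at_dagger gamma (xi X s w))%:E)%E]].

Definition branch_place (w : Path) (c : R) : option E :=
  if lifetime w c is r%:E%E then xi X r w else None.

(* The law of the life of a particle born at [y]. When the particle does not
   branch, its offspring is never used and is drawn from an arbitrary law. *)
Definition life_law (y : E) (B : set life) : \bar R :=
  (\int[xi_law X y]_w \int[exponential_prob (1 : R)]_c
     off_law Z (odflt y (branch_place w c)) [set z | B (w, c, z)])%E.

(* Particles are labelled by words: the root is [::], and [i :: v] is the child
   number [i] of [v]. [birth x L u] is the time and place of birth of the
   particle [u] if the root starts at [x] and [L] gives the lives, or [None] if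
   there is no such particle. *)
Fixpoint birth (x : E) (L : seq nat -> life) (u : seq nat) : option (R * E) :=
  if u is i :: v then
    if birth x L v is Some (b, _) then
      let: (w, c, z) := L v in
      if lifetime w c is r%:E%E then
        if (i < off_num Z z)%N then Some (b + r, off_pos Z i z) else None
      else None
    else None
  else Some (0, x).

Definition position (x : E) (L : seq nat -> life) (t : R) (u : seq nat) :
    option E :=
  if birth x L u is Some (b, _) then
    let: (w, c, _) := L u in
    if (b <= t) && ((t - b)%:E < lifetime w c)%E then xi X (t - b) w else None
  else None.

(* [bmp_branching]: conditionally on the lives of the particles of the previous
   generations, the lives of the particles of generation [n] are independent
   and each has law [life_law] at its place of birth. *)
Record branching_process d (Omega : measurableType d) := BranchingProcess {
  bmp_law : E -> probability Omega R;
  bmp_life : seq nat -> Omega -> life;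
  bmp_life_measurable : forall u, measurable_fun setT (bmp_life u);
  bmp_branching : forall (x : E) n (us : seq (seq nat))
      (B : seq nat -> set life) (A : set Omega),
    uniq us -> (forall u, u \in us -> size u = n) ->
    (forall u, measurable (B u)) ->
    <<s [set C | exists v (D : set life),
           [/\ (size v < n)%N, measurable D & C = bmp_life v @^-1` D]] >> A ->
    bmp_law x (A `&` [set w | forall u, u \in us ->
       birth x (bmp_life ^~ w) u <> None /\ B u (bmp_life u w)]) =
    (\int[bmp_law x]_(w in A) \big[*%E/1]_(u <- us)
       if birth x (bmp_life ^~ w) u is Some (_, y) then life_law y (B u)
       else 0)%E }.

Context d (Omega : measurableType d) (Y : branching_process Omega).

(* [X_t[f]] when the process starts from one particle at [x]. The sum is finite
   whenever finitely many particles are alive. *)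
Definition bmp_eval (x : E) (t : R) (f : E -> R[i]) (w : Omega) : R[i] :=
  \sum_(u \in [set: seq nat]) at_dagger f (position x (bmp_life Y ^~ w) t u).

Definition psi (t : R) (f : E -> R[i]) (x : E) : R[i] :=
  cexpectation (bmp_law Y x) (bmp_eval x t f).

End BranchingProcess.

Section Spectral.
Context (R : realType) (E : completePseudoMetricType R).
Local Notation F := (E -> R[i]).

Definition linear_on (V : lmodType R[i]) (D : set F) (T : F -> V) :=
  forall (a : R[i]) f g, D f -> D g -> T (a *: f + g) = a *: T f + T g.

(* The function exp((lambda + N) t) f, as a pointwise exponential series. *)
Definition exp_op (lambda : R[i]) (N : F -> F) (t : R) (f : F) : F := fun x =>
  cexp (lambda * t%:C) *
  limn (fun n => \sum_(0 <= l < n) (t ^+ l / l`!%:R)%:C * iter l N f x : R[i]^o).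

(* [Pi] is the projection onto the range A = [set f | BE f /\ Pi f = f], with
   kernel K = [set f | BE f /\ Pi f = 0]. *)
Definition generalised_eigenvalue (ps : R -> F -> F) (lambda : R[i])
    (Pi N : F -> F) :=
  let A := [set f | BE f /\ Pi f = f] in
  let K := [set f | BE f /\ Pi f = 0] in
  [/\ [/\ linear_on (@BE R E) Pi,
          forall f, BE f -> A (Pi f) &
          exists M, forall f x, BE1 f -> cnorm (Pi f x) <= M],
      exists n (b : 'I_n -> F), forall f, A f ->
        exists a : 'I_n -> R[i], f = \sum_i a i *: b i,
      forall t f, 0 <= t -> (A f -> A (ps t f)) /\ (K f -> K (ps t f)),
      [/\ linear_on A N, forall f, A f -> A (N f) &
          exists n, forall f, A f -> iter n N f = 0] &
      forall t f, 0 <= t -> A f -> ps t f = exp_op lambda N t f].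

(* Indices start at 1. [sd_k i j] is k_{i,j}; [sd_phi i j k] is the basis function
   phi_{i,j}^(k) and [sd_phit i j k] its coordinate map; [sd_Pi i] and [sd_N i]
   only matter on [BE] and on the range of [sd_Pi i]. *)
Record spectral_data := SpectralData {
  sd_m : nat;
  sd_lambda : nat -> R[i];
  sd_Pi : nat -> F -> F;
  sd_N : nat -> F -> F;
  sd_p : nat -> nat;
  sd_k : nat -> nat -> nat;
  sd_phi : nat -> nat -> nat -> F;
  sd_phit : nat -> nat -> nat -> F -> R[i] }.

Variable S : spectral_data.

Definition basis_index i j k :=
  [/\ (1 <= i <= sd_m S)%N, (1 <= j <= sd_p S i)%N & (1 <= k <= sd_k S i j)%N].

Definition jordan_basis i :=
  let A := [set f | BE f /\ sd_Pi S i f = f] in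
  let comb (a : nat -> nat -> R[i]) : F :=
    \sum_(1 <= j < (sd_p S i).+1) \sum_(1 <= k < (sd_k S i j).+1)
      a j k *: sd_phi S i j k in
  [/\ (1 <= sd_p S i)%N /\
        (forall j, (1 <= j <= sd_p S i)%N -> (1 <= sd_k S i j)%N) /\
        (forall j, (1 <= j < sd_p S i)%N -> (sd_k S i j.+1 <= sd_k S i j)%N),
      forall j k, basis_index i j k -> A (sd_phi S i j k),
      forall a, comb a = 0 -> forall j k, basis_index i j k -> a j k = 0,
      forall f, A f -> exists a, f = comb a &
      forall j k, basis_index i j k ->
        sd_N S i (sd_phi S i j k) = if j == 1%N then 0 else sd_phi S i j.-1 k].

Definition coordinate_map i j k :=
  let T := sd_phit S i j k in
  [/\ linear_on (@BE R E) (T : F -> R[i]^o),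
      exists M, forall f, BE1 f -> cnorm (T f) <= M,
      forall i' j' k', basis_index i' j' k' ->
        T (sd_phi S i' j' k') = ((i', j', k') == (i, j, k))%:R &
      forall f, BE f -> sd_Pi S i f = 0 -> T f = 0].

Definition Phi i (f : F) : F :=
  \sum_(1 <= j < (sd_p S i).+1) \sum_(1 <= k < (sd_k S i j).+1)
    sd_phit S i j k f *: sd_phi S i j k.

(* [sd_Pi S i f] is the component of [f] in the i-th generalised eigenspace. *)
Definition calN (f : F) : F :=
  \sum_(1 <= i < (sd_m S).+1) sd_N S i (sd_Pi S i f).

Definition spectral_assumption (ps : R -> F -> F) :=
  let m := sd_m S in
  let lambda := sd_lambda S in
  [/\ [/\ (1 <= m)%N, cimag (lambda 1%N) = 0 /\ 0 < creal (lambda 1%N),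
          forall i, (1 < i <= m)%N -> creal (lambda i) < creal (lambda 1%N),
          forall i, (1 < i < m)%N -> creal (lambda i.+1) <= creal (lambda i) &
          forall i j, (1 <= i <= m)%N -> (1 <= j <= m)%N ->
            lambda i = lambda j -> i = j],
      forall i, (1 <= i <= m)%N ->
        generalised_eigenvalue ps (lambda i) (sd_Pi S i) (sd_N S i) /\
        jordan_basis i,
      forall i j k, basis_index i j k -> coordinate_map i j k,
      (ereal_sup [set e | exists x f, BE1 f /\
          e = (expR (- creal (lambda m) * t) * t *
               cnorm (ps t f x - \sum_(1 <= i < m.+1)
                       exp_op (lambda i) calN t (Phi i f) x))%:E]
        @[t --> +oo%R] --> 0)%E &
      (forall i, (1 <= i <= m)%N ->
         exists2 i', (1 <= i' <= m)%N & lambda i' = conjc (lambda i)) /\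
      (forall i j k, basis_index i j k -> exists i' j' k',
         basis_index i' j' k' /\
         sd_phi S i' j' k' = (fun x => conjc (sd_phi S i j k x)))].

Definition m_L : nat :=
  \max_(1 <= i < (sd_m S).+1 |
        creal (sd_lambda S 1%N) < 2 * creal (sd_lambda S i)) i.

End Spectral.

Section Conclusion.
Context (R : realType) (E : completePseudoMetricType R).
Context dP (Path : measurableType dP) (X : markov_process E Path).
Context (gamma : E -> R).
Context dO (Off : measurableType dO) (Z : offspring E Off).
Context d (Omega : measurableType d) (Y : branching_process X gamma Z Omega).
Context (S : spectral_data E).

Definition mart (x : E) i j k (t : R) : Omega -> R[i] :=
  bmp_eval Y x t (exp_op (sd_lambda S i) (calN S) (- t) (sd_phi S i j k)).

Definition fluctuation (x : E) (f : E -> R[i])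
    (W : nat -> nat -> nat -> Omega -> R[i]) (t : R) (w : Omega) : R[i] :=
  (expR (- creal (sd_lambda S (m_L S)) * t))%:C *
  (bmp_eval Y x t f w -
   \sum_(1 <= i < (m_L S).+1) \sum_(1 <= j < (sd_p S i).+1)
     \sum_(1 <= k < (sd_k S i j).+1)
       sd_phit S i j k (exp_op (sd_lambda S i) (calN S) t f) * W i j k w).

End Conclusion.

Definition Lq_cvg0 (R : realType) d (T : measurableType d)
    (P : probability T R) (q : nat) (Z : R -> T -> R[i]) :=
  ('N[P]_(q%:R%:E)[(fun w => (cnorm (Z t w))%:E)] @[t --> +oo%R] --> 0)%E.

(* Main.v *)
Require Import Defs.
From HB Require Import structures.
From mathcomp Require Import all_boot all_order all_algebra finmap.
From mathcomp Require Import all_classical all_reals all_analysis.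
From mathcomp Require Import measurable_realfun complex.
From mathcomp Require Import ring lra zify.
Set Implicit Arguments.
Unset Strict Implicit.
Unset Printing Implicit Defensive.
Import Order.TTheory GRing.Theory Num.Theory.
Import numFieldNormedType.Exports.
Local Open Scope classical_set_scope.
Local Open Scope ring_scope.
Local Notation measT := (measurable_fun setT).

(** The branching Markov property is obtained generation by generation: a life
    is Markov up to its branching time, the exploration of the first K
    generations is an iterated integral, and a monotone-class argument passes
    from cylinder events to functionals.  A particle alive at time s starts an
    independent copy, so a power Taylor expansion over the particles alive at s
    (whose labels form an antichain) gives a Marcinkiewicz-Zygmund bound
      E |X_{s+t}[h] - X_s[psi_t h]|^{2p} <= C E N_s^p       (t <= 1, |h| <= 1).
    For a family with psi_{t-s} g_t = g_s and |g_r| <= B e^{-ar}, telescoping in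
    unit steps turns a bound E N_s^p <= C e^{p l s} with a > l/2 into
      E |X_t[g_t] - X_s[g_s]|^{2p} <= C B^{2p} e^{-2p(a - l/2)s}.
    With g_r = psi_{T-r} 1 this yields the growth of the moments of N.  With
    g_r = e^{-(lambda+N)r} phi it gives the L^q rate of the martingales and,
    with Doob's inequality and Borel-Cantelli, their almost sure convergence.
    With g_r = psi_{T-r} f_0, where f_0 is the part of f outside the eigenspaces
    1..m_L, it shows that X_T[f_0] is negligible: |psi_r f_0| <= eta e^{rho r}
    for r >= s_0, and the last s_0 units of time only contribute an error
    of relative size e^{-q(rho - l/2)(T - s_0)}. *)

(** * Positive operators on nonnegative measurable functions *)

(** The hypothesis [bmp_branching] describes lives at their births, one generation at a time,
    whereas the particles alive at a time s belong to different generations and are in the middle of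
    their lives. Two devices bridge this gap. The Markov property of the path is joined to the
    memorylessness of the clock: the probability of surviving to s, given the path, is a function of
    the past of the path. And events are encoded by avoidance of sets, which an unborn or dead
    particle satisfies trivially, so that expectations factor over the tree without case
    distinctions. No moment of N is assumed finite: births are discounted by e^(-theta b), with
    theta so large that the discounted generations decrease geometrically. A fluctuation of order 2p
    costs only the p-th moment of N, hence the induction on moments by halving. Rates are taken with
    slack: lambda_1 is replaced by some l with lambda_1 < l < 2 Re lambda_(m_L), which absorbs the
    polynomial factors of Jordan blocks. No regularity of t -> X_t[f] is at hand; the maximal
    inequality is therefore applied to finite lists of times, and limits are taken along sequences
    of times. *)

Section PositiveOperators.
Context (R : realType) d (T : measurableType d).
Local Open Scope ereal_scope.

Definition nnm (f : T -> \bar R) :=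
  (forall x, 0 <= f x) /\ measurable_fun [set: T] f.

Record posop (I : (T -> \bar R) -> \bar R) : Prop := Posop {
  posop_ge0 : forall f, nnm f -> 0 <= I f;
  posop_le : forall f g, nnm f -> nnm g -> (forall x, f x <= g x) -> I f <= I g;
  posopD : forall f g, nnm f -> nnm g ->
    I (fun x => f x + g x) = I f + I g;
  posopZ : forall (c : R) f, (0 <= c)%R -> nnm f ->
    I (fun x => c%:E * f x) = c%:E * I f;
  posop_lim : forall f : (T -> \bar R)^nat, (forall n, nnm (f n)) ->
    (forall x, nondecreasing_seq (f ^~ x)) ->
    I (fun x => limn (f ^~ x)) = limn (fun n => I (f n)) }.

Lemma nnm_indic (A : set T) : measurable A -> nnm (fun x => (\1_A x)%:E).
Proof.
move=> mA; split=> [x|]; first by rewrite lee_fin.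
exact/measurable_EFinP/measurable_indic.
Qed.

Lemma nnm_cst (c : \bar R) : 0 <= c -> nnm (cst c).
Proof. by move=> c0; split. Qed.

Lemma nnmD f g : nnm f -> nnm g -> nnm (fun x => f x + g x).
Proof.
move=> [f0 mf] [g0 mg]; split=> [x|]; first exact: adde_ge0.
exact: emeasurable_funD.
Qed.

Lemma nnmM f g : nnm f -> nnm g -> nnm (fun x => f x * g x).
Proof.
move=> [f0 mf] [g0 mg]; split=> [x|]; first exact: mule_ge0.
exact: emeasurable_funM.
Qed.

Lemma nnmZ (c : R) f : (0 <= c)%R -> nnm f -> nnm (fun x => c%:E * f x).
Proof. by move=> c0 nf; apply: nnmM => //; exact: nnm_cst. Qed.

Lemma nnm_sum I (s : seq I) (f : I -> T -> \bar R) :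
  (forall i, nnm (f i)) -> nnm (fun x => \sum_(i <- s) f i x).
Proof.
move=> nf; elim: s => [|i s ih].
  by under eq_fun do rewrite big_nil; exact: nnm_cst.
by under eq_fun do rewrite big_cons; exact: nnmD.
Qed.

Lemma nnm_prod I (s : seq I) (f : I -> T -> \bar R) :
  (forall i, nnm (f i)) -> nnm (fun x => \big[*%E/1]_(i <- s) f i x).
Proof.
move=> nf; elim: s => [|i s ih].
  by under eq_fun do rewrite big_nil; exact: nnm_cst.
by under eq_fun do rewrite big_cons; exact: nnmM.
Qed.

Lemma nd_is_cvgn (u : (\bar R)^nat) : nondecreasing_seq u -> cvgn u.
Proof. exact: ereal_nondecreasing_is_cvgn. Qed.

Import HBNNSimple.

Lemma nnm_ind (P : (T -> \bar R) -> Prop) :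
  (forall A, measurable A -> P (fun x => (\1_A x)%:E)) ->
  (forall (c : R) f, (0 <= c)%R -> nnm f -> P f -> P (fun x => c%:E * f x)) ->
  (forall f g, nnm f -> nnm g -> P f -> P g -> P (fun x => f x + g x)) ->
  (forall f : (T -> \bar R)^nat, (forall n, nnm (f n)) ->
    (forall x, nondecreasing_seq (f ^~ x)) ->
    (forall n, P (f n)) -> P (fun x => limn (f ^~ x))) ->
  forall f, nnm f -> P f.
Proof.
move=> PI PZ PD PL f [f0 mf].
pose f_ := nnsfun_approx measurableT mf.
have -> : f = (fun x => limn ((fun n x => (f_ n x)%:E) ^~ x)).
  by apply/funext => x; apply/esym/cvg_lim => //; exact: cvg_nnsfun_approx.
have P0 : P (fun=> 0).
  have -> : (fun=> 0 : \bar R) = (fun x : T => (\1_(set0 : set T) x)%:E).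
    by apply/funext => x; rewrite indic0.
  exact: PI.
apply: PL => [n|x m n mn|n].
- by split=> [x|]; [rewrite lee_fin|exact/measurable_EFinP].
- by rewrite lee_fin; exact/lefP/nd_nnsfun_approx.
(* [Num.max y 0] equals y on the range of [f_ n] and is nonnegative for every real y, so the
   induction on the list of values carries no side condition. *)
- have -> : (fun x => (f_ n x)%:E) = (fun x => \sum_(y <- enum_fset (fset_set (range (f_ n))))
       (Num.max y 0)%:E * (\1_(f_ n @^-1` [set y]) x)%:E).
    apply/funext => x; rewrite fimfunE fsbig_finite//= -sumEFin.
    rewrite big_seq [RHS]big_seq; apply: eq_bigr => y.
    rewrite in_fset_set// inE => -[z _ <-].
    by rewrite EFinM max_l.
  elim: (enum_fset _) => [|y s ih].
    by under eq_fun do rewrite big_nil; exact: P0.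
  under eq_fun do rewrite big_cons.
  have nI (z : R) : nnm (fun x => (\1_(f_ n @^-1` [set z]) x)%:E).
    exact: nnm_indic.
  apply: PD => //.
  - by apply: nnmZ => //; rewrite le_max lexx orbT.
  - by apply: nnm_sum => z; apply: nnmZ => //; rewrite le_max lexx orbT.
  - by apply: PZ => //; [rewrite le_max lexx orbT|exact: PI].
Qed.

Lemma posop0 (I : (T -> \bar R) -> \bar R) : posop I -> I (fun=> 0) = 0.
Proof.
move=> pI; have := @posopZ _ pI 0%R (cst 0) (lexx _) (nnm_cst (lexx _)).
rewrite mul0e => e0; rewrite -[RHS]e0; congr (I _).
by apply/funext => x; rewrite mul0e.
Qed.

Lemma posop_bigcup (I : (T -> \bar R) -> \bar R) (F : (set T)^nat) : posop I ->
  (forall n, measurable (F n)) -> trivIset setT F ->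
  I (fun x => (\1_(\bigcup_k F k) x)%:E) =
  limn (fun n => \sum_(k <- index_iota 0 n) I (fun x => (\1_(F k) x)%:E)).
Proof.
move=> pI mF tF.
pose g n x : \bar R := \sum_(k <- index_iota 0 n) (\1_(F k) x)%:E.
have ng n : nnm (g n) by apply: nnm_sum => k; exact: nnm_indic.
have -> : (fun x => (\1_(\bigcup_k F k) x)%:E) = fun x => limn (g ^~ x).
  apply/funext => x; rewrite indicE; have [|xF] := boolP (x \in _).
    rewrite inE => -[k _ Fkx]; apply/esym/cvg_lim => //.
    apply: cvg_near_cst; near=> n.
    have kn : (k < n)%N by near: n; exact: nbhs_infty_gt.
    rewrite /g (bigD1_seq k)//= ?iota_uniq//; last first.
      by rewrite mem_index_iota.
    rewrite indicE mem_set// big1 ?adde0// => j jk.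
    rewrite indicE memNset// => Fjx; move/eqP : jk; apply.
    by apply: tF => //; exists x.
  apply/esym; rewrite (_ : g ^~ x = cst 0) ?lim_cst//.
  apply/funext => n; rewrite /g big1// => k _; rewrite indicE memNset// => Fkx.
  by move/negP: xF; apply; rewrite inE; exists k.
rewrite posop_lim//; last first.
  by move=> x m n mn; apply: lee_sum_nneg_natr => // k _ _; rewrite lee_fin.
congr (limn _); apply/funext => n; rewrite /g.
elim: (index_iota 0 n) => [|k s ih].
  by rewrite big_nil; under eq_fun do rewrite big_nil; exact: posop0.
rewrite big_cons; under eq_fun do rewrite big_cons.
rewrite posopD ?ih//; first exact: nnm_indic.
by apply: nnm_sum => j; exact: nnm_indic.
Unshelve. all: by end_near. Qed.

Lemma posop_eq (G : set (set T)) (I1 I2 : (T -> \bar R) -> \bar R) :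
  @measurable _ T = <<s G >> -> setI_closed G -> G setT ->
  posop I1 -> posop I2 -> I1 (cst 1) < +oo ->
  (forall A, G A -> I1 (fun x => (\1_A x)%:E) = I2 (fun x => (\1_A x)%:E)) ->
  forall f, nnm f -> I1 f = I2 f.
Proof.
move=> GE GI GT p1 p2 fin I12.
have ind1 : (fun x => (\1_[set: T] x)%:E : \bar R) = cst 1.
  by apply/funext => x; rewrite indicT.
suff main A : measurable A -> I1 (fun x => (\1_A x)%:E) = I2 (fun x => (\1_A x)%:E).
  apply: nnm_ind => // [c f c0 nf ih|f g nf ng f12 g12|f nf ndf f12].
  - by rewrite !posopZ// ih.
  - by rewrite !posopD// f12 g12.
  - by rewrite !posop_lim//; congr (limn _); apply/funext => n; rewrite f12.
move=> mA; have sA : <<s G >> A by rewrite -GE.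
apply: (@dynkin_induction _ _ G (fun A =>
  I1 (fun x => (\1_A x)%:E) = I2 (fun x => (\1_A x)%:E)) GE GI _ _ _ _ A sA).
- exact: I12.
- exact: I12.
- move=> S mS S12.
  have H I : posop I ->
      I (cst 1) = I (fun x => (\1_S x)%:E) + I (fun x => (\1_(~` S) x)%:E).
    move=> pI; rewrite -posopD//; last 2 first.
      exact: nnm_indic.
      exact/nnm_indic/measurableC.
    congr (I _); apply/funext => x; rewrite indicC /= -EFinD indicE.
    by case: (x \in S); rewrite /= ?addr0 ?add0r.
  have e := I12 _ GT; rewrite ind1 in e.
  have := H _ p1; rewrite e (H _ p2) S12.
  set s := I2 _; set a := I2 _; set b := I1 _ => sab.
  have f2 : I2 (fun x => (\1_S x)%:E) \is a fin_num.
    rewrite ge0_fin_numE; last exact/posop_ge0/nnm_indic.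
    rewrite -S12; apply: le_lt_trans fin; apply: posop_le => //.
    - exact: nnm_indic.
    - by move=> x; rewrite lee_fin indicE; case: (_ \in _).
  have := congr1 (fun z => z - s) sab.
  by rewrite ![s + _]addeC !addeK.
- move=> F mF tF F12; rewrite !posop_bigcup//; congr (limn _).
  by apply/funext => n; apply: eq_bigr => k _.
Qed.

Lemma posop_eval (t : T) : posop (fun f => f t).
Proof. by split=> // f [f0 _]. Qed.

Lemma posop_integral (m : {measure set T -> \bar R}) :
  posop (fun f => \int[m]_x f x).
Proof.
split=> [f [f0 _]|f g [f0 mf] [g0 mg] fg|f g [f0 mf] [g0 mg]|c f c0 [f0 mf]
        |f nf ndf].
- exact: integral_ge0.
- by apply: ge0_le_integral => // x _.
- by rewrite ge0_integralD.
- by rewrite ge0_integralZl_EFin.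
- by apply: monotone_convergence => // [n|n x _]; case: (nf n).
Qed.

End PositiveOperators.
Arguments posop_eval {R d T}.
Arguments posop_integral {R d T}.

Section PositiveOperatorsComposition.
Context (R : realType) d (T : measurableType d).
Local Open Scope ereal_scope.

Lemma nnm_comp d' (S : measurableType d') (h : S -> T) (f : T -> \bar R) :
  measT h -> nnm f -> nnm (f \o h).
Proof.
move=> mh [f0 mf]; split=> [x|]; first exact: f0.
exact: measurableT_comp.
Qed.

Lemma posop_comp d' (S : measurableType d') (h : S -> T) I :
  measT h -> posop I ->
  posop (fun f : T -> \bar R => I (f \o h)).
Proof.
move=> mh pI.
have nh := fun f => @nnm_comp _ _ h f mh.
split=> [f nf|f g nf ng fg|f g nf ng|c f c0 nf|f nf ndf].
- exact/(posop_ge0 pI)/nh.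
- by apply: (posop_le pI) => // [||x]; [exact: nh|exact: nh|exact: fg].
- by rewrite -(posopD pI)//; exact: nh.
- by rewrite -(posopZ pI)//; exact: nh.
- by rewrite -(posop_lim pI)// => [n|x]; [exact: nh|exact: ndf].
Qed.

(** Composition of a weight and a kernel. The weight is real-valued because multiplication by a
    finite number commutes with the increasing limit. *)
Lemma posop_bind d' (S : measurableType d') (I : (S -> \bar R) -> \bar R)
    (g : S -> R) (J : S -> (T -> \bar R) -> \bar R) :
  posop I -> (forall s, (0 <= g s)%R) -> measT g ->
  (forall s, posop (J s)) ->
  (forall f, nnm f -> measT (fun s => J s f)) ->
  posop (fun f => I (fun s => (g s)%:E * J s f)).
Proof.
move=> pI g0 mg pJ mJ.
have nJ f : nnm f -> nnm (fun s => J s f).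
  by move=> nf; split; [move=> s; exact/(posop_ge0 (pJ s))|exact: mJ].
have ng : nnm (fun s => (g s)%:E).
  by split=> [s|]; [rewrite lee_fin|exact/measurable_EFinP].
have nH f : nnm f -> nnm (fun s => (g s)%:E * J s f).
  by move=> nf; apply: nnmM => //; exact: nJ.
split=> [f nf|f h nf nh fh|f h nf nh|c f c0 nf|f nf ndf].
- exact/(posop_ge0 pI)/nH.
- apply: (posop_le pI); [exact: nH|exact: nH|move=> s].
  by apply: lee_wpmul2l; [rewrite lee_fin|exact: (posop_le (pJ s))].
- rewrite -(posopD pI); [|exact: nH|exact: nH].
  congr (I _); apply/funext => s; rewrite (posopD (pJ s))//.
  by rewrite ge0_muleDr//; exact/(posop_ge0 (pJ s)).
- rewrite -(posopZ pI)//; last exact: nH.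
  by congr (I _); apply/funext => s; rewrite (posopZ (pJ s))// muleCA.
- rewrite -(posop_lim pI).
  + congr (I _); apply/funext => s; rewrite (posop_lim (pJ s))//.
    have cJ : cvgn (fun n => J s (f n)).
      apply: nd_is_cvgn => m n mn; apply: (posop_le (pJ s)) => // x.
      exact: ndf.
    by rewrite limeMl.
  + by move=> n; exact: nH.
  + move=> s m n mn; apply: lee_wpmul2l; first by rewrite lee_fin.
    by apply: (posop_le (pJ s)) => // x; exact: ndf.
Qed.

End PositiveOperatorsComposition.

(** * Measurability on a space with an added cemetery *)

Section OptionMeasurable.
Context d (T : measurableType d).

(** [xi_measurable] speaks only of images of Borel sets under [Some]. They are enough to generate
    the sigma-algebra: the cemetery is the complement of the image of the whole space. *)
Definition some_images : set (set (option T)) :=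
  [set C | exists2 B : set T, measurable B & C = Some @` B].

Definition optm : measurableType _ := g_sigma_algebraType some_images.

Lemma measurable_some_image (B : set T) : measurable B ->
  measurable (Some @` B : set optm).
Proof. by move=> mB; apply: sub_sigma_algebra; exists B. Qed.

Lemma measurable_fun_optm d' (S : measurableType d') (f : S -> optm) :
  (forall B : set T, measurable B -> measurable (f @^-1` (Some @` B))) ->
  measT f.
Proof.
move=> mf; apply: (@measurability _ _ S optm setT f some_images) => //.
by move=> _ [_ [B mB ->] <-]; rewrite setTI; exact: mf.
Qed.

Lemma preimage_some_image (B : set T) : Some @^-1` (Some @` B) = B.
Proof.
by apply/seteqP; split=> [y [z Bz [<-]]//|y By]; exists y.
Qed.

Lemma measurable_Some : measT (Some : T -> optm).
Proof. by apply: measurable_fun_optm => B mB; rewrite preimage_some_image. Qed.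

Lemma measurable_fun_isSome : measT (isSome : optm -> bool).
Proof.
apply: (measurable_fun_bool true) => /=; rewrite setTI.
rewrite (_ : _ @^-1` _ = Some @` [set: T]); first exact: measurable_some_image.
by apply/seteqP; split=> -[y|]//= => [_|[]//]; exists y.
Qed.

Lemma measurable_fun_odflt (t : T) : measT (odflt t : optm -> T).
Proof.
move=> _ B mB; rewrite setTI.
rewrite (_ : _ @^-1` _ = (Some @` B) `|` [set o | ~~ isSome o /\ B t]).
  apply: measurableU; first exact: measurable_some_image.
  have [Bt|Bt] := pselect (B t).
    rewrite (_ : [set _ | _] = isSome @^-1` [set false]).
      by have := measurable_fun_isSome measurableT (Y := [set false]); rewrite setTI; exact.
    by apply/seteqP; split=> -[y|]//= [].
  by rewrite (_ : [set _ | _] = set0)//; apply/seteqP; split=> o // [].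
apply/seteqP; split=> -[y|]/=.
- by move=> By; left; exists y.
- by move=> Bt; right.
- by move=> [[z Bz [<-]]//|[]].
- by move=> [[]//|[]].
Qed.

Lemma measurable_fun_match d1 d2 (S : measurableType d1) (U : measurableType d2)
    (h : S -> optm) (k : S * T -> U) (u : S -> U) :
  measT h -> measT k -> measT u ->
  measT (fun s => if h s is Some y then k (s, y) else u s).
Proof.
move=> mh mk mu.
rewrite (_ : (fun _ => _) =
    (fun s => if isSome (h s) then k (s, odflt point (h s)) else u s)); last first.
  by apply/funext => s; case: (h s).
apply: measurable_fun_ifT => //.
- exact: (measurableT_comp measurable_fun_isSome mh).
- apply: (measurableT_comp mk); apply: measurable_fun_pair => //.
  exact: (measurableT_comp (measurable_fun_odflt point) mh).
Qed.

End OptionMeasurable.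
Arguments optm {d}.

Section FiniteIntersections.
Context (T : Type).

(** Turns a generating family into a pi-system containing the whole space, as Dynkin's theorem
    requires. The inductive form lets a member be read off as a finite list of generators. *)
Inductive fcap (G : set (set T)) : set (set T) :=
| fcap0 : fcap G setT
| fcapS A B : G A -> fcap G B -> fcap G (A `&` B).

Lemma fcap_setI G : setI_closed (fcap G).
Proof.
move=> A B GA GB; elim: GA => [|A' B' GA' _ ih]; first by rewrite setTI.
by rewrite -setIA; exact: fcapS.
Qed.

Lemma sub_fcap (G : set (set T)) A : G A -> fcap G A.
Proof. by move=> GA; rewrite -(setIT A); apply: fcapS => //; exact: fcap0. Qed.

Lemma sigma_fcap G : <<s fcap G >> = <<s G >>.
Proof.
apply/seteqP; split; last first.
  by apply: sub_sigma_algebra2 => A; exact: sub_fcap.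
apply: smallest_sub; first exact: smallest_sigma_algebra.
move=> A; elim=> [|A' B GA' _ ih].
  by rewrite -[X in <<s _ >> X]setD0; apply: sigma_algebraCD; exact: sigma_algebra0.
rewrite -(setCK (_ `&` _)) setCI -[X in <<s _ >> X]setTD.
apply: sigma_algebraCD.
rewrite -bigcup2E; apply: sigma_algebra_bigcup => -[|[|n]]/=.
- by rewrite -setTD; apply: sigma_algebraCD; exact: sub_sigma_algebra.
- by rewrite -setTD; exact: sigma_algebraCD.
- exact: sigma_algebra0.
Qed.

End FiniteIntersections.

(** * Joint measurability of right-continuous paths *)

Section BorelTrajectories.
Context (R : realType) (E : completePseudoMetricType R).

Local Notation oE := (@optm _ (borel E)).

Lemma measurable_fun_optm_open d (S : measurableType d) (f : S -> oE) :
  (forall U : set E, open U -> measurable (f @^-1` (Some @` U))) ->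
  measT f.
Proof.
move=> mf; apply: measurable_fun_optm => B.
pose H := [set B : set E | measurable (f @^-1` (Some @` B))].
suff : <<s @open E >> `<=` H by apply.
apply: smallest_sub => //; split.
- by rewrite /H/= image_set0 preimage_set0.
- move=> A HA; rewrite /H/= setTD.
  rewrite (_ : _ @^-1` _ = f @^-1` (Some @` [set: E]) `\` f @^-1` (Some @` A)).
    by apply: measurableD => //; apply: mf; exact: openT.
  apply/seteqP; split=> x /=.
    move=> [y nAy yx]; split; first by exists y.
    by move=> [z Az]; rewrite -yx => -[zy]; apply: nAy; rewrite -zy.
  by move=> [[y _ yx] nA]; exists y => // Ay; apply: nA; exists y.
- move=> F HF; rewrite /H/=.
  rewrite (_ : _ @^-1` _ = \bigcup_k (f @^-1` (Some @` (F k)))).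
    exact: bigcupT_measurable.
  apply/seteqP; split=> x /=.
    by move=> [y [k _ Fy] yx]; exists k => //; exists y.
  by move=> [k _ [y Fy yx]]; exists y => //; exists k.
Qed.

(** Absorption, and right-continuity while alive: both survive shifting and stopping, and together
    they give joint measurability in time and path. *)
Definition rcl (p : R -> option E) :=
  (forall s t, 0 <= s <= t -> p s = None -> p t = None) /\
  (forall t y, 0 <= t -> p t = Some y ->
     forall U, nbhs y U -> \forall s \near t^'+, (Some @` U) (p s)).

Lemma rcl_right p t y (U : set E) : rcl p -> 0 <= t -> p t = Some y -> nbhs y U ->
  exists2 e, 0 < e & forall s, t < s < t + e -> (Some @` U) (p s).
Proof.
move=> [_ pr] t0 pty nU; have := pr _ _ t0 pty _ nU.
move=> [e /= e0 he].
exists e => // s /andP[ts ste]; apply: he => //.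
by rewrite /ball/= ltr_distlC; apply/andP; split; lra.
Qed.

(** The first point of the grid of mesh [1/(n+1)] strictly to the right of [max t 0]. Strictness
    matters because the filter of right neighbourhoods excludes the point itself. *)
Definition right_approx (n : nat) (t : R) : R :=
  (Num.truncn (Num.max t 0 * n.+1%:R)).+1%:R / n.+1%:R.

Lemma right_approxP n t :
  Num.max t 0 < right_approx n t <= Num.max t 0 + n.+1%:R^-1.
Proof.
have t0 : 0 <= Num.max t 0 * n.+1%:R by rewrite mulr_ge0// le_max lexx orbT.
have /andP[h1 h2] := Num.Theory.truncn_itv t0.
rewrite /right_approx ltr_pdivlMr// h2/= ler_pdivrMr// mulrDl mulVf//.
by rewrite -natr1 lerD2r.
Qed.

Lemma measurable_truncn_eq n k :
  measurable [set t : R | Num.truncn (Num.max t 0 * n.+1%:R) = k].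
Proof.
have -> : [set t : R | Num.truncn (Num.max t 0 * n.+1%:R) = k] =
    (fun t => Num.max t 0 * n.+1%:R) @^-1` `[k%:R, k.+1%:R[%classic.
  apply/seteqP; split=> t /=; rewrite in_itv/=;
    have t0 : 0 <= Num.max t 0 * n.+1%:R by rewrite mulr_ge0// le_max lexx orbT.
    by move=> <-; exact: Num.Theory.truncn_itv.
  by move=> /Num.Theory.truncn_def.
have : measT (fun t : R => Num.max t 0 * n.+1%:R).
  by apply: measurable_funM => //; exact: measurable_maxr.
by move=> /(_ measurableT `[k%:R, k.+1%:R[%classic); rewrite setTI; exact.
Qed.

Lemma ltr_truncn_inv (e : R) n : 0 < e -> (Num.truncn e^-1 <= n)%N ->
  n.+1%:R^-1 < e.
Proof.
move=> e0 en; rewrite invf_plt ?posrE//.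
have e0' : 0 <= e^-1 by rewrite invr_ge0 ltW.
have /andP[_] := Num.Theory.truncn_itv e0'.
by move=> /lt_le_trans; apply; rewrite ler_nat.
Qed.

(** The path at t is the limit of its values at grid times to the right of t, and those values form
    a countable patchwork of maps that are measurable at fixed times. *)
Lemma measurable_path d (S : measurableType d) (p : R -> S -> option E) :
  (forall w, rcl (p ^~ w)) ->
  (forall t, 0 <= t -> measT (p t : S -> oE)) ->
  measT (fun z : R * S => p (Num.max z.1 0) z.2 : oE).
Proof.
move=> rp mp; apply: measurable_fun_optm_open => U oU.
(* A limit of points of U may leave U. The sets [Um m] stay at distance [1/(m+1)] inside U, so being
   eventually in one of them forces the limit into U; conversely a limit in U lies in some [Um m],
   which is open. *)
pose Um (m : nat) := [set y | ball y m.+1%:R^-1 `<=` U]^°.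
pose f n (z : R * S) := p (right_approx n z.1) z.2.
have mf n B : open B -> measurable (f n @^-1` (Some @` B)).
  move=> oB.
  rewrite (_ : _ @^-1` _ = \bigcup_k
     ([set t : R | Num.truncn (Num.max t 0 * n.+1%:R) = k] `*`
      (p (k.+1%:R / n.+1%:R) @^-1` (Some @` B)))).
    apply: bigcupT_measurable => k; apply: measurableX.
      exact: measurable_truncn_eq.
    rewrite -[X in measurable X]setTI; apply: mp => //.
    by apply: measurable_some_image; exact: sub_sigma_algebra.
  apply/seteqP; split=> -[t w]/=.
    by move=> h; exists (Num.truncn (Num.max t 0 * n.+1%:R)).
  by move=> [k _ [/= <- h]].
rewrite (_ : _ @^-1` _ = \bigcup_m \bigcup_N \bigcap_(n in [set n | (N <= n)%N])
    (f n @^-1` (Some @` (Um m)))); last first.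
  apply/seteqP; split=> -[t w] /=.
    move=> [y Uy /esym py].
    have t0 : 0 <= Num.max t 0 by rewrite le_max lexx orbT.
    have /nbhs_ballP[e /= e0 eU] : nbhs y U by exact: open_nbhs_nbhs.
    have [m me] : exists m : nat, m.+1%:R^-1 < e / 2.
      have e20 : 0 < e / 2 by rewrite divr_gt0.
      exists (Num.truncn (e / 2)^-1).
      exact: ltr_truncn_inv.
    have nUm : nbhs y (Um m).
      apply: nbhs_interior; apply/nbhs_ballP; exists (e / 2) => /=.
        by rewrite divr_gt0.
      move=> z yz v zv; apply: eU.
      by apply: (ball_split yz); exact: le_ball (ltW me) _ zv.
    have [d0 d00 hd] := rcl_right (rp w) t0 py nUm.
    exists m => //; exists (Num.truncn d0^-1) => // n /= Nn.
    apply: hd; have /andP[-> h] := right_approxP n t.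
    by rewrite /= (le_lt_trans h)// ltrD2l ltr_truncn_inv.
  move=> [m _ [N _ h]].
  have t0 : 0 <= Num.max t 0 by rewrite le_max lexx orbT.
  (* A path at the cemetery at t is there at all later grid times, so it cannot be in [Um m] at one
     of them. *)
  case py : (p (Num.max t 0) w) => [y|]; last first.
    have [z _] := h N (leqnn N); rewrite /f/=.
    have /andP[h1 _] := right_approxP N t.
    have [abs _] := rp w; rewrite (abs _ _ _ py) ?t0 ?(ltW h1)//.
  exists y => //.
  have nb : nbhs y (ball y m.+1%:R^-1) by apply: nbhsx_ballx.
  have [d0 d00 hd] := rcl_right (rp w) t0 py nb.
  pose n := maxn N (Num.truncn d0^-1).
  have [z Uz zE] := h n (leq_maxl _ _).
  have [z' yz'] : (Some @` ball y m.+1%:R^-1) (p (right_approx n t) w).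
    apply: hd; have /andP[-> hh] := right_approxP n t.
    by rewrite /= (le_lt_trans hh)// ltrD2l ltr_truncn_inv// leq_maxr.
  rewrite -[p _ _]/(f n (t, w)) -zE => -[zz'].
  by move: yz'; rewrite zz' => yz; apply: (interior_subset Uz); exact: ball_sym.
apply: bigcupT_measurable => m; apply: bigcupT_measurable => N.
apply: bigcap_measurable => [|n _]; first by exists N => /=.
by apply: mf; exact: open_interior.
Qed.

End BorelTrajectories.

(** * Trajectories with a cemetery state *)

Section LebesgueShift.
Context (R : realType).
Notation mu := (@lebesgue_measure R).
Local Open Scope ereal_scope.

(** The image of Lebesgue measure under a translation takes the same values on half-open intervals,
    hence is Lebesgue measure. *)
Lemma ge0_integral_shift (f : R -> \bar R) (a : R) : (forall x, 0 <= f x) ->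
  measT f -> \int[mu]_x f (x + a)%R = \int[mu]_x f x.
Proof.
move=> f0 mf; pose phi (x : measurableTypeR R) : measurableTypeR R := (x + a)%R.
have mphi : measT phi by exact: measurable_funD.
transitivity (\int[pushforward mu phi]_x f x).
  by rewrite ge0_integral_pushforward.
apply: eq_measure_integral => A mA _; apply/esym/lebesgue_measure_unique => //.
move=> _ [[u v] _ <-] /=; rewrite /pushforward.
rewrite (_ : phi @^-1` _ = `]u - a, v - a]%classic)%R; last first.
  by apply/seteqP; split=> x /=; rewrite !in_itv/= /phi ltrBlDr lerBrDr.
rewrite !lebesgue_measure_itv/= !lte_fin ltrD2r.
by case: ifP => // _; rewrite -!EFinB; congr (_%:E); ring.
Qed.

End LebesgueShift.

Section Trajectories.
Context (R : realType) (E : completePseudoMetricType R).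
Local Notation oE := (@optm _ (borel E)).

Lemma rcl_none : rcl (fun _ : R => None : option E).
Proof. by split. Qed.

(** A shifted path need not be of the form [xi X ^~ w]. The space of all trajectories is closed
    under shifting and stopping, so the future after s has a place to live in. *)
Definition trajs := {p : R -> option E | rcl p}.
HB.instance Definition _ := gen_eqMixin trajs.
HB.instance Definition _ := gen_choiceMixin trajs.
HB.instance Definition _ := isPointed.Build trajs (exist _ _ rcl_none).

Definition traj_cylinders : set (set trajs) :=
  [set C | exists t, exists2 B : set (borel E), 0 <= t /\ measurable B &
             C = [set p | (Some @` B) (sval p t)]].

Definition traj : measurableType _ := g_sigma_algebraType traj_cylinders.

Lemma measurable_traj d (S : measurableType d) (F : S -> traj) :
  (forall t, 0 <= t -> measT (fun w => sval (F w) t : oE)) ->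
  measT F.
Proof.
move=> mF; apply: (@measurability _ _ S traj setT F traj_cylinders) => //.
move=> _ [_ [t [B [t0 mB] ->]] <-].
exact: (mF t t0 measurableT _ (measurable_some_image mB)).
Qed.

Lemma measurable_traj_eval t : 0 <= t ->
  measT (fun p : traj => sval p t : oE).
Proof.
move=> t0; apply: measurable_fun_optm => B mB.
by apply: sub_sigma_algebra; exists t; exists B.
Qed.

Lemma measurable_traj_path :
  measT (fun z : R * traj => sval z.2 (Num.max z.1 0) : oE).
Proof.
apply: (@measurable_path _ _ _ traj (fun t p => sval p t)) => [p|t t0].
  exact: (svalP p).
exact: measurable_traj_eval.
Qed.

Lemma near_at_right (t : R) (P : R -> Prop) e : 0 < e ->
  (forall s, t < s < t + e -> P s) -> \forall s \near t^'+, P s.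
Proof.
move=> e0 h; exists e => //= s; rewrite /ball/= ltr_distlC => /andP[_ h1] ts.
by apply: h; rewrite ts.
Qed.

(** The clamps at 0 make the shift a total operation; it is the plain shift for nonnegative
    arguments, see [shift_trajE]. *)
Lemma rcl_shift s p : rcl p -> @rcl R E (fun r => p (Num.max s 0 + Num.max r 0)).
Proof.
move=> rp; have s0 : 0 <= Num.max s 0 by rewrite le_max lexx orbT.
split=> [a b /andP[a0 ab]|t y t0 pt U yU].
  apply: rp.1; rewrite addr_ge0//= ?le_max ?lexx ?orbT// lerD2l.
  by rewrite !max_l// (le_trans a0).
have st0 : 0 <= Num.max s 0 + t by rewrite addr_ge0.
rewrite [Num.max t 0]max_l// in pt.
have [e e0 he] := rcl_right rp st0 pt yU.
apply: (near_at_right e0) => r /andP[tr re]; apply: he.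
by rewrite [Num.max r 0]max_l ?(le_trans t0 (ltW tr))// ltrD2l tr -addrA ltrD2l.
Qed.

Definition shift_traj (s : R) (p : traj) : traj :=
  exist _ _ (rcl_shift s (svalP p)).

Lemma shift_trajE s p r : 0 <= s -> 0 <= r ->
  sval (shift_traj s p) r = sval p (s + r).
Proof. by move=> s0 r0; rewrite /= !max_l. Qed.

Lemma rcl_stop s p : rcl p -> @rcl R E (fun r => p (Num.min r (Num.max s 0))).
Proof.
move=> rp; have s0 : 0 <= Num.max s 0 by rewrite le_max lexx orbT.
split=> [a b /andP[a0 ab]|t y t0 pt U yU].
  by apply: rp.1; rewrite le_min a0 s0/= le_min !ge_min lexx orbT ab.
have [ts|st] := ltP t (Num.max s 0).
  rewrite min_l ?ltW// in pt.
  have [e e0 he] := rcl_right rp t0 pt yU.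
  have e0' : 0 < Num.min e (Num.max s 0 - t) by rewrite lt_min e0 subr_gt0.
  apply: (near_at_right e0') => r /andP[tr].
  rewrite -ltrBlDl lt_min !ltrBlDl => /andP[re]; rewrite subrKC => rs.
  by rewrite min_l ?ltW//; apply: he; rewrite tr.
rewrite min_r// in pt; apply: (near_at_right ltr01) => r /andP[tr _].
rewrite min_r ?(le_trans st (ltW tr))// pt; exists y => //.
exact: nbhs_singleton.
Qed.

(** Serves to show that the rate accumulated up to s is a function of the path up to s: it is
    unchanged when the path is stopped at s. *)
Definition stop_traj (s : R) (p : traj) : traj := exist _ _ (rcl_stop s (svalP p)).

Variables (gamma : E -> R) (G : R).
Hypothesis gamma0 : forall y, 0 <= gamma y.
Hypothesis mgamma : measurable_fun [set: borel E] (gamma : borel E -> R).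
Hypothesis gammaG : forall y, gamma y <= G.

Notation mu := (@lebesgue_measure R).
Local Open Scope ereal_scope.

Definition rate_int (p : R -> option E) (t : R) : \bar R :=
  \int[mu]_(r in `[0%R, t]) (at_dagger gamma (p r))%:E.

Definition lifetime_traj (p : traj) (c : R) : \bar R :=
  ereal_inf [set t%:E | t in [set t : R | (0 <= t)%R /\ c%:E < rate_int (sval p) t]].

(** Clamping the time yields a rate that is jointly measurable on the whole line and is the true
    rate at nonnegative times. *)
Let rt (p : traj) (r : R) : R := at_dagger gamma (sval p (Num.max r 0%R)).

Let rt0 p r : (0 <= rt p r)%R.
Proof. by rewrite /rt; case: (sval p _) => //=. Qed.

Let rtG p r : (rt p r <= Num.max G 0)%R.
Proof.
rewrite /rt; case: (sval p _) => [y|]/=; rewrite le_max ?gammaG//.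
by rewrite lexx orbT.
Qed.

Lemma measurable_at_dagger (h : E -> R) :
  measurable_fun [set: borel E] (h : borel E -> R) ->
  measT (at_dagger h : oE -> R).
Proof.
move=> mh; rewrite (_ : at_dagger h = fun o : oE =>
    if id o is Some y then (fun z : oE * borel E => h z.2) (o, y) else 0%R).
  apply: (@measurable_fun_match _ (borel E) _ _ oE R (@id oE)
            (fun z : oE * borel E => h z.2) (fun=> 0%R)) => //.
  exact: (measurableT_comp mh).
by apply/funext => -[].
Qed.

Let mrt : measT (fun z : R * traj => rt z.2 z.1).
Proof. exact: (measurableT_comp (measurable_at_dagger mgamma) measurable_traj_path). Qed.

Let mrtE p : measT (fun r => (rt p r)%:E).
Proof.
have m2 : measT (fun r : R => (r, p)) by exact: measurable_fun_pair.
by apply/measurable_EFinP; exact: (measurableT_comp mrt m2).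
Qed.

Let rate_intE (p : traj) (t : R) : rate_int (sval p) t = \int[mu]_(r in `[0%R, t]) (rt p r)%:E.
Proof.
apply: eq_integral => r; rewrite inE/= in_itv/= => /andP[r0 _].
by rewrite /rt max_l.
Qed.

Lemma rate_int_ge0 (p : traj) (t : R) : 0 <= rate_int (sval p) t.
Proof. by rewrite rate_intE; apply: integral_ge0 => r _; rewrite lee_fin. Qed.

Lemma rate_int_le (p : traj) (t : R) : (0 <= t)%R -> rate_int (sval p) t <= (Num.max G 0 * t)%:E.
Proof.
move=> t0; rewrite rate_intE.
apply: (@le_trans _ _ (\int[mu]_(r in `[0%R, t]) (Num.max G 0)%:E)).
  apply: ge0_le_integral => //.
  all: try by move=> r _; rewrite lee_fin ?rt0 ?rtG// le_max lexx orbT.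
  all: try exact: measurable_funTS (mrtE _).
rewrite integral_cst//= lebesgue_measure_itv/= lte_fin.
have G0 : (0 <= Num.max G 0 * t)%R by rewrite mulr_ge0// le_max lexx orbT.
by case: ifPn => _; rewrite ?sube0 -EFinM lee_fin ?mulr0.
Qed.

Lemma rate_int_fin (p : traj) (t : R) : (0 <= t)%R -> rate_int (sval p) t \is a fin_num.
Proof.
move=> t0; rewrite ge0_fin_numE ?rate_int_ge0//.
by apply: le_lt_trans (rate_int_le p t0) _; rewrite ltry.
Qed.

Lemma rate_intD (p : traj) (s t : R) : (0 <= s)%R -> (0 <= t)%R ->
  rate_int (sval p) (s + t)%R =
  rate_int (sval p) s + rate_int (sval (shift_traj s p)) t.
Proof.
move=> s0 t0; rewrite !rate_intE.
have -> : `[0%R, (s + t)%R]%classic = `[0%R, s]%classic `|` `]s, (s + t)%R]%classic :> set R.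
  rewrite -itv_bndbnd_setU// ?bnd_simp ?lerDl//.
rewrite ge0_integral_setU//=; last 3 first.
- exact: measurable_funTS (mrtE _).
- by move=> r _; rewrite lee_fin.
- apply/eqP/seteqP; split => // r /= []; rewrite !in_itv/= => /andP[_ rs] /andP[sr _].
  by move: (lt_le_trans sr rs); rewrite ltxx.
congr (_ + _).
rewrite integral_mkcond -[in LHS](ge0_integral_shift s)//; last 2 first.
- by move=> r; rewrite patchE; case: ifP; rewrite ?lee_fin.
- apply/measurable_restrict => //; exact: measurable_funTS (mrtE _).
rewrite -(integral_itv_obnd_cbnd (r := 0%R) (b := BRight t)); last first.
  exact: measurable_funTS (mrtE _).
rewrite [RHS]integral_mkcond; apply: eq_integral => r _.
rewrite !patchE; have -> : (r + s \in `]s, (s + t)%R]%classic)%R = (r \in `]0%R, t]%classic).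
  by apply/idP/idP; rewrite !inE/= !in_itv/= => /andP[? ?]; apply/andP; split; lra.
case: ifPn => //; rewrite inE/= in_itv/= => /andP[r0 _].
by rewrite /rt shift_trajE// ?max_l ?addr_ge0// ?ltW// addrC.
Qed.

Lemma rate_int_nd (p : traj) (s t : R) : (0 <= s <= t)%R ->
  rate_int (sval p) s <= rate_int (sval p) t.
Proof.
move=> /andP[s0 st]; rewrite -(subrKC s t) rate_intD ?subr_ge0//.
by rewrite leeDl// rate_int_ge0.
Qed.

Lemma rate_int_lip (p : traj) (s t : R) : (0 <= s <= t)%R ->
  rate_int (sval p) t <= rate_int (sval p) s + (Num.max G 0 * (t - s))%R%:E.
Proof.
move=> /andP[s0 st]; rewrite -{1}(subrKC s t) rate_intD ?subr_ge0//.
by rewrite leeD2l// rate_int_le// subr_ge0.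
Qed.

Lemma measurable_rate_int t :
  measT (fun p : traj => rate_int (sval p) t).
Proof.
pose f (z : traj * R) : \bar R := ((\1_(`[0%R, t]%classic) z.2 : R) * rt z.1 z.2)%:E.
have mf : measT f.
  apply/measurable_EFinP; apply: measurable_funM.
    by apply: measurableT_comp => //; exact: measurable_indic.
  rewrite (_ : (fun _ => _) = (fun z : R * traj => rt z.2 z.1) \o
                              (fun z : traj * R => (z.2, z.1)))//.
  by apply: (measurableT_comp mrt); exact: measurable_fun_pair.
have f0 z : 0 <= f z by rewrite lee_fin mulr_ge0.
have := @measurable_fun_fubini_tonelli_F _ _ _ _ _ mu f mf f0.
congr (measurable_fun _ _); apply/funext => p.
rewrite rate_intE [RHS]integral_mkcond; apply: eq_integral => r _ /=.
by rewrite patchE /f/= indicE; case: ifP; rewrite ?mul1r ?mul0r.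
Qed.

Lemma measurable_lifetime :
  measT (fun z : traj * R => lifetime_traj z.1 z.2).
Proof.
apply: (@measurability _ _ (traj * R)%type (\bar R) setT _ (@ErealGenInftyO.G R)).
  exact: ErealGenInftyO.measurableE.
move=> _ [_ [x ->] <-]; rewrite setTI.
(* The accumulated rate is nondecreasing, so a time at which it exceeds the clock can be moved to
   the right onto a rational below x. *)
rewrite (_ : _ @^-1` _ = \bigcup_(q : rat)
    [set z : traj * R | (0 <= ratr q :> R)%R /\ (ratr q < x)%R /\
                        z.2%:E < rate_int (sval z.1) (ratr q)]).
  apply: bigcupT_measurable_rat => q.
  have [q0|] := boolP (0 <= ratr q :> R)%R; last first.
    by move=> q0; rewrite (_ : [set _ | _] = set0)//; apply/seteqP; split=> z //= [].
  have [qx|] := boolP (ratr q < x)%R; last first.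
    by move=> q1; rewrite (_ : [set _ | _] = set0)//; apply/seteqP; split=> z //= [_ []].
  rewrite (_ : [set _ | _] = [set: traj * R] `&`
     [set z : traj * R | z.2%:E < rate_int (sval z.1) (ratr q)]).
    apply: emeasurable_fun_lt => //.
      exact/measurable_EFinP.
    exact: (measurableT_comp (measurable_rate_int _)).
  by rewrite setTI; apply/seteqP; split=> z //= [_ []].
apply/seteqP; split=> -[p c] /=; rewrite in_itv/=.
  move/ereal_inf_lt => [_ [t [t0 ct] <-]]; rewrite lte_fin => tx.
  have [q] := rat_in_itvoo tx; rewrite in_itv/= => /andP[tq qx].
  exists q => //; split; first exact: (le_trans t0 (ltW tq)).
  by split=> //; apply: (lt_le_trans ct); apply: rate_int_nd; rewrite t0 ltW.
move=> [q _ [q0 [qx cq]]]; apply: le_lt_trans (_ : (ratr q)%:E < _); last first.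
  by rewrite lte_fin.
by apply: ereal_inf_lbound; exists (ratr q).
Qed.

Lemma lifetime_ge0 p c : 0 <= lifetime_traj p c.
Proof. by apply: le_ereal_inf_tmp => _ [t [t0 _] <-]; rewrite lee_fin. Qed.

Lemma lifetime_le p c (t : R) : (0 <= t)%R -> c%:E < rate_int (sval p) t ->
  lifetime_traj p c <= t%:E.
Proof. by move=> t0 ct; apply: ereal_inf_lbound; exists t. Qed.

Lemma lifetime_gt (p : traj) (c s : R) : (0 <= s)%R ->
  s%:E < lifetime_traj p c -> rate_int (sval p) s <= c%:E.
Proof.
move=> s0; rewrite ltNge => sc; rewrite leNgt; apply/negP => cs.
by move/negP: sc; apply; exact: lifetime_le.
Qed.

(** Strict form of the converse of [lifetime_gt]: together they say that survival past s means that
    the clock exceeds the accumulated rate, except possibly at the one value of c where the two are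
    equal. A bounded rate needs some time to catch up with the clock. *)
Lemma rate_int_lt (p : traj) (c s : R) : (0 <= s)%R ->
  rate_int (sval p) s < c%:E -> s%:E < lifetime_traj p c.
Proof.
move=> s0; have := rate_int_fin p s0.
case es : (rate_int _ _) => [a| |]// _; rewrite lte_fin => ac.
pose K := Num.max G 0%R; have K0 : (0 <= K)%R by rewrite le_max lexx orbT.
(* At rate at most K the amount c - a cannot be gained within time e; the 1 in the denominator
   covers K = 0. *)
pose e := ((c - a) / (K + 1))%R.
have K1 : (0 < K + 1)%R by rewrite ltr_wpDl.
have e0 : (0 < e)%R by rewrite divr_gt0// subr_gt0.
have Ke : (K * e <= c - a)%R.
  rewrite /e mulrCA ler_piMr ?subr_ge0 ?(ltW ac)//.
  by rewrite ler_pdivrMr// mul1r lerDl.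
apply: (@lt_le_trans _ _ (s + e)%:E); first by rewrite lte_fin ltrDl.
apply: le_ereal_inf_tmp => _ [t [t0 ct] <-]; rewrite lee_fin leNgt.
apply/negP => tse; move: ct; rewrite ltNge => /negP; apply.
have [ts|st] := leP t s.
  by apply: (le_trans (rate_int_nd p _)) (_ : rate_int (sval p) s <= _);
    rewrite ?t0 ?ts// es lee_fin ltW.
have := rate_int_lip p (_ : 0 <= s <= t)%R; rewrite s0 (ltW st) => /(_ isT).
rewrite es => /le_trans; apply; rewrite -EFinD lee_fin -/K.
have : (K * (t - s) <= K * e)%R by rewrite ler_wpM2l// lerBlDl ltW.
by move=> ?; lra.
Qed.

(** The residual life is the life of the shifted path with the clock lowered by what has been
    consumed: this is additivity of the accumulated rate. *)
Lemma lifetime_shift (p : traj) (c s : R) : (0 <= s)%R ->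
  rate_int (sval p) s < c%:E ->
  lifetime_traj p c =
  s%:E + lifetime_traj (shift_traj s p) (c - fine (rate_int (sval p) s))%R.
Proof.
move=> s0 sc; have fs := rate_int_fin p s0.
have key (t : R) : (0 <= t)%R -> c%:E < rate_int (sval p) (s + t)%R <->
    (c - fine (rate_int (sval p) s))%:E < rate_int (sval (shift_traj s p)) t.
  move=> t0; rewrite (rate_intD p s0 t0).
  have := rate_int_fin (shift_traj s p) t0.
  move: fs; case: (rate_int _ _) => // a _; case: (rate_int _ _) => // b _.
  by rewrite -EFinD !lte_fin/= ltrBlDl.
apply/eqP; rewrite eq_le; apply/andP; split.
  rewrite -leeBlDl//; apply: le_ereal_inf_tmp => _ [t [t0 ct] <-].
  rewrite leeBlDl// -EFinD; apply: lifetime_le; first exact: addr_ge0.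
  exact/key.
apply: le_ereal_inf_tmp => _ [t [t0 ct] <-].
have st : (s < t)%R.
  rewrite ltNge; apply/negP => ts; move: ct; rewrite ltNge => /negP; apply.
  by apply: le_trans (ltW sc); apply: rate_int_nd; rewrite t0.
have -> : t%:E = s%:E + (t - s)%:E by rewrite -EFinD subrKC.
apply: leeD2l => //; apply: lifetime_le; first by rewrite subr_ge0 ltW.
by apply/key; rewrite ?subr_ge0 ?(ltW st)// subrKC.
Qed.

(** A particle does not branch at the cemetery. By continuity the accumulated rate is at most c at
    the branching time; at the cemetery it would stay constant and never exceed c. A negative c is
    excluded because the rate exceeds it at once. *)
Lemma lifetime_alive (p : traj) (c r : R) : (0 <= c)%R ->
  lifetime_traj p c = r%:E -> sval p r <> None.
Proof.
move=> c0 tr pr; have r0 : (0 <= r)%R by rewrite -lee_fin -tr lifetime_ge0.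
have cst (h : R) : (0 <= h)%R -> rate_int (sval p) (r + h)%R = rate_int (sval p) r.
  move=> h0; rewrite rate_intD// [X in _ + X]integral0_eq ?adde0// => x /=.
  rewrite in_itv/= => /andP[x0 _]; rewrite !max_l//.
  by rewrite ((svalP p).1 r (r + x)%R)// r0 lerDl.
have rc : rate_int (sval p) r <= c%:E.
  rewrite leNgt; apply/negP => cr.
  have [re|rn] := eqVneq r 0%R.
    move: cr; rewrite re ltNge => /negP; apply.
    by apply: le_trans (rate_int_le p (lexx _)) _; rewrite mulr0 lee_fin.
  have rp : (0 < r)%R by rewrite lt_neqAle eq_sym rn.
  have := rate_int_fin p r0; case er : (rate_int _ _) cr => [a| |]// ca _.
  rewrite lte_fin in ca.
  pose K := Num.max G 0%R; have K0 : (0 <= K)%R by rewrite le_max lexx orbT.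
  have K1 : (0 < K + 1)%R by rewrite ltr_wpDl.
  (* If the rate were above c at r, it would still be so at the earlier time r - e, against
     minimality of r. The factor 1/2 makes the loss strictly smaller than a - c, and e <= r keeps
     the time nonnegative. *)
  pose e := Num.min r ((a - c) / (K + 1) / 2)%R.
  have e0 : (0 < e)%R by rewrite lt_min rp !divr_gt0// subr_gt0.
  have er' : (e <= r)%R by rewrite ge_min lexx.
  have Ke : (K * e < a - c)%R.
    apply: (@le_lt_trans _ _ ((K + 1) * ((a - c) / (K + 1) / 2)))%R.
      apply: ler_pM => //; first exact: ltW.
        by rewrite lerDl.
      by rewrite ge_min lexx orbT.
    rewrite mulrA mulrCA divff ?gt_eqF// mulr1.
    by rewrite ltr_pdivrMr// ltr_pMr ?subr_gt0// ltr1n.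
  have := rate_int_lip p (_ : 0 <= r - e <= r)%R.
  rewrite subr_ge0 er' lerBlDr lerDl (ltW e0) => /(_ isT).
  have u0 : (0 <= r - e)%R by rewrite subr_ge0.
  have := rate_int_fin p u0; case eu : (rate_int _ (r - e)) => [b| |]// _.
  rewrite er -EFinD lee_fin (_ : r - (r - e) = e)%R; last by ring.
  rewrite -/K => h.
  have : lifetime_traj p c <= (r - e)%:E.
    by apply: lifetime_le => //; rewrite eu lte_fin; lra.
  by rewrite tr lee_fin => ?; lra.
suff A0 : lifetime_traj p c = +oo by rewrite A0 in tr.
rewrite /lifetime_traj (_ : [set _ | _ in _] = set0) ?ereal_inf0//.
apply/seteqP; split=> // y [t [t0 ct] _].
move: ct; rewrite ltNge => /negP; apply.
have [tr'|rt'] := leP t r.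
  by apply: le_trans rc; apply: rate_int_nd; rewrite t0.
by rewrite -(subrKC r t) cst// subr_ge0 ltW.
Qed.

Lemma rate_int_stop (p : traj) (s : R) : (0 <= s)%R ->
  rate_int (sval (stop_traj s p)) s = rate_int (sval p) s.
Proof.
move=> s0; apply: eq_integral => r; rewrite inE/= in_itv/= => /andP[r0 rs].
by rewrite max_l// min_l.
Qed.

End Trajectories.

(** * Product sigma-algebras, kernels and the exponential law *)

Section IntegralTools.
Context (R : realType).
Local Open Scope ereal_scope.

Lemma integral_indicM d (T : measurableType d) (m : {measure set T -> \bar R})
    (D : set T) (f : T -> \bar R) :
  \int[m]_(x in D) f x = \int[m]_x ((\1_D x)%:E * f x).
Proof.
rewrite integral_mkcond; apply: eq_integral => x _; rewrite patchE indicE.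
by case: ifPn => _; rewrite ?mul1e ?mul0e.
Qed.

Lemma posop_bind1 d (T : measurableType d) d' (S : measurableType d')
    (I : (S -> \bar R) -> \bar R) (J : S -> (T -> \bar R) -> \bar R) :
  posop I -> (forall s, posop (J s)) ->
  (forall f, nnm f -> measT (fun s => J s f)) ->
  posop (fun f => I (fun s => J s f)).
Proof.
move=> pI pJ mJ.
rewrite (_ : (fun f => _) = fun f => I (fun s => ((fun=> 1%R) s)%:E * J s f)).
  exact: posop_bind.
by apply/funext => f; congr (I _); apply/funext => s; rewrite mul1e.
Qed.

Lemma posop_option d (T : measurableType d) (A : Type) (o : option A)
    (J : A -> (T -> \bar R) -> \bar R) : (forall z, posop (J z)) ->
  posop (fun f => if o is Some z then J z f else 0).
Proof.
case: o => [z /(_ z)//|_]; split=> //.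
- by move=> f g _ _; rewrite adde0.
- by move=> c f _ _; rewrite mule0.
- by move=> f _ _; rewrite lim_cst.
Qed.

Lemma measurable_sigma_id d (T : measurableType d) :
  @measurable _ T = <<s (@measurable _ T) >>.
Proof. by rewrite sigma_algebra_id//; exact: sigma_algebra_measurable. Qed.

(** A measurable rectangle is the intersection of two strips, and each strip is reached by varying
    one factor; this is where the whole spaces must be generators. *)
Lemma measurable_prod_gen d1 d2 (T1 : measurableType d1) (T2 : measurableType d2)
    (G1 : set (set T1)) (G2 : set (set T2)) :
  @measurable _ T1 = <<s G1 >> -> @measurable _ T2 = <<s G2 >> ->
  G1 setT -> G2 setT ->
  @measurable _ (T1 * T2)%type = <<s [set A `*` B | A in G1 & B in G2] >>.
Proof.
move=> E1 E2 GT1 GT2; rewrite measurable_prod_measurableType.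
apply/seteqP; split; last first.
  apply: sub_sigma_algebra2 => _ [A GA [B GB <-]].
  exists A; first by rewrite E1; exact: sub_sigma_algebra.
  by exists B => //; rewrite E2; exact: sub_sigma_algebra.
apply: smallest_sub; first exact: smallest_sigma_algebra.
move=> _ [A mA [B mB <-]].
set H := <<s _ >>.
have HC C : H C -> H (~` C) by rewrite -setTD; exact: sigma_algebraCD.
have HI C D : H C -> H D -> H (C `&` D).
  move=> HC' HD; rewrite -(setCK (_ `&` _)) setCI; apply: (HC).
  rewrite -bigcup2E; apply: sigma_algebra_bigcup => -[|[|n]]/=.
  - exact: HC. - exact: HC. - exact: sigma_algebra0.
have HA : H (A `*` setT).
  have : <<s G1 >> A by rewrite -E1.
  apply: (smallest_sub (C := sigma_algebra setT) (X := [set A | H (A `*` setT)])).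
    split.
    - by rewrite /= set0X; exact: sigma_algebra0.
    - move=> C /= HC'; rewrite setTD (_ : _ `*` _ = ~` (C `*` setT)); first exact: HC.
      by apply/seteqP; split=> -[a b]/=; [move=> [nC _] [//]|move=> nC; split=> // Ca; apply: nC].
    - move=> F HF /=; rewrite (_ : _ `*` _ = \bigcup_k (F k `*` setT)).
        exact: sigma_algebra_bigcup.
      apply/seteqP; split=> -[a b]/=; first by move=> [[k _ Fa] _]; exists k.
      by move=> [k _ [/= Fa _]]; split => //; exists k.
  by move=> C GC; apply: sub_sigma_algebra; exists C => //; exists setT.
have HB : H (setT `*` B).
  have : <<s G2 >> B by rewrite -E2.
  apply: (smallest_sub (C := sigma_algebra setT) (X := [set B | H (setT `*` B)])).
    split.
    - by rewrite /= setX0; exact: sigma_algebra0.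
    - move=> C /= HC'; rewrite setTD (_ : _ `*` _ = ~` (setT `*` C)); first exact: HC.
      by apply/seteqP; split=> -[a b]/=; [move=> [_ nC] [//]|move=> nC; split=> // Ca; apply: nC].
    - move=> F HF /=; rewrite (_ : _ `*` _ = \bigcup_k (setT `*` F k)).
        exact: sigma_algebra_bigcup.
      apply/seteqP; split=> -[a b]/=; first by move=> [_ [k _ Fa]]; exists k.
      by move=> [k _ [/= _ Fa]]; split => //; exists k.
  by move=> C GC; apply: sub_sigma_algebra; exists setT => //; exists C.
by rewrite -[A]setIT -[B]setTI setXI; exact: HI.
Qed.

Lemma rectangles_setI (T1 T2 : Type) (G1 : set (set T1)) (G2 : set (set T2)) :
  setI_closed G1 -> setI_closed G2 ->
  setI_closed [set A `*` B | A in G1 & B in G2].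
Proof.
move=> I1 I2 _ _ [A GA [B GB <-]] [A' GA' [B' GB' <-]].
exists (A `&` A'); first exact: I1.
by exists (B `&` B'); [exact: I2|rewrite setXI].
Qed.

Section KernelPrecomposition.
Context d d1 d2 (S : measurableType d) (X : measurableType d1)
  (T : measurableType d2) (k : R.-pker X ~> T) (h : S -> X).
Hypothesis mh : measT h.

Definition kprecomp (s : S) : {measure set T -> \bar R} := k (h s).

Let mk U : measurable U -> measT (kprecomp ^~ U).
Proof. by move=> mU; exact: (measurableT_comp (measurable_kernel k U mU) mh). Qed.

HB.instance Definition _ := isKernel.Build _ _ S T R kprecomp mk.

Let kprecomp1 s : kprecomp s setT = 1.
Proof. exact: prob_kernel. Qed.

HB.instance Definition _ := Kernel_isProbability.Build _ _ _ _ _ kprecomp kprecomp1.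

Lemma measurable_kernel_integral (f : S * T -> \bar R) : nnm f ->
  measT (fun s => \int[k (h s)]_t f (s, t)).
Proof.
by move=> [f0 mf]; exact: (measurable_fun_integral_finite_kernel f kprecomp).
Qed.

End KernelPrecomposition.

Definition exp_law : probability (measurableTypeR R) R :=
  exponential_distribution_exponential_prob__canonical__probability_measure_Probability (@ltr01 R).

Notation Exp := exp_law.
Notation mu := (@lebesgue_measure R).

Lemma measurable_Exp_integral d (S : measurableType d)
    (f : S * measurableTypeR R -> \bar R) :
  nnm f -> measT (fun s => \int[Exp]_c f (s, c)).
Proof. by move=> [f0 mf]; exact: measurable_fun_fubini_tonelli_F. Qed.

Lemma integral_Exp (f : measurableTypeR R -> \bar R) : nnm f ->
  \int[Exp]_c f c = \int[mu]_c ((exponential_pdf 1 c)%:E * f c).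
Proof.
move: f; apply: (@posop_eq _ _ (measurableTypeR R) measurable
  (fun f => \int[Exp]_c f c) (fun f => \int[mu]_c ((exponential_pdf 1 c)%:E * f c))) => //.
- exact: measurable_sigma_id.
- exact: measurableI.
- exact: posop_integral.
- apply: (posop_bind (J := fun s f => f s)) => //.
  + exact: posop_integral.
  + by move=> s; exact: exponential_pdf_ge0.
  + exact: measurable_exponential_pdf.
  + by move=> s; exact: posop_eval.
  + by move=> g [].
- by rewrite integral_cst//= mul1e probability_setT; first exact: (ltry 1%R).
- move=> A mA; rewrite integral_indic// setIT [LHS]integral_indicM.
  by apply: eq_integral => x _; rewrite muleC.
Qed.

(** The exceptional value a is the clock equal to the accumulated rate, for which survival is
    ambiguous; it is null, and so are negative clocks. *)
Lemma Exp_ae_gt (f g : measurableTypeR R -> \bar R) (a : R) : nnm f -> nnm g ->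
  (forall c, (0 <= c)%R -> c != a -> f c = g c) ->
  \int[Exp]_c f c = \int[Exp]_c g c.
Proof.
move=> nf ng fg; rewrite !integral_Exp//.
have npdf : nnm (fun c : measurableTypeR R => (exponential_pdf 1 c)%:E : \bar R).
  by split=> [c|]; [rewrite lee_fin exponential_pdf_ge0|apply/measurable_EFinP; exact: measurable_exponential_pdf].
apply: ge0_ae_eq_integral => //.
- exact: (nnmM npdf nf).2.
- exact: (nnmM npdf ng).2.
- by move=> c _; exact: (nnmM npdf nf).1.
- by move=> c _; exact: (nnmM npdf ng).1.
- exists [set a]; split => //; first exact: lebesgue_measure_set1.
  move=> c /= H; apply/eqP/negPn/negP => ca; apply: H => _.
  have [c0|c0] := ltP c 0%R; first by rewrite lt0_exponential_pdf// !mul0e.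
  by rewrite fg.
Qed.

(** Translation by a multiplies the density by [expR (- a)]. *)
Lemma Exp_memoryless (f : measurableTypeR R -> \bar R) (a : R) : (0 <= a)%R -> nnm f ->
  \int[Exp]_c (if (a < c)%R then f (c - a)%R else 0) =
  (expR (- a))%:E * \int[Exp]_c f c.
Proof.
move=> a0 nf.
have mshift : measT (fun c : measurableTypeR R => (c - a)%R : measurableTypeR R).
  exact: measurable_funB.
have nfa b : nnm (fun c : measurableTypeR R => if (b < c)%R then f (c - a)%R else 0).
  split=> [c|]; first by case: ifP => // _; exact: nf.1.
  apply: measurable_fun_ifT => //.
  - exact: measurable_fun_ltr.
  - exact: (measurableT_comp nf.2 mshift).
rewrite integral_Exp//.
have npdf : nnm (fun c : measurableTypeR R => (exponential_pdf 1 c)%:E : \bar R).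
  by split=> [c|]; [rewrite lee_fin exponential_pdf_ge0|apply/measurable_EFinP; exact: measurable_exponential_pdf].
have nh := nnmM npdf (nfa a).
rewrite -(ge0_integral_shift a nh.1 nh.2).
have nf0 : nnm (fun c : measurableTypeR R => if (0 < c)%R then f c else 0).
  split=> [c|]; first by case: ifP => // _; exact: nf.1.
  apply: measurable_fun_ifT => //.
    exact: measurable_fun_ltr.
  exact: nf.2.
rewrite (@Exp_ae_gt f (fun c => if (0 < c)%R then f c else 0) 0)//; last first.
  by move=> c c0 cn; rewrite lt_neqAle eq_sym cn c0.
rewrite integral_Exp// -ge0_integralZl_EFin ?expR_ge0//; last 2 first.
- by move=> c _; exact: (nnmM npdf nf0).1.
- exact: (nnmM npdf nf0).2.
apply: eq_integral => c _.
rewrite /= ltrDr addrK; case: ifPn => [c0|_]; last by rewrite !mule0.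
rewrite !exponential_pdfE ?addr_ge0 ?(ltW c0)// muleA -EFinM; congr (_%:E * _).
by rewrite !mul1r !mulN1r opprD expRD mulrC.
Qed.

End IntegralTools.

(** * The Markov property of a single path *)

Section PathMarkov.
Context (R : realType) (E : completePseudoMetricType R).
Context dP (Path : measurableType dP) (X : markov_process E Path).
Local Notation oE := (@optm _ (borel E)).
Local Notation P := (xi_law X).
Local Open Scope ereal_scope.

Lemma rcl_xi w : rcl (xi X ^~ w).
Proof.
by split=> [s t|t y t0 + U]; [exact: xi_absorbed|move/xi_right_continuous; exact].
Qed.

Definition path_traj (w : Path) : traj E := exist _ _ (rcl_xi w).

Lemma measurable_xi t : (0 <= t)%R -> measT (xi X t : Path -> oE).
Proof. by move=> t0; apply: measurable_fun_optm => B; exact: xi_measurable. Qed.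

Lemma measurable_path_traj : measT path_traj.
Proof. by apply: measurable_traj => t; exact: measurable_xi. Qed.

Lemma measurable_oapp d (T : measurableType d) d' (S : measurableType d')
    (k : S * T -> \bar R) (o : S -> optm T) : measT k ->
  measT o -> measT (fun s => oapp (fun z => k (s, z)) 0 (o s)).
Proof. by move=> mk mo; exact: measurable_fun_match. Qed.

Lemma measurable_oapp1 d (T : measurableType d) d' (S : measurableType d')
    (k : T -> \bar R) (o : S -> optm T) : measT k ->
  measT o -> measT (fun s => oapp k 0 (o s)).
Proof.
move=> mk mo; apply: (@measurable_oapp _ T _ S (fun z => k z.2)) => //.
exact: (measurableT_comp mk).
Qed.

Lemma oapp_ge0 (T : Type) (k : T -> \bar R) o : (forall z, 0 <= k z) -> 0 <= oapp k 0 o.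
Proof. by case: o => [z|] /=. Qed.

Definition past_events (s : R) : set (set Path) :=
  [set C | exists r (D : set (borel E)),
     [/\ (0 <= r <= s)%R, measurable D & C = xi X r @^-1` (Some @` D)]].

(** The past as a second measurable structure on [Path], so that functions of the past are ordinary
    measurable functions and can be paired with a future trajectory. *)
Definition xi_past s : measurableType _ := g_sigma_algebraType (past_events s).

Lemma measurable_past_event s r (D : set (borel E)) : (0 <= r <= s)%R -> measurable D ->
  @measurable _ (xi_past s) (xi X r @^-1` (Some @` D)).
Proof. by move=> rs mD; apply: sub_sigma_algebra; exists r; exists D. Qed.

Lemma measurable_past_xi s r : (0 <= r <= s)%R ->
  measT (xi X r : xi_past s -> oE).
Proof.
by move=> rs; apply: measurable_fun_optm => B mB; exact: measurable_past_event.
Qed.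

Lemma past_measurable s (A : set Path) : @measurable _ (xi_past s) A -> measurable A.
Proof.
apply: smallest_sub; first exact: sigma_algebra_measurable.
by move=> _ [r [D [/andP[r0 _] mD ->]]]; exact: xi_measurable.
Qed.

Lemma past_nd s t (A : set Path) : (s <= t)%R ->
  @measurable _ (xi_past s) A -> @measurable _ (xi_past t) A.
Proof.
move=> st; apply: sub_sigma_algebra2 => _ [r [D [/andP[r0 rs] mD ->]]].
by exists r; exists D; split=> //; rewrite r0 (le_trans rs).
Qed.

Lemma measurable_fun_past s d (T : measurableType d) (f : Path -> T) :
  measT (f : xi_past s -> T) -> measT f.
Proof.
move=> mf _ B mB; rewrite setTI; apply: (@past_measurable s).
by rewrite -[X in measurable X]setTI; exact: mf.
Qed.

Lemma integral_Path_indic (y : E) (A : set Path) :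
  measurable A -> \int[P y]_w (\1_A w)%:E = P y A.
Proof. by move=> mA; rewrite integral_indic// setIT. Qed.

Lemma indic_xi t (B : set E) w :
  \1_(xi X t @^-1` (Some @` B)) w = oapp \1_B 0%R (xi X t w) :> R.
Proof.
case ex : (xi X t w) => [z|]/=.
  rewrite !indicE; congr (_%:R); congr (nat_of_bool _).
  by apply/idP/idP; rewrite !inE/= ex; [move=> [z2 Bz [<-]]|move=> Bz; exists z].
by rewrite indicE memNset//= ex => -[].
Qed.

Lemma xi_markov_fun (y : E) (s t : R) (A : set Path) (k : borel E -> \bar R) :
  (0 <= s)%R -> (0 <= t)%R -> @measurable _ (xi_past s) A -> nnm k ->
  \int[P y]_w ((\1_A w)%:E * oapp k 0 (xi X (s + t) w)) =
  \int[P y]_w ((\1_A w)%:E *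
     oapp (fun z => \int[P z]_w' oapp k 0 (xi X t w')) 0 (xi X s w)).
Proof.
move=> s0 t0 pA; have mA := past_measurable pA.
have st0 : (0 <= s + t)%R by rewrite addr_ge0.
have moapp (r : R) (h : borel E -> \bar R) : (0 <= r)%R -> nnm h ->
    nnm (fun w : Path => oapp h 0 (xi X r w)).
  move=> r0 [h0 mh]; split; first by move=> w; exact: oapp_ge0.
  by apply: measurable_oapp1 => //; exact: measurable_xi.
have mint (h : borel E -> \bar R) : nnm h ->
    nnm (fun z : borel E => \int[P z]_w' oapp h 0 (xi X t w')).
  move=> nh; split=> [z|].
    by apply: integral_ge0 => w _; apply: oapp_ge0; exact: nh.1.
  apply: (measurable_fun_integral_kernel (measurable_kernel P)).
  - by move=> w; exact: (moapp _ _ t0 nh).1.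
  - exact: (moapp _ _ t0 nh).2.
have Jp z : posop (fun h : borel E -> \bar R => \int[P z]_w oapp h 0 (xi X t w)).
  apply: (@posop_bind1 _ _ (borel E) _ Path (fun f => \int[P z]_w f w)
    (fun w h => oapp h 0 (xi X t w))).
  - exact: posop_integral.
  - by move=> w; apply: (@posop_option _ _ (borel E) _ _ (fun z h => h z)) => ?; exact: posop_eval.
  - by move=> h /(moapp _ _ t0) [].
move: k; apply: (@posop_eq _ _ (borel E) measurable
   (fun k => \int[P y]_w ((\1_A w)%:E * oapp k 0 (xi X (s + t) w)))
   (fun k => \int[P y]_w ((\1_A w)%:E *
     oapp (fun z => \int[P z]_w' oapp k 0 (xi X t w')) 0 (xi X s w)))).
- exact: measurable_sigma_id.
- exact: measurableI.
- exact: measurableT.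
- apply: (@posop_bind _ _ (borel E) _ Path (fun f => \int[P y]_w f w) \1_A (fun w k => oapp k 0 (xi X (s + t) w))) => //.
  + exact: posop_integral.
  + by move=> w; apply: (@posop_option _ _ (borel E) _ _ (fun z h => h z)) => ?; exact: posop_eval.
  + by move=> h /(moapp _ _ st0) [].
- apply: (@posop_bind _ _ (borel E) _ Path (fun f => \int[P y]_w f w) \1_A (fun w k => oapp (fun z => \int[P z]_w' oapp k 0 (xi X t w')) 0 (xi X s w))) => //.
  + exact: posop_integral.
  + by move=> w; apply: posop_option.
  + by move=> h /mint /(moapp _ _ s0) [].
- apply: (@le_lt_trans _ _ (\int[P y]_w (cst 1 w))); last first.
    by rewrite integral_cst// mul1e prob_kernel; exact: (ltry 1%R).
  apply: ge0_le_integral => //.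
  + by move=> w _; apply: mule_ge0; [rewrite lee_fin|apply: oapp_ge0].
  + apply: emeasurable_funM; first exact/measurable_EFinP/measurable_indic.
    by apply: (moapp _ (cst 1) st0 _).2; exact: nnm_cst.
  + move=> w _; rewrite indicE /=; case: (xi X _ w) => [z|]/=; case: (_ \in _);
    by rewrite ?mule1 ?mule0 ?lee_fin.
- move=> B mB; have := xi_markov y s0 t0 mB pA.
  rewrite [in X in _ = X -> _]integral_indicM => Hm.
  transitivity (P y (A `&` xi X (s + t) @^-1` (Some @` B))).
    rewrite -integral_Path_indic; last first.
      by apply: measurableI => //; exact: xi_measurable.
    apply: eq_integral => w _; rewrite indicI/= EFinM indic_xi; congr (_ * _).
    by case: (xi X _ w).
  rewrite Hm; apply: eq_integral => w _; congr (_ * _).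
  case: (xi X s w) => //= z.
  rewrite -integral_Path_indic; last exact: xi_measurable.
  by apply: eq_integral => w' _; rewrite indic_xi; case: (xi X t w').
Qed.

(** Times are increments, so that the tail of the list is again a cylinder, for the shifted path;
    this is the form in which the Markov property is iterated. *)
Fixpoint cyl_incr (l : seq (R * set E)) (p : R -> option E) : Prop :=
  if l is (t, B) :: l' then (Some @` B) (p t) /\ cyl_incr l' (fun r => p (t + r)%R)
  else True.

Fixpoint wf_incr (l : seq (R * set E)) : Prop :=
  if l is (t, B) :: l' then
    [/\ (0 <= t)%R, measurable (B : set (borel E)) & wf_incr l']
  else True.

Lemma xi_addA s t w :
  (fun r => xi X (s + (t + r))%R w) = (fun r => xi X (s + t + r)%R w).
Proof. by apply/funext => r; rewrite addrA. Qed.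

Lemma xi_add0 w : (fun r => xi X (0 + r)%R w) = xi X ^~ w.
Proof. by apply/funext => r; rewrite add0r. Qed.

Lemma measurable_cyl_incr l s : (0 <= s)%R -> wf_incr l ->
  measurable [set w : Path | cyl_incr l (fun r => xi X (s + r)%R w)].
Proof.
elim: l s => [|[t B] l ih] s s0 /=; first by move=> _; exact: measurableT.
move=> [t0 mB wl].
have -> : [set w | (Some @` B) (xi X (s + t) w) /\
      cyl_incr l (fun r => xi X (s + (t + r)) w)]%R =
   (xi X (s + t)%R @^-1` (Some @` B)) `&`
   [set w | cyl_incr l (fun r => xi X ((s + t) + r) w)]%R.
  by apply/seteqP; split=> w /= [h1 h2]; split=> //; move: h2; rewrite xi_addA.
apply: measurableI; first by apply: xi_measurable => //; exact: addr_ge0.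
by apply: ih => //; exact: addr_ge0.
Qed.

(** The first condition of the list is moved into the past event, the induction hypothesis is
    applied at time s + t, and the Markov property over the first increment brings the result back
    to s. *)
Lemma xi_markov_incr l : wf_incr l ->
  forall (y : E) (s : R) (A : set Path), (0 <= s)%R -> @measurable _ (xi_past s) A ->
  \int[P y]_w ((\1_A w)%:E * oapp (fun=> (\1_[set w | cyl_incr l (fun r => xi X (s + r)%R w)] w)%:E) 0 (xi X s w)) =
  \int[P y]_w ((\1_A w)%:E *
     oapp (fun z => P z [set w | cyl_incr l (xi X ^~ w)]) 0 (xi X s w)).
Proof.
elim: l => [|[t B] l ih].
  move=> _ y s A s0 pA; apply: eq_integral => w _; congr (_ * _).
  case: (xi X s w) => //= z.
  rewrite (_ : [set w | True] = setT)//.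
  by rewrite prob_kernel indicT.
move=> /= [t0 mB wl] y s A s0 pA.
have st0 : (0 <= s + t)%R by rewrite addr_ge0.
pose h z := P z [set w | cyl_incr l (xi X ^~ w)].
have cyl0 : measurable [set w | cyl_incr l (xi X ^~ w)].
  have := measurable_cyl_incr (lexx 0%R) wl.
  by congr measurable; apply/seteqP; split=> w /=; rewrite xi_add0.
pose g z := (\1_B z)%:E * h z.
have ng : nnm (g : borel E -> \bar R).
  apply: nnmM; first exact: nnm_indic.
  by split=> // ; exact: measurable_kernel.
(* Used twice: at time s under [P y], and at time 0 under [P z] to recognise the probability of the
   whole cylinder. *)
have key s' y' A' : (0 <= s')%R -> @measurable _ (xi_past s') A' ->
   \int[P y']_w ((\1_A' w)%:E * oapp (fun=> (\1_[set w | (Some @` B) (xi X (s' + t) w) /\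
      cyl_incr l (fun r => xi X (s' + (t + r)) w)]%R w)%:E) 0 (xi X s' w)) =
   \int[P y']_w ((\1_A' w)%:E * oapp g 0 (xi X (s' + t)%R w)).
  move=> s'0 pA'; have st'0 : (0 <= s' + t)%R by rewrite addr_ge0.
  pose A2 := A' `&` xi X (s' + t)%R @^-1` (Some @` B).
  have pA2 : @measurable _ (xi_past (s' + t)%R) A2.
    apply: measurableI; first by apply: past_nd pA'; rewrite lerDl.
    by apply: measurable_past_event => //; rewrite st'0 lexx.
  have := ih wl y' (s' + t)%R A2 st'0 pA2.
  move=> H; transitivity (\int[P y']_w ((\1_A2 w)%:E *
     oapp (fun z => P z [set w | cyl_incr l (xi X ^~ w)]) 0 (xi X (s' + t)%R w))).
    rewrite -H; apply: eq_integral => w _.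
    rewrite [in RHS]indicI/= EFinM -muleA; congr (_ * _); rewrite indic_xi.
    case ex : (xi X (s' + t)%R w) => [z|]/=; last first.
      rewrite mul0e; case: (xi X s' w) => //= _.
      by rewrite indicE memNset//= => -[[]]; rewrite ex.
    case ex' : (xi X s' w) => [z'|]/=; last first.
      have := @xi_absorbed _ _ _ _ X w s' (s' + t)%R.
      by rewrite s'0 lerDl t0 ex => /(_ isT ex').
    rewrite !indicE -EFinM; congr (_%:E).
    have [Bz|nBz] := pselect (B z).
      rewrite (mem_set Bz) mul1r; congr (_%:R); congr (nat_of_bool _).
      apply/idP/idP; rewrite !inE/= xi_addA; [by move=> []|move=> c].
      by split=> //; rewrite ex; exists z.
    rewrite (memNset nBz) mul0r memNset//= => -[[z2 Bz2 e] _].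
    by move: e; rewrite ex => -[e]; apply: nBz; rewrite -e.
  apply: eq_integral => w _; rewrite indicI/= EFinM -muleA; congr (_ * _).
  by rewrite indic_xi; case: (xi X _ w) => //=; rewrite mul0e.
rewrite key// xi_markov_fun//; apply: eq_integral => w _; congr (_ * _).
case: (xi X s w) => //= z.
have := key 0%R z setT (lexx _) measurableT.
under eq_integral do rewrite indicT mul1e.
under [in X in _ = X -> _]eq_integral do rewrite indicT mul1e add0r.
move=> <-; rewrite -integral_Path_indic; last first.
  have := measurable_cyl_incr (l := (t, B) :: l) (lexx 0%R).
  move=> /(_ (And3 t0 mB wl)) /=; congr measurable.
  by apply/seteqP; split=> w' /=; rewrite ?add0r xi_addA ?add0r.
apply: eq_integral => w' _.
rewrite [in RHS](_ : [set _ | _] = [set w | (Some @` B) (xi X t w) /\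
        cyl_incr l (fun r => xi X (t + r)%R w)]); last first.
  by apply/seteqP; split.
case ex : (xi X 0%R w') => [z'|]/=.
  congr (_%:E); congr (\1_(_) w').
  by apply/seteqP; split=> w2 /=; rewrite xi_addA add0r.
rewrite indicE memNset//= => -[[z2 _ e] _].
have := @xi_absorbed _ _ _ _ X w' 0%R t.
by rewrite lexx t0 -e => /(_ isT ex).
Qed.

End PathMarkov.

Section PathMarkovFull.
Context (R : realType) (E : completePseudoMetricType R).
Context dP (Path : measurableType dP) (X : markov_process E Path).
Local Notation P := (xi_law X).
Local Open Scope ereal_scope.

Let okc (x : R * set E) : bool := `[< (0 <= x.1)%R /\ measurable (x.2 : set (borel E)) >].
Let inc (p : R -> option E) (x : R * set E) : bool := `[< (Some @` x.2) (p x.1) >].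

Let fcap_cyl (C : set (traj E)) : fcap (@traj_cylinders R E) C ->
  exists2 l : seq (R * set E), all okc l & C = [set p | all (inc (sval p)) l].
Proof.
elim=> [|A B [t [D [t0 mD] ->]] _ [l ol ->]].
  by exists [::] => //; apply/seteqP; split.
exists ((t, D) :: l); first by rewrite /= ol andbT; apply/asboolP.
apply/seteqP; split=> p /=.
  by move=> [h1 ->]; rewrite andbT; apply/asboolP.
by move=> /andP[/asboolP h1 h2].
Qed.

(** A finite intersection of cylinders lists its times in any order; once sorted, the consecutive
    differences are the increments. *)
Let sorted_incr (l : seq (R * set E)) (a : R) : (0 <= a)%R ->
  all (fun x => (a <= x.1)%R) l ->
  sorted (fun x y : R * set E => x.1 <= y.1)%R l -> all okc l ->
  exists2 li, wf_incr li &
    forall p, all (inc p) l <-> cyl_incr li (fun r => p (a + r)%R).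
Proof.
elim: l a => [|x l ih] a a0; first by move=> _ _ _; exists [::].
move=> /= /andP[ax al] sl /andP[/asboolP[x0 mx] ol].
have tr : transitive (fun x y : R * set E => x.1 <= y.1)%R.
  by move=> u v w; exact: le_trans.
have xl : all (fun y => (x.1 <= y.1)%R) l by exact: order_path_min sl.
have [li wl Hl] := ih _ x0 xl (path_sorted sl) ol.
exists (((x.1 - a)%R, x.2) :: li); first by rewrite /= subr_ge0.
move=> p /=; rewrite subrKC.
have -> : (fun r => p (a + (x.1 - a + r))%R) = (fun r => p (x.1 + r)%R).
  by apply/funext => r; rewrite addrA subrKC.
split=> [/andP[/asboolP h1 /Hl//]|[h1 /Hl h2]].
by apply/andP; split => //; apply/asboolP.
Qed.

Lemma cyl_incr_ext (l : seq (R * set E)) (p p' : R -> option E) : wf_incr l ->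
  (forall r, (0 <= r)%R -> p r = p' r) -> cyl_incr l p <-> cyl_incr l p'.
Proof.
elim: l p p' => [//|[t B] l ih] p p' /= [t0 _ wl] pp'.
rewrite pp'//; have := ih (fun r => p (t + r)%R) (fun r => p' (t + r)%R) wl.
move=> /(_ (fun r r0 => pp' _ (addr_ge0 t0 r0))) [h1 h2].
by split=> -[? ?]; split => //; [exact: h1|exact: h2].
Qed.

Let fcap_incr (C : set (traj E)) : fcap (@traj_cylinders R E) C ->
  exists2 li, wf_incr li & C = [set p | cyl_incr li (sval p)].
Proof.
move=> /fcap_cyl[l ol ->].
pose le1 (x y : R * set E) := (x.1 <= y.1)%R.
have tot : total le1 by move=> x y; exact: le_total.
have ol' : all okc (sort le1 l) by rewrite all_sort.
have a0 : all (fun x : R * set E => (0 <= x.1)%R) (sort le1 l).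
  by apply: sub_all ol' => x /asboolP[].
have [li wl Hl] := sorted_incr (lexx _) a0 (sort_sorted tot l) ol'.
exists li => //; apply/seteqP; split=> p /=.
  rewrite -(all_sort _ le1) => /Hl; apply: (cyl_incr_ext _ _).1 => //.
  by move=> r _; rewrite add0r.
move=> h; rewrite -(all_sort _ le1); apply/Hl; apply: (cyl_incr_ext _ _).1 h => //.
by move=> r _; rewrite add0r.
Qed.

Lemma measurable_shift_traj s : (0 <= s)%R ->
  measT (shift_traj s : traj E -> traj E).
Proof.
move=> s0; apply: measurable_traj => t t0 /=.
rewrite [Num.max t 0%R]max_l// [Num.max s 0%R]max_l//.
by apply: measurable_traj_eval; exact: addr_ge0.
Qed.

Lemma past_id s d (T : measurableType d) (f : Path -> T) :
  measT (f : xi_past X s -> T) -> measT f.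
Proof. exact: measurable_fun_past. Qed.

(** Past and future enter f jointly, because the survival probability of a life is a function of the
    past that multiplies a functional of the future. Rectangles of a past event and a cylinder form
    the pi-system. *)
Lemma path_markov (y : E) (s : R) (f : xi_past X s * traj E -> \bar R) :
  (0 <= s)%R -> nnm f ->
  \int[P y]_w oapp (fun=> f (w, shift_traj s (path_traj X w))) 0 (xi X s w) =
  \int[P y]_w oapp (fun z => \int[P z]_w' f (w, path_traj X w')) 0 (xi X s w).
Proof.
move=> s0.
have mid : measT (id : Path -> xi_past X s).
  by apply: past_id; exact: measurable_id.
have m1 : measT (fun w : Path => (w, shift_traj s (path_traj X w)) : xi_past X s * traj E).
  apply: measurable_fun_pair => //; apply: (measurableT_comp (measurable_shift_traj s0)).
  exact: measurable_path_traj.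
have n1 (g : xi_past X s * traj E -> \bar R) : nnm g -> nnm (fun w : Path => oapp (fun=> g (w, shift_traj s (path_traj X w))) 0 (xi X s w)).
  move=> ng; split=> [w|]; first by apply: oapp_ge0 => _; exact: ng.1.
  apply: (@measurable_oapp _ _ (borel E) _ _ (fun z : Path * borel E => g (z.1, shift_traj s (path_traj X z.1)))).
    by apply: (measurableT_comp ng.2); exact: (measurableT_comp m1).
  exact: measurable_xi.
have n2 (g : xi_past X s * traj E -> \bar R) : nnm g -> nnm (fun w : Path => oapp (fun z => \int[P z]_w' g (w, path_traj X w')) 0 (xi X s w)).
  move=> ng; split=> [w|]; first by apply: oapp_ge0 => z; apply: integral_ge0 => ? _; exact: ng.1.
  apply: (@measurable_oapp _ _ (borel E) _ _ (fun z : Path * borel E => \int[P z.2]_w' g (z.1, path_traj X w'))).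
    apply: (@measurable_kernel_integral _ _ _ _ (Path * borel E)%type _ _ P snd _
       (fun u : (Path * borel E) * Path => g (u.1.1, path_traj X u.2))) => //.
    split=> [u|]; first exact: ng.1.
    apply: (measurableT_comp ng.2); apply: measurable_fun_pair.
      apply: (measurableT_comp mid); exact: (measurableT_comp measurable_fst).
    exact: (measurableT_comp (measurable_path_traj X)).
  exact: measurable_xi.
pose G1 : set (set (xi_past X s)) := measurable.
have GE : @measurable _ (xi_past X s * traj E)%type =
    <<s [set A `*` B | A in G1 & B in fcap (@traj_cylinders R E)] >>.
  apply: measurable_prod_gen; first exact: measurable_sigma_id.
  - by rewrite sigma_fcap.
  - exact: measurableT.
  - exact: fcap0.
move: f; apply: (@posop_eq _ _ (xi_past X s * traj E)%type _
  (fun f => \int[P y]_w oapp (fun=> f (w, shift_traj s (path_traj X w))) 0 (xi X s w))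
  (fun f => \int[P y]_w oapp (fun z => \int[P z]_w' f (w, path_traj X w')) 0 (xi X s w)) GE).
- by apply: rectangles_setI; [exact: measurableI|exact: fcap_setI].
- by exists setT; [exact: measurableT|exists setT; [exact: fcap0|rewrite setXTT]].
- apply: (@posop_bind1 _ _ _ _ Path (fun f => \int[P y]_w f w)
    (fun w (f : xi_past X s * traj E -> \bar R) => oapp (fun=> f (w, shift_traj s (path_traj X w))) 0 (xi X s w))).
  + exact: posop_integral.
  + by move=> w; apply: (@posop_option _ _ _ _ _ (fun=> _)) => ?; exact: posop_eval.
  + by move=> g /n1[].
- apply: (@posop_bind1 _ _ _ _ Path (fun f => \int[P y]_w f w)
    (fun w (f : xi_past X s * traj E -> \bar R) => oapp (fun z => \int[P z]_w' f (w, path_traj X w')) 0 (xi X s w))).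
  + exact: posop_integral.
  + move=> w; apply: (@posop_option _ _ _ _ _ (fun z (f : xi_past X s * traj E -> \bar R) => \int[P z]_w' f (w, path_traj X w'))) => z.
    apply: (@posop_comp _ _ (xi_past X s * traj E)%type _ Path (fun w' => (w, path_traj X w'))
      (fun f => \int[P z]_w f w)); last exact: posop_integral.
    by apply: measurable_fun_pair => //; exact: measurable_path_traj.
  + by move=> g /n2[].
- apply: (@le_lt_trans _ _ (\int[P y]_w (cst 1 w))); last first.
    by rewrite integral_cst// mul1e prob_kernel; exact: (ltry 1%R).
  apply: ge0_le_integral => //.
  + by move=> w _; apply: oapp_ge0.
  + by apply: (n1 (cst 1) _).2; exact: nnm_cst.
  + by move=> w _; case: (xi X s w) => [z|] /=; rewrite ?lexx ?lee01.
- move=> _ [A pA [C /fcap_incr[li wl ->] <-]].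
  have := xi_markov_incr wl y s0 pA.
  have e0 w' : [set w | cyl_incr li (sval (path_traj X w))] w' =
     [set w | cyl_incr li (xi X ^~ w)] w' by [].
  move=> Hm; transitivity (\int[P y]_w
      ((\1_A w)%:E * oapp (fun=> (\1_[set w | cyl_incr li (fun r => xi X (s + r)%R w)] w)%:E)
                          0 (xi X s w))).
    apply: eq_integral => w _; case: (xi X s w) => /= [_|]; last by rewrite mule0.
    rewrite -EFinM !indicE -[in RHS]natrM mulnb; congr (_%:R%:E); congr (nat_of_bool _).
    have H : cyl_incr li (sval (shift_traj s (path_traj X w))) <->
             cyl_incr li (fun r => xi X (s + r)%R w).
      by apply: cyl_incr_ext => // r r0; rewrite shift_trajE.
    apply/idP/andP; rewrite !inE/=; first by move=> [? /H].
    by move=> [? /H].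
  rewrite Hm; apply: eq_integral => w _; case: (xi X s w) => /= [z|]; last by rewrite mule0.
  have mc : measurable [set w | cyl_incr li (xi X ^~ w)].
    have := measurable_cyl_incr X (lexx 0%R) wl.
    by congr measurable; apply/seteqP; split=> w2 /=; rewrite xi_add0.
  rewrite -integral_Path_indic// -ge0_integralZl_EFin//; last exact/measurable_EFinP/measurable_indic.
  apply: eq_integral => w' _.
  rewrite -EFinM !indicE -[in LHS]natrM mulnb; congr (_%:R%:E); congr (nat_of_bool _).
  by apply/andP/idP; rewrite !inE.
Qed.

End PathMarkovFull.

(** * The law of a life and its Markov property *)

Section LifeOperator.
Context (R : realType) (E : completePseudoMetricType R).
Context dP (Path : measurableType dP) (X : markov_process E Path).
Context (gamma : E -> R) (G : R).
Context dO (Off : measurableType dO) (Z : offspring E Off).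
Hypothesis gamma0 : forall y, 0 <= gamma y.
Hypothesis mgamma : measurable_fun [set: borel E] (gamma : borel E -> R).
Hypothesis gammaG : forall y, gamma y <= G.
Local Notation oE := (@optm _ (borel E)).
Local Notation P := (xi_law X).
Local Notation Exp := (exp_law R).
Local Notation life := (life R Path Off).
Local Notation tau := (lifetime X gamma).
Local Open Scope ereal_scope.

Lemma lifetimeE w c : tau w c = lifetime_traj gamma (path_traj X w) c.
Proof. by []. Qed.

Lemma measurable_tau : measT (fun z : Path * measurableTypeR R => tau z.1 z.2).
Proof.
pose h (z : Path * measurableTypeR R) : traj E * R := (path_traj X z.1, z.2).
have mh : measT h.
  apply: measurable_fun_pair => //.
  exact: (measurableT_comp (measurable_path_traj X)).
exact: (measurableT_comp (measurable_lifetime gamma0 mgamma) mh).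
Qed.

Lemma measurable_fin_num d (T : measurableType d) (f : T -> \bar R) :
  measT f -> measT (fun x => f x \is a fin_num).
Proof.
move=> mf; apply: (measurable_fun_bool true) => /=.
exact: emeasurable_fin_num.
Qed.

Lemma tau_ge0 w c : 0 <= tau w c.
Proof. by rewrite lifetimeE lifetime_ge0. Qed.

Lemma measurable_branch_place :
  measT (fun z : Path * measurableTypeR R => branch_place X gamma z.1 z.2 : oE).
Proof.
rewrite (_ : (fun z => _) = fun z : Path * measurableTypeR R =>
   if tau z.1 z.2 \is a fin_num then
     sval (path_traj X z.1) (Num.max (fine (tau z.1 z.2)) 0%R) else None); last first.
  apply/funext => -[w c] /=; rewrite /branch_place.
  by have := tau_ge0 w c; case: (tau w c) => //= r; rewrite lee_fin => r0; rewrite max_l.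
apply: measurable_fun_ifT => //; first exact: (measurable_fin_num measurable_tau).
pose h (z : Path * measurableTypeR R) : R * traj E := (fine (tau z.1 z.2), path_traj X z.1).
have mh : measT h.
  apply: measurable_fun_pair.
    exact: (measurableT_comp (fine_measurable measurableT) measurable_tau).
  exact: (measurableT_comp (measurable_path_traj X)).
exact: (measurableT_comp (@measurable_traj_path R E) mh).
Qed.

Lemma measurable_place d (S : measurableType d) (h : S -> borel E) (w : S -> Path)
    (c : S -> measurableTypeR R) : measT h -> measT w ->
  measT c ->
  measT (fun s => odflt (h s) (branch_place X gamma (w s) (c s)) : borel E).
Proof.
move=> mh mw mc.
have mbp : measT (fun s => branch_place X gamma (w s) (c s) : oE).
  exact: (measurableT_comp measurable_branch_place (measurable_fun_pair mw mc)).
rewrite (_ : (fun s => _) = fun s => if branch_place X gamma (w s) (c s) is Some y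
    then (fun z : S * borel E => z.2) (s, y) else h s).
  apply: (@measurable_fun_match _ (borel E) _ _ S (borel E) _ (fun z => z.2)) => //.
  exact: measurable_snd.
by apply/funext => s; case: branch_place.
Qed.

(** Operator form of [life_law]: expectations of functions, unlike measures of sets, can be iterated
    through generations. *)
Definition life_int (y : E) (f : life -> \bar R) : \bar R :=
  \int[P y]_w \int[Exp]_c
     \int[off_law Z (odflt y (branch_place X gamma w c))]_z f (w, c, z).

Lemma nnm_off_int d (S : measurableType d) (h : S -> borel E) (f : S * life -> \bar R) :
  measT h -> nnm f ->
  nnm (fun u : (S * Path) * measurableTypeR R =>
    \int[off_law Z (odflt (h u.1.1) (branch_place X gamma u.1.2 u.2))]_z
       f (u.1.1, (u.1.2, u.2, z))).
Proof.
move=> mh nf; split=> [u|]; first by apply: integral_ge0 => ? _; exact: nf.1.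
apply: (@measurable_kernel_integral _ _ _ _ ((S * Path) * measurableTypeR R)%type _ _
  (off_law Z) (fun u => odflt (h u.1.1) (branch_place X gamma u.1.2 u.2)) _
  (fun v : ((S * Path) * measurableTypeR R) * Off => f (v.1.1.1, (v.1.1.2, v.1.2, v.2)))).
  apply: measurable_place => //.
  - by apply: (measurableT_comp mh); exact: (measurableT_comp measurable_fst).
  - exact: (measurableT_comp measurable_snd).
apply: (nnm_comp _ nf (h := fun v : ((S * Path) * measurableTypeR R) * Off =>
   (v.1.1.1, (v.1.1.2, v.1.2, v.2)))).
have m1 : measT (fun v : ((S * Path) * measurableTypeR R) * Off => v.1.1).
  exact: (measurableT_comp measurable_fst).
apply: measurable_fun_pair; first exact: (measurableT_comp measurable_fst).
apply: measurable_fun_pair => //; apply: measurable_fun_pair.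
  exact: (measurableT_comp measurable_snd).
exact: (measurableT_comp measurable_snd).
Qed.

Lemma nnm_clock_int d (S : measurableType d) (h : S -> borel E) (f : S * life -> \bar R) :
  measT h -> nnm f ->
  nnm (fun u : S * Path => \int[Exp]_c
    \int[off_law Z (odflt (h u.1) (branch_place X gamma u.2 c))]_z f (u.1, (u.2, c, z))).
Proof.
move=> mh nf; split=> [u|].
  by apply: integral_ge0 => ? _; apply: integral_ge0 => ? _; exact: nf.1.
have := measurable_Exp_integral (nnm_off_int mh nf).
exact.
Qed.

Lemma nnm_life_int d (S : measurableType d) (h : S -> borel E) (f : S * life -> \bar R) :
  measT h -> nnm f ->
  nnm (fun s => life_int (h s) (fun l => f (s, l))).
Proof.
move=> mh nf; split=> [s|].
  by do 3 (apply: integral_ge0 => ? _); exact: nf.1.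
exact: (@measurable_kernel_integral R _ _ _ S (borel E) Path P h mh
  (fun u : S * Path => \int[Exp]_c
    \int[off_law Z (odflt (h u.1) (branch_place X gamma u.2 c))]_z f (u.1, (u.2, c, z)))
  (nnm_clock_int mh nf)).
Qed.

Lemma posop_life_int (y : E) : posop (life_int y).
Proof.
have ny (f : life -> \bar R) : nnm f -> nnm (fun z : unit * life => f z.2).
  by move=> nf; apply: (nnm_comp _ nf (h := snd)).
have my : measT ((fun=> y) : unit -> borel E) by [].
apply: (@posop_bind1 _ _ _ _ Path (fun f => \int[P y]_w f w)
  (fun w f => \int[Exp]_c
     \int[off_law Z (odflt y (branch_place X gamma w c))]_z f (w, c, z))).
- exact: posop_integral.
- move=> w; apply: (@posop_bind1 _ _ _ _ (measurableTypeR R) (fun f => \int[Exp]_c f c)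
    (fun c f => \int[off_law Z (odflt y (branch_place X gamma w c))]_z f (w, c, z))).
  + exact: posop_integral.
  + move=> c; apply: (@posop_comp _ _ life _ Off (fun z => (w, c, z))
     (fun f => \int[off_law Z (odflt y (branch_place X gamma w c))]_z f z)).
      exact: measurable_fun_pair.
    exact: posop_integral.
  + move=> f nf; have [_] := nnm_off_int my (ny f nf).
    have m2 : measT (fun c : measurableTypeR R => ((tt, w), c)).
      exact: measurable_fun_pair.
    by move=> m1; exact: (measurableT_comp m1 m2).
- move=> f nf; have [_] := nnm_clock_int my (ny f nf).
  have m2 : measT (fun w : Path => (tt, w)) by exact: measurable_fun_pair.
  by move=> m1; exact: (measurableT_comp m1 m2).
Qed.

Lemma life_int_indic (y : E) (B : set life) : measurable B ->
  life_int y (fun l => (\1_B l)%:E) = life_law X gamma Z y B.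
Proof.
move=> mB; apply: eq_integral => w _.
rewrite (eq_measure_integral (exp_law R))//; apply: eq_integral => c _.
rewrite (_ : (fun z => _) = fun z => (\1_[set z | B (w, c, z)] z)%:E).
  rewrite integral_indic ?setIT//.
  have := @measurable_fun_pair _ _ _ Off (Path * measurableTypeR R)%type Off (fun=> (w, c)) id.
  move=> /(_ (measurable_cst _) (@measurable_id _ _ _)) /(_ measurableT _ mB).
  by rewrite setTI.
by [].
Qed.

Lemma life_int1 (y : E) : life_int y (cst 1) = 1.
Proof.
rewrite /life_int (eq_integral (cst 1)) => [|w _].
  by rewrite integral_cst// mul1e prob_kernel.
rewrite (eq_integral (cst 1)) => [|c _].
  by rewrite integral_cst// mul1e; exact: probability_setT.
by rewrite integral_cst// mul1e prob_kernel.
Qed.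

Lemma life_int_le1 (y : E) f : nnm f -> (forall l, f l <= 1) -> life_int y f <= 1.
Proof.
move=> nf f1; rewrite -(life_int1 y); by apply: (posop_le (posop_life_int y)) => //; exact: nnm_cst.
Qed.

Local Notation Gam := (rate_int gamma).

(** For a fixed trajectory, survival past s has probability [expR] of minus the accumulated rate,
    and the residual clock is then a fresh exponential one. *)
Lemma clock_after (p : traj E) (s : R) (phi : measurableTypeR R -> \bar R) :
  (0 <= s)%R -> nnm phi ->
  \int[Exp]_c (if s%:E < lifetime_traj gamma p c then
                 phi (c - fine (Gam (sval p) s))%R else 0) =
  (expR (- fine (Gam (sval p) s)))%:E * \int[Exp]_c phi c.
Proof.
move=> s0 nphi; set a := fine _.
have ea : Gam (sval p) s = a%:E.
  by rewrite /a fineK// (rate_int_fin gamma0 mgamma gammaG).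
have a0 : (0 <= a)%R by rewrite fine_ge0// rate_int_ge0.
have mshift : measT (fun c : measurableTypeR R => (c - a)%R : measurableTypeR R).
  exact: measurable_funB.
rewrite -Exp_memoryless//; apply: (@Exp_ae_gt _ _ _ a).
- split=> [c|]; first by case: ifP => // _; exact: nphi.1.
  apply: measurable_fun_ifT => //.
    apply: (measurable_fun_bool true); rewrite /=.
    apply: emeasurable_fun_o_infty => //.
    have m2 : measT (fun c : measurableTypeR R => (p, c)).
      exact: measurable_fun_pair.
    exact: (measurableT_comp (measurable_lifetime gamma0 mgamma) m2).
  exact: (measurableT_comp nphi.2 mshift).
- split=> [c|]; first by case: ifP => // _; exact: nphi.1.
  apply: measurable_fun_ifT => //; first exact: measurable_fun_ltr.
  exact: (measurableT_comp nphi.2 mshift).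
- move=> c _ ca; congr (if _ then _ else _); apply/idP/idP.
    move=> /(lifetime_gt s0); rewrite ea lee_fin => ac.
    by rewrite lt_neqAle eq_sym ca.
  by move=> ac; apply: (rate_int_lt gamma0 mgamma gammaG) => //; rewrite ea lte_fin.
Qed.

Lemma measurable_past_rate s : (0 <= s)%R ->
  measT (fun w : xi_past X s => Gam (xi X ^~ w) s).
Proof.
move=> s0; rewrite (_ : (fun w => _) =
    (fun w => Gam (sval (stop_traj s (path_traj X w))) s)); last first.
  by apply/funext => w; rewrite rate_int_stop.
have m2 : measT (fun w : xi_past X s => stop_traj s (path_traj X w)).
  apply: measurable_traj => t t0 /=; rewrite [Num.max s 0%R]max_l//.
  by apply: measurable_past_xi; rewrite le_min t0 s0 ge_min lexx orbT.
exact: (measurableT_comp (measurable_rate_int gamma0 mgamma s) m2).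
Qed.

Lemma nnm_clock (Phi : traj E * measurableTypeR R -> \bar R) : nnm Phi ->
  nnm (fun p : traj E => \int[Exp]_c Phi (p, c)).
Proof.
move=> nP; split=> [p|]; first by apply: integral_ge0 => ? _; exact: nP.1.
exact: measurable_Exp_integral.
Qed.

(** Integrating the clock first leaves a survival factor that depends on the past alone; the path
    Markov property restarts the trajectory, and the factor is finally turned back into the event of
    survival. *)
Lemma life_markov (y : E) (s : R) (A : set Path) (Phi : traj E * measurableTypeR R -> \bar R) :
  (0 <= s)%R -> @measurable _ (xi_past X s) A -> nnm Phi ->
  \int[P y]_w ((\1_A w)%:E * oapp (fun=> \int[Exp]_c (if s%:E < tau w c then
      Phi (shift_traj s (path_traj X w), c - fine (Gam (xi X ^~ w) s))%R else 0)) 0 (xi X s w)) =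
  \int[P y]_w ((\1_A w)%:E * oapp (fun z => \int[Exp]_c (if s%:E < tau w c then
      \int[P z]_w' \int[Exp]_c' Phi (path_traj X w', c') else 0)) 0 (xi X s w)).
Proof.
move=> s0 pA nP; have nc := nnm_clock nP.
(* First coordinate: indicator and survival probability, both known at s. Second coordinate: the
   future with a fresh clock. *)
pose f (u : xi_past X s * traj E) : \bar R :=
  (\1_A u.1 * expR (- fine (Gam (xi X ^~ u.1) s)))%:E * \int[Exp]_c Phi (u.2, c).
have nf : nnm f.
  apply: nnmM.
    split=> [u|]; first by rewrite lee_fin mulr_ge0// expR_ge0.
    apply/measurable_EFinP; apply: measurable_funM.
      by apply: (measurableT_comp (measurable_indic pA)).
    have m2 : measT (fun u : xi_past X s * traj E => Gam (xi X ^~ u.1) s).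
      exact: (measurableT_comp (measurable_past_rate s0) measurable_fst).
    have m3 := measurable_funN (measurableT_comp (fine_measurable measurableT) m2).
    exact: (measurableT_comp (@measurable_expR R) m3).
  exact: (nnm_comp _ nc (h := snd)).
have := path_markov y s0 nf.
have E1 w : (\1_A w)%:E * oapp (fun=> \int[Exp]_c (if s%:E < tau w c then
      Phi (shift_traj s (path_traj X w), c - fine (Gam (xi X ^~ w) s))%R else 0)) 0 (xi X s w)
    = oapp (fun=> f (w, shift_traj s (path_traj X w))) 0 (xi X s w).
  case: (xi X s w) => [z|]/=; last by rewrite mule0.
  rewrite /f/= EFinM -muleA; congr (_ * _).
  rewrite -(@clock_after (path_traj X w) s (fun c => Phi (shift_traj s (path_traj X w), c)))//.
  apply: (nnm_comp _ nP (h := fun c => (shift_traj s (path_traj X w), c))).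
  exact: measurable_fun_pair.
under eq_integral do rewrite -E1.
move=> ->; apply: eq_integral => w _.
case: (xi X s w) => [z|]/=; last by rewrite mule0.
rewrite /f/= ge0_integralZl_EFin//=; last 2 first.
- by move=> w' _; exact: (nc.1 (path_traj X w')).
- exact: (measurableT_comp nc.2 (measurable_path_traj X)).
rewrite EFinM -muleA; congr (_ * _).
set I := \int[P z]__ _.
have I0 : 0 <= I by apply: integral_ge0 => w' _; exact: nc.1.
(* Read from right to left, with a constant function, to restore the event of survival. *)
have := @clock_after (path_traj X w) s (fun=> I) s0 (nnm_cst _ I0).
by rewrite integral_cst// [X in _ * (_ * X)]probability_setT mule1 => <-.
Qed.

End LifeOperator.

(** * Trees of lives *)

Section UnitInterval.
Context (R : realType).
Local Open Scope ereal_scope.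

Lemma prob_integral_le1 d (T : measurableType d) (P : probability T R) (f : T -> \bar R) :
  nnm f -> (forall w, f w <= 1) -> \int[P]_w f w <= 1.
Proof.
move=> [f0 mf] f1; apply: (@le_trans _ _ (\int[P]_w cst 1 w)); last first.
  by rewrite integral_cst// mul1e; exact: probability_le1.
by apply: ge0_le_integral.
Qed.

Lemma mule_le1 (a b : \bar R) : 0 <= a <= 1 -> 0 <= b <= 1 -> 0 <= a * b <= 1.
Proof.
move=> /andP[a0 a1] /andP[b0 b1]; rewrite mule_ge0//= -[leRHS]mule1.
exact: lee_pmul.
Qed.

Lemma indic01 (T : Type) (A : set T) w : (0 : \bar R) <= (\1_A w : R)%:E <= 1.
Proof. by rewrite indicE !lee_fin; case: (_ \in _); rewrite ?lexx ?ler01. Qed.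

Lemma prod_le1 (I : Type) (s : seq I) (f : I -> \bar R) :
  (forall i, 0 <= f i <= 1) -> 0 <= \big[*%E/1]_(i <- s) f i <= 1.
Proof.
move=> h; elim: s => [|i s ih]; first by rewrite big_nil lee01 lexx.
by rewrite big_cons; exact: mule_le1.
Qed.

Lemma fin_01 (a : \bar R) : 0 <= a <= 1 -> a \is a fin_num.
Proof. by case: a => //= /andP[]; rewrite ?leNye ?leye_eq. Qed.

Lemma indicX (T1 T2 : Type) (A : set T1) (B : set T2) z :
  (\1_(A `*` B) z = \1_A z.1 * \1_B z.2 :> R)%R.
Proof.
rewrite !indicE -natrM mulnb; congr (_%:R); congr nat_of_bool.
by apply/idP/andP; rewrite !inE.
Qed.

Lemma mule_perm4 (a p q d c : \bar R) : a * (p * q) * (d * c) = a * d * (p * (c * q)).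
Proof.
rewrite -!muleA; congr (a * _); rewrite [in RHS]muleCA; congr (p * _).
by rewrite muleC -muleA.
Qed.

Lemma mule_perm3 (a k p q : \bar R) : a * (k * p * q) = a * (p * q) * k.
Proof. by rewrite -[RHS]muleA; congr (a * _); rewrite [RHS]muleC muleA. Qed.

End UnitInterval.

Section Generations.
Context (R : realType) (E : completePseudoMetricType R).
Context dP (Path : measurableType dP) (X : markov_process E Path).
Context (gamma : E -> R) (G : R).
Context dO (Off : measurableType dO) (Z : offspring E Off).
Context dW (Omega : measurableType dW) (Y : branching_process X gamma Z Omega).
Hypothesis gamma0 : forall y, 0 <= gamma y.
Hypothesis mgamma : measurable_fun [set: borel E] (gamma : borel E -> R).
Hypothesis gammaG : forall y, gamma y <= G.
Local Notation life := (life R Path Off).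
Local Notation tau := (lifetime X gamma).
Local Notation word := (seq nat).
Local Notation bE := (R * borel E)%type.
Local Notation LI := (life_int X gamma Z).
Local Open Scope ereal_scope.

Arguments life_int : simpl never.
Arguments life_law : simpl never.
Arguments lifetime : simpl never.

(** The time is the delay after the birth of the parent, so that a child depends on the life of its
    parent only. *)
Definition child (i : nat) (l : life) : option (R * E) :=
  if tau l.1.1 l.1.2 is r%:E then
    if (i < off_num Z l.2)%N then Some (r, off_pos Z i l.2) else None
  else None.

Lemma birth_cons x (L : word -> life) i v :
  birth X gamma Z x L (i :: v) =
  obind (fun a => omap (fun r => ((a.1 + r.1)%R, r.2)) (child i (L v)))
        (birth X gamma Z x L v).
Proof.
rewrite /=; case: (birth _ _ _ _ _ _) => [[b y]|]//=.
rewrite /child; case: (L v) => [[w c] z] /=.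
by case: (tau w c) => [r| |]//=; case: ifP.
Qed.

Lemma measurable_life_tau : measT (fun l : life => tau l.1.1 l.1.2).
Proof.
exact: (measurableT_comp (measurable_tau X gamma0 mgamma) (@measurable_fst _ _ _ _)).
Qed.

Lemma measurable_child i : measT (child i : life -> optm bE).
Proof.
rewrite (_ : child i = fun l => if tau l.1.1 l.1.2 \is a fin_num then
    (if (i < off_num Z l.2)%N then Some (fine (tau l.1.1 l.1.2), off_pos Z i l.2)
     else None) else None); last first.
  by apply/funext => l; rewrite /child; case: (tau _ _).
have mt := measurable_life_tau.
apply: measurable_fun_ifT => //; first exact: measurable_fin_num.
apply: measurable_fun_ifT => //.
  apply: measurable_fun_ltn => //.
  exact: (measurableT_comp (off_num_measurable Z)).
have m2 : measT (fun l : life => (fine (tau l.1.1 l.1.2), off_pos Z i l.2) : bE).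
  apply: measurable_fun_pair.
    exact: (measurableT_comp (fine_measurable measurableT) mt).
  exact: (measurableT_comp (off_pos_measurable Z i)).
exact: (measurableT_comp (@measurable_Some _ bE) m2).
Qed.

Lemma measurable_birth d (S : measurableType d) (l : word -> S -> life) x n :
  (forall v, (size v < n)%N -> measT (l v)) ->
  forall u, (size u <= n)%N ->
  measT (fun s => birth X gamma Z x (l ^~ s) u : optm bE).
Proof.
move=> ml; elim=> [|i v ih] un; first exact: measurable_cst.
rewrite (_ : (fun s => _) = fun s =>
   obind (fun a => omap (fun r => ((a.1 + r.1)%R, r.2)) (child i (l v s)))
        (birth X gamma Z x (l ^~ s) v)); last by apply/funext => s; rewrite birth_cons.
have mv := ih (ltnW un); have mlv := ml v un.
have mc : measT (fun s => child i (l v s) : optm bE).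
  exact: (measurableT_comp (measurable_child i) mlv).
pose k (z : S * bE) : optm bE := omap (fun r => ((z.2.1 + r.1)%R, r.2)) (child i (l v z.1)).
have mk : measT k.
  pose k2 (u : (S * bE) * bE) : optm bE := Some ((u.1.2.1 + u.2.1)%R, u.2.2).
  rewrite (_ : k = fun z => if child i (l v z.1) is Some r then k2 (z, r) else None).
    apply: (@measurable_fun_match _ bE _ _ (S * bE)%type (optm bE) _ k2 (fun=> None)) => //.
    - exact: (measurableT_comp mc measurable_fst).
    - have mp : measT (fun u : (S * bE) * bE => ((u.1.2.1 + u.2.1)%R, u.2.2) : bE).
        apply: measurable_fun_pair; last exact: (measurableT_comp measurable_snd).
        apply: measurable_funD; last exact: (measurableT_comp measurable_fst).
        apply: (measurableT_comp measurable_fst); apply: (measurableT_comp measurable_snd).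
        exact: measurable_fst.
      exact: (measurableT_comp (@measurable_Some _ bE) mp).
  by apply/funext => z; rewrite /k; case: child.
rewrite (_ : (fun s => _) = fun s => if birth X gamma Z x (l ^~ s) v is Some a then k (s, a) else None).
  exact: (@measurable_fun_match _ bE _ _ S (optm bE) _ k (fun=> None)).
by apply/funext => s; case: birth.
Qed.

Definition gen_events (n : nat) : set (set Omega) :=
  [set C | exists v (D : set life),
     [/\ (size v < n)%N, measurable D & C = bmp_life Y v @^-1` D]].

Definition gen n : measurableType _ := g_sigma_algebraType (gen_events n).

Lemma measurable_gen_life n v : (size v < n)%N ->
  measT (bmp_life Y v : gen n -> life).
Proof.
move=> vn _ D mD; rewrite setTI; apply: sub_sigma_algebra.
by exists v; exists D.
Qed.

Lemma gen_measurable n (A : set Omega) : @measurable _ (gen n) A -> measurable A.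
Proof.
apply: smallest_sub; first exact: sigma_algebra_measurable.
move=> _ [v [D [_ mD ->]]]; rewrite -[X in measurable X]setTI.
exact: bmp_life_measurable.
Qed.

Lemma gen_nd n m (A : set Omega) : (n <= m)%N ->
  @measurable _ (gen n) A -> @measurable _ (gen m) A.
Proof.
move=> nm; apply: sub_sigma_algebra2 => _ [v [D [vn mD ->]]].
by exists v; exists D; split=> //; exact: leq_trans nm.
Qed.

Lemma measurable_fun_gen n d (T : measurableType d) (f : Omega -> T) :
  measT (f : gen n -> T) -> measT f.
Proof.
move=> mf _ B mB; rewrite setTI; apply: (@gen_measurable n).
by rewrite -[X in measurable X]setTI; exact: mf.
Qed.

Lemma measurable_fun_gen_nd n m d (T : measurableType d) (f : Omega -> T) : (n <= m)%N ->
  measT (f : gen n -> T) -> measT (f : gen m -> T).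
Proof.
move=> nm mf _ B mB; rewrite setTI; apply: (gen_nd nm).
by rewrite -[X in measurable X]setTI; exact: mf.
Qed.

Variable x : E.
Local Notation Pr := (bmp_law Y x).

Definition brt (u : word) (w : Omega) : option (R * E) :=
  birth X gamma Z x (bmp_life Y ^~ w) u.

Lemma measurable_brt_gen n u : (size u <= n)%N ->
  measT (brt u : gen n -> optm bE).
Proof. by move=> un; apply: (measurable_birth x _ un) => v; exact: measurable_gen_life. Qed.

Lemma measurable_brt u : measT (brt u : Omega -> optm bE).
Proof. exact: (measurable_fun_gen (measurable_brt_gen (leqnn _))). Qed.

(** Functions with values in [0, 1]: products stay finite, so all factors but one can serve as a
    real weight in [posop_bind]. *)
Definition ui d (T : measurableType d) (f : T -> \bar R) := nnm f /\ forall z, f z <= 1.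

(** [KH] is the conditional expectation of [KF] given the earlier generations. The default e is the
    value for an unborn particle: 1 lets it drop out of a product, 0 requires it to be born. *)
Definition KF e (phi : R * life -> \bar R) u w :=
  oapp (fun a : R * E => phi (a.1, bmp_life Y u w)) e (brt u w).

Definition KH e (phi : R * life -> \bar R) u w :=
  oapp (fun a : R * E => LI a.2 (fun l => phi (a.1, l))) e (brt u w).

Lemma KF_some e phi u w a : brt u w = Some a -> KF e phi u w = phi (a.1, bmp_life Y u w).
Proof. by rewrite /KF => ->. Qed.

Lemma KF_none e phi u w : brt u w = None -> KF e phi u w = e.
Proof. by rewrite /KF => ->. Qed.

Lemma KH_some e phi u w a : brt u w = Some a -> KH e phi u w = LI a.2 (fun l => phi (a.1, l)).
Proof. by rewrite /KH => ->. Qed.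

Lemma KH_none e phi u w : brt u w = None -> KH e phi u w = e.
Proof. by rewrite /KH => ->. Qed.

Lemma nnm_KF_gen n e phi u : (size u < n)%N -> 0 <= e -> nnm phi ->
  nnm (KF e phi u : gen n -> \bar R).
Proof.
move=> un e0 nphi; split=> [w|]; first by rewrite /KF; case: brt => //= a; exact: nphi.1.
apply: (@measurable_fun_match _ bE _ _ (gen n) (\bar R) _
  (fun z => phi (z.2.1, bmp_life Y u z.1)) (fun=> e)) => //.
- exact: measurable_brt_gen (ltnW un).
- apply: (measurableT_comp nphi.2); apply: measurable_fun_pair.
    exact: (measurableT_comp measurable_fst).
  exact: (measurableT_comp (measurable_gen_life un)).
Qed.

Lemma nnm_gen n (f : Omega -> \bar R) : nnm (f : gen n -> \bar R) -> nnm f.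
Proof. by move=> [f0 mf]; split=> //; exact: measurable_fun_gen mf. Qed.

Lemma nnm_gen_nd n m (f : Omega -> \bar R) : (n <= m)%N ->
  nnm (f : gen n -> \bar R) -> nnm (f : gen m -> \bar R).
Proof. by move=> nm [f0 mf]; split=> //; exact: measurable_fun_gen_nd mf. Qed.

Lemma nnm_KF e phi u : 0 <= e -> nnm phi -> nnm (KF e phi u).
Proof. by move=> e0 np; exact: (nnm_gen (nnm_KF_gen (ltnSn _) e0 np)). Qed.

Lemma nnm_LI (phi : R * life -> \bar R) : nnm phi ->
  nnm (fun a : bE => LI a.2 (fun l => phi (a.1, l))).
Proof.
move=> nphi.
apply: (nnm_life_int X Z gamma0 mgamma (S := bE) (h := snd) (f := fun z => phi (z.1.1, z.2))) => //.
apply: (nnm_comp _ nphi (h := fun z : bE * life => (z.1.1, z.2))).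
apply: measurable_fun_pair => //.
exact: (measurableT_comp measurable_fst).
Qed.

Lemma nnm_KH_gen n e phi u : (size u <= n)%N -> 0 <= e -> nnm phi ->
  nnm (KH e phi u : gen n -> \bar R).
Proof.
move=> un e0 nphi; have [h0 mh] := nnm_LI nphi.
split=> [w|]; first by rewrite /KH; case: brt => //= a; exact: h0.
apply: (@measurable_fun_match _ bE _ _ (gen n) (\bar R) _
  (fun z => LI z.2.2 (fun l => phi (z.2.1, l))) (fun=> e)) => //.
- exact: measurable_brt_gen.
- exact: (measurableT_comp mh measurable_snd).
Qed.

Lemma nnm_KH e phi u : 0 <= e -> nnm phi -> nnm (KH e phi u).
Proof. by move=> e0 np; exact: (nnm_gen (nnm_KH_gen (leqnn _) e0 np)). Qed.

Lemma LI_le1 y (phi : R * life -> \bar R) b : ui phi -> LI y (fun l => phi (b, l)) <= 1.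
Proof.
move=> [nphi phi1]; apply: life_int_le1 => //.
apply: (nnm_comp _ nphi (h := fun l : life => (b, l))).
exact: measurable_fun_pair.
Qed.

Lemma KF_le1 e phi u w : e <= 1 -> ui phi -> KF e phi u w <= 1.
Proof. by move=> e1 [_ phi1]; rewrite /KF; case: brt => /=. Qed.

Lemma KH_le1 e phi u w : e <= 1 -> ui phi -> KH e phi u w <= 1.
Proof. by move=> e1 up; rewrite /KH; case: brt => //= a; exact: LI_le1. Qed.

Let ind (B : set life) (z : R * life) : \bar R := (\1_B z.2)%:E.

Let ui_ind B : measurable B -> ui (ind B).
Proof.
move=> mB; split=> [|z]; last by rewrite /ind indicE lee_fin; case: (_ \in _).
split=> [z|]; first by rewrite lee_fin.
by apply/measurable_EFinP; exact: (measurableT_comp (measurable_indic mB) measurable_snd).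
Qed.

Let prod_indic (us : seq word) (B : word -> set life) w :
  \big[*%E/1]_(u <- us) KF 0 (ind (B u)) u w =
  (\1_[set w | forall u, u \in us -> brt u w <> None /\ B u (bmp_life Y u w)] w)%:E.
Proof.
elim: us => [|u us ih].
  by rewrite big_nil indicE mem_set.
rewrite big_cons ih /KF; case eb : (brt u w) => [a|]/=.
  rewrite /ind/= -EFinM !indicE -natrM mulnb; congr (_%:R%:E); congr nat_of_bool.
  apply/andP/idP; rewrite !inE/=.
    by move=> [Bu h] v; rewrite in_cons => /orP[/eqP ->|/h//]; rewrite eb.
  move=> h; split; first by have [] := h u (mem_head _ _).
  by move=> v vus; apply: h; rewrite in_cons vus orbT.
rewrite mul0e indicE memNset// => h.
by have [] := h u (mem_head _ _).
Qed.

Let measurable_exist (us : seq word) (B : word -> set life) : (forall u, measurable (B u)) ->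
  measurable [set w | forall u, u \in us -> brt u w <> None /\ B u (bmp_life Y u w)].
Proof.
move=> mB; rewrite (_ : [set w | _] =
    (fun w => \big[*%E/1]_(u <- us) KF 0 (ind (B u)) u w) @^-1` [set 1]).
  have [_] : nnm (fun w => \big[*%E/1]_(u <- us) KF 0 (ind (B u)) u w).
    by apply: nnm_prod => u; apply: nnm_KF => //; exact: (ui_ind (mB u)).1.
  by move=> /(_ measurableT _ (emeasurable_set1 1)); rewrite setTI.
apply/seteqP; split=> w /=; rewrite prod_indic indicE.
  by move=> h; rewrite mem_set.
by have [|] := boolP (w \in _); [rewrite inE|move=> _ /= [] /eqP; rewrite eq_sym oner_eq0].
Qed.

(** [bmp_branching] gives the case of indicators of life events for particles that must be born. The
    induction moves the particles one at a time to the list [vs], where arbitrary functions of birth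
    time and life are allowed and an unborn particle counts 1. *)
Lemma gen_step_aux n (Phi : word -> R * life -> \bar R) :
  (forall u, ui (Phi u)) ->
  forall (vs us : seq word) (B : word -> set life) (A : set Omega),
  uniq (vs ++ us) -> (forall u, u \in vs ++ us -> size u = n) ->
  (forall u, measurable (B u)) -> @measurable _ (gen n) A ->
  \int[Pr]_w ((\1_A w)%:E * ((\big[*%E/1]_(u <- vs) KF 1 (Phi u) u w) *
              \big[*%E/1]_(u <- us) KF 0 (ind (B u)) u w)) =
  \int[Pr]_w ((\1_A w)%:E * ((\big[*%E/1]_(u <- vs) KH 1 (Phi u) u w) *
              \big[*%E/1]_(u <- us) KH 0 (ind (B u)) u w)).
Proof.
move=> uPhi; elim=> [|v vs ih] us B A.
  move=> /= uus sus mB gA; have mA := gen_measurable gA.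
  have := bmp_branching x uus sus mB gA.
  rewrite [in X in _ = X -> _]integral_indicM => H.
  pose S := [set w | forall u, u \in us -> brt u w <> None /\ B u (bmp_life Y u w)].
  rewrite (eq_integral (fun w => (\1_(A `&` S) w)%:E)) => [|w _]; last first.
    by rewrite big_nil mul1e prod_indic -EFinM indicI.
  rewrite integral_indic// ?setIT; last by apply: measurableI => //; exact: measurable_exist.
  rewrite [LHS]H; apply: eq_integral => w _; rewrite big_nil mul1e; congr (_ * _).
  apply: eq_bigr => u _; rewrite /KH -/(brt u w); case: (brt u w) => [[b y]|]; last by [].
  exact: (esym (life_int_indic _ _ _ _ (mB u))).
move=> uniq_all size_all mB gA; have mA := gen_measurable gA.
have sv : size v = n by apply: size_all; rewrite mem_head.
have /andP[vnin uniq'] : (v \notin vs ++ us) && uniq (vs ++ us) by [].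
have size' u : u \in vs ++ us -> size u = n.
  by move=> h; apply: size_all; rewrite in_cons h orbT.
have pe : perm_eq (vs ++ v :: us) (v :: vs ++ us) by rewrite -cat1s perm_catCA.
have uniq2 : uniq (vs ++ v :: us) by rewrite (perm_uniq pe).
have size2 u : u \in vs ++ v :: us -> size u = n by rewrite (perm_mem pe); exact: size_all.
pose Q1 w := (\big[*%E/1]_(u <- vs) KF 1 (Phi u) u w) * \big[*%E/1]_(u <- us) KF 0 (ind (B u)) u w.
pose Q2 w := (\big[*%E/1]_(u <- vs) KH 1 (Phi u) u w) * \big[*%E/1]_(u <- us) KH 0 (ind (B u)) u w.
have nQ1 : nnm Q1.
  apply: nnmM; apply: nnm_prod => u; apply: nnm_KF => //; first exact: (uPhi u).1.
  exact: (ui_ind (mB u)).1.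
have nQ2 : nnm Q2.
  apply: nnmM; apply: nnm_prod => u; apply: nnm_KH => //; first exact: (uPhi u).1.
  exact: (ui_ind (mB u)).1.
have bQ1 w : 0 <= Q1 w <= 1.
  apply: mule_le1; apply: prod_le1 => u.
    by rewrite KF_le1// andbT (nnm_KF _ _ (uPhi u).1).1.
  rewrite KF_le1 ?lee01 ?andbT//; last exact: ui_ind.
  by rewrite (nnm_KF _ _ (ui_ind (mB u)).1).1.
have bQ2 w : 0 <= Q2 w <= 1.
  apply: mule_le1; apply: prod_le1 => u.
    by rewrite KH_le1// andbT (nnm_KH _ _ (uPhi u).1).1.
  rewrite KH_le1 ?lee01 ?andbT//; last exact: ui_ind.
  by rewrite (nnm_KH _ _ (ui_ind (mB u)).1).1.
pose NO : set Omega := [set w | brt v w = None].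
have gNO : @measurable _ (gen n) NO.
  have := measurable_brt_gen (eq_leq sv) measurableT.
  move=> /(_ (~` (Some @` [set: bE]))) H.
  rewrite (_ : NO = setT `&` brt v @^-1` (~` (Some @` [set: bE]))).
    by apply: H; apply: measurableC; exact: measurable_some_image.
  rewrite setTI; apply/seteqP; split=> w /=.
    by rewrite /NO/= => -> -[].
  by rewrite /NO/=; case: (brt v w) => // a; case; exists a.
(* With the other factors frozen as a weight, both sides are positive operators in the factor of v
   and may be tested on rectangles of a birth time event and a life event. *)
pose I1 (phi : R * life -> \bar R) := \int[Pr]_w ((fine ((\1_A w)%:E * Q1 w))%:E * KF 0 phi v w).
pose I2 (phi : R * life -> \bar R) := \int[Pr]_w ((fine ((\1_A w)%:E * Q2 w))%:E * KH 0 phi v w).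
have fQ (Q : Omega -> \bar R) w : (0 <= Q w <= 1) -> (fine ((\1_A w)%:E * Q w))%:E = (\1_A w)%:E * Q w.
  by move=> q01; rewrite fineK//; apply/fin_01/mule_le1 => //; exact: indic01.
have pos (Q : Omega -> \bar R) : nnm Q -> (forall w, 0 <= Q w <= 1) ->
    (forall w, 0 <= fine ((\1_A w)%:E * Q w))%R /\
    measT (fun w => fine ((\1_A w)%:E * Q w)).
  move=> nQ bQ; have n1 := nnmM (nnm_indic R mA) nQ; split=> [w|].
    by apply: fine_ge0; exact: n1.1.
  exact: (measurableT_comp (fine_measurable measurableT) n1.2).
have pI1 : posop I1.
  have [h1 h2] := pos _ nQ1 bQ1.
  rewrite /I1; apply: (@posop_bind _ _ (R * life)%type _ Omega (fun f => \int[Pr]_w f w) _ (fun w phi => KF 0 phi v w) _ h1 h2).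
  - exact: posop_integral.
  - move=> w; apply: (@posop_option _ _ _ _ _ (fun a phi => phi (a.1, bmp_life Y v w))) => a.
    exact: posop_eval.
  - by move=> phi nphi; have [] := @nnm_KF 0 phi v (lexx _) nphi.
have pI2 : posop I2.
  have [h1 h2] := pos _ nQ2 bQ2.
  rewrite /I2; apply: (@posop_bind _ _ (R * life)%type _ Omega (fun f => \int[Pr]_w f w) _ (fun w phi => KH 0 phi v w) _ h1 h2).
  - exact: posop_integral.
  - move=> w; apply: (@posop_option _ _ (R * life)%type _ _ (fun a phi => LI a.2 (fun l => phi (a.1, l)))) => a.
    apply: (@posop_comp _ _ (R * life)%type _ life (fun l => (a.1, l))).
      exact: measurable_fun_pair.
    exact: posop_life_int.
  - by move=> phi nphi; have [] := @nnm_KH 0 phi v (lexx _) nphi.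
have I12 : forall phi, nnm phi -> I1 phi = I2 phi.
  pose GG : set (set (R * life)) := [set D `*` C | D in (measurable : set (set R)) & C in (measurable : set (set life))].
  have GE : @measurable _ (R * life)%type = <<s GG >>.
    by apply: measurable_prod_gen => //; exact: measurable_sigma_id.
  apply: (posop_eq GE _ _ pI1 pI2).
  - by apply: rectangles_setI; exact: measurableI.
  - by exists setT => //; exists setT => //; rewrite setXTT.
  - have ncst : nnm (cst 1 : R * life -> \bar R) by exact: nnm_cst.
    have nK := nnm_KF v (lexx 0) ncst.
    have [h1 h2] := pos _ nQ1 bQ1.
    rewrite /I1; apply: le_lt_trans (ltry 1%R); apply: prob_integral_le1 => [|w].
      apply: nnmM => //; split=> [w|]; first by rewrite lee_fin.
      exact/measurable_EFinP.
    have KF01 : 0 <= KF 0 (cst 1) v w <= 1.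
      by rewrite nK.1/= KF_le1 ?lee01.
    rewrite fQ//; have := mule_le1 (mule_le1 (indic01 R A w) (bQ1 w)) KF01.
    by move=> /andP[].
  - move=> _ [D mD [C mC <-]].
    (* The birth time of v is determined by earlier generations, so this half of the rectangle joins
       the past event A; the other half makes v a member of the list [us]. *)
    pose AD := A `&` brt v @^-1` (Some @` (D `*` [set: E])).
    have gAD : @measurable _ (gen n) AD.
      apply: measurableI => //.
      have := measurable_brt_gen (eq_leq sv) measurableT.
      move=> /(_ (Some @` (D `*` [set: E]))); rewrite setTI; apply.
      by apply: measurable_some_image; apply: measurableX => //; exact: measurableT.
    pose B' u := if u == v then C else B u.
    have mB' u : measurable (B' u) by rewrite /B'; case: ifP.
    have := ih (v :: us) B' AD uniq2 size2 mB' gAD.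
    have sameus (K : word -> \bar R) (K' : word -> \bar R) : (forall u, u != v -> K u = K' u) ->
        \big[*%E/1]_(u <- us) K u = \big[*%E/1]_(u <- us) K' u.
      move=> KK; rewrite big_seq [RHS]big_seq; apply: eq_bigr => u uus; apply: KK.
      by apply: contraNneq vnin => <-; rewrite mem_cat uus orbT.
    have ADE w : (\1_AD w = \1_A w * oapp (fun a : R * E => \1_D a.1) 0 (brt v w) :> R)%R.
      rewrite indicI/=; congr (_ * _)%R; case eb : (brt v w) => [[b y]|]/=.
        rewrite !indicE; congr (_%:R); congr nat_of_bool.
        by apply/idP/idP; rewrite !inE/= eb; [move=> [[b' y'] [/= Db _] [<- _]]|move=> Db; exists (b, y)].
      by rewrite indicE memNset//= eb => -[].
    rewrite /I1 /I2 => H; transitivity (\int[Pr]_w ((\1_AD w)%:E *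
        ((\big[*%E/1]_(u <- vs) KF 1 (Phi u) u w) *
          \big[*%E/1]_(u <- v :: us) KF 0 (ind (B' u)) u w))).
      apply: eq_integral => w _; rewrite fQ// ADE EFinM big_cons.
      rewrite (sameus (fun u => KF 0 (ind (B' u)) u w) (fun u => KF 0 (ind (B u)) u w)); last first.
        by move=> u uv; rewrite /B' (negbTE uv).
      case eb : (brt v w) => [[b y]|]; last first.
        by rewrite !(KF_none _ _ eb) !mule0 !mul0e.
      by rewrite !(KF_some _ _ eb) /B' eqxx indicX EFinM /Q1 mule_perm4.
    rewrite H; apply: eq_integral => w _; rewrite fQ// ADE EFinM big_cons.
    rewrite (sameus (fun u => KH 0 (ind (B' u)) u w) (fun u => KH 0 (ind (B u)) u w)); last first.
      by move=> u uv; rewrite /B' (negbTE uv).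
    case eb : (brt v w) => [[b y]|]; last first.
      by rewrite !(KH_none _ _ eb) !mule0 !mul0e.
    rewrite !(KH_some _ _ eb) /B' eqxx /Q2.
    have -> : LI y (fun l => (\1_(D `*` C) (b, l))%:E) = (\1_D b)%:E * LI y (fun l => ind C (b, l)).
      rewrite -(posopZ (posop_life_int X Z gamma0 mgamma y)); last 2 first.
      - by rewrite indicE.
      - exact: nnm_indic.
      by congr (LI _ _); apply/funext => l; rewrite indicX EFinM.
    by rewrite [RHS]mule_perm4.
(* When v is unborn its factor is 1 and the induction hypothesis applies without it. The integrand
   is the sum of this case and of the case, with default 0, where v is born. *)
pose AN := A `&` NO.
have gAN : @measurable _ (gen n) AN by exact: measurableI.
have := ih us B AN uniq' size' mB gAN => HN.
have decF w : (\1_A w)%:E * ((\big[*%E/1]_(u <- v :: vs) KF 1 (Phi u) u w) *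
              \big[*%E/1]_(u <- us) KF 0 (ind (B u)) u w) =
   (\1_AN w)%:E * Q1 w + (fine ((\1_A w)%:E * Q1 w))%:E * KF 0 (Phi v) v w.
  rewrite fQ// big_cons; case eb : (brt v w) => [a|].
    rewrite !(KF_some _ _ eb) (_ : \1_AN w = 0%R); last first.
      by rewrite indicE memNset// => -[_]; rewrite /NO/= eb.
    by rewrite mul0e add0e /Q1 mule_perm3.
  rewrite !(KF_none _ _ eb) mule0 adde0 mul1e; congr (_%:E * _).
  by rewrite !indicE; congr (_%:R); congr nat_of_bool; apply/idP/idP; rewrite !inE; [|move=> []].
have decH w : (\1_A w)%:E * ((\big[*%E/1]_(u <- v :: vs) KH 1 (Phi u) u w) *
              \big[*%E/1]_(u <- us) KH 0 (ind (B u)) u w) =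
   (\1_AN w)%:E * Q2 w + (fine ((\1_A w)%:E * Q2 w))%:E * KH 0 (Phi v) v w.
  rewrite fQ// big_cons; case eb : (brt v w) => [a|].
    rewrite !(KH_some _ _ eb) (_ : \1_AN w = 0%R); last first.
      by rewrite indicE memNset// => -[_]; rewrite /NO/= eb.
    by rewrite mul0e add0e /Q2 mule_perm3.
  rewrite !(KH_none _ _ eb) mule0 adde0 mul1e; congr (_%:E * _).
  by rewrite !indicE; congr (_%:R); congr nat_of_bool; apply/idP/idP; rewrite !inE; [|move=> []].
under eq_integral do rewrite decF.
under [RHS]eq_integral do rewrite decH.
have mAN := gen_measurable gAN.
have add (Q KK : Omega -> \bar R) : nnm Q -> (forall w, 0 <= Q w <= 1) -> nnm KK ->
   \int[Pr]_w ((\1_AN w)%:E * Q w + (fine ((\1_A w)%:E * Q w))%:E * KK w) =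
   \int[Pr]_w ((\1_AN w)%:E * Q w) + \int[Pr]_w ((fine ((\1_A w)%:E * Q w))%:E * KK w).
  move=> nQ bQ nK; have [p1 p2] := pos _ nQ bQ.
  apply: (posopD (posop_integral Pr)).
    by apply: nnmM => //; exact: nnm_indic.
  apply: nnmM => //; split=> [w|]; first by rewrite lee_fin.
  exact/measurable_EFinP.
have nK1 := nnm_KF v (lexx 0) (uPhi v).1.
have nK2 := nnm_KH v (lexx 0) (uPhi v).1.
rewrite (add _ _ nQ1 bQ1 nK1) (add _ _ nQ2 bQ2 nK2).
by congr (_ + _); [exact: HN|exact: (I12 _ (uPhi v).1)].
Qed.

End Generations.

(** * Expectations over finitely many generations as iterated integrals *)

Section TreeIntegral.
Context (R : realType) (E : completePseudoMetricType R).
Context dP (Path : measurableType dP) (X : markov_process E Path).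
Context (gamma : E -> R).
Context dO (Off : measurableType dO) (Z : offspring E Off).
Context dW (Omega : measurableType dW) (Y : branching_process X gamma Z Omega).
Hypothesis gamma0 : forall y, 0 <= gamma y.
Hypothesis mgamma : measurable_fun [set: borel E] (gamma : borel E -> R).
Local Notation life := (life R Path Off).
Local Notation tau := (lifetime X gamma).
Local Notation word := (seq nat).
Local Notation bE := (R * borel E)%type.
Local Notation LI := (life_int X gamma Z).
Local Notation chd := (child X gamma Z).
Local Open Scope ereal_scope.

Lemma nnm_prod_in d (T : measurableType d) (I : eqType) (s : seq I) (f : I -> T -> \bar R) :
  (forall i, i \in s -> nnm (f i)) -> nnm (fun x => \big[*%E/1]_(i <- s) f i x).
Proof.
move=> nf; rewrite (_ : (fun x => _) = fun x => \big[*%E/1]_(i <- s) (if i \in s then f i x else 1)).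
  by apply: nnm_prod => i; have [/nf//|_] := boolP (i \in s); exact: nnm_cst.
by apply/funext => x; rewrite big_seq [RHS]big_seq; apply: eq_bigr => i ->.
Qed.

Lemma ui_cst1 d (T : measurableType d) : ui (cst 1 : T -> \bar R).
Proof. by split=> //; exact: nnm_cst. Qed.

Lemma ui01 d (T : measurableType d) (f : T -> \bar R) z : ui f -> 0 <= f z <= 1.
Proof. by move=> [[f0 _] f1]; rewrite f0 f1. Qed.

Lemma uiM d (T : measurableType d) (f g : T -> \bar R) : ui f -> ui g -> ui (fun z => f z * g z).
Proof.
move=> uf ug; split; first exact: nnmM uf.1 ug.1.
by move=> z; have /andP[] := mule_le1 (ui01 z uf) (ui01 z ug).
Qed.

Lemma ui_prod d (T : measurableType d) (I : Type) (s : seq I) (f : I -> T -> \bar R) :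
  (forall i, ui (f i)) -> ui (fun z => \big[*%E/1]_(i <- s) f i z).
Proof.
move=> uf; split; first by apply: nnm_prod => i; exact: (uf i).1.
by move=> z; have /andP[] := prod_le1 s (fun i => ui01 z (uf i)).
Qed.

Lemma ui_comp d (T : measurableType d) d' (S : measurableType d') (h : S -> T) (f : T -> \bar R) :
  measT h -> ui f -> ui (f \o h).
Proof. by move=> mh [nf f1]; split=> [|z]; [exact: nnm_comp|exact: f1]. Qed.

Variable K : nat.

(** Expected product of F over d generations issued from a particle with birth data a, labels below
    K. Words carry the most recent label first, so the particle v of the subtree of child i is
    [rcons v i] in the whole tree. *)
Fixpoint tree_int (d : nat) (F : word -> R * life -> \bar R) (a : R * E) : \bar R :=
  if d is d'.+1 then
    LI a.2 (fun l => F [::] (a.1, l) * \big[*%E/1]_(i <- iota 0 K)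
      oapp (fun r => tree_int d' (fun v => F (rcons v i)) ((a.1 + r.1)%R, r.2)) 1 (chd i l))
  else 1.

Definition node d (F : word -> R * life -> \bar R) (z : R * life) : \bar R :=
  F [::] z * \big[*%E/1]_(i <- iota 0 K)
    oapp (fun r => tree_int d (fun v => F (rcons v i)) ((z.1 + r.1)%R, r.2)) 1 (chd i z.2).

Lemma tree_intS d F a : tree_int d.+1 F a = LI a.2 (fun l => node d F (a.1, l)).
Proof. by []. Qed.

Arguments tree_int : simpl never.

Lemma ui_child_oapp (k : bE -> \bar R) i : ui k ->
  ui (fun z : R * life => oapp (fun r => k ((z.1 + r.1)%R, r.2)) 1 (chd i z.2)).
Proof.
move=> [nk k1]; split; last by move=> z; case: chd => [r|]/=; rewrite ?k1.
split; first by move=> z; case: chd => [r|]//=; exact: nk.1.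
apply: (@measurable_fun_match _ bE _ _ (R * life)%type (\bar R) (fun z => chd i z.2)
  (fun u => k ((u.1.1 + u.2.1)%R, u.2.2)) (fun=> 1)) => //.
- exact: (measurableT_comp (measurable_child X Z gamma0 mgamma i) measurable_snd).
- have m2 : measT (fun u : (R * life) * bE => ((u.1.1 + u.2.1)%R, u.2.2) : bE).
    apply: measurable_fun_pair; last exact: (measurableT_comp measurable_snd).
    apply: measurable_funD; last exact: (measurableT_comp measurable_fst).
    exact: (measurableT_comp measurable_fst).
  exact: (measurableT_comp nk.2 m2).
Qed.

Lemma ui_node_aux d F : (forall v, ui (F v)) ->
  (forall i, ui (tree_int d (fun v => F (rcons v i)) : bE -> \bar R)) -> ui (node d F).
Proof.
by move=> uF ut; apply: uiM => //; apply: ui_prod => i; exact: ui_child_oapp.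
Qed.

Lemma ui_tree_int d F : (forall v, ui (F v)) -> ui (tree_int d F : bE -> \bar R).
Proof.
elim: d F => [|d ih] F uF; first exact: ui_cst1.
have un : ui (node d F) by apply: ui_node_aux => // i; apply: ih => v; exact: uF.
split; first exact: (nnm_LI X Z gamma0 mgamma un.1).
move=> a; rewrite tree_intS.
by apply: (LI_le1 X Z gamma0 mgamma a.2 a.1 un).
Qed.

Lemma ui_node d F : (forall v, ui (F v)) -> ui (node d F).
Proof. by move=> uF; apply: ui_node_aux => // i; apply: ui_tree_int => v; exact: uF. Qed.

Lemma child_ge0 i l r p : chd i l = Some (r, p) -> (0 <= r)%R.
Proof.
rewrite /child; case et : (tau _ _) => [r'| |]//; case: ifP => // _ [<- _].
by rewrite -lee_fin -et; exact: tau_ge0.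
Qed.

(** Delays are nonnegative, so a tree rooted after s only evaluates F at birth times after s. *)
Lemma tree_int_after d F F' s : (forall v z, (s < z.1)%R -> F v z = F' v z) ->
  forall b y, (s < b)%R -> tree_int d F (b, y) = tree_int d F' (b, y).
Proof.
elim: d F F' => [//|d ih] F F' FF b y sb.
rewrite !tree_intS; congr (LI _ _); apply/funext => l; rewrite /node FF//; congr (_ * _).
apply: eq_bigr => i _; case ec : (chd i _) => [[r p]|]//.
apply: ih; first by move=> v z sz; exact: FF.
by rewrite /= (lt_le_trans sb)// lerDl (child_ge0 ec).
Qed.

Lemma tree_int_shift d F s : forall b y,
  tree_int d (fun v z => F v ((z.1 - s)%R, z.2)) (b, y) = tree_int d F ((b - s)%R, y).
Proof.
elim: d F => [//|d ih] F b y.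
rewrite !tree_intS; congr (LI _ _); apply/funext => l; rewrite /node; congr (_ * _).
apply: eq_bigr => i _; case: (chd i _) => [[r p]|]//.
rewrite /oapp [LHS](ih (fun v => F (rcons v i)) (b + r)%R p) addrAC.
by [].
Qed.

Lemma tree_int_one d a : tree_int d (fun _ _ => 1) a = 1.
Proof.
elim: d a => [//|d ih] a; rewrite tree_intS -[RHS](life_int1 X gamma Z a.2).
congr (LI _ _); apply/funext => l; rewrite /node mul1e big1// => i _.
by case: (chd i _) => [r|]//=; rewrite ih.
Qed.

Fixpoint words (n : nat) : seq word :=
  if n is n'.+1 then [seq i :: v | v <- words n', i <- iota 0 K] else [:: [::]].

Lemma mem_words n v : (v \in words n) = (size v == n) && all (ltn^~ K) v.
Proof.
elim: n v => [|n ih] [|i v]/=; first by rewrite inE.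
- by rewrite inE.
- by apply/allpairsP => -[[? ?] []].
- apply/allpairsP/idP => [[[v' i'] [/= + + [-> ->]]]|/andP[sv /andP[iK vK]]].
    by rewrite ih mem_iota/= add0n => /andP[/eqP -> ->] ->; rewrite eqxx.
  exists (v, i); split => //=; first by rewrite ih -eqSS sv vK.
  by rewrite mem_iota add0n.
Qed.

Lemma uniq_words n : uniq (words n).
Proof.
elim: n => [//|n ih]; apply: allpairs_uniq => //; first exact: iota_uniq.
by move=> [v i] [v' i'] _ _ /= [-> ->].
Qed.

Fixpoint gen_prod (d n : nat) (g : word -> \bar R) : \bar R :=
  if d is d'.+1 then (\big[*%E/1]_(v <- words n) g v) * gen_prod d' n.+1 g else 1.

Variable x : E.
Local Notation Pr := (bmp_law Y x).
Local Notation brt := (brt Y x).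
Local Notation KF := (KF Y x).
Local Notation KH := (KH Y x).
Local Notation gen := (gen Y).

(** Passage from events to functions of the earlier generations, both sides being positive operators
    in [Psi]. *)
Lemma gen_step n (vs : seq word) (Phi : word -> R * life -> \bar R) (Psi : Omega -> \bar R) :
  (forall u, ui (Phi u)) -> uniq vs -> (forall u, u \in vs -> size u = n) ->
  nnm (Psi : gen n -> \bar R) ->
  \int[Pr]_w (Psi w * \big[*%E/1]_(u <- vs) KF 1 (Phi u) u w) =
  \int[Pr]_w (Psi w * \big[*%E/1]_(u <- vs) KH 1 (Phi u) u w).
Proof.
move=> uPhi uvs svs nPsi.
pose QF w := \big[*%E/1]_(u <- vs) KF 1 (Phi u) u w.
pose QH w := \big[*%E/1]_(u <- vs) KH 1 (Phi u) u w.
have nQF : nnm QF by apply: nnm_prod => u; apply: nnm_KF => //; exact: (uPhi u).1.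
have nQH : nnm QH by apply: nnm_prod => u; apply: nnm_KH => //; exact: (uPhi u).1.
have bQF w : 0 <= QF w <= 1.
  by apply: prod_le1 => u; rewrite KF_le1// andbT (nnm_KF Y gamma0 mgamma _ _ _ (uPhi u).1).1.
have bQH w : 0 <= QH w <= 1.
  by apply: prod_le1 => u; rewrite KH_le1// andbT (nnm_KH Y gamma0 mgamma _ _ _ (uPhi u).1).1.
have fQ (Q : Omega -> \bar R) w : (0 <= Q w <= 1) -> (fine (Q w))%:E = Q w.
  by move=> q01; rewrite fineK//; exact: fin_01.
have pI (Q : Omega -> \bar R) : nnm Q -> (forall w, 0 <= Q w <= 1) ->
    posop (fun f : gen n -> \bar R => \int[Pr]_w ((fine (Q w))%:E * f w)).
  move=> nQ bQ; apply: (@posop_bind _ _ (gen n) _ Omega (fun f => \int[Pr]_w f w)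
    (fun w => fine (Q w)) (fun w f => f w)).
  - exact: posop_integral.
  - by move=> w; apply: fine_ge0; exact: nQ.1.
  - exact: (measurableT_comp (fine_measurable measurableT) nQ.2).
  - by move=> w; exact: posop_eval.
  - by move=> f /nnm_gen[].
have main := @posop_eq _ _ (gen n) measurable _ _ (@measurable_sigma_id _ (gen n))
  (@measurableI _ (gen n)) (@measurableT _ (gen n)) (pI _ nQF bQF) (pI _ nQH bQH).
transitivity (\int[Pr]_w ((fine (QF w))%:E * Psi w)).
  by apply: eq_integral => w _; rewrite fQ// muleC.
transitivity (\int[Pr]_w ((fine (QH w))%:E * Psi w)); last first.
  by apply: eq_integral => w _; rewrite fQ// muleC.
apply: main => //.
- apply: le_lt_trans (ltry 1%R); apply: prob_integral_le1 => [|w].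
    apply: nnmM; last exact: nnm_cst.
    split=> [w|]; first by rewrite lee_fin fine_ge0// nQF.1.
    by apply/measurable_EFinP; exact: (measurableT_comp (fine_measurable measurableT) nQF.2).
  by rewrite fQ// mule1; have /andP[] := bQF w.
- move=> A gA.
  have := @gen_step_aux _ _ _ _ _ _ _ _ _ _ _ Y gamma0 mgamma x n Phi uPhi vs [::] (fun=> setT) A.
  rewrite cats0 => /(_ uvs svs (fun=> measurableT) gA) H.
  transitivity (\int[Pr]_w ((\1_A w)%:E * (QF w *
     \big[*%E/1]_(u <- [::]) KF 0 (fun z => (\1_[set: life] z.2)%:E) u w))).
    by apply: eq_integral => w _; rewrite fQ// big_nil mule1 muleC.
  rewrite H; apply: eq_integral => w _.
  by rewrite fQ// big_nil mule1 muleC.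
Qed.

Lemma brt_cons i v w : brt (i :: v) w =
  obind (fun a => omap (fun r => ((a.1 + r.1)%R, r.2)) (chd i (bmp_life Y v w))) (brt v w).
Proof. exact: birth_cons. Qed.

(** Generations after n are integrated first, by the induction hypothesis at n + 1. The resulting
    factors are grouped by parent into [node], a function of the parent's birth time and life, which
    [gen_step] then integrates. *)
Lemma peel d n (Psi : Omega -> \bar R) (F : word -> R * life -> \bar R) :
  (forall v, ui (F v)) -> nnm (Psi : gen n -> \bar R) ->
  \int[Pr]_w (Psi w * gen_prod d n (fun v => KF 1 (F v) v w)) =
  \int[Pr]_w (Psi w * \big[*%E/1]_(v <- words n)
     oapp (tree_int d (fun v' => F (v' ++ v))) 1 (brt v w)).
Proof.
move=> uF; elim: d n Psi => [|d ih] n Psi nPsi.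
  apply: eq_integral => w _; congr (_ * _); rewrite big1// => v _.
  by case: (brt v w).
pose A w := \big[*%E/1]_(v <- words n) KF 1 (F v) v w.
transitivity (\int[Pr]_w ((Psi w * A w) * gen_prod d n.+1 (fun v => KF 1 (F v) v w))).
  by apply: eq_integral => w _; rewrite /= muleA.
rewrite ih; last first.
  apply: nnmM; first exact: nnm_gen_nd nPsi.
  apply: (@nnm_prod_in _ (gen n.+1)) => v; rewrite mem_words => /andP[/eqP sv _].
  by apply: nnm_KF_gen; rewrite ?sv//; exact: (uF v).1.
pose Phi v := node d (fun v' => F (v' ++ v)).
have uPhi v : ui (Phi v) by apply: ui_node => v'; exact: uF.
transitivity (\int[Pr]_w (Psi w * \big[*%E/1]_(v <- words n) KF 1 (Phi v) v w)).
  apply: eq_integral => w _; rewrite -muleA; congr (_ * _).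
  rewrite [words n.+1]/= big_allpairs_dep/= -big_split; apply: eq_bigr => v _.
  change (KF 1 (F v) v w * \big[*%E/1]_(i <- iota 0 K) oapp (tree_int d (fun v' => F (v' ++ i :: v))) 1 (brt (i :: v) w) = KF 1 (Phi v) v w).
  case eb : (brt v w) => [a|]; last first.
    rewrite !(KF_none _ _ eb) mul1e big1// => i _.
    by rewrite brt_cons eb.
  rewrite !(KF_some _ _ eb) /Phi /node; congr (_ * _); apply: eq_bigr => i _.
  rewrite brt_cons eb [obind _ _]/=; case: (chd i _) => [r|]//=.
  by congr (tree_int _ _ _); apply/funext => v'; rewrite cat_rcons.
have sw v : v \in words n -> size v = n by rewrite mem_words => /andP[/eqP].
rewrite (@gen_step n (words n) Phi Psi uPhi (uniq_words n) sw nPsi).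
by [].
Qed.

End TreeIntegral.

(** * The Markov property at a fixed time for one tree *)

Section LifeMarkov.
Context (R : realType) (E : completePseudoMetricType R).
Context dP (Path : measurableType dP) (X : markov_process E Path).
Context (gamma : E -> R) (G : R).
Context dO (Off : measurableType dO) (Z : offspring E Off).
Hypothesis gamma0 : forall y, 0 <= gamma y.
Hypothesis mgamma : measurable_fun [set: borel E] (gamma : borel E -> R).
Hypothesis gammaG : forall y, gamma y <= G.
Local Notation life := (life R Path Off).
Local Notation tau := (lifetime X gamma).
Local Notation word := (seq nat).
Local Notation bE := (R * borel E)%type.
Local Notation oE := (@optm _ (borel E)).
Local Notation LI := (life_int X gamma Z).
Local Notation chd := (child X gamma Z).
Local Notation TI := (tree_int X gamma Z).
Local Notation nodeF := (node X gamma Z).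
Local Notation P := (xi_law X).
Local Notation Exp := (exp_law R).
Local Open Scope ereal_scope.

Arguments life_int : simpl never.
Arguments lifetime : simpl never.
Arguments lifetime_traj : simpl never.
Arguments tree_int : simpl never.

Definition pos_traj (t : R) (u : traj E * R) : option E :=
  if t%:E < lifetime_traj gamma u.1 u.2 then sval u.1 t else None.

Definition posat (t : R) (z : R * life) : option E :=
  if (z.1 <= t)%R && ((t - z.1)%:E < tau z.2.1.1 z.2.1.2)
  then xi X (t - z.1) z.2.1.1 else None.

Lemma posatE t z : (z.1 <= t)%R ->
  posat t z = pos_traj (t - z.1) (path_traj X z.2.1.1, z.2.1.2).
Proof. by move=> bt; rewrite /posat bt. Qed.

Lemma posat_shift s t b l : posat t ((b - s)%R, l) = posat (s + t) (b, l).
Proof.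
rewrite /posat/= lerBlDl; congr (if _ && (_%:E < _) then xi X _ _ else _); lra.
Qed.

Lemma measurable_pos_traj :
  measT (fun u : R * (traj E * R) => pos_traj (Num.max u.1 0%R) u.2 : oE).
Proof.
apply: measurable_fun_ifT => //.
  apply: measurable_fun_lte.
    apply/measurable_EFinP; apply: measurable_maxr => //.
  exact: (measurableT_comp (measurable_lifetime gamma0 mgamma) measurable_snd).
have m2 : measT (fun u : R * (traj E * R) => (u.1, u.2.1)).
  by apply: measurable_fun_pair => //; exact: (measurableT_comp measurable_fst).
exact: (measurableT_comp (@measurable_traj_path R E) m2).
Qed.

Lemma measurable_posat t : measT (posat t : R * life -> oE).
Proof.
rewrite (_ : posat t = fun z => if (z.1 <= t)%R then
   pos_traj (Num.max (t - z.1) 0)%R (path_traj X z.2.1.1, z.2.1.2) else None); last first.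
  apply/funext => z; rewrite /posat; case: ifPn => [/andP[zt ztau]|].
    by rewrite zt /pos_traj/= max_l ?subr_ge0// ztau.
  case: (leP z.1 t) => //= zt /negbTE ztau.
  by rewrite /pos_traj/= max_l ?subr_ge0// ztau.
apply: measurable_fun_ifT => //; first exact: measurable_fun_ler.
pose h (z : R * life) : R * (traj E * R) := ((t - z.1)%R, (path_traj X z.2.1.1, z.2.1.2)).
have m1 : measT (fun z : R * life => z.2.1).
  exact: (measurableT_comp measurable_fst).
have mh : measT h.
  apply: measurable_fun_pair; first exact: measurable_funB.
  apply: measurable_fun_pair.
    apply: (measurableT_comp (measurable_path_traj X)).
    exact: (measurableT_comp measurable_fst).
  exact: (measurableT_comp measurable_snd).
exact: (measurableT_comp measurable_pos_traj mh).
Qed.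

(** Avoidance rather than presence: an absent particle avoids every set, so its factor is 1, which
    matches the default of products over the tree. Complements of presence events generate the same
    sigma-algebra. *)
Definition off_set (B : set E) (o : option E) : \bar R := (\1_(~` (Some @` B)) o)%:E.

Lemma off_set01 B o : 0 <= off_set B o <= 1.
Proof. exact: indic01. Qed.

Lemma ui_off_set d (S : measurableType d) (B : set (borel E)) (h : S -> oE) :
  measurable B -> measT h -> ui (fun s => off_set B (h s)).
Proof.
move=> mB mh; split; last by move=> z; have /andP[] := off_set01 B (h z).
split; first by move=> z; have /andP[] := off_set01 B (h z).
apply/measurable_EFinP; apply: (measurableT_comp _ mh); apply: measurable_indic.
by apply: measurableC; exact: measurable_some_image.
Qed.

Local Notation obl := (R * set (borel E))%type.

Definition av (l : seq obl) (z : R * life) : \bar R :=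
  \big[*%E/1]_(a <- l) off_set a.2 (posat a.1 z).

Definition av_traj (l : seq obl) (u : traj E * R) : \bar R :=
  \big[*%E/1]_(a <- l) off_set a.2 (pos_traj (Num.max a.1 0%R) u).

Definition obl_ok (p : R -> Prop) (l : seq obl) :=
  forall a, a \in l -> p a.1 /\ measurable a.2.

Lemma ui_prod_in d (T : measurableType d) (I : eqType) (s : seq I) (f : I -> T -> \bar R) :
  (forall i, i \in s -> ui (f i)) -> ui (fun x => \big[*%E/1]_(i <- s) f i x).
Proof.
move=> nf; rewrite (_ : (fun x => _) = fun x => \big[*%E/1]_(i <- s) (if i \in s then f i x else 1)).
  by apply: ui_prod => i; have [/nf//|_] := boolP (i \in s); exact: ui_cst1.
by apply/funext => x; rewrite big_seq [RHS]big_seq; apply: eq_bigr => i ->.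
Qed.

Lemma ui_av p l : obl_ok p l -> ui (av l).
Proof.
by move=> okl; apply: ui_prod_in => a /okl[_ ma]; exact: ui_off_set (measurable_posat _).
Qed.

Lemma ui_av_traj p l : obl_ok p l -> ui (av_traj l : traj E * measurableTypeR R -> \bar R).
Proof.
move=> okl; apply: ui_prod_in => a /okl[_ ma]; apply: ui_off_set => //.
have m2 : measT (fun u : traj E * measurableTypeR R => (a.1, u) : R * (traj E * R)).
  by apply: measurable_fun_pair => //; exact: measurable_id.
exact: (measurableT_comp measurable_pos_traj m2).
Qed.

Lemma av_after s l z : obl_ok (fun t => t <= s)%R l -> (s < z.1)%R -> av l z = 1.
Proof.
move=> okl sz; rewrite /av big_seq big1// => a /okl[as_ _].
rewrite /posat leNgt (le_lt_trans as_ sz)/= /off_set indicE mem_set//.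
by move=> -[].
Qed.

Lemma av_zero l y c z : obl_ok (fun t => 0 <= t)%R l ->
  av l (0%R, (y, c, z)) = av_traj l (path_traj X y, c).
Proof.
move=> okl; rewrite /av /av_traj big_seq [RHS]big_seq; apply: eq_bigr => a /okl[a0 _].
by rewrite posatE//= subr0 max_l.
Qed.

Lemma pos_traj_shift (p : traj E) (c s t : R) : (0 <= s)%R -> (0 <= t)%R ->
  rate_int gamma (sval p) s < c%:E ->
  pos_traj (s + t) (p, c) =
  pos_traj t (shift_traj s p, (c - fine (rate_int gamma (sval p) s))%R).
Proof.
move=> s0 t0 sc; rewrite /pos_traj (lifetime_shift gamma0 mgamma gammaG s0 sc).
by rewrite EFinD lteD2lE// shift_trajE.
Qed.

Lemma av_shift s b l w c z : obl_ok (fun t => 0 <= t)%R l -> (b <= s)%R ->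
  rate_int gamma (xi X ^~ w) (s - b)%R < c%:E ->
  av l ((b - s)%R, (w, c, z)) =
  av_traj l (shift_traj (s - b) (path_traj X w),
             (c - fine (rate_int gamma (xi X ^~ w) (s - b)))%R).
Proof.
move=> okl bs sc; rewrite /av /av_traj big_seq [RHS]big_seq; apply: eq_bigr => a /okl[a0 _].
rewrite posatE/=; last by rewrite (le_trans _ a0)// subr_le0.
congr (off_set _ _); rewrite max_l//.
rewrite -pos_traj_shift ?subr_ge0//; congr (pos_traj _ _); lra.
Qed.

Variable K : nat.

Definition off_prod (k : nat -> R * E -> \bar R) (a : R * E) : \bar R :=
  \int[off_law Z a.2]_z \big[*%E/1]_(i <- iota 0 K)
     (if (i < off_num Z z)%N then k i (a.1, off_pos Z i z) else 1).

Lemma nnm_off_prod (k : nat -> bE -> \bar R) : (forall i, ui (k i)) ->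
  nnm (off_prod k : bE -> \bar R).
Proof.
move=> uk; have np : nnm (fun u : bE * Off => \big[*%E/1]_(i <- iota 0 K)
     (if (i < off_num Z u.2)%N then k i (u.1.1, off_pos Z i u.2) else 1)).
  apply: nnm_prod => i; split=> [u|]; first by case: ifP => // _; exact: (uk i).1.1.
  apply: measurable_fun_ifT => //.
    apply: measurable_fun_ltn => //.
    exact: (measurableT_comp (off_num_measurable Z)).
  apply: (measurableT_comp (uk i).1.2); apply: measurable_fun_pair.
    exact: (measurableT_comp measurable_fst).
  exact: (measurableT_comp (off_pos_measurable Z i)).
split=> [u|]; first by apply: integral_ge0 => z _; exact: np.1 (u, z).
exact: (@measurable_kernel_integral _ _ _ _ bE (borel E) Off (off_law Z) snd measurable_snd _ np).
Qed.

(** With a nonnegative clock a particle that branches is not at the cemetery, so the default of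
    [odflt] only serves particles that never branch, and those have no children. *)
Lemma off_integral_children (k : nat -> R * E -> \bar R) y w c : (0 <= c)%R ->
  \int[off_law Z (odflt y (branch_place X gamma w c))]_z
     \big[*%E/1]_(i <- iota 0 K) oapp (k i) 1 (chd i (w, c, z)) =
  if tau w c is r%:E then oapp (fun y' => off_prod k (r, y')) 1 (xi X r w) else 1.
Proof.
move=> c0; rewrite /branch_place /child/=; case et : (tau w c) => [r| |].
- case ex : (xi X r w) => [y'|]/=; last first.
    by have := lifetime_alive gamma0 mgamma gammaG (p := path_traj X w) c0 et; rewrite [sval _ _]ex.
  by apply: eq_integral => z _; apply: eq_bigr => i _; case: ifP.
- rewrite (eq_integral (cst 1)) => [|z _]; last by rewrite big1.
  by rewrite integral_cst// mul1e prob_kernel.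
- rewrite (eq_integral (cst 1)) => [|z _]; last by rewrite big1.
  by rewrite integral_cst// mul1e prob_kernel.
Qed.

(** What a trajectory and a clock contribute from now on: their own avoidance conditions and, at the
    branching time, the trees of the children, summarised by k. *)
Definition fut_traj (l : seq obl) (k : nat -> R * E -> \bar R) (u : traj E * R) : \bar R :=
  av_traj l u * (if lifetime_traj gamma u.1 u.2 is r%:E
                 then oapp (fun y' => off_prod k (r, y')) 1 (sval u.1 r) else 1).

Lemma nnm_fut_traj p l (k : nat -> bE -> \bar R) : obl_ok p l -> (forall i, ui (k i)) ->
  nnm (fut_traj l k : traj E * measurableTypeR R -> \bar R).
Proof.
move=> okl uk; apply: nnmM; first exact: (ui_av_traj okl).1.
have nop := nnm_off_prod uk.
split=> [u|]; first by case: lifetime_traj => //= r; case: (sval _ _) => //= y; exact: nop.1.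
pose T := (traj E * measurableTypeR R)%type.
pose tauT (u : T) := lifetime_traj gamma u.1 u.2.
have mt : measT tauT by exact: (measurable_lifetime gamma0 mgamma).
rewrite (_ : (fun u => _) = fun u : T => if tauT u \is a fin_num then
   (if sval u.1 (Num.max (fine (tauT u)) 0%R) is Some y'
    then off_prod k (fine (tauT u), y') else 1) else 1); last first.
  apply/funext => u; rewrite /tauT; have := lifetime_ge0 gamma u.1 u.2.
  case: (lifetime_traj _ _ _) => //= r; rewrite lee_fin => r0; rewrite max_l//.
apply: measurable_fun_ifT => //; first exact: measurable_fin_num.
have mf : measT (fun u : T => fine (tauT u)).
  exact: (measurableT_comp (fine_measurable measurableT) mt).
apply: (@measurable_fun_match _ (borel E) _ _ T (\bar R)
   (fun u => sval u.1 (Num.max (fine (tauT u)) 0%R))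
   (fun z => off_prod k (fine (tauT z.1), z.2)) (fun=> 1)) => //.
- have m2 : measT (fun u : T => (fine (tauT u), u.1) : R * traj E).
    exact: measurable_fun_pair.
  exact: (measurableT_comp (@measurable_traj_path R E) m2).
- have m2 : measT (fun z : T * borel E => (fine (tauT z.1), z.2) : bE).
    by apply: measurable_fun_pair => //; exact: (measurableT_comp mf).
  exact: (measurableT_comp nop.2 m2).
Qed.

Lemma measurable_off_children (k : nat -> bE -> \bar R) b w c : (forall i, ui (k i)) ->
  nnm (fun z : Off => \big[*%E/1]_(i <- iota 0 K)
     oapp (fun r => k i ((b + r.1)%R, r.2)) 1 (chd i (w, c, z))).
Proof.
move=> uk; apply: nnm_prod => i.
have m2 : measT (fun z : Off => (b, (w, c, z)) : R * life).
  by apply: measurable_fun_pair => //; exact: measurable_fun_pair.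
exact: (nnm_comp m2 (ui_child_oapp X Z gamma0 mgamma i (uk i)).1).
Qed.

Lemma off_integral_fut p l (k : nat -> bE -> \bar R) y s b w c :
  obl_ok (fun t => 0 <= t)%R l -> obl_ok p l ->
  (forall i, ui (k i)) -> (b <= s)%R -> (0 <= c)%R ->
  rate_int gamma (xi X ^~ w) (s - b)%R < c%:E ->
  \int[off_law Z (odflt y (branch_place X gamma w c))]_z
     (av l ((b - s)%R, (w, c, z)) * \big[*%E/1]_(i <- iota 0 K)
        oapp (fun r => k i ((b - s + r.1)%R, r.2)) 1 (chd i (w, c, z))) =
  fut_traj l k (shift_traj (s - b) (path_traj X w),
             (c - fine (rate_int gamma (xi X ^~ w) (s - b)))%R).
Proof.
move=> ok0 okl uk bs c0 sc.
under eq_integral do rewrite (av_shift _ ok0 bs sc).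
set u := (X in av_traj l X); have [uav _] := ui_av_traj okl.
have nk := measurable_off_children (b - s)%R w c uk.
rewrite ge0_integralZl//; last 3 first.
- exact: nk.2.
- by move=> z _; exact: nk.1.
- exact: uav.1.
congr (_ * _).
rewrite (off_integral_children (fun i r => k i ((b - s + r.1)%R, r.2)))//.
rewrite lifetimeE (lifetime_shift gamma0 mgamma gammaG (p := path_traj X w) _ sc) ?subr_ge0//.
rewrite -/u; have := lifetime_ge0 gamma u.1 u.2.
case: (lifetime_traj gamma u.1 u.2) => [r| |]//=; rewrite lee_fin => r0.
rewrite max_l ?subr_ge0// max_l//.
case: (xi X _ w) => //= y'; rewrite /off_prod/=.
apply: eq_integral => z _; apply: eq_bigr => i _; case: ifP => // _.
by congr (k i (_, _)); lra.
Qed.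

Lemma off_integral_fut0 p l (k : nat -> bE -> \bar R) y w c :
  obl_ok (fun t => 0 <= t)%R l -> obl_ok p l -> (forall i, ui (k i)) -> (0 <= c)%R ->
  \int[off_law Z (odflt y (branch_place X gamma w c))]_z
     (av l (0%R, (w, c, z)) * \big[*%E/1]_(i <- iota 0 K)
        oapp (fun r => k i ((0 + r.1)%R, r.2)) 1 (chd i (w, c, z))) =
  fut_traj l k (path_traj X w, c).
Proof.
move=> ok0 okl uk c0.
under eq_integral do rewrite (av_zero _ _ _ ok0).
set u := (X in av_traj l X); have [uav _] := ui_av_traj okl.
have nk := measurable_off_children 0%R w c uk.
rewrite ge0_integralZl//; last 3 first.
- exact: nk.2.
- by move=> z _; exact: nk.1.
- exact: uav.1.
congr (_ * _).
rewrite (off_integral_children (fun i r => k i ((0 + r.1)%R, r.2)))//.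
rewrite lifetimeE -/u; case: (lifetime_traj gamma u.1 u.2) => [r| |]//=.
case: (xi X _ w) => //= y'; rewrite /off_prod/=.
apply: eq_integral => z _; apply: eq_bigr => i _; case: ifP => // _.
by rewrite add0r.
Qed.

Lemma integral_bool_oapp dT (T : measurableType dT) (m : {measure set T -> \bar R}) (B : Type)
    (a : bool) (f : B -> T -> \bar R) (o : option B) :
  \int[m]_c ((a%:R)%:E * oapp (f ^~ c) 0 o) = (a%:R)%:E * oapp (fun z => \int[m]_c f z c) 0 o.
Proof.
case: o => [z|]; rewrite /oapp; last by rewrite mule0 integral0.
case: a; first by rewrite mul1e; under eq_integral do rewrite mul1e.
by rewrite mul0e; apply: integral0_eq => c _; rewrite mul0e.
Qed.

Section Step.
Variables (s b : R) (y : E) (d : nat) (l1 l2 : word -> seq obl).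
Hypothesis ok1 : forall v, obl_ok (fun t => t <= s)%R (l1 v).
Hypothesis ok2 : forall v, obl_ok (fun t => 0 <= t)%R (l2 v).
Hypothesis bs : (b <= s)%R.

(** The factor at the root also requires it to be alive at s, by means of the default 0. [l1] holds
    conditions up to s, [l2] conditions after s on a time axis restarted at s; [past_res] replaces
    the latter by a function h of the root's place at s. *)
Definition past_fut (v : word) (z : R * life) : \bar R :=
  av (l1 v) z * (av (l2 v) ((z.1 - s)%R, z.2) *
                 (if v is [::] then oapp (fun=> 1) 0 (posat s z) else 1)).

Definition past_res (h : E -> \bar R) (v : word) (z : R * life) : \bar R :=
  av (l1 v) z * (if v is [::] then oapp h 0 (posat s z) else 1).

Let k i := TI K d (fun v => av (l2 (rcons v i))) : bE -> \bar R.
Let h z := TI K d.+1 (fun v => av (l2 v)) (0%R, z).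
(** For a root that survives past s the lifetime test of [posat] is met at all times of [l1], so
    avoidance becomes an event of the path alone, up to its age s - b. *)
Let alive_path : set Path := [set w | forall a, a \in l1 [::] ->
  ~ (Some @` a.2) (if (b <= a.1)%R then xi X (a.1 - b) w else None)].
Local Notation A := alive_path.
Local Notation s0 := (s - b)%R.

Lemma past_alive_path : @measurable _ (xi_past X s0) A.
Proof.
have := @ok1 [::]; rewrite /alive_path; elim: (l1 [::]) => [|a l ih] okl.
  rewrite (_ : [set w | _] = setT); first exact: measurableT.
  by apply/seteqP.
have {}ih := ih (fun a' ha => okl a' (mem_behead (s := a :: l) ha)).
have [as_ ma] := okl a (mem_head _ _).
rewrite (_ : [set w | _] = [set w | ~ (Some @` a.2) (if (b <= a.1)%R then xi X (a.1 - b) w else None)] `&`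
  [set w | forall a, a \in l -> ~ (Some @` a.2) (if (b <= a.1)%R then xi X (a.1 - b) w else None)]).
  apply: (@measurableI _ (xi_past X s0)) => //.
  have [ba|ba] := leP b a.1.
    rewrite (_ : [set w | _] = ~` (xi X (a.1 - b) @^-1` (Some @` a.2)))//.
    apply: (@measurableC _ (xi_past X s0)); apply: measurable_past_event => //.
    by rewrite subr_ge0 ba lerD2r.
  rewrite (_ : [set w | _] = setT); first exact: measurableT.
  by apply/seteqP; split=> // w _ [].
apply/seteqP; split=> w /=.
  move=> H; split; first by apply: H; rewrite mem_head.
  by move=> a' ha; apply: H; rewrite in_cons ha orbT.
by move=> [H1 H2] a'; rewrite in_cons => /orP[/eqP ->//|/H2].
Qed.

Lemma av_alive_path w c z : s0%:E < tau w c -> av (l1 [::]) (b, (w, c, z)) = (\1_A w)%:E.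
Proof.
move=> st.
have -> : av (l1 [::]) (b, (w, c, z)) =
    \big[*%E/1]_(a <- l1 [::]) off_set a.2 (if (b <= a.1)%R then xi X (a.1 - b) w else None).
  rewrite /av big_seq [RHS]big_seq; apply: eq_bigr => a /(@ok1 [::])[as_ _].
  congr off_set; rewrite /posat/=; case: ifPn => [/andP[->//]|].
  case: ifPn => //= ba; rewrite (le_lt_trans _ st)// lee_fin lerD2r//.
have [Aw|Aw] := pselect (A w).
  rewrite indicE mem_set// big_seq big1// => a ha.
  by rewrite /off_set indicE mem_set//=; exact: Aw.
rewrite indicE memNset//.
have /existsNP[a /not_implyP[ha /contrapT Ba]] := Aw.
rewrite (perm_big _ (perm_to_rem ha)) big_cons /off_set indicE memNset; first exact: mul0e.
by move=> /(_ Ba).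
Qed.

Lemma uk i : ui (k i).
Proof. by apply: ui_tree_int => // v; exact: ui_av (@ok2 _). Qed.

Lemma ui_oapp_posat (g : borel E -> \bar R) t : ui g ->
  ui (fun z : R * life => oapp g 0 (posat t z)).
Proof.
move=> [ng g1]; split; last by move=> z; case: posat => /=.
split=> [z|]; first by apply: oapp_ge0 => ?; exact: ng.1.
exact: (measurable_oapp1 ng.2 (measurable_posat t)).
Qed.

Lemma ui_past_fut v : ui (past_fut v).
Proof.
apply: uiM; first exact: ui_av (@ok1 v).
apply: uiM.
  have m2 : measT (fun z : R * life => ((z.1 - s)%R, z.2) : R * life).
    by apply: measurable_fun_pair => //; exact: measurable_funB.
  exact: (ui_comp m2 (ui_av (@ok2 v))).
by case: v => [|? ?]; [exact: ui_oapp_posat (ui_cst1 _ _)|exact: ui_cst1].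
Qed.

(** Children are born after s here: their conditions up to s are void, and the later ones only see
    birth times counted from s. *)
Lemma node_past_fut w c z z0 : s0%:E < tau w c -> xi X s0 w = Some z0 ->
  nodeF K d past_fut (b, (w, c, z)) = (\1_A w)%:E *
   (av (l2 [::]) ((b - s)%R, (w, c, z)) * \big[*%E/1]_(i <- iota 0 K)
        oapp (fun r => k i ((b - s + r.1)%R, r.2)) 1 (chd i (w, c, z))).
Proof.
move=> st xs; rewrite /node /past_fut av_alive_path//.
have -> : posat s (b, (w, c, z)) = Some z0 by rewrite /posat/= bs st xs.
rewrite /= mule1 -muleA; congr (_ * (_ * _)); apply: eq_bigr => i _.
case ec : (chd i _) => [[r p]|]//=.
have sr : (s < b + r)%R.
  move: ec; rewrite /child/=; case et : (tau w c) => [r'| |]//; case: ifP => // _ [<- _].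
  by move: st; rewrite et lte_fin ltrBlDl.
rewrite (@tree_int_after _ _ _ _ X gamma _ _ Z K d _
   (fun v z => av (l2 (rcons v i)) ((z.1 - s)%R, z.2)) s)//; last first.
  move=> v z' sz; rewrite (av_after (@ok1 _) sz) mul1e.
  by case: v => [|? ?] /=; rewrite mule1.
rewrite (@tree_int_shift _ _ _ _ X gamma _ _ Z K d (fun v => av (l2 (rcons v i)))).
by rewrite /k; congr (TI _ _ _ (_, _)); lra.
Qed.

Lemma node_past_fut0 w c z : ~~ (s0%:E < tau w c) || (xi X s0 w == None) ->
  nodeF K d past_fut (b, (w, c, z)) = 0.
Proof.
move=> H; rewrite /node /past_fut.
have -> : posat s (b, (w, c, z)) = None.
  by rewrite /posat/= bs; case: ifP H => //= -> /eqP.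
by rewrite /= !mule0 mul0e.
Qed.

Lemma node_past_res g w c z : nodeF K d (past_res g) (b, (w, c, z)) =
  (\1_A w)%:E * oapp (fun z0 => if s0%:E < tau w c then g z0 else 0) 0 (xi X s0 w).
Proof.
rewrite /node /past_res.
have -> : posat s (b, (w, c, z)) = if s0%:E < tau w c then xi X s0 w else None.
  by rewrite /posat/= bs.
case: ifPn => [st|_]; last by rewrite /= mule0 mul0e; case: (xi X _ _) => /=; rewrite mule0.
rewrite av_alive_path//; case: (xi X s0 w) => [z0|]/=; last by rewrite mule0 mul0e.
rewrite big1 ?mule1// => i _.
case ec : (chd i _) => [[r p]|]//=.
have sr : (s < b + r)%R.
  move: ec; rewrite /child/=; case et : (tau w c) => [r'| |]//; case: ifP => // _ [<- _].
  by move: st; rewrite et lte_fin ltrBlDl.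
rewrite (@tree_int_after _ _ _ _ X gamma _ _ Z K d _ (fun _ _ => 1) s)//.
  exact: tree_int_one.
move=> v z' sz; rewrite (av_after (@ok1 _) sz) mul1e.
by case: v => [|? ?].
Qed.

Lemma life_int_past_fut :
  LI y (fun l => nodeF K d past_fut (b, l)) = LI y (fun l => nodeF K d (past_res h) (b, l)).
Proof.
have s00 : (0 <= s0)%R by rewrite subr_ge0.
have nP := nnm_fut_traj (@ok2 [::]) uk.
have := life_markov gamma0 mgamma gammaG y s00 past_alive_path nP.
set LHS := (X in X = _ -> _); set RHS := (X in _ = X -> _) => LR.
have un : ui (nodeF K d past_fut) by exact: (ui_node X Z gamma0 mgamma K d ui_past_fut).
transitivity LHS.
  apply: eq_integral => w _.
  transitivity (\int[Exp]_c ((\1_A w)%:E * oapp (fun=> if s0%:E < tau w c then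
      fut_traj (l2 [::]) k (shift_traj s0 (path_traj X w),
        (c - fine (rate_int gamma (xi X ^~ w) s0))%R) else 0) 0 (xi X s0 w))); last first.
    by rewrite indicE; exact: (integral_bool_oapp Exp _ (fun _ c => _)).
  (* Survival past s and a clock strictly above the accumulated rate are the same event except at
     this one clock value. *)
  apply: (Exp_ae_gt (a := fine (rate_int gamma (xi X ^~ w) s0))).
  - have my : measT ((fun=> y) : unit -> borel E) by [].
    have nu : nnm (fun u : unit * life => nodeF K d past_fut (b, u.2)).
      have m2 : measT (fun u : unit * life => (b, u.2) : R * life).
        by apply: measurable_fun_pair.
      exact: (nnm_comp m2 un.1).
    have m3 : measT (fun c : measurableTypeR R => ((tt, w), c) : (unit * Path) * measurableTypeR R).
      by apply: measurable_fun_pair.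
    exact: (nnm_comp m3 (nnm_off_int X Z gamma0 mgamma my nu)).
  - apply: nnmM; first by split=> [c|]; [rewrite lee_fin|exact: measurable_cst].
    case: (xi X s0 w) => [z0|]/=; last exact: nnm_cst.
    split=> [c|]; first by case: ifP => _; [exact: nP.1|exact: lexx].
    apply: measurable_fun_ifT; last exact: measurable_cst.
      apply: measurable_fun_lte; first exact: measurable_cst.
      have m2 : measT (fun c : measurableTypeR R => (w, c) : Path * measurableTypeR R).
        by apply: measurable_fun_pair.
      exact: (measurableT_comp (measurable_tau X gamma0 mgamma) m2).
    have m2 : measT (fun c : measurableTypeR R =>
        (shift_traj s0 (path_traj X w), (c - fine (rate_int gamma (xi X ^~ w) s0))%R)
          : traj E * measurableTypeR R).
      apply: measurable_fun_pair; first exact: measurable_cst.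
      apply: measurable_funB; [exact: measurable_id|exact: measurable_cst].
    exact: (measurableT_comp nP.2 m2).
  - move=> c c0 cG.
    have [st|st] := boolP (s0%:E < tau w c); last first.
      rewrite integral0_eq; last by move=> z _; apply: node_past_fut0; rewrite st.
      by case: (xi X s0 w) => /=; rewrite mule0.
    case xs : (xi X s0 w) => [z0|]/=; last first.
      rewrite mule0; apply: (@integral0_eq _ _ _ (off_law Z _)) => z _.
      by apply: node_past_fut0; rewrite xs eqxx orbT.
    under eq_integral do rewrite (node_past_fut _ st xs).
    have sc : rate_int gamma (xi X ^~ w) s0 < c%:E.
      rewrite lt_neqAle (lifetime_gt (p := path_traj X w) s00 st) andbT.
      apply: contra cG => /eqP /(congr1 fine)/= E1; by rewrite -E1.
    rewrite indicE; case: (w \in A); last first.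
      rewrite mul0e; apply: (@integral0_eq _ _ _ (off_law Z _)) => z _; exact: mul0e.
    rewrite mul1e; under eq_integral do rewrite mul1e.
    exact: (off_integral_fut y (@ok2 _) (@ok2 _) uk).
rewrite LR; apply: eq_integral => w _.
transitivity (\int[Exp]_c ((\1_A w)%:E * oapp (fun z0 => if s0%:E < tau w c then h z0 else 0) 0 (xi X s0 w))); last first.
  apply: eq_integral => c _.
  under eq_integral do rewrite node_past_res.
  rewrite (integral_cst (off_law Z _) measurableT) prob_kernel.
  by rewrite mule1.
have hE z0 : \int[P z0]_w' \int[Exp]_c' fut_traj (l2 [::]) k (path_traj X w', c') = h z0.
  rewrite /h tree_intS; apply: eq_integral => w' _; apply/esym.
  have uN : ui (nodeF K d (fun v => av (l2 v))) by exact: (ui_node X Z gamma0 mgamma K d (fun v => ui_av (@ok2 v))).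
  (* Applied only to restrict attention to nonnegative clocks. *)
  apply: (Exp_ae_gt (a := 0%R)).
  - have my : measT ((fun=> z0) : unit -> borel E) by [].
    have nu : nnm (fun u : unit * life => nodeF K d (fun v => av (l2 v)) (0%R, u.2)).
      have m2 : measT (fun u : unit * life => (0%R, u.2) : R * life).
        by apply: measurable_fun_pair.
      exact: (nnm_comp m2 uN.1).
    have m3 : measT (fun c : measurableTypeR R => ((tt, w'), c) : (unit * Path) * measurableTypeR R).
      by apply: measurable_fun_pair.
    exact: (nnm_comp m3 (nnm_off_int X Z gamma0 mgamma my nu)).
  - have m3 : measT (fun c : measurableTypeR R => (path_traj X w', c) : traj E * measurableTypeR R).
      by apply: measurable_fun_pair.
    exact: (nnm_comp m3 nP).
  - move=> c c0 _; exact: (off_integral_fut0 z0 w' (@ok2 _) (@ok2 _) uk c0).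
rewrite indicE (integral_bool_oapp Exp _ (fun z0 c => if s0%:E < tau w c then h z0 else 0)).
case: (xi X s0 w) => [z0|]; rewrite /oapp; last exact: erefl.
by rewrite hE.
Qed.

End Step.

(** If the root is born after s both sides vanish, since it is not alive at s; otherwise the Markov
    property of its life applies. *)
Lemma tree_int_markov d (l1 l2 : word -> seq obl) s a :
  (forall v, obl_ok (fun t => t <= s)%R (l1 v)) ->
  (forall v, obl_ok (fun t => 0 <= t)%R (l2 v)) ->
  TI K d.+1 (past_fut s l1 l2) a =
  TI K d.+1 (past_res s l1 (fun z => TI K d.+1 (fun v => av (l2 v)) (0%R, z))) a.
Proof.
case: a => b y ok1 ok2; rewrite !tree_intS.
have [bs|sb] := leP b s; first exact: life_int_past_fut.
congr (LI _ _); apply/funext => l; rewrite /node /past_fut /past_res /posat.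
by rewrite leNgt sb/= !mule0 !mul0e.
Qed.

End LifeMarkov.

(** * The branching Markov property *)

Section BranchingMarkov.
Context (R : realType) (E : completePseudoMetricType R).
Context dP (Path : measurableType dP) (X : markov_process E Path).
Context (gamma : E -> R) (G : R).
Context dO (Off : measurableType dO) (Z : offspring E Off).
Context dW (Omega : measurableType dW) (Y : branching_process X gamma Z Omega).
Hypothesis gamma0 : forall y, 0 <= gamma y.
Hypothesis mgamma : measurable_fun [set: borel E] (gamma : borel E -> R).
Hypothesis gammaG : forall y, gamma y <= G.
Local Notation life := (life R Path Off).
Local Notation word := (seq nat).
Local Notation bE := (R * borel E)%type.
Local Notation oE := (@optm _ (borel E)).
Local Notation obl := (R * set (borel E))%type.
Local Notation event := (R * word * set (borel E))%type.
Local Notation AV l := (av X gamma l : R * life -> \bar R).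
Local Open Scope ereal_scope.

Arguments life_int : simpl never.
Arguments lifetime : simpl never.
Arguments tree_int : simpl never.

Definition pos (x : E) (t : R) (u : word) (w : Omega) : option E :=
  position X gamma Z x (bmp_life Y ^~ w) t u.

Lemma posE x t u w :
  pos x t u w = obind (fun a => posat X gamma t (a.1, bmp_life Y u w)) (brt Y x u w).
Proof.
rewrite /pos /position /brt; case: birth => [[b y]|]//=.
by rewrite /posat; case: (bmp_life Y u w) => [[p c] z].
Qed.

Lemma measurable_pos x t u : measT (pos x t u : Omega -> oE).
Proof.
rewrite (_ : pos x t u = fun w => if brt Y x u w is Some a
   then posat X gamma t (a.1, bmp_life Y u w) else None); last first.
  by apply/funext => w; rewrite posE; case: brt.
apply: (@measurable_fun_match _ bE _ _ Omega oE (brt Y x u)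
   (fun z => posat X gamma t (z.2.1, bmp_life Y u z.1)) (fun=> None)) => //.
- exact: measurable_brt.
- have m2 : measT (fun z : Omega * bE => (z.2.1, bmp_life Y u z.1) : R * life).
    apply: measurable_fun_pair; first exact: (measurableT_comp measurable_fst).
    apply: (measurableT_comp (bmp_life_measurable Y u)); exact: measurable_fst.
  exact: (measurableT_comp (measurable_posat X gamma0 mgamma t) m2).
Qed.

Definition offp (x : E) (L : seq event) (w : Omega) : \bar R :=
  \big[*%E/1]_(e <- L) off_set e.2 (pos x e.1.1 e.1.2 w).

Definition events_at (L : seq event) (v : word) : seq obl :=
  [seq (e.1.1, e.2) | e <- L & e.1.2 == v].

Fixpoint all_words (K d n : nat) : seq word :=
  if d is d'.+1 then words K n ++ all_words K d' n.+1 else [::].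

Lemma gen_prodE K d n (g : word -> \bar R) :
  gen_prod K d n g = \big[*%E/1]_(v <- all_words K d n) g v.
Proof. by elim: d n => [|d ih] n /=; rewrite ?big_nil// big_cat/= ih. Qed.

Lemma mem_all_words K d n v :
  (v \in all_words K d n) = (n <= size v < n + d)%N && all (ltn^~ K) v.
Proof.
elim: d n => [|d ih] n /=; first by rewrite in_nil addn0; case: leqP => //= /leq_gtF ->.
rewrite mem_cat ih mem_words -andb_orl; congr (_ && _).
rewrite addSnnS; case: (ltngtP n (size v)) => //= <-.
by rewrite -[X in (X < _)%N]addn0 ltn_add2l.
Qed.

Lemma uniq_all_words K d n : uniq (all_words K d n).
Proof.
elim: d n => [//|d ih] n /=; rewrite cat_uniq uniq_words ih andbT/=.
apply/hasPn => v; rewrite mem_all_words mem_words => /andP[/andP[h _] _].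
by rewrite negb_and gtn_eqF.
Qed.

Lemma all_words_cat K d n m : all_words K (d + m) n = all_words K d n ++ all_words K m (n + d).
Proof. by elim: d n => [|d ih] n /=; rewrite ?addn0// ih catA addnS. Qed.

Lemma offp_all_words K M x L w :
  (forall e, e \in L -> (size e.1.2 < M)%N && all (ltn^~ K) e.1.2) ->
  offp x L w = \big[*%E/1]_(v <- all_words K M 0) KF Y x 1 (AV (events_at L v)) v w.
Proof.
move=> HL.
have KFE v : KF Y x 1 (AV (events_at L v)) v w =
    \big[*%E/1]_(e <- L | e.1.2 == v) off_set e.2 (pos x e.1.1 e.1.2 w).
  rewrite /KF /av /events_at; case eb : (brt Y x v w) => [a|]; rewrite /oapp.
    rewrite big_map big_filter; apply: eq_bigr => e /eqP ev.
    by rewrite posE ev eb.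
  rewrite big1// => e /eqP ev; rewrite posE ev eb /off_set/= indicE mem_set//.
  by move=> -[].
under eq_bigr do rewrite KFE.
rewrite /offp (exchange_big_dep xpredT)//= big_seq [RHS]big_seq; apply: eq_bigr => e eL.
rewrite big_mkcond (bigD1_seq e.1.2) ?uniq_all_words//=; last by rewrite mem_all_words add0n HL.
by rewrite eqxx big1 ?mule1// => v /negbTE ne; rewrite eq_sym ne.
Qed.

Lemma prodeM (I : Type) (r : seq I) (f g : I -> \bar R) :
  \big[*%E/1]_(i <- r) (f i * g i) = (\big[*%E/1]_(i <- r) f i) * (\big[*%E/1]_(i <- r) g i).
Proof. exact: big_split. Qed.

Lemma mem_cons_cat1 (T : eqType) (a b : T) s1 s2 s3 : b \in s1 -> b \in a :: s1 ++ s2 ++ s3.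
Proof. by move=> h; rewrite in_cons !mem_cat h orbT. Qed.

Lemma mem_cons_cat2 (T : eqType) (a b : T) s1 s2 s3 : b \in s2 -> b \in a :: s1 ++ s2 ++ s3.
Proof. by move=> h; rewrite in_cons !mem_cat h !orbT. Qed.

Lemma mem_cons_cat3 (T : eqType) (a b : T) s1 s2 s3 : b \in s3 -> b \in a :: s1 ++ s2 ++ s3.
Proof. by move=> h; rewrite in_cons !mem_cat h !orbT. Qed.

Lemma eq_prod_in (I : eqType) (r : seq I) (f g : I -> \bar R) :
  (forall i, i \in r -> f i = g i) -> \big[*%E/1]_(i <- r) f i = \big[*%E/1]_(i <- r) g i.
Proof. by move=> fg; rewrite big_seq [RHS]big_seq; apply: eq_bigr. Qed.

Lemma KFM x (f g : R * life -> \bar R) v w :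
  KF Y x 1 (fun z => f z * g z) v w = KF Y x 1 f v w * KF Y x 1 g v w.
Proof. by rewrite /KF; case: brt => [a|]; rewrite /oapp ?mule1. Qed.

(** A finite avoidance event involves finitely many words, so its probability is a tree integral
    from the root, born at time 0. *)
Lemma offp_one K D z (L : seq event) :
  (forall e, e \in L -> measurable e.2) ->
  (forall e, e \in L -> (size e.1.2 < D)%N && all (ltn^~ K) e.1.2) ->
  \int[bmp_law Y z]_w offp z L w =
  tree_int X gamma Z K D (fun v => AV (events_at L v)) (0%R, z).
Proof.
move=> mL HL.
have okL v : obl_ok (fun=> True) (events_at L v).
  by move=> a /mapP[e]; rewrite mem_filter => /andP[_ /mL me] ->.
have uF v : ui (AV (events_at L v)) by exact: (ui_av X Off gamma0 mgamma (@okL v)).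
have := @peel _ _ _ _ _ _ _ _ _ _ _ Y gamma0 mgamma K z D 0 (fun=> 1) _ uF (nnm_cst _ lee01).
under eq_integral do rewrite mul1e gen_prodE -(offp_all_words _ _ HL).
move=> ->.
under eq_integral do rewrite mul1e big_cons big_nil mule1 /=.
rewrite (_ : (fun v' => _) = fun v => AV (events_at L v)); last first.
  by apply/funext => v; rewrite cats0.
apply: (etrans (integral_cst (bmp_law Y z) measurableT _)).
exact: (etrans (congr1 (mule _) (probability_setT (bmp_law Y z))) (mule1 _)).
Qed.

Section FixedWord.
Variables (x : E) (u : word) (s : R) (L1 L2 : seq event).
Hypothesis mL1 : forall e, e \in L1 -> measurable e.2.
Hypothesis tL1 : forall e, e \in L1 -> (e.1.1 <= s)%R || ~~ suffix u e.1.2.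
Hypothesis mL2 : forall e, e \in L2 -> measurable e.2.
Hypothesis tL2 : forall e, e \in L2 -> (0 <= e.1.1)%R.

Definition later (e : event) : event := ((s + e.1.1)%R, e.1.2 ++ u, e.2).

Let l1 v := events_at L1 v.
Let l2 v := events_at L2 v.
Let desc (v : word) := take (size v - size u) v.

Let descK v : suffix u v -> desc v ++ u = v.
Proof.
move=> /suffixP[v' ->]; rewrite /desc size_cat addnK take_size_cat//.
Qed.

Let desc_cat v' : desc (v' ++ u) = v'.
Proof. by rewrite /desc size_cat addnK take_size_cat. Qed.

Let descE v' v : suffix u v -> (v' ++ u == v) = (v' == desc v).
Proof. by move=> uv; apply/eqP/eqP => [<-|->]; rewrite ?desc_cat ?descK. Qed.

Let ok1 v' : obl_ok (fun t => t <= s)%R (l1 (v' ++ u)).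
Proof.
move=> a /mapP[e]; rewrite mem_filter => /andP[/eqP ev eL] ->; split; last exact: mL1.
by have := tL1 eL; rewrite ev suffix_suffix orbF.
Qed.

Let okT v : obl_ok (fun=> True) (l1 v).
Proof. by move=> a /mapP[e]; rewrite mem_filter => /andP[_ /mL1 me] ->. Qed.

Let ok2 v : obl_ok (fun t => 0 <= t)%R (l2 v).
Proof.
by move=> a /mapP[e]; rewrite mem_filter => /andP[_ eL] ->; split; [exact: tL2|exact: mL2].
Qed.

(** The two sides of the Markov property as products over one tree: they differ inside the subtree
    of u only, whose particles are exactly the words with suffix u. *)
Let F1 v : R * life -> \bar R := if suffix u v then past_fut X gamma s (fun v' => l1 (v' ++ u)) l2 (desc v)
            else AV (l1 v).

Let F2 h v : R * life -> \bar R := if suffix u v then past_res X gamma s (fun v' => l1 (v' ++ u)) h (desc v)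
            else AV (l1 v).

Let events_later v : AV (events_at (map later L2) v) =
  if suffix u v then (fun z => AV (l2 (desc v)) ((z.1 - s)%R, z.2)) else cst 1.
Proof.
apply/funext => z; have [uv|uv] := boolP (suffix u v).
  rewrite /av /events_at !big_map !big_filter big_map.
  rewrite (eq_bigl (fun e : event => e.1.2 == desc v)); last by move=> e; exact: descE.
  by apply: eq_bigr => e _; rewrite posat_shift; case: z.
rewrite /av big_seq big1// => a /mapP[e]; rewrite mem_filter => /andP[/eqP ev] /mapP[e' _ ee].
by case/negP: uv; rewrite -ev ee/= suffix_suffix.
Qed.

Let KF1 w v : brt Y x u w <> None ->
  KF Y x 1 (F1 v) v w = KF Y x 1 (AV (l1 v)) v w *
   (KF Y x 1 (AV (events_at (map later L2) v)) v w *
    (if v == u then oapp (fun=> 1) 0 (pos x s u w) else 1)).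
Proof.
move=> bu; rewrite events_later /F1; have [uv|uv] := boolP (suffix u v); last first.
  rewrite ifN; last by apply: contra uv => /eqP ->; exact: suffix_refl.
  by rewrite /(KF Y x 1 (cst 1)); case: brt => [a|]; rewrite /oapp !mule1.
have -> : (v == u) = (desc v == [::]).
  by rewrite [RHS]eq_sym -(descE [::] uv) eq_sym.
rewrite !KFM (descK uv); congr (_ * (_ * _)).
case: eqP => [dv|]; last by case: (desc v) => // ? ? _; rewrite /KF; case: brt.
have vu : v = u by rewrite -(descK uv) dv.
rewrite dv vu posE /KF; by case eb : (brt Y x u w) bu.
Qed.

Let KF2 h w v : brt Y x u w <> None ->
  KF Y x 1 (F2 h v) v w = KF Y x 1 (AV (l1 v)) v w *
    (if v == u then oapp h 0 (pos x s u w) else 1).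
Proof.
move=> bu; rewrite /F2; have [uv|uv] := boolP (suffix u v); last first.
  rewrite ifN ?mule1//; apply: contra uv => /eqP ->; exact: suffix_refl.
have -> : (v == u) = (desc v == [::]).
  by rewrite [RHS]eq_sym -(descE [::] uv) eq_sym.
rewrite !KFM (descK uv); congr (_ * _).
case: eqP => [dv|]; last by case: (desc v) => // ? ? _; rewrite /KF; case: brt.
have vu : v = u by rewrite -(descK uv) dv.
rewrite dv vu posE /KF; by case eb : (brt Y x u w) bu.
Qed.

Let existsu w : \bar R := oapp (fun=> 1) 0 (brt Y x u w).

(** The generations before that of u form the weight [Psi]. At the generation of u the product
    splits into subtrees; only that of u changes, and there [tree_int_markov] applies. The events of
    [L1] may lie after s as long as they concern no descendant of u. *)
Lemma branching_markov_off :
  \int[bmp_law Y x]_w (offp x L1 w * (offp x (map later L2) w * oapp (fun=> 1) 0 (pos x s u w))) =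
  \int[bmp_law Y x]_w (offp x L1 w *
     oapp (fun z => \int[bmp_law Y z]_w' offp z L2 w') 0 (pos x s u w)).
Proof.
pose allw := u :: [seq e.1.2 | e <- L1] ++ [seq e.1.2 | e <- map later L2] ++ [seq e.1.2 | e <- L2].
(* D and K bound the lengths and labels of all words involved, so that finitely many generations
   with finitely many labels contain every event. *)
pose D := \max_(v <- allw) size v.
pose K := (\max_(v <- allw) \max_(i <- v) i).+1.
have sD v : v \in allw -> (size v < D.+1)%N by move=> va; rewrite ltnS; exact: leq_bigmax_seq.
have aK v : v \in allw -> all (ltn^~ K) v.
  move=> va; apply/allP => i iv /=; rewrite ltnS.
  apply: (@leq_trans (\max_(j <- v) j)); first exact: leq_bigmax_seq.
  exact: (@leq_bigmax_seq _ _ xpredT (fun v : word => \max_(j <- v) j)).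
have mf (L : seq event) e : e \in L -> e.1.2 \in [seq e.1.2 | e <- L].
  by move=> eL; exact: (map_f (fun e : event => e.1.2) eL).
have ua : u \in allw by rewrite mem_head.
have L1a e : e \in L1 -> e.1.2 \in allw.
  by move/mf => h; exact: mem_cons_cat1.
have L2a e : e \in map later L2 -> e.1.2 \in allw.
  by move/mf => h; exact: mem_cons_cat2.
have L2b e : e \in L2 -> e.1.2 \in allw.
  by move/mf => h; exact: mem_cons_cat3.
pose n := size u; pose TD := tree_int X gamma Z K D.+1.
pose h z := TD (fun v => AV (l2 v)) (0%R, z).
have hE z : \int[bmp_law Y z]_w' offp z L2 w' = h z.
  by apply: offp_one => // e eL; rewrite sD ?aK ?L2b.
pose M := (n + D.+1)%N.
have HM (L : seq event) : (forall e, e \in L -> e.1.2 \in allw) ->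
    forall e, e \in L -> (size e.1.2 < M)%N && all (ltn^~ K) e.1.2.
  by move=> La e eL; rewrite aK ?La// andbT (leq_trans (sD _ (La _ eL)))// leq_addl.
(* The birth of u is decided by the generations before its own, hence so is this weight; on the
   event that u is unborn both sides vanish. *)
pose Psi w := existsu w * \big[*%E/1]_(v <- all_words K n 0) KF Y x 1 (AV (l1 v)) v w.
have um : u \in all_words K D.+1 n.
  by rewrite mem_all_words -/n leqnn aK// andbT addnS ltnS leq_addr.
have uF1 v : ui (F1 v).
  rewrite /F1; case: ifP => _; last exact: (ui_av X Off gamma0 mgamma (@okT v)).
  exact: (ui_past_fut X Off gamma0 mgamma ok1 ok2).
have uh : ui (h : borel E -> \bar R).
  have uT := ui_tree_int X Z gamma0 mgamma K D.+1 (fun v => ui_av X Off gamma0 mgamma (@ok2 v)).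
  have m2 : measT (fun z : borel E => (0%R, z) : bE) by exact: measurable_fun_pair.
  exact: (ui_comp m2 uT).
have uF2 v : ui (F2 h v).
  rewrite /F2; case: ifP => _; last exact: (ui_av X Off gamma0 mgamma (@okT v)).
  apply: uiM; first exact: (ui_av X Off gamma0 mgamma (@ok1 (desc v))).
  by case: (desc v) => [|? ?]; [exact: (ui_oapp_posat X Off gamma0 mgamma s uh)|exact: ui_cst1].
have nPsi : nnm (Psi : gen Y n -> \bar R).
  apply: nnmM.
    split=> [w|]; first by rewrite /existsu; case: brt.
    apply: (@measurable_fun_match _ bE _ _ (gen Y n) (\bar R) (brt Y x u) (fun=> 1) (fun=> 0)).
    - by apply: measurable_brt_gen.
    - exact: measurable_cst.
    - exact: measurable_cst.
  apply: (@nnm_prod_in _ _ (gen Y n)) => v; rewrite mem_all_words => /andP[/andP[_ vn] _].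
  apply: nnm_KF_gen => //.
  exact: (ui_av X Off gamma0 mgamma (@okT v)).1.
have bigu (a : \bar R) : \big[*%E/1]_(v <- all_words K D.+1 n) (if v == u then a else 1) = a.
  rewrite (bigD1_seq u) ?uniq_all_words//= eqxx big1 ?mule1// => v /negbTE ->//.
have cut (L : seq event) w : (forall e, e \in L -> e.1.2 \in allw) -> offp x L w =
    (\big[*%E/1]_(v <- all_words K n 0) KF Y x 1 (AV (events_at L v)) v w) *
    (\big[*%E/1]_(v <- all_words K D.+1 n) KF Y x 1 (AV (events_at L v)) v w).
  move=> La; rewrite (offp_all_words _ _ (HM _ La)) /M all_words_cat big_cat.
  by rewrite add0n.
have early w : \big[*%E/1]_(v <- all_words K n 0) KF Y x 1 (AV (events_at (map later L2) v)) v w = 1.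
  rewrite big_seq big1// => v; rewrite mem_all_words => /andP[/andP[_ vn] _].
  rewrite events_later ifN; first by rewrite /KF; case: brt.
  by apply/negP => /size_suffix; rewrite leqNgt vn.
transitivity (\int[bmp_law Y x]_w (Psi w * gen_prod K D.+1 n (fun v => KF Y x 1 (F1 v) v w))).
  apply: eq_integral => w _; rewrite gen_prodE /Psi /existsu.
  case eb : (brt Y x u w) => [a|]; last by rewrite posE eb /oapp !mule0 !mul0e.
  have bu : brt Y x u w <> None by rewrite eb.
  rewrite (cut _ _ L1a) (cut _ _ L2a) early mul1e [oapp _ _ (Some a)]/oapp mul1e -muleA.
  apply: (congr1 (mule _)); rewrite [RHS](eq_bigr _ (fun v _ => KF1 v bu)).
  by rewrite !prodeM bigu.
transitivity (\int[bmp_law Y x]_w (Psi w * gen_prod K D.+1 n (fun v => KF Y x 1 (F2 h v) v w))); last first.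
  apply: eq_integral => w _; rewrite gen_prodE /Psi /existsu.
  rewrite (_ : (fun z => _) = h); last by apply/funext => z; exact: hE.
  case eb : (brt Y x u w) => [a|]; last by rewrite posE eb /oapp !mule0 !mul0e.
  have bu : brt Y x u w <> None by rewrite eb.
  rewrite (cut _ _ L1a) [oapp _ _ (Some a)]/oapp mul1e -muleA.
  apply: (congr1 (mule _)); rewrite (eq_bigr _ (fun v _ => KF2 h v bu)).
  by rewrite prodeM bigu.
rewrite (peel gamma0 mgamma K x D.+1 uF1 nPsi) (peel gamma0 mgamma K x D.+1 uF2 nPsi).
apply: eq_integral => w _; apply: (congr1 (mule _)).
apply: eq_prod_in => v.
rewrite mem_words => /andP[/eqP sv _]; case: (brt Y x v w) => [a|]; rewrite /oapp; last by [].
have [vu|vu] := eqVneq v u.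
  rewrite vu (_ : (fun v' => F1 (v' ++ u)) = past_fut X gamma s (fun v' => l1 (v' ++ u)) l2); last first.
    by apply/funext => v'; rewrite /F1 suffix_suffix desc_cat.
  rewrite (_ : (fun v' => F2 h (v' ++ u)) = past_res X gamma s (fun v' => l1 (v' ++ u)) h); last first.
    by apply/funext => v'; rewrite /F2 suffix_suffix desc_cat.
  exact: (@tree_int_markov _ _ _ _ X gamma G _ _ Z gamma0 mgamma gammaG K D (fun v' => l1 (v' ++ u)) l2 s a (fun v' => @ok1 v') (fun v' => @ok2 v')).
have nsuf v' : suffix u (v' ++ v) = false.
  apply/negP => /suffixP[v2 e].
  have es : size v' = size v2 by have /eqP := congr1 size e; rewrite !size_cat sv eqn_add2r => /eqP.
  by move/eqP: e; rewrite eqseq_cat// (negbTE vu) andbF.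
rewrite (_ : (fun v' => F1 (v' ++ v)) = fun v' => F2 h (v' ++ v))//.
by apply/funext => v'; rewrite /F1 /F2 nsuf.
Qed.

End FixedWord.
End BranchingMarkov.

(** * Configurations and the branching Markov property for functionals *)

Section Configurations.
Context (R : realType) (E : completePseudoMetricType R).
Local Notation word := (seq nat).
Local Notation oE := (@optm _ (borel E)).
Local Open Scope ereal_scope.

Definition conf_events : set (set (word -> option E)) :=
  [set C | exists v, exists2 B : set (borel E), measurable B &
     C = [set z | ~ (Some @` B) (z v)]].

Definition conf : measurableType _ := g_sigma_algebraType conf_events.

Lemma measurable_off d (S : measurableType d) (f : S -> oE) :
  (forall B : set (borel E), measurable B -> measurable [set s | ~ (Some @` B) (f s)]) ->
  measT f.
Proof.
move=> mf; apply: measurable_fun_optm => B mB.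
by rewrite -[X in measurable X]setCK; apply: measurableC; exact: mf.
Qed.

Lemma measurable_conf d (S : measurableType d) (F : S -> conf) :
  (forall v, measT (fun s => F s v : oE)) -> measT F.
Proof.
move=> mF; apply: (@measurability _ _ S conf setT F conf_events) => //.
move=> _ [_ [v [B mB ->]] <-].
exact: (mF v measurableT _ (measurableC (measurable_some_image mB))).
Qed.

Lemma measurable_conf_eval v : measT (fun z : conf => z v : oE).
Proof.
by apply: measurable_off => B mB; apply: sub_sigma_algebra; exists v; exists B.
Qed.

Lemma fcap_conf A : fcap conf_events A ->
  exists2 L : seq (word * set (borel E)), (forall e, e \in L -> measurable e.2) &
    forall z : word -> option E, (\1_A z)%:E = \big[*%E/1]_(e <- L) off_set e.2 (z e.1) :> \bar R.
Proof.
elim=> [|_ A' [v [B mB ->]] _ [L mL LE]].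
  by exists [::] => // z; rewrite big_nil indicT.
exists ((v, B) :: L) => [e|z]; first by rewrite in_cons => /orP[/eqP ->//|/mL].
rewrite big_cons -LE /off_set -EFinM; congr (_%:E).
by rewrite indicI; congr (_ * _)%R; rewrite !indicE.
Qed.

Lemma fcap_measurable d (T : measurableType d) (GG : set (set T)) A :
  @measurable _ T = <<s GG >> -> fcap GG A -> measurable A.
Proof. by move=> -> GA; rewrite -sigma_fcap; exact: sub_sigma_algebra. Qed.

End Configurations.

Section FunctionalBranchingMarkov.
Context (R : realType) (E : completePseudoMetricType R).
Context dP (Path : measurableType dP) (X : markov_process E Path).
Context (gamma : E -> R) (G : R).
Context dO (Off : measurableType dO) (Z : offspring E Off).
Context dW (Omega : measurableType dW) (Y : branching_process X gamma Z Omega).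
Hypothesis gamma0 : forall y, 0 <= gamma y.
Hypothesis mgamma : measurable_fun [set: borel E] (gamma : borel E -> R).
Hypothesis gammaG : forall y, gamma y <= G.
Local Notation word := (seq nat).
Local Notation oE := (@optm _ (borel E)).
Local Notation event := (R * word * set (borel E))%type.
Local Notation conf := (conf E).
Local Notation pos := (pos Y).
Local Open Scope ereal_scope.

Definition cfg (x : E) (t : R) (w : Omega) : conf := fun v => pos x t v w.

Definition sub_cfg (x : E) (t : R) (u : word) (w : Omega) : conf := fun v => pos x t (v ++ u) w.

Lemma measurable_cfg x t : measT (cfg x t).
Proof. by apply: measurable_conf => v; exact: measurable_pos. Qed.

Lemma measurable_sub_cfg x t u : measT (sub_cfg x t u).
Proof. by apply: measurable_conf => v; exact: measurable_pos. Qed.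

(** More than the past at s: it contains the entire evolution of all particles that do not descend
    from u. Conditional independence of the subtrees of different alive particles is thus part of
    the Markov property for a single u. *)
Definition hist_events (x : E) (s : R) (u : word) : set (set Omega) :=
  [set C | exists r v (B : set (borel E)), [/\ (r <= s)%R || ~~ suffix u v, measurable B &
     C = [set w | ~ (Some @` B) (pos x r v w)]]].

Definition hist x s u : measurableType _ := g_sigma_algebraType (hist_events x s u).

Lemma measurable_hist_pos x s u r v : (r <= s)%R || ~~ suffix u v ->
  measT (pos x r v : hist x s u -> oE).
Proof.
move=> ok; apply: measurable_off => B mB; apply: sub_sigma_algebra.
by exists r, v, B.
Qed.

Lemma hist_measurable x s u (A : set Omega) : @measurable _ (hist x s u) A -> measurable A.
Proof.
apply: smallest_sub; first exact: sigma_algebra_measurable.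
move=> _ [r [v [B [_ mB ->]]]]; rewrite -[X in measurable X]setTI.
have := measurable_pos Y gamma0 mgamma x r v.
by move=> /(_ measurableT _ (measurableC (measurable_some_image mB))).
Qed.

Lemma measurable_hist_id x s u : measT (id : Omega -> hist x s u).
Proof. by move=> _ A mA; rewrite setTI; exact: hist_measurable mA. Qed.

Lemma fcap_hist x s u A : fcap (hist_events x s u) A ->
  exists2 L : seq event, (forall e, e \in L -> measurable e.2 /\ ((e.1.1 <= s)%R || ~~ suffix u e.1.2)) &
    forall w, (\1_A w)%:E = offp Y x L w.
Proof.
elim=> [|_ A' [r [v [B [ok mB ->]]]] _ [L mL LE]].
  by exists [::] => // w; rewrite /offp big_nil indicT.
exists ((r, v, B) :: L) => [e|w]; first by rewrite in_cons => /orP[/eqP ->//|/mL].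
rewrite /offp big_cons -/(offp Y x L w) -LE /off_set -EFinM; congr (_%:E).
by rewrite indicI; congr (_ * _)%R; rewrite !indicE.
Qed.

Section Kernel.
Variable t : R.

Definition law_at (z : borel E) : {measure set conf -> \bar R} :=
  measure_function_pushforward__canonical__measure_function_Measure (bmp_law Y z) (measurable_cfg z t).

Lemma law_at_offp (L : seq (word * set (borel E))) z : (forall e, e \in L -> measurable e.2) ->
  \int[bmp_law Y z]_w \big[*%E/1]_(e <- L) off_set e.2 (cfg z t w e.1) =
  \int[bmp_law Y z]_w offp Y z [seq (t, e.1, e.2) | e <- L] w.
Proof. by move=> mL; apply: eq_integral => w _; rewrite /offp big_map. Qed.

Lemma measurable_offp_law (L : seq event) : (forall e, e \in L -> measurable e.2) ->
  measurable_fun [set: borel E] (fun z => \int[bmp_law Y z]_w offp Y z L w).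
Proof.
move=> mL; pose D := (\max_(e <- L) size e.1.2).+1.
pose K := (\max_(e <- L) \max_(i <- e.1.2) i).+1.
have HL e : e \in L -> (size e.1.2 < D)%N && all (ltn^~ K) e.1.2.
  move=> eL; rewrite ltnS (@leq_bigmax_seq _ _ xpredT (fun e : event => size e.1.2))//=.
  apply/allP => i iv /=; rewrite ltnS.
  apply: (@leq_trans (\max_(j <- e.1.2) j)); first exact: leq_bigmax_seq.
  exact: (@leq_bigmax_seq _ _ xpredT (fun e : event => \max_(j <- e.1.2) j)).
rewrite (_ : (fun z => _) = fun z => tree_int X gamma Z K D (fun v => av X gamma (events_at L v)) (0%R, z)); last first.
  by apply/funext => z; exact: offp_one.
have okL v : obl_ok (fun=> True) (events_at L v).
  by move=> a /mapP[e]; rewrite mem_filter => /andP[_ /mL me] ->.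
have [[_ mT] _] := ui_tree_int X Z gamma0 mgamma K D (fun v => ui_av X Off gamma0 mgamma (@okL v)).
have m2 : measT (fun z : borel E => (0%R, z) : (R * borel E)%type).
  exact: measurable_fun_pair.
exact: (measurableT_comp mT m2).
Qed.

(** [bmp_law] is a family of probabilities indexed by E, not a kernel. Its dependence on the
    starting point is measurable because avoidance probabilities are tree integrals; Dynkin's
    theorem does the rest. *)
Lemma measurable_law_at U : measurable U -> measT (law_at ^~ U).
Proof.
move=> mU.
have GE : @measurable _ conf = <<s fcap (@conf_events R E) >> by rewrite sigma_fcap.
have sU : <<s fcap (@conf_events R E) >> U by rewrite -GE.
have ind A : measurable A -> (law_at ^~ A) = (fun z => \int[bmp_law Y z]_w (\1_A (cfg z t w))%:E).
  move=> mA; apply/funext => z.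
  have mA' : measurable (cfg z t @^-1` A).
    by rewrite -[X in measurable X]setTI; exact: measurable_cfg.
  by rewrite -[LHS]/(bmp_law Y z (cfg z t @^-1` A)) -[X in bmp_law Y z X]setIT -integral_indic.
have law1 z : law_at z setT = 1 by rewrite /law_at /= /pushforward preimage_setT; exact: probability_setT.
pose Pm (A : set conf) := measurable_fun [set: borel E] (fun z : borel E => law_at z A).
suff : Pm U by [].
apply: (@dynkin_induction _ conf (fcap (@conf_events R E)) Pm GE (@fcap_setI _ _) _ _ _ _ U sU).
- by rewrite /Pm (_ : law_at ^~ setT = cst 1)//; apply/funext => z; exact: law1.
- move=> A GA; have mA := @fcap_measurable _ conf (@conf_events R E) _ erefl GA.
  have [L mL LE] := fcap_conf GA.
  rewrite /Pm ind// (_ : (fun z => _) = fun z => \int[bmp_law Y z]_w offp Y z [seq (t, e.1, e.2) | e <- L] w).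
    by apply: measurable_offp_law => _ /mapP[e eL ->]; exact: (mL e).
  by apply/funext => z; rewrite -law_at_offp//; apply: eq_integral => w _; rewrite LE.
- move=> S mS mlS; rewrite /Pm (_ : law_at ^~ _ = fun z => 1 - law_at z S); first exact: emeasurable_funB.
  apply/funext => z; apply: (@probability_setC _ _ _ (bmp_law Y z) (cfg z t @^-1` S)).
  by rewrite -[X in measurable X]setTI; exact: measurable_cfg.
- move=> F mF tF mlF.
  rewrite /Pm (_ : law_at ^~ _ = fun z => \sum_(0 <= k <oo | k \in xpredT) law_at z (F k)).
    by apply: (ge0_emeasurable_sum (h := fun k z => law_at z (F k))) => k // _; exact: mlF.
  by apply/funext => z; rewrite measure_bigcup//=; apply: eq_eseriesl => k; rewrite in_setT.
Qed.

HB.instance Definition _ := isKernel.Build _ _ (borel E) conf R law_at measurable_law_at.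

Let law_at1 z : law_at z setT = 1.
Proof. by rewrite /law_at /= /pushforward preimage_setT; exact: probability_setT. Qed.

HB.instance Definition _ := Kernel_isProbability.Build _ _ _ _ _ law_at law_at1.

Lemma measurable_law_integral d (S : measurableType d) (f : S * conf -> \bar R) (h : S -> borel E) :
  measT h -> nnm f ->
  measT (fun s => \int[bmp_law Y (h s)]_w f (s, cfg (h s) t w)).
Proof.
move=> mh nf.
rewrite (_ : (fun s => _) = fun s => \int[law_at (h s)]_z f (s, z)).
  exact: (@measurable_kernel_integral _ _ _ _ S (borel E) conf law_at h mh f nf).
have mfs s : nnm (fun z : conf => f (s, z)).
  have m2 : measT (fun z : conf => (s, z)) by exact: measurable_fun_pair.
  exact: (nnm_comp m2 nf).
apply/funext => s; rewrite [RHS]ge0_integral_pushforward//.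
- exact: measurable_cfg.
- exact: (mfs s).2.
- by move=> z _; exact: (mfs s).1.
Qed.

End Kernel.

Lemma measurable_of_hist x s u (f : Omega -> R) :
  measT (f : hist x s u -> R) -> measT f.
Proof.
move=> mf _ B mB; rewrite setTI; apply: (@hist_measurable x s u).
by rewrite -[X in measurable X]setTI; exact: mf.
Qed.

Lemma nnm_branching_markov x s t u (f : hist x s u * conf -> \bar R) : nnm f ->
  nnm (fun w : Omega => oapp (fun z => \int[bmp_law Y z]_w' f (w, cfg z t w')) 0 (pos x s u w)).
Proof.
move=> nf; split=> [w|]; first by apply: oapp_ge0 => ?; apply: integral_ge0 => ? _; exact: nf.1.
apply: (@measurable_oapp _ _ (borel E) _ Omega (fun z => \int[bmp_law Y z.2]_w' f (z.1, cfg z.2 t w'))) => //.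
  apply: (@measurable_law_integral t _ (Omega * borel E)%type (fun a => f (a.1.1, a.2)) snd) => //.
  apply: (nnm_comp _ nf (h := fun a : (Omega * borel E) * conf => (a.1.1, a.2) : hist x s u * conf)).
  apply: measurable_fun_pair => //; apply: (measurableT_comp (@measurable_hist_id x s u)).
  exact: (measurableT_comp measurable_fst).
exact: measurable_pos.
Qed.

(** Both sides are positive operators in f, and on rectangles of avoidance events the identity is
    [branching_markov_off]. *)
Lemma branching_markov x s t u (f : hist x s u * conf -> \bar R) : (0 <= t)%R -> nnm f ->
  \int[bmp_law Y x]_w oapp (fun=> f (w, sub_cfg x (s + t) u w)) 0 (pos x s u w) =
  \int[bmp_law Y x]_w
     oapp (fun z => \int[bmp_law Y z]_w' f (w, cfg z t w')) 0 (pos x s u w).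
Proof.
move=> t0; move: f.
pose H := hist x s u.
have mpos : measT (pos x s u : Omega -> oE) by exact: measurable_pos.
have mH : measT (fun w : Omega => (w, sub_cfg x (s + t) u w) : H * conf).
  apply: measurable_fun_pair; first exact: measurable_hist_id.
  exact: measurable_sub_cfg.
have n1 (f : H * conf -> \bar R) : nnm f ->
    nnm (fun w : Omega => oapp (fun=> f (w, sub_cfg x (s + t) u w)) 0 (pos x s u w)).
  move=> nf; split=> [w|]; first by apply: oapp_ge0 => ?; exact: nf.1.
  apply: (@measurable_oapp _ _ (borel E) _ Omega (fun z => f (z.1, sub_cfg x (s + t) u z.1))) => //.
  by apply: (measurableT_comp nf.2); exact: (measurableT_comp mH).
have n2 (f : H * conf -> \bar R) (nf : nnm f) := nnm_branching_markov t nf.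
have p1 : posop (fun f : H * conf -> \bar R => \int[bmp_law Y x]_w oapp (fun=> f (w, sub_cfg x (s + t) u w)) 0 (pos x s u w)).
  apply: (@posop_bind1 _ _ (H * conf)%type _ Omega (fun f => \int[bmp_law Y x]_w f w)
    (fun w f => oapp (fun=> f (w, sub_cfg x (s + t) u w)) 0 (pos x s u w))).
  - exact: posop_integral.
  - move=> w; apply: (@posop_option _ _ (H * conf)%type _ _ (fun _ f => f (w, sub_cfg x (s + t) u w))) => z.
    exact: posop_eval.
  - by move=> f nf; exact: (n1 f nf).2.
have p2 : posop (fun f : H * conf -> \bar R => \int[bmp_law Y x]_w
     oapp (fun z => \int[bmp_law Y z]_w' f (w, cfg z t w')) 0 (pos x s u w)).
  apply: (@posop_bind1 _ _ (H * conf)%type _ Omega (fun f => \int[bmp_law Y x]_w f w)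
    (fun w f => oapp (fun z => \int[bmp_law Y z]_w' f (w, cfg z t w')) 0 (pos x s u w))).
  - exact: posop_integral.
  - move=> w; apply: (@posop_option _ _ (H * conf)%type _ _ (fun z f => \int[bmp_law Y z]_w' f (w, cfg z t w'))) => z.
    apply: (@posop_comp _ _ (H * conf)%type _ Omega (fun w' => (w, cfg z t w')) (fun f => \int[bmp_law Y z]_w f w)).
      by apply: measurable_fun_pair => //; exact: measurable_cfg.
    exact: posop_integral.
  - by move=> f nf; exact: (n2 f nf).2.
pose GH : set (set H) := fcap (hist_events x s u).
pose GC : set (set conf) := fcap (@conf_events R E).
have GE : @measurable _ (H * conf)%type = <<s [set A `*` B | A in GH & B in GC] >>.
  apply: measurable_prod_gen; [by rewrite sigma_fcap|by rewrite sigma_fcap|exact: fcap0|exact: fcap0].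
apply: (posop_eq GE _ _ p1 p2).
- by apply: rectangles_setI; exact: fcap_setI.
- by exists setT; [exact: fcap0|exists setT; [exact: fcap0|rewrite setXTT]].
- apply: le_lt_trans (ltry 1%R); apply: prob_integral_le1; first exact: n1 (nnm_cst _ lee01).
  by move=> w; case: pos => //=; rewrite lee01.
- move=> _ [A GA [B GB <-]].
  have [L1 okL1 LE1] := fcap_hist GA.
  have [L2 mL2 LE2] := fcap_conf GB.
  have H1 := @branching_markov_off _ _ _ _ X gamma G _ _ Z _ _ Y gamma0 mgamma gammaG x u s L1
    [seq (t, e.1, e.2) | e <- L2] (fun e h => (okL1 e h).1) (fun e h => (okL1 e h).2).
  have mL2' e : e \in [seq (t, e.1, e.2) | e <- L2] -> measurable e.2.
    by move=> /mapP[e' e'L ->]; exact: (mL2 e').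
  have tL2' e : e \in [seq (t, e.1, e.2) | e <- L2] -> (0 <= e.1.1)%R.
    by move=> /mapP[e' e'L ->].
  have {}H1 := H1 mL2' tL2'.
  transitivity (\int[bmp_law Y x]_w (offp Y x L1 w *
      (offp Y x (map (later u s) [seq (t, e.1, e.2) | e <- L2]) w * oapp (fun=> 1) 0 (pos x s u w)))).
    apply: eq_integral => w _; rewrite -LE1 /offp 2!big_map.
    case: (pos x s u w) => [z|]; rewrite /oapp ?mule0//.
    by rewrite mule1 indicX/= EFinM LE2.
  rewrite H1; apply: eq_integral => w _; rewrite -LE1.
  case: (pos x s u w) => [z|]; rewrite /oapp ?mule0//.
  rewrite -law_at_offp// -ge0_integralZl//.
  + by apply: eq_integral => w' _; rewrite indicX EFinM/= LE2.
  + have [_ mB] := nnm_comp (measurable_cfg z t) (nnm_indic R (@fcap_measurable _ conf (@conf_events R E) _ erefl GB)).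
    by apply: eq_measurable_fun mB => w' _; rewrite /= LE2.
  + by move=> w' _; have /andP[] := prod_le1 L2 (fun e => @off_set01 R E e.2 (cfg z t w' e.1)).
Qed.

End FunctionalBranchingMarkov.

(** * Moments of the population *)

Section PowerMean.
Context (R : realType).

(** A convex power lies above its tangent at m. *)
Lemma power_tangent (q : nat) (m c : R) : 0 <= m -> 0 <= c ->
  m ^+ q.+1 + q.+1%:R * m ^+ q * (c - m) <= c ^+ q.+1.
Proof.
move=> m0 c0; elim: q => [|q ih]; first by rewrite !expr1 expr0; lra.
have cq : 0 <= c ^+ q.+1 by rewrite exprn_ge0.
have h : 0 <= (c ^+ q.+1 - m ^+ q.+1) * (c - m).
  have [mc|cm] := leP m c.
    by rewrite mulr_ge0 ?subr_ge0// lerXn2r.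
  by rewrite mulr_le0 ?subr_le0 ?(ltW cm)// lerXn2r// ltW.
have h2 := ler_wpM2r m0 ih; rewrite (exprS m q.+1) (exprS c q.+1) -[in X in X <= _]natr1.
rewrite (exprS m q) in ih h h2 *; move: h h2 ih; set A := m ^+ q; set B := c ^+ q.+1; set k : R := q.+1%:R.
nra.
Qed.

Lemma sum_weights0 (I : Type) (s : seq I) (a c : I -> R) : (forall i, 0 <= a i) ->
  \sum_(i <- s) a i = 0 -> \sum_(i <- s) a i * c i = 0.
Proof.
move=> a0; elim: s => [|j s ih]; rewrite ?big_nil// !big_cons => A1.
have s0 : 0 <= \sum_(i <- s) a i by exact: sumr_ge0.
have /andP[/eqP aj /eqP sj] : (a j == 0) && (\sum_(i <- s) a i == 0).
  by rewrite -paddr_eq0//; apply/eqP.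
by rewrite aj mul0r ih ?addr0.
Qed.

(** Jensen's inequality without normalised weights: the tangent is taken at the weighted mean, where
    the linear terms cancel. *)
Lemma power_mean (I : Type) (s : seq I) (a c : I -> R) (q : nat) :
  (forall i, 0 <= a i) -> (forall i, 0 <= c i) ->
  (\sum_(i <- s) a i * c i) ^+ q.+1 <=
  (\sum_(i <- s) a i) ^+ q * \sum_(i <- s) a i * c i ^+ q.+1.
Proof.
move=> a0 c0; set A := \sum_(i <- s) a i; set B := \sum_(i <- s) a i * c i.
have A0 : 0 <= A by exact: sumr_ge0.
have B0 : 0 <= B by apply: sumr_ge0 => i _; rewrite mulr_ge0.
have [A1|A1] := eqVneq A 0.
  rewrite /B (sum_weights0 c a0 A1) expr0n/= mulr_ge0 ?exprn_ge0//.
  by apply: sumr_ge0 => i _; rewrite mulr_ge0 ?exprn_ge0.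
have Ap : 0 < A by rewrite lt_neqAle eq_sym A1.
pose m := B / A; have m0 : 0 <= m by rewrite divr_ge0.
have : A * m ^+ q.+1 <= \sum_(i <- s) a i * c i ^+ q.+1.
  apply: (@le_trans _ _ (\sum_(i <- s) a i * (m ^+ q.+1 + q.+1%:R * m ^+ q * (c i - m)))).
    rewrite (eq_bigr (fun i => m ^+ q.+1 * a i + q.+1%:R * m ^+ q * (a i * c i - m * a i))).
      rewrite big_split/= -!mulr_sumr sumrB -mulr_sumr -/A -/B /m divfK// subrr mulr0 addr0.
      by rewrite mulrC.
    by move=> i _; ring.
  by apply: ler_sum => i _; rewrite ler_wpM2l// power_tangent.
move=> /(ler_wpM2l (exprn_ge0 q A0)); apply: le_trans.
by rewrite mulrA -exprSr -exprMn mulrC /m divfK.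
Qed.

(** [power_mean] with weights [2 ^- k.+1], whose sum stays below 1, so that the bound has no
    constant growing with the number of terms. *)
Lemma power_sum_geometric (s : nat -> R) (q D : nat) : (forall k, 0 <= s k) ->
  (\sum_(k < D) s k) ^+ q.+1 <=
  \sum_(k < D) 2 ^- k.+1 * (2 ^+ k.+1 * s k) ^+ q.+1.
Proof.
move=> s0; pose a (k : 'I_D) : R := 2 ^- k.+1; pose c (k : 'I_D) := 2 ^+ k.+1 * s k.
have a0 k : 0 <= a k by rewrite /a invr_ge0 exprn_ge0.
have c0 k : 0 <= c k by rewrite /c mulr_ge0 ?exprn_ge0.
have -> : \sum_(k < D) s k = \sum_(k <- index_enum 'I_D) a k * c k.
  by apply: eq_bigr => k _; rewrite /a /c mulrA mulVf ?mul1r// expf_neq0.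
apply: le_trans (power_mean _ q a0 c0) _.
rewrite -[leRHS]mul1r; apply: ler_wpM2r.
  by apply: sumr_ge0 => k _; rewrite mulr_ge0// exprn_ge0.
apply: exprn_ile1; first exact: sumr_ge0.
have : \sum_(k < D) 2 ^- k.+1 = 1 - 2 ^- D :> R.
  elim: D {s0 a c a0 c0} => [|D ih]; first by rewrite big_ord0 expr0 invr1 subrr.
  by rewrite big_ord_recr/= ih exprSr invfM; field.
by rewrite /a => ->; rewrite gerBl invr_ge0 exprn_ge0.
Qed.

End PowerMean.

(** * Discounted generations *)

Section BirthLife.
Context (R : realType) (E : completePseudoMetricType R).
Context dP (Path : measurableType dP) (X : markov_process E Path).
Context (gamma : E -> R) (G : R).
Context dO (Off : measurableType dO) (Z : offspring E Off).
Context dW (Omega : measurableType dW) (Y : branching_process X gamma Z Omega).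
Hypothesis gamma0 : forall y, 0 <= gamma y.
Hypothesis mgamma : measurable_fun [set: borel E] (gamma : borel E -> R).
Hypothesis gammaG : forall y, gamma y <= G.
Local Notation life := (life R Path Off).
Local Notation tau := (lifetime X gamma).
Local Notation word := (seq nat).
Local Notation bE := (R * borel E)%type.
Local Notation LI := (life_int X gamma Z).
Local Notation chd := (child X gamma Z).
Local Notation Exp := (exp_law R).
Local Notation gen := (gen Y).
Local Notation brt := (brt Y).
Local Open Scope ereal_scope.

Arguments life_int : simpl never.
Arguments lifetime : simpl never.

Lemma measurable_gen_id n : measT (id : Omega -> gen n).
Proof. by move=> _ A mA; rewrite setTI; exact: (gen_measurable mA). Qed.

Lemma nnm_birth_life x u n (f : gen n * life -> \bar R) : nnm f ->
  nnm (fun w : Omega => oapp (fun a => LI a.2 (fun l => f (w, l))) 0 (brt x u w)).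
Proof.
have mid := @measurable_gen_id n.
have mb : measT (brt x u : Omega -> optm bE) by exact: measurable_brt.
move=> nf; have nl : nnm (fun z : Omega * bE => LI z.2.2 (fun l => f (z.1, l))).
  apply: (@nnm_life_int _ _ _ _ X gamma _ _ Z gamma0 mgamma _ (Omega * bE)%type
    (fun z => z.2.2) (fun z => f (z.1.1, z.2))).
    exact: (measurableT_comp measurable_snd measurable_snd).
  apply: (@nnm_comp _ _ _ _ _ (fun z : (Omega * bE) * life => (z.1.1, z.2) : gen n * life) f _ nf).
  apply: measurable_fun_pair; last exact: measurable_snd.
  apply: (measurableT_comp mid); exact: (measurableT_comp measurable_fst).
split=> [w|]; first by apply: oapp_ge0 => a; exact: nl.1 (w, a).
exact: (@measurable_oapp _ _ bE _ Omega (fun z => LI z.2.2 (fun l => f (z.1, l))) _ nl.2 mb).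
Qed.

(** Disintegration of one life at its birth, jointly with the earlier generations: rectangles
    suffice, and there it is [gen_step_aux] with a single particle. *)
Lemma birth_life x u n (f : gen n * life -> \bar R) : size u = n -> nnm f ->
  \int[bmp_law Y x]_w oapp (fun=> f (w, bmp_life Y u w)) 0 (brt x u w) =
  \int[bmp_law Y x]_w oapp (fun a => LI a.2 (fun l => f (w, l))) 0 (brt x u w).
Proof.
move=> su; move: f.
have mid := @measurable_gen_id n.
have mb : measT (brt x u : Omega -> optm bE) by exact: measurable_brt.
have n1 (f : gen n * life -> \bar R) : nnm f ->
    nnm (fun w : Omega => oapp (fun=> f (w, bmp_life Y u w)) 0 (brt x u w)).
  move=> nf; split=> [w|]; first by apply: oapp_ge0 => ?; exact: nf.1.
  apply: (@measurable_oapp _ _ bE _ Omega (fun z => f (z.1, bmp_life Y u z.1))) => //.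
  apply: (measurableT_comp nf.2); apply: measurable_fun_pair.
    exact: (measurableT_comp mid measurable_fst).
  exact: (measurableT_comp (bmp_life_measurable Y u) measurable_fst).
have n2 (f : gen n * life -> \bar R) (nf : nnm f) := nnm_birth_life x u nf.
have p1 : posop (fun f : gen n * life -> \bar R =>
    \int[bmp_law Y x]_w oapp (fun=> f (w, bmp_life Y u w)) 0 (brt x u w)).
  apply: (@posop_bind1 _ _ (gen n * life)%type _ Omega (fun f => \int[bmp_law Y x]_w f w)
    (fun w f => oapp (fun=> f (w, bmp_life Y u w)) 0 (brt x u w))).
  - exact: posop_integral.
  - move=> w; apply: (@posop_option _ _ (gen n * life)%type _ _ (fun _ f => f (w, bmp_life Y u w))) => z.
    exact: posop_eval.
  - by move=> f nf; exact: (n1 f nf).2.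
have p2 : posop (fun f : gen n * life -> \bar R =>
    \int[bmp_law Y x]_w oapp (fun a => LI a.2 (fun l => f (w, l))) 0 (brt x u w)).
  apply: (@posop_bind1 _ _ (gen n * life)%type _ Omega (fun f => \int[bmp_law Y x]_w f w)
    (fun w f => oapp (fun a => LI a.2 (fun l => f (w, l))) 0 (brt x u w))).
  - exact: posop_integral.
  - move=> w; apply: (@posop_option _ _ (gen n * life)%type _ _ (fun a f => LI a.2 (fun l => f (w, l)))) => z.
    apply: (@posop_comp _ _ (gen n * life)%type _ life (fun l => (w, l))).
      exact: measurable_fun_pair.
    exact: posop_life_int.
  - by move=> f nf; exact: (n2 f nf).2.
pose GG : set (set (gen n * life)) :=
  [set A `*` B | A in (measurable : set (set (gen n))) & B in (measurable : set (set life))].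
have GE : @measurable _ (gen n * life)%type = <<s GG >>.
  by apply: measurable_prod_gen => //; exact: measurable_sigma_id.
apply: (posop_eq GE _ _ p1 p2).
- by apply: rectangles_setI; exact: measurableI.
- by exists setT; [exact: measurableT|exists setT; [exact: measurableT|rewrite setXTT]].
- apply: le_lt_trans (ltry 1%R); apply: prob_integral_le1; first exact: n1 (nnm_cst _ lee01).
  by move=> w; case: brt => //=; rewrite lee01.
- move=> _ [A gA [B mB <-]].
  have us1 v : v \in [::] ++ [:: u] -> size v = n by rewrite inE => /eqP ->.
  have uphi (v : word) : ui (fun _ : R * life => 1 : \bar R) by exact: ui_cst1.
  have := @gen_step_aux _ _ _ _ _ _ _ _ _ _ _ Y gamma0 mgamma x n (fun _ _ => 1) uphi [::] [:: u]
    (fun=> B) A isT us1 (fun=> mB) gA.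
  set I1 := (X in X = _ -> _); set I2 := (X in _ = X -> _) => I12.
  transitivity I1.
    apply: eq_integral => w _; rewrite big_nil big_cons big_nil mule1 mul1e /KF.
    by case: (brt x u w) => [a|]; rewrite /oapp ?mule0// indicX EFinM.
  rewrite I12; apply: eq_integral => w _; rewrite big_nil big_cons big_nil mule1 mul1e /KH.
  case: (brt x u w) => [a|]; rewrite /oapp ?mule0//.
  under [in RHS]eq_fun do rewrite indicX EFinM.
  rewrite indicE; case: (w \in A); first by rewrite mul1e; under [in RHS]eq_fun do rewrite mul1e.
  rewrite mul0e; under [in RHS]eq_fun do rewrite mul0e.
  exact: (esym (posop0 (posop_life_int X Z gamma0 mgamma _))).
Qed.

Lemma Exp_le (a : R) : (0 <= a)%R -> \int[Exp]_c (\1_(`]-oo, a]%classic : set R) c)%:E <= a%:E.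
Proof.
move=> a0.
have mi : measurable (`]-oo, a]%classic : set R) by exact: measurable_itv.
rewrite integral_Exp; last exact: (nnm_indic R mi).
apply: (@le_trans _ _ (\int[lebesgue_measure]_c (\1_(`[0%R, a]%classic : set R) c)%:E)).
  apply: ge0_le_integral => //.
  - by move=> c _; rewrite -EFinM lee_fin mulr_ge0// exponential_pdf_ge0.
  - apply: emeasurable_funM.
      by apply/measurable_EFinP; exact: measurable_exponential_pdf.
    by apply/measurable_EFinP; exact: measurable_indic.
  - by apply/measurable_EFinP; exact: measurable_indic.
  - move=> c _; rewrite -EFinM lee_fin !indicE.
    have [ca|ca] := boolP (c \in `]-oo, a]%classic); last by rewrite mulr0.
    rewrite mulr1 /exponential_pdf /patch.
    have [c0|c0] := boolP (c \in `[0%R, +oo[%classic); last by case: (_ \in _).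
    rewrite mem_set; last first.
      move: ca c0; rewrite !inE/= !in_itv/= => -> /=; by rewrite andbT => ->.
    rewrite mul1r mulN1r; apply: (@le_trans _ _ (expR 0)); last by rewrite expR0.
    by rewrite ler_expR oppr_le0; move: c0; rewrite inE/= in_itv/= andbT.
rewrite integral_indic//= setIT lebesgue_measure_itv/= lte_fin.
by case: ifP => _; rewrite ?sube0// lee_fin.
Qed.

(** The number of children discounted by their birth delay. A large discount makes the discounted
    branching mechanism subcritical. *)
Definition child_weight (K : nat) (theta : R) (l : life) : R :=
  (\sum_(i <- iota 0 K) oapp (fun r : R * E => expR (- theta * r.1)) 0 (chd i l))%R.

Lemma child_weight_ge0 K theta l : (0 <= child_weight K theta l)%R.
Proof. by apply: sumr_ge0 => i _; case: (chd i l) => //= r; exact: expR_ge0. Qed.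

Lemma measurable_child_weight K theta : measT (child_weight K theta).
Proof.
apply: measurable_sum => i.
apply: (@measurable_fun_match _ bE _ _ life R (chd i) (fun z => expR (- theta * z.2.1)) (fun=> 0%R)) => //.
- exact: measurable_child.
- apply: (measurableT_comp (@measurable_expR R)).
  apply: measurable_funM => //; exact: (measurableT_comp measurable_fst).
Qed.

Variables (q : nat) (Gam M a theta : R).
Hypothesis Gam0 : (0 < Gam)%R.
Hypothesis gammaGam : forall y, (gamma y <= Gam)%R.
Hypothesis M0 : (0 <= M)%R.
Hypothesis offM : forall y, \int[off_law Z y]_z ((off_num Z z)%:R ^+ q.+1)%:E <= M%:E.
Hypothesis a0 : (0 < a)%R.
Hypothesis theta0 : (0 <= theta)%R.
Hypothesis theta_a : (expR (- (theta * q.+1%:R * (a / Gam))) <= a)%R.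

(** Either the clock is at most a, which has probability at most a; or it is larger and, the rate
    being at most [Gam], the life lasts at least [a / Gam], so that the discount brings the factor
    below a. *)
Lemma child_weight_le K w c z :
  (child_weight K theta (w, c, z) ^+ q.+1 <=
   (\1_(`]-oo, a]%classic : set R) c + a) * (off_num Z z)%:R ^+ q.+1)%R.
Proof.
have nn : (0 <= (off_num Z z)%:R :> R)%R by [].
case et : (tau w c) => [r| |].
- have r0 : (0 <= r)%R by rewrite -lee_fin -et; exact: tau_ge0.
  have le1 : (child_weight K theta (w, c, z) <= expR (- theta * r) * (off_num Z z)%:R)%R.
    rewrite /child_weight; apply: (@le_trans _ _ (\sum_(i <- iota 0 K) expR (- theta * r) * (i < off_num Z z)%:R)%R).
      apply: ler_sum => i _; rewrite /child/= et; case: ifP => _ /=; rewrite ?mulr1 ?mulr0//.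
    rewrite -mulr_sumr ler_wpM2l ?expR_ge0// -natr_sum ler_nat.
    have -> : (\sum_(i <- iota 0 K) (i < off_num Z z))%N = count (ltn^~ (off_num Z z)) (iota 0 K).
      by rewrite -sum1_count [RHS]big_mkcond; apply: eq_bigr => i _ /=; case: ltnP.
    rewrite -size_filter -[leqRHS](size_iota 0).
    apply: uniq_leq_size; first by rewrite filter_uniq// iota_uniq.
    by move=> i; rewrite mem_filter !mem_iota/= add0n => /andP[].
  have := lerXn2r q.+1 _ _ le1; rewrite !nnegrE child_weight_ge0 mulr_ge0 ?expR_ge0// => /(_ isT isT).
  move=> /le_trans; apply; rewrite exprMn ler_wpM2r ?exprn_ge0//.
  rewrite -expRM_natl indicE; have [ca|ca] := boolP (c \in _).
    rewrite -[leLHS]addr0 lerD// ?(ltW a0)// -expR0 ler_expR.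
    by rewrite mulr_ge0_le0// mulNr oppr_le0 mulr_ge0.
  rewrite add0r; apply: le_trans theta_a; rewrite ler_expR mulNr mulrN lerN2.
  rewrite [leRHS]mulrCA [leRHS]mulrA ler_wpM2l ?mulr_ge0//.
  rewrite -lee_fin -et ltW//.
  apply: (rate_int_lt (p := path_traj X w) gamma0 mgamma gammaGam); first by rewrite divr_ge0// ltW.
  apply: (le_lt_trans (rate_int_le gamma0 mgamma gammaGam (path_traj X w) _)); first by rewrite divr_ge0// ltW.
  rewrite max_l ?(ltW Gam0)// mulrC divfK ?gt_eqF// lte_fin.
  by move: ca; rewrite notin_setE/= in_itv/= => /negP; rewrite -ltNge.
- rewrite /child_weight big1; last by move=> i _; rewrite /child/= et.
  by rewrite expr0n/= mulr_ge0 ?exprn_ge0// addr_ge0 ?(ltW a0).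
- by have := tau_ge0 X gamma w c; rewrite et.
Qed.

Lemma life_int_child_weight K y :
  LI y (fun l => (child_weight K theta l ^+ q.+1)%:E) <= (M * (2 * a))%:E.
Proof.
pose h (c : R) : R := (\1_(`]-oo, a]%classic : set R) c + a)%R.
have h0 c : (0 <= h c)%R by rewrite addr_ge0 ?(ltW a0).
have mh : measT h.
  by apply: measurable_funD => //; apply: measurable_indic; exact: measurable_itv.
have mnum : measT (fun z : Off => ((off_num Z z)%:R ^+ q.+1 : R)%:E).
  apply/measurable_EFinP; apply: measurable_funX.
  have mn : measT (fun n : nat => n%:R : R) by [].
  exact: (measurableT_comp mn (off_num_measurable Z)).
have ncw : nnm (fun l : life => (child_weight K theta l ^+ q.+1)%:E).
  split=> [l|]; first by rewrite lee_fin exprn_ge0// child_weight_ge0.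
  by apply/measurable_EFinP; apply: measurable_funX; exact: measurable_child_weight.
have nM : nnm (fun c : measurableTypeR R => M%:E * (h c)%:E).
  apply: nnmM; first exact: nnm_cst.
  by split=> [c|]; [rewrite lee_fin|exact/measurable_EFinP].
have my : measT ((fun=> y) : unit -> borel E) by [].
have nu : nnm (fun z : unit * life => (child_weight K theta z.2 ^+ q.+1)%:E).
  exact: (nnm_comp measurable_snd ncw).
have le2 w : \int[Exp]_c \int[off_law Z (odflt y (branch_place X gamma w c))]_z
     (child_weight K theta (w, c, z) ^+ q.+1)%:E <= (M * (2 * a))%:E.
  apply: (@le_trans _ _ (\int[Exp]_c (M%:E * (h c)%:E))).
    have m3 : measT (fun c : measurableTypeR R => ((tt, w), c) : (unit * Path) * measurableTypeR R).
      by apply: measurable_fun_pair.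
    have [n30 n3] := nnm_comp m3 (nnm_off_int X Z gamma0 mgamma my nu).
    apply: ge0_le_integral => //.
    - by move=> c _; exact: n30.
    - exact: nM.2.
    - move=> c _; apply: (@le_trans _ _ (\int[off_law Z (odflt y (branch_place X gamma w c))]_z
          ((h c)%:E * ((off_num Z z)%:R ^+ q.+1)%:E))).
        have m4 : measT (fun z : Off => (w, c, z) : life).
          by apply: measurable_fun_pair => //; exact: measurable_fun_pair.
        apply: ge0_le_integral => //.
        + by move=> z _; exact: ncw.1.
        + exact: (measurableT_comp ncw.2 m4).
        + by apply: emeasurable_funM => //; exact: measurable_cst.
        + by move=> z _; rewrite -EFinM lee_fin; exact: child_weight_le.
      rewrite ge0_integralZl//; last by rewrite lee_fin.
      by rewrite muleC lee_wpmul2r// lee_fin.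
  rewrite ge0_integralZl//; last 2 first.
  - exact/measurable_EFinP.
  - by move=> c _; rewrite lee_fin.
  rewrite EFinM lee_wpmul2l ?lee_fin//.
  under eq_integral do rewrite EFinD.
  rewrite ge0_integralD//; last 2 first.
  - by apply/measurable_EFinP; apply: measurable_indic; exact: measurable_itv.
  - by move=> c _; rewrite lee_fin ltW.
  rewrite (_ : (2 * a)%:E = a%:E + a%:E); last by rewrite -EFinD; congr (_%:E); ring.
  apply: leeD; first exact: Exp_le (ltW a0).
  rewrite le_eqVlt; apply/orP; left; apply/eqP.
  exact: (etrans (integral_cst Exp measurableT a%:E) (etrans (congr1 (mule _) (probability_setT Exp)) (mule1 _))).
rewrite /life_int; apply: (@le_trans _ _ (\int[xi_law X y]_w (M * (2 * a))%:E)).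
  have m3 : measT (fun w : Path => (tt, w) : unit * Path) by apply: measurable_fun_pair.
  have [n30 n3] := nnm_comp m3 (nnm_clock_int X Z gamma0 mgamma my nu).
  apply: ge0_le_integral => //; first by move=> w _; exact: n30.
by rewrite integral_cst// prob_kernel mule1.
Qed.

Section GenerationMoments.
Variables (x : E) (K : nat).
Local Notation rho := (M * (2 * a))%R.
Local Notation cw := (child_weight K theta).
Local Notation lf := (bmp_life Y).

Definition birth_weight (u : word) (w : Omega) : R :=
  oapp (fun b : R * E => expR (- theta * b.1)) 0%R (brt x u w).
Local Notation wt := birth_weight.

Lemma birth_weight_ge0 u w : (0 <= wt u w)%R.
Proof. by rewrite /wt; case: brt => //= b; exact: expR_ge0. Qed.

Lemma measurable_birth_weight n u : (size u <= n)%N ->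
  measT (wt u : gen n -> R).
Proof.
move=> un; apply: (@measurable_fun_match _ bE _ _ (gen n) R (brt x u)
  (fun z => expR (- theta * z.2.1)) (fun=> 0%R)) => //.
- by apply: measurable_brt_gen.
- apply: (measurableT_comp (@measurable_expR R)).
  apply: measurable_funM => //; exact: (measurableT_comp measurable_fst).
Qed.

Lemma birth_weight_children u w :
  (\sum_(i <- iota 0 K) wt (i :: u) w = wt u w * cw (lf u w))%R.
Proof.
rewrite /cw mulr_sumr; apply: eq_bigr => i _; rewrite /wt brt_cons.
case: (brt x u w) => [b|]/=; last by rewrite mul0r.
by case: (chd i _) => [r|] /=; rewrite ?mulr0// -expRD mulrDr.
Qed.

Definition gen_weight k w : R := (\sum_(u <- words K k) wt u w)%R.

Lemma gen_weight_ge0 k w : (0 <= gen_weight k w)%R.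
Proof. by apply: sumr_ge0 => u _; exact: birth_weight_ge0. Qed.

Lemma gen_weightS k w : (gen_weight k.+1 w = \sum_(u <- words K k) wt u w * cw (lf u w))%R.
Proof.
rewrite /gen_weight [words K k.+1]/= big_allpairs_dep/=; apply: eq_bigr => u _.
exact: birth_weight_children.
Qed.

Lemma measurable_gen_weight k : measT (gen_weight k : gen k -> R).
Proof.
rewrite (_ : gen_weight k = fun w => (\sum_(u <- words K k) if size u == k then wt u w else 0)%R).
  by apply: measurable_sum => u; case: eqP => [<-|_]; [exact: measurable_birth_weight|exact: measurable_cst].
apply/funext => w; rewrite /gen_weight big_seq [RHS]big_seq; apply: eq_bigr => u.
by rewrite mem_words => /andP[->].
Qed.

(** [power_mean] with the birth weights of generation k as weights separates the children of
    different parents; each life is then integrated given the earlier generations and contributes a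
    factor [rho]. *)
Lemma gen_moment k : \int[bmp_law Y x]_w (gen_weight k w ^+ q.+1)%:E <= (rho ^+ k)%:E.
Proof.
elim: k => [|k ih].
  rewrite expr0 (eq_integral (cst 1)) => [|w _].
    by rewrite integral_cst// mul1e; exact: probability_le1.
  by rewrite /gen_weight/= big_seq1 /wt/= mulr0 expR0 expr1n.
have mG : measT (gen_weight k : Omega -> R) by exact: (measurableT_comp (@measurable_gen_weight k) (@measurable_gen_id k)).
have mw u : measT (wt u : Omega -> R) by exact: (measurableT_comp (measurable_birth_weight (leqnn _)) (@measurable_gen_id (size u))).
have mc u : measT (fun w => cw (lf u w)).
  by apply: (measurableT_comp (measurable_child_weight K theta)); exact: bmp_life_measurable.
have g0 u w : (0 <= gen_weight k w ^+ q * (wt u w * cw (lf u w) ^+ q.+1))%R.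
  by rewrite mulr_ge0 ?exprn_ge0 ?gen_weight_ge0// mulr_ge0 ?birth_weight_ge0 ?exprn_ge0 ?child_weight_ge0.
have mg u : measT (fun w => (gen_weight k w ^+ q * (wt u w * cw (lf u w) ^+ q.+1))%:E).
  apply/measurable_EFinP; apply: measurable_funM; first exact: measurable_funX.
  by apply: measurable_funM => //; exact: measurable_funX.
have r0 : (0 <= rho)%R by rewrite !mulr_ge0// ltW.
apply: (@le_trans _ _ (\int[bmp_law Y x]_w \sum_(u <- words K k)
   (gen_weight k w ^+ q * (wt u w * cw (lf u w) ^+ q.+1))%:E)).
  apply: ge0_le_integral => //.
  - by move=> w _; rewrite lee_fin exprn_ge0// gen_weight_ge0.
  - apply/measurable_EFinP; apply: measurable_funX.
    exact: (measurableT_comp (@measurable_gen_weight k.+1) (@measurable_gen_id k.+1)).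
  - exact: emeasurable_sum.
  - move=> w _; rewrite sumEFin lee_fin gen_weightS -mulr_sumr.
    by apply: power_mean => u; [exact: birth_weight_ge0|exact: child_weight_ge0].
rewrite ge0_integral_sum//; last by move=> u w _; rewrite lee_fin.
apply: (@le_trans _ _ (\sum_(u <- words K k) \int[bmp_law Y x]_w (rho%:E * (gen_weight k w ^+ q * wt u w)%:E))).
  rewrite big_seq [leRHS]big_seq; apply: lee_sum => u; rewrite mem_words => /andP[/eqP su _].
  pose f (z : gen k * life) : \bar R := (gen_weight k z.1 ^+ q * wt u z.1)%:E * (cw z.2 ^+ q.+1)%:E.
  have nf : nnm f.
    apply: nnmM.
      split=> [z|]; first by rewrite lee_fin mulr_ge0 ?exprn_ge0 ?gen_weight_ge0 ?birth_weight_ge0.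
      apply/measurable_EFinP; apply: measurable_funM.
        by apply: measurable_funX; exact: (measurableT_comp (@measurable_gen_weight k) measurable_fst).
      apply: (@measurableT_comp _ _ _ _ _ _ (wt u : gen k -> R) _ fst) => //.
      by apply: measurable_birth_weight; rewrite su.
    split=> [z|]; first by rewrite lee_fin exprn_ge0 ?child_weight_ge0.
    apply/measurable_EFinP; apply: measurable_funX.
    exact: (measurableT_comp (measurable_child_weight K theta) measurable_snd).
  rewrite (_ : \int[_]_w _ = \int[bmp_law Y x]_w oapp (fun=> f (w, lf u w)) 0 (brt x u w)); last first.
    apply: eq_integral => w _; rewrite /f/= /wt; case eb : (brt x u w) => [b|]/=.
      by rewrite -EFinM mulrA.
    by rewrite mul0r mulr0.
  have nli b w : 0 <= LI b (fun l => f (w, l)).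
    have m2 : measT (fun l : life => (w, l) : gen k * life) by exact: measurable_fun_pair.
    exact: (posop_ge0 (posop_life_int X Z gamma0 mgamma _) (nnm_comp m2 nf)).
  rewrite (birth_life x su nf); apply: ge0_le_integral => //.
  - by move=> w _; apply: oapp_ge0 => b; exact: nli.
  - by have [] := nnm_birth_life x u nf.
  - apply: emeasurable_funM; first exact: measurable_cst.
    by apply/measurable_EFinP; apply: measurable_funM => //; exact: measurable_funX.
  - move=> w _; case eb : (brt x u w) => [b|]; rewrite /oapp; last by rewrite /birth_weight eb mulr0 mule0.
    have ncw : nnm (fun l : life => (cw l ^+ q.+1)%:E).
      split=> [l|]; first by rewrite lee_fin exprn_ge0// child_weight_ge0.
      by apply/measurable_EFinP; apply: measurable_funX; exact: measurable_child_weight.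
    rewrite /f/= (posopZ (posop_life_int X Z gamma0 mgamma b.2) _ ncw); last first.
      by rewrite mulr_ge0 ?exprn_ge0 ?gen_weight_ge0 ?birth_weight_ge0.
    rewrite muleC /birth_weight eb/= lee_wpmul2r//.
      by rewrite lee_fin mulr_ge0 ?exprn_ge0 ?gen_weight_ge0 ?expR_ge0.
    exact: life_int_child_weight.
have mgw u : measT (fun w => (gen_weight k w ^+ q * wt u w)%:E).
  by apply/measurable_EFinP; apply: measurable_funM => //; exact: measurable_funX.
have gw0 u w : 0 <= (gen_weight k w ^+ q * wt u w)%:E.
  by rewrite lee_fin mulr_ge0 ?exprn_ge0 ?gen_weight_ge0 ?birth_weight_ge0.
under eq_bigr => u _ do rewrite ge0_integralZl//.
rewrite -ge0_sume_distrr; last by move=> u _; apply: integral_ge0 => w _; exact: gw0.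
rewrite -ge0_integral_sum// exprS [X in _ <= X]EFinM lee_wpmul2l ?lee_fin//.
apply: le_trans ih; apply: ge0_le_integral => //.
- by move=> w _; apply: sume_ge0 => u _; exact: gw0.
- exact: emeasurable_sum.
- by apply/measurable_EFinP; exact: measurable_funX.
- by move=> w _; rewrite sumEFin lee_fin -mulr_sumr exprSr.
Qed.

Definition alive_count (D : nat) (t : R) (w : Omega) : R :=
  (\sum_(v <- all_words K D 0) (pos Y x t v w : bool)%:R)%R.

Lemma sum_all_words D n (g : word -> R) :
  (\sum_(v <- all_words K D n) g v = \sum_(n <= k < n + D) \sum_(v <- words K k) g v)%R.
Proof.
elim: D n => [|D ih] n /=; first by rewrite addn0 big_geq// big_nil.
by rewrite big_cat/= ih [RHS]big_ltn ?addnS ?ltnS ?leq_addr// addSn.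
Qed.

(** A particle alive at t is born at some b <= t, so its weight [expR (- theta * b)] is at least
    [expR (- theta * t)]. *)
Lemma alive_count_le D t w :
  (alive_count D t w <= expR (theta * t) * \sum_(k < D) gen_weight k w)%R.
Proof.
rewrite /alive_count sum_all_words add0n big_mkord mulr_sumr; apply: ler_sum => k _.
rewrite mulr_sumr; apply: ler_sum => u _; rewrite posE /wt.
case: (brt x u w) => [[b y]|]/=; last by rewrite mulr0.
rewrite /posat/=; case: ifPn => [/andP[bt _]|_]; last by rewrite mulr_ge0// expR_ge0.
rewrite -expRD; apply: (@le_trans _ _ 1%R); first by case: (xi _ _ _).
by rewrite -expR0 ler_expR mulNr -mulrBr mulr_ge0// subr_ge0.
Qed.

Lemma alive_count_ge0 D t w : (0 <= alive_count D t w)%R.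
Proof. by apply: sumr_ge0. Qed.

Lemma measurable_alive_count D t : measT (alive_count D t).
Proof.
apply: measurable_sum => u.
have m1 : measT (fun w => pos Y x t u w : bool).
  exact: (measurableT_comp (@measurable_fun_isSome _ (borel E)) (measurable_pos Y gamma0 mgamma x t u)).
have m2 : measT (fun b : bool => b%:R : R) by [].
exact: (measurableT_comp m2 m1).
Qed.

Hypothesis rho_small : (rho <= 2 ^- q.+1)%R.

(** The geometric decay [rho ^+ k] compensates the factors [(2 ^+ k.+1) ^+ q.+1] of
    [power_sum_geometric]. The bound does not depend on the numbers D of generations and K of
    labels, which are later sent to infinity. *)
Lemma alive_count_moment D t :
  \int[bmp_law Y x]_w (alive_count D t w ^+ q.+1)%:E <= (expR (theta * t) ^+ q.+1 * 2 ^+ q.+1)%:E.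
Proof.
have mG k : measT (gen_weight k : Omega -> R).
  exact: (measurableT_comp (@measurable_gen_weight k) (@measurable_gen_id k)).
pose g k w : R := (2 ^- k.+1 * (2 ^+ k.+1 * gen_weight k w) ^+ q.+1)%R.
have g0 k w : (0 <= g k w)%R.
  by rewrite mulr_ge0 ?invr_ge0 ?exprn_ge0 ?mulr_ge0 ?exprn_ge0 ?gen_weight_ge0.
have mg k : measT (fun w => (g k w)%:E).
  by apply/measurable_EFinP; apply: measurable_funM => //; apply: measurable_funX; exact: measurable_funM.
have e0 : (0 <= expR (theta * t) ^+ q.+1)%R by rewrite exprn_ge0 ?expR_ge0.
apply: (@le_trans _ _ (\int[bmp_law Y x]_w ((expR (theta * t) ^+ q.+1)%:E * \sum_(k < D) (g k w)%:E))).
  apply: ge0_le_integral => //.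
  - by move=> w _; rewrite lee_fin exprn_ge0// alive_count_ge0.
  - by apply/measurable_EFinP; apply: measurable_funX; exact: measurable_alive_count.
  - by apply: emeasurable_funM; [exact: measurable_cst|exact: emeasurable_sum].
  - move=> w _; rewrite sumEFin -EFinM lee_fin.
    have := lerXn2r q.+1 _ _ (alive_count_le D t w).
    have s0 : (0 <= \sum_(k < D) gen_weight k w)%R by apply: sumr_ge0 => k _; exact: gen_weight_ge0.
    rewrite !nnegrE alive_count_ge0 mulr_ge0 ?expR_ge0//.
    move=> /(_ isT isT) /le_trans; apply; rewrite exprMn ler_wpM2l//.
    by apply: (power_sum_geometric q D (s := fun k => gen_weight k w)) => k; exact: gen_weight_ge0.
rewrite ge0_integralZl//; last 2 first.
- exact: emeasurable_sum.
- by move=> w _; apply: sume_ge0 => k _; rewrite lee_fin.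
rewrite EFinM lee_wpmul2l ?lee_fin// ge0_integral_sum//; last by move=> k w _; rewrite lee_fin.
apply: (@le_trans _ _ (\sum_(k < D) (2 ^+ q.+1 * 2 ^- k.+1)%:E)).
  apply: lee_sum => k _; rewrite /g; under eq_integral do rewrite exprMn mulrA EFinM.
  have p0 : (0 <= 2 ^- k.+1 * (2 ^+ k.+1) ^+ q.+1 :> R)%R by rewrite mulr_ge0 ?invr_ge0 ?exprn_ge0.
  rewrite ge0_integralZl//; last 2 first.
  - by apply/measurable_EFinP; exact: measurable_funX.
  - by move=> w _; rewrite lee_fin exprn_ge0// gen_weight_ge0.
  apply: (@le_trans _ _ ((2 ^- k.+1 * (2 ^+ k.+1) ^+ q.+1)%:E * (rho ^+ k)%:E)).
    by rewrite lee_wpmul2l ?lee_fin// gen_moment.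
  rewrite -EFinM lee_fin [leRHS]mulrC -mulrA ler_wpM2l ?invr_ge0 ?exprn_ge0//.
  have rk : (rho ^+ k <= (2 ^- q.+1) ^+ k)%R.
    by rewrite lerXn2r// ?nnegrE ?invr_ge0 ?exprn_ge0// !mulr_ge0// ltW.
  apply: (@le_trans _ _ ((2 ^+ k.+1) ^+ q.+1 * (2 ^- q.+1) ^+ k)%R).
    by rewrite ler_wpM2l// !exprn_ge0.
  rewrite -exprM exprVn -exprM mulSn exprD mulnC -mulrA divff ?mulr1//.
rewrite sumEFin lee_fin -mulr_sumr -[leRHS]mulr1 ler_wpM2l ?exprn_ge0//.
have -> : (\sum_(k < D) 2 ^- k.+1 = 1 - 2 ^- D :> R)%R.
  elim: D => [|D' ih]; first by rewrite big_ord0 expr0 invr1 subrr.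
  by rewrite big_ord_recr/= ih exprSr invfM; field.
by rewrite gerBl invr_ge0 exprn_ge0.
Qed.

End GenerationMoments.

End BirthLife.

Section CountMoment.
Context (R : realType) (E : completePseudoMetricType R).
Context dP (Path : measurableType dP) (X : markov_process E Path).
Context (gamma : E -> R) (Gam : R).
Context dO (Off : measurableType dO) (Z : offspring E Off).
Context dW (Omega : measurableType dW) (Y : branching_process X gamma Z Omega).

Lemma count_moment (q : nat) (M : R) : (forall y, 0 <= gamma y) ->
  measurable_fun [set: borel E] (gamma : borel E -> R) ->
  0 < Gam -> (forall y, gamma y <= Gam) -> 0 <= M ->
  (forall y, \int[off_law Z y]_z ((off_num Z z)%:R ^+ q.+1)%:E <= M%:E)%E ->
  exists2 theta, 0 <= theta & forall x K D t,
    (\int[bmp_law Y x]_w (alive_count Y x K D t w ^+ q.+1)%:E <=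
      (expR (theta * t) ^+ q.+1 * 2 ^+ q.+1)%:E)%E.
Proof.
move=> gamma0 mgamma Gam0 gammaG M0 offM.
have M1 : 0 < M + 1 by rewrite ltr_wpDl.
(* Chosen so that [M * (2 * a) <= 2 ^- q.+1], the smallness required of the generation factor; M + 1
   avoids a zero denominator. *)
pose a : R := (2 ^+ q.+2 * (M + 1))^-1.
have p0 : 0 < 2 ^+ q.+2 :> R by rewrite exprn_gt0.
have a0 : 0 < a by rewrite invr_gt0 mulr_gt0.
(* This makes the exponent [theta * q.+1%:R * (a / Gam)] equal to 1/a, and e^(-1/a) <= a. *)
pose theta := Gam / (q.+1%:R * a ^+ 2).
have theta0 : 0 <= theta by rewrite divr_ge0 ?mulr_ge0 ?exprn_ge0// ltW.
exists theta => // x K D t.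
have ta : expR (- (theta * q.+1%:R * (a / Gam))) <= a.
  have -> : theta * q.+1%:R * (a / Gam) = a^-1.
    rewrite /theta; move: (a) a0 => b b0; field.
    by rewrite !gt_eqF// ltr0n.
  have ea : a^-1 <= expR a^-1 by apply: le_trans (expR_ge1Dx _); rewrite lerDr.
  have ai : 0 < a^-1 by rewrite invr_gt0.
  have := lef_pV2 (x := expR a^-1) (y := a^-1); rewrite !posrE => /(_ (expR_gt0 _) ai).
  by rewrite ea expRN (invrK a).
have rs : M * (2 * a) <= 2 ^- q.+1.
  rewrite /a exprS invfM.
  have -> : M * (2 * ((2 * 2 ^+ q.+1)^-1 * (M + 1)^-1)) = 2 ^- q.+1 * (M / (M + 1)).
    by field; rewrite gt_eqF//= expf_neq0.
  by rewrite -[leRHS]mulr1 ler_wpM2l ?invr_ge0 ?exprn_ge0// ler_pdivrMr// mul1r lerDl.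
have := @alive_count_moment R E dP Path X gamma dO Off Z dW Omega Y gamma0 mgamma q Gam M a theta.
by move=> /(_ Gam0 gammaG M0 offM a0 theta0 ta x K rs D t).
Qed.

End CountMoment.

(** * Evaluation of functions on configurations *)

Section Evaluation.
Context (R : realType) (E : completePseudoMetricType R).
Local Notation word := (seq nat).
Local Notation oE := (@optm _ (borel E)).
Local Notation conf := (conf E).

Definition box (K : nat) : seq word := all_words K K 0.

Lemma mem_box K v : (v \in box K) = (size v < K)%N && all (ltn^~ K) v.
Proof. by rewrite mem_all_words add0n. Qed.

Lemma uniq_box K : uniq (box K).
Proof. exact: uniq_all_words. Qed.

Lemma box_mono K K' v : (K <= K')%N -> v \in box K -> v \in box K'.
Proof.
move=> KK; rewrite !mem_box => /andP[sv av]; rewrite (leq_trans sv)//=.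
by apply: sub_all av => i /= iK; exact: leq_trans iK KK.
Qed.

Lemma box_cover (l : seq word) : exists K, forall v, v \in l -> v \in box K.
Proof.
elim: l => [|v l [K hK]]; first by exists 0%N.
have [K' vK'] : exists K', v \in box K'.
  exists (maxn (size v) (\max_(i <- v) i)).+1; rewrite mem_box ltnS leq_maxl/=.
  apply/allP => i iv /=; rewrite ltnS; apply: leq_trans (leq_maxr _ _).
  exact: (@leq_bigmax_seq _ _ xpredT id).
exists (maxn K K') => u; rewrite in_cons => /orP[/eqP ->|uL].
  exact: box_mono (leq_maxr _ _) vK'.
by apply: box_mono (leq_maxl _ _) _; exact: hK.
Qed.

Definition falive (z : word -> option E) := finite_set [set u | z u <> None].

Lemma falive_seq z : falive z -> exists2 l : seq word, uniq l & forall u, z u <> None -> u \in l.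
Proof.
move=> fz; exists (fset_set [set u | z u <> None]); first exact: fset_uniq.
by move=> u zu; rewrite in_fset_set// inE.
Qed.

Lemma seq_falive z (l : seq word) : (forall u, z u <> None -> u \in l) -> falive z.
Proof. by move=> zl; apply: (sub_finite_set (B := [set` l])) => //; exact: finite_seq. Qed.

Definition evc (f : E -> R[i]) (z : word -> option E) : R[i] :=
  \sum_(u \in [set: word]) at_dagger f (z u).

Definition xev (h : E -> R) (z : word -> option E) : R :=
  creal (evc (fun y => (h y)%:C%C) z).

Lemma evcE f z (l : seq word) : uniq l -> (forall u, z u <> None -> u \in l) ->
  evc f z = \sum_(u <- l) at_dagger f (z u).
Proof.
move=> ul zl; rewrite /evc (fsbigE l)//.
  by apply: eq_bigl => i; rewrite in_setT.
move=> u _ ul'.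
by case ez : (z u) => [y|]//; move: ul'; rewrite zl ?ez.
Qed.

Lemma creal_sum (I : Type) (l : seq I) (F : I -> R[i]) :
  creal (\sum_(i <- l) F i) = \sum_(i <- l) creal (F i).
Proof.
elim: l => [|i l ih]; rewrite ?big_nil// !big_cons -ih.
by case: (F i) => ? ?; case: (\sum_(j <- l) _).
Qed.

Lemma cimag_sum (I : Type) (l : seq I) (F : I -> R[i]) :
  cimag (\sum_(i <- l) F i) = \sum_(i <- l) cimag (F i).
Proof.
elim: l => [|i l ih]; rewrite ?big_nil// !big_cons -ih.
by case: (F i) => ? ?; case: (\sum_(j <- l) _).
Qed.

Lemma xevE h z (l : seq word) : uniq l -> (forall u, z u <> None -> u \in l) ->
  xev h z = \sum_(u <- l) at_dagger h (z u).
Proof.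
move=> ul zl; rewrite /xev (evcE _ ul zl) creal_sum; apply: eq_bigr => u _.
by case: (z u).
Qed.

(** Finiteness of the configuration is essential: the real part of f may have finite support on an
    infinite configuration where f itself does not, and then the two sums follow different
    conventions. *)
Lemma creal_evc f z : falive z -> creal (evc f z) = xev (fun y => creal (f y)) z.
Proof.
move=> /falive_seq[l ul zl]; rewrite (xevE _ ul zl) (evcE _ ul zl) creal_sum.
by apply: eq_bigr => u _; case: (z u).
Qed.

Lemma cimag_evc f z : falive z -> cimag (evc f z) = xev (fun y => cimag (f y)) z.
Proof.
move=> /falive_seq[l ul zl]; rewrite (xevE _ ul zl) (evcE _ ul zl) cimag_sum.
by apply: eq_bigr => u _; case: (z u).
Qed.

Lemma xevZ c h z : falive z -> xev (fun y => c * h y) z = c * xev h z.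
Proof.
move=> /falive_seq[l ul zl]; rewrite !(xevE _ ul zl) mulr_sumr; apply: eq_bigr => u _.
by case: (z u) => //=; rewrite mulr0.
Qed.

Lemma xev_le h g z : falive z -> (forall y, h y <= g y) -> xev h z <= xev g z.
Proof.
move=> /falive_seq[l ul zl] hg; rewrite !(xevE _ ul zl); apply: ler_sum => u _.
by case: (z u) => /=.
Qed.

Lemma xev_abs h b z : falive z -> (forall y, `|h y| <= b) -> `|xev h z| <= b * xev (cst 1) z.
Proof.
move=> fz hb; rewrite -xevZ// ler_norml; apply/andP; split; last first.
  by apply: xev_le => // y; rewrite mulr1; exact: le_trans (ler_norm _) (hb y).
rewrite lerNl -mulN1r -xevZ//; apply: xev_le => // y.
by rewrite mulN1r mulr1; apply: le_trans (hb y); rewrite -normrN ler_norm.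
Qed.

Lemma xev1_ge0 z : falive z -> 0 <= xev (cst 1) z.
Proof.
move=> /falive_seq[l ul zl]; rewrite (xevE _ ul zl); apply: sumr_ge0 => u _.
by case: (z u).
Qed.

(** A sum with infinite support is 0 by convention; a function without zeros makes every infinite
    configuration such a case. *)
Lemma xev_infinite h z : (forall y, h y != 0) -> ~ falive z -> xev h z = 0.
Proof.
move=> h0 fz; rewrite /xev /evc fsbig_dflt// => fin; apply: fz.
apply: sub_finite_set fin => u /= zu; split=> //=.
case ez : (z u) zu => [y|]//= _ /eqP; rewrite eq_complex /= => /andP[/eqP hy _].
by move: (h0 y); rewrite hy eqxx.
Qed.

Definition nth_word (n : nat) : word := odflt [::] (choice.unpickle n).

Lemma nth_wordP u : exists n, nth_word n = u.
Proof. by exists (choice.pickle u); rewrite /nth_word choice.pickleK. Qed.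

(** Finiteness of the set of selected particles, phrased through an increasing sequence of finite
    boxes so that it is a countable combination of events. *)
Definition box_fin (b : option E -> bool) : set conf :=
  [set z | exists K, forall u, b (z u) -> u \in box K].

Lemma measurable_box_fin b : measT (b : oE -> bool) -> measurable (box_fin b).
Proof.
move=> mb.
rewrite (_ : box_fin b = \bigcup_K \bigcap_(n in [set: nat])
   [set z : conf | (nth_word n \in box K) || ~~ b (z (nth_word n))]).
  apply: bigcupT_measurable => K; apply: bigcap_measurable => [|n _]; first by exists 0%N.
  move: (nth_word n) => u.
  have mT : measurable [set z : conf | true].
    by rewrite (_ : [set z : conf | true] = setT)//; apply/seteqP.
  case: (u \in box K) => /=; first exact: mT.
  have mbu : measT (fun z : conf => b (z u)).
    exact: (measurableT_comp mb (measurable_conf_eval u)).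
  rewrite (_ : [set z | _] = setT `&` (fun z : conf => b (z u)) @^-1` [set false]).
    exact: mbu.
  by rewrite setTI; apply/seteqP; split=> z /=; case: (b _).
apply/seteqP; split=> z.
  move=> [K hK]; exists K => // n _ /=.
  by have [/hK ->//|] := boolP (b (z (nth_word n))); rewrite orbT.
move=> [K _ hK]; exists K => u bu; have [n nu] := nth_wordP u.
by have := hK n I; rewrite /= nu bu orbF.
Qed.

Lemma measurable_at_dagger_part (p : R[i] -> R) (f : E -> R[i]) :
  measurable_fun [set: borel E] ((fun y => p (f y)) : borel E -> R) -> p 0 = 0 ->
  measT ((fun o => p (at_dagger f o)) : oE -> R).
Proof.
move=> mf p0; rewrite (_ : (fun o => _) = at_dagger (fun y => p (f y))).
  exact: measurable_at_dagger.
by apply/funext => -[y|].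
Qed.

(** p stands for the real or the imaginary part. On the event of finite support the value is the
    limit of the sums over boxes, elsewhere it is 0. *)
Lemma measurable_evc (p : R[i] -> R) (f : E -> R[i]) : @cmeasurable R _ (borel E) f ->
  measurable_fun [set: borel E] ((fun y => p (f y)) : borel E -> R) -> p 0 = 0 ->
  (forall (l : seq word) F, p (\sum_(i <- l) F i) = \sum_(i <- l) p (F i)) ->
  measT (fun z : conf => p (evc f z)).
Proof.
move=> [mr mi] mp p0 psum.
pose b (o : option E) := (at_dagger f o != 0).
have mb : measT (b : oE -> bool).
  rewrite (_ : b = fun o => (creal (at_dagger f o) != 0) || (cimag (at_dagger f o) != 0)); last first.
    by apply/funext => o; rewrite /b eq_complex negb_and.
  have m0 (g : oE -> R) : measT g -> measT (fun o => g o != 0).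
    move=> mg; apply: (measurable_fun_bool true); rewrite setTI.
    rewrite (_ : _ @^-1` _ = setT `&` g @^-1` (~` [set 0])).
      by apply: mg => //; apply: measurableC; exact: measurable_set1.
    by rewrite setTI; apply/seteqP; split=> o /= /eqP.
  by apply: measurable_or; apply: m0; exact: measurable_at_dagger_part.
have mg u : measT (fun z : conf => p (at_dagger f (z u))).
  have h := measurable_at_dagger_part mp p0.
  exact: (measurableT_comp h (measurable_conf_eval u)).
apply: (@measurable_fun_cvg _ _ _ _ (fun K z => \1_(box_fin b) z * \sum_(u <- box K) p (at_dagger f (z u)))).
  move=> K; apply: measurable_funM; first exact: measurable_indic (measurable_box_fin mb).
  exact: measurable_sum.
move=> z _; have [bz|bz] := boolP (z \in box_fin b); last first.
  rewrite (_ : p (evc f z) = 0).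
    rewrite (_ : (fun K => _) = cst 0); first exact: cvg_cst.
    by apply/funext => K; rewrite indicE (negbTE bz) mul0r.
  rewrite /evc fsbig_dflt// => fin; move/negP: bz; apply; rewrite inE.
  have [K hK] := box_cover (fset_set ([set: word] `&` (fun u => at_dagger f (z u)) @^-1` [set~ 0])).
  by exists K => u bu; apply: hK; rewrite in_fset_set// inE; split=> //=; apply/eqP.
have [K0 hK0] : box_fin b z by move: bz; rewrite inE.
apply: cvg_near_cst; near=> K.
have KK : (K0 <= K)%N by near: K; exact: nbhs_infty_ge.
rewrite indicE bz mul1r -psum; congr (p _); apply/esym.
rewrite /evc (fsbigE (box K)) ?uniq_box//.
  by apply: eq_bigl => i; rewrite in_setT.
move=> u _ uK; apply/eqP; rewrite -[_ == _]negbK; apply/negP => bu.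
by move/negP: uK; apply; apply: box_mono KK _; exact: hK0.
Unshelve. all: by end_near. Qed.

Lemma measurable_creal_evc (f : E -> R[i]) : @cmeasurable R _ (borel E) f ->
  measT (fun z : conf => creal (evc f z)).
Proof. by move=> mf; apply: measurable_evc => //; [exact: mf.1|exact: creal_sum]. Qed.

Lemma measurable_cimag_evc (f : E -> R[i]) : @cmeasurable R _ (borel E) f ->
  measT (fun z : conf => cimag (evc f z)).
Proof. by move=> mf; apply: measurable_evc => //; [exact: mf.2|exact: cimag_sum]. Qed.

Lemma measurable_xev (h : E -> R) : measurable_fun [set: borel E] (h : borel E -> R) ->
  measT (xev h : conf -> R).
Proof. by move=> mh; apply: measurable_creal_evc; split. Qed.

End Evaluation.

Lemma suffix_total (T : eqType) (u u' v : seq T) :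
  suffix u v -> suffix u' v -> suffix u u' || suffix u' u.
Proof.
have main (a b : seq T) : (size a <= size b)%N -> suffix a v -> suffix b v -> suffix a b.
  move=> ab av /suffixP[c vE]; move: av; rewrite vE !suffixE size_cat drop_cat.
  rewrite ltnNge -addnBA// leq_addr/=.
  by rewrite addnC addnK.
by have [h|/ltnW h] := leqP (size u) (size u') => uv u'v; apply/orP; [left|right]; exact: main.
Qed.

(** * Genealogy between two times *)

Section TreeFacts.
Context (R : realType) (E : completePseudoMetricType R).
Context dP (Path : measurableType dP) (X : markov_process E Path).
Context (gamma : E -> R) (G : R).
Context dO (Off : measurableType dO) (Z : offspring E Off).
Context dW (Omega : measurableType dW) (Y : branching_process X gamma Z Omega).
Hypothesis gamma0 : forall y, 0 <= gamma y.
Hypothesis mgamma : measurable_fun [set: borel E] (gamma : borel E -> R).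
Hypothesis gammaG : forall y, gamma y <= G.
Local Notation tau := (lifetime X gamma).
Local Notation word := (seq nat).
Local Notation pos := (pos Y).
Local Notation brt := (brt Y).
Local Notation lf := (bmp_life Y).
Arguments lifetime : simpl never.

Lemma child_tau i l r : child X gamma Z i l = Some r -> tau l.1.1 l.1.2 = r.1%:E.
Proof. by rewrite /child; case: (tau _ _) => // t; case: ifP => // _ [<-]. Qed.

(** The line of descent passes through a child of u, which is born at the moment u branches. *)
Lemma birth_descendant x u v w b : v <> [::] -> brt x (v ++ u) w = Some b ->
  exists b0 r, [/\ brt x u w = Some b0, tau (lf u w).1.1 (lf u w).1.2 = r%:E & b0.1 + r <= b.1].
Proof.
elim: v b => [//|i v ih] b _ /=; rewrite brt_cons.
case ea : (brt x (v ++ u) w) => [a|]//=.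
case ec : (child _ _ _ _ _) => [r|]//= -[<-]/=.
case: v ih ea ec => [_|j v ih] ea ec.
  by exists a, r.1; split=> //; exact: child_tau ec.
have [//|b0 [r0 [e1 e2 e3]]] := ih a _ ea.
exists b0, r0; split=> //; apply: le_trans e3 _; rewrite lerDl.
by case: r ec => r p ec; exact: child_ge0 ec.
Qed.

Lemma alive_antichain x t u v w : pos x t (v ++ u) w <> None -> pos x t u w <> None -> v = [::].
Proof.
move=> pv pu; apply/eqP; rewrite -[_ == _]negbK; apply/negP => /eqP v0.
move: pv; rewrite posE; case eb : (brt x (v ++ u) w) => [b|]//=.
have [b0 [r [e1 e2 e3]]] := birth_descendant v0 eb.
move: pu; rewrite posE e1 /= /posat/= e2 lte_fin; case: ifPn => // /andP[bt tr] _.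
case: ifPn => // /andP[bt' _] _.
by have := le_lt_trans bt' (le_lt_trans _ tr); lra.
Qed.

Lemma lifetime_neg w c : c < 0 -> (tau w c <= 0%:E)%E.
Proof.
move=> c0; rewrite lifetimeE; apply: lifetime_le => //.
apply: (lt_le_trans _ (rate_int_ge0 gamma0 _ _)).
by rewrite lte_fin.
Qed.

(** Going up the line of ancestors one reaches the first that is born by time s; the next one on the
    line is born after s, so this ancestor branches after s and is alive at s. *)
Lemma alive_ancestor x s t v w : 0 <= s -> 0 <= t -> pos x (s + t) v w <> None ->
  exists v' u, v = v' ++ u /\ pos x s u w <> None.
Proof.
move=> s0 t0.
have late : forall v b, brt x v w = Some b -> s < b.1 -> exists v' u, v = v' ++ u /\ pos x s u w <> None.
  elim=> [|i v0 ih] b; first by rewrite /(brt _ [::] _)/= => -[<-]/=; rewrite ltNge s0.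
  rewrite brt_cons; case ea : (brt x v0 w) => [a|]//=.
  case ec : (child _ _ _ _ _) => [r|]//= -[<-]/= sb.
  have [sa|as_] := ltP s a.1.
    by have [v' [u [-> pu]]] := ih a ea sa; exists (i :: v'), u.
  exists [:: i], v0; split=> //; rewrite posE ea /= /posat/= as_/=.
  have et := child_tau ec; rewrite et lte_fin ltrBlDl sb.
  (* For a nonnegative clock the branching place is not the cemetery, and absorption gives a
     position at s. For a negative clock the lifetime is at most 0, and the child would be born by
     time s. *)
  have [c0|c0] := leP 0 (lf v0 w).1.2.
    have al := lifetime_alive gamma0 mgamma gammaG (p := path_traj X (lf v0 w).1.1) c0 et.
    move=> xn; apply: al; apply: (xi_absorbed _ xn); rewrite subr_ge0 as_/=.
    by rewrite lerBlDl ltW.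
  have := lifetime_neg (lf v0 w).1.1 c0; rewrite et lee_fin => r0.
  by move: sb; rewrite ltNge (le_trans _ as_)// gerDl.
rewrite posE; case eb : (brt x v w) => [b|]//=.
have [sb _|bs] := ltP s b.1; first exact: late eb sb.
rewrite /posat/=; case: ifPn => // /andP[_ tl] pn.
exists [::], v; split=> //; rewrite posE eb /= /posat/= bs/= ifT.
  move=> xn; apply: pn; apply: (xi_absorbed _ xn); rewrite subr_ge0 bs/=.
  by rewrite lerB// lerDl.
by apply: le_lt_trans tl; rewrite lee_fin lerB// lerDl.
Qed.

Lemma falive_sub x s t u w : falive (cfg Y x (s + t) w) -> falive (sub_cfg Y x (s + t) u w).
Proof.
move=> /falive_seq[l _ zl].
apply: (seq_falive (l := [seq take (size v - size u) v | v <- l])) => v pv.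
have := zl _ pv => /(map_f (fun v => take (size v - size u) v)).
by rewrite size_cat addnK take_size_cat.
Qed.

(** Each particle alive at s + t has exactly one ancestor alive at s: existence is [alive_ancestor],
    uniqueness comes from comparability of two ancestors and [alive_antichain]. *)
Lemma xev_branching x s t w h (l : seq word) : 0 <= s -> 0 <= t ->
  uniq l -> (forall u, pos x s u w <> None -> u \in l) -> falive (cfg Y x (s + t) w) ->
  xev h (cfg Y x (s + t) w) =
  \sum_(u <- l) (if pos x s u w is Some _ then xev h (sub_cfg Y x (s + t) u w) else 0).
Proof.
move=> s0 t0 ul al ft; have [L uL zL] := falive_seq ft.
pose g v := at_dagger h (pos x (s + t) v w).
rewrite (xevE _ uL zL).
transitivity (\sum_(u <- l) \sum_(v <- L) (if (pos x s u w : bool) && suffix u v then g v else 0)).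
  rewrite exchange_big/=; apply: eq_bigr => v _.
  rewrite -/(g v); case ep : (pos x (s + t) v w) => [y|]; last first.
    by rewrite /g ep big1// => u _; case: ifP.
  have [|v' [u [vE pu]]] := @alive_ancestor x s t v w s0 t0; first by rewrite ep.
  rewrite (bigD1_seq u)//=; last exact: al.
  rewrite vE suffix_suffix andbT ifT; last by case: (pos x s u w) pu.
  rewrite -vE big1_seq ?addr0 /g ?ep// => u' /andP[u'u u'l].
  case: ifPn => // /andP[pu' /suffixP[v2 vE2]].
  exfalso; move/eqP: u'u; apply.
  have pu2 : pos x s u' w <> None by case: (pos x s u' w) pu'.
  have cmp : suffix u u' || suffix u' u.
    by apply: (suffix_total (v := v)); [rewrite vE suffix_suffix|rewrite vE2 suffix_suffix].
  move: cmp => /orP[/suffixP[a aE]|/suffixP[a aE]].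
    by rewrite aE in pu2; rewrite aE (alive_antichain pu2 pu).
  by rewrite aE in pu; rewrite aE (alive_antichain pu pu2).
apply: eq_bigr => u _; case ep : (pos x s u w) => [y|] /=; last by rewrite big1.
pose L' := [seq take (size v - size u) v | v <- L & suffix u v].
have tK v : suffix u v -> take (size v - size u) v ++ u = v.
  by move=> /suffixP[v' ->]; rewrite size_cat addnK take_size_cat.
rewrite (@xevE _ _ _ _ L'); first last.
- move=> v pv; have vL := zL (v ++ u) pv.
  apply/mapP; exists (v ++ u); first by rewrite mem_filter suffix_suffix.
  by rewrite size_cat addnK take_size_cat.
- rewrite map_inj_in_uniq ?filter_uniq// => v1 v2; rewrite !mem_filter => /andP[s1 _] /andP[s2 _] e.
  by rewrite -(tK _ s1) -(tK _ s2) e.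
rewrite /L' big_map big_filter [RHS]big_mkcond; apply: eq_bigr => v _; case: ifPn => // sv.
by rewrite /sub_cfg tK.
Qed.

End TreeFacts.

(** * Elementary inequalities for powers *)

Section Inequalities.
Context (R : realType).

Lemma expr_le1D (a : R) (p q : nat) : 0 <= a -> (p <= q)%N -> a ^+ p <= 1 + a ^+ q.
Proof.
move=> a0 pq; have [a1|a1] := leP a 1.
  have h : a ^+ p <= 1 by exact: exprn_ile1.
  by rewrite (le_trans h)// lerDl exprn_ge0.
by rewrite (le_trans (ler_weXn2l (ltW a1) pq))// lerDr.
Qed.

Lemma exprD_le (a b : R) (q : nat) : 0 <= a -> 0 <= b ->
  (a + b) ^+ q <= 2 ^+ q * (a ^+ q + b ^+ q).
Proof.
wlog ab : a b / a <= b => [hw a0 b0|a0 b0].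
  have [|/ltW] := leP a b; first by move/hw; exact.
  by move=> /hw; rewrite addrC [b ^+ q + _]addrC; apply.
apply: (@le_trans _ _ ((2 * b) ^+ q)).
  by apply: lerXn2r; rewrite ?nnegrE ?addr_ge0 ?mulr_ge0//; lra.
by rewrite exprMn ler_wpM2l ?exprn_ge0// lerDr exprn_ge0.
Qed.

Lemma mixed_power (x y : R) (a b : nat) : `|x ^+ a * y ^+ b| <= `|x| ^+ (a + b) + `|y| ^+ (a + b).
Proof.
rewrite normrM !normrX.
have [xy|/ltW yx] := leP `|x| `|y|.
  rewrite (@le_trans _ _ (`|y| ^+ (a + b)))// ?lerDr ?exprn_ge0// exprD.
  by rewrite ler_wpM2r ?exprn_ge0// lerXn2r ?nnegrE.
rewrite (@le_trans _ _ (`|x| ^+ (a + b)))// ?lerDl ?exprn_ge0// exprD.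
by rewrite ler_wpM2l ?exprn_ge0// lerXn2r ?nnegrE.
Qed.

Lemma even_power_ge0 (x : R) (p : nat) : 0 <= x ^+ p.*2.
Proof. by rewrite -mul2n exprM exprn_ge0 ?sqr_ge0. Qed.

Lemma normr_even (x : R) (p : nat) : `|x| ^+ p.*2 = x ^+ p.*2.
Proof. by rewrite -mul2n !exprM real_normK ?num_real. Qed.

(* Taylor expansion of [(s + y) ^+ 2k] in which only the linear term in [y] keeps its sign. *)
Lemma power_taylor (p : nat) : exists2 B : R, 0 <= B & forall s y : R,
  (s + y) ^+ p.+1.*2 <= s ^+ p.+1.*2 + p.+1.*2%:R * s ^+ p.*2.+1 * y +
    B * (s ^+ p.*2 * y ^+ 2 + y ^+ p.+1.*2).
Proof.
elim: p => [|p [B B0 ih]].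
  exists 1 => // s y; rewrite !doubleS double0 !expr2 expr1 expr0 /=.
  by have := sqr_ge0 y; nra.
exists (3 * p.+1.*2%:R + 8 * B + 1); first by rewrite !addr_ge0// mulr_ge0.
move=> s y; have h1 := ler_wpM2l (sqr_ge0 (s + y)) (ih s y).
have m1 := mixed_power s y p.*2.+1 1; have m2 := mixed_power s y p.*2 2.
have m3 := mixed_power s y 2 p.*2; have m4 := mixed_power s y 1 p.*2.+1.
have n4 : p.+2.*2%:R = p.+1.*2%:R + 2 :> R by rewrite -natrD doubleS addn2.
rewrite n4 (doubleS p.+1) [(s + y) ^+ _.+2]exprS exprS mulrA -expr2; apply: le_trans h1 _.
have U a b : (a + b = p.+1.*2)%N -> `|s| ^+ (a + b) + `|y| ^+ (a + b) = s ^+ 2 * s ^+ p.*2 + y ^+ 2 * y ^+ p.*2.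
  by move=> ->; rewrite !normr_even doubleS -!exprD.
rewrite U ?addn1 ?doubleS// in m1; rewrite U ?addn2 ?doubleS// in m2.
rewrite U ?add2n ?doubleS// in m3; rewrite U ?add1n ?doubleS// in m4.
have k0 : 0 <= p.+1.*2%:R :> R by [].
have S0 := even_power_ge0 s p; have T0 := even_power_ge0 y p; have y2 := sqr_ge0 y; have s2 := sqr_ge0 s.
move: m1 m2 m3 m4 S0 T0 k0; rewrite doubleS !exprS !expr0 !mulr1.
set k : R := p.*2.+2%:R; set S := s ^+ p.*2; set T := y ^+ p.*2.
rewrite !ler_norml => /andP[_ m1] /andP[_ m2] /andP[_ m3] /andP[_ m4] S0 T0 k0.
have ym a b : a <= b -> y * y * a <= y * y * b by move=> ab; rewrite ler_wpM2l// -expr2.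
have m5 : s * s * S <= s * s * S + y * y * T by rewrite lerDl mulr_ge0// -expr2.
have m6 : y * y * T <= s * s * S + y * y * T by rewrite lerDr mulr_ge0// -expr2.
have {}m1 := ym _ _ m1; have {}m2 := ym _ _ m2; have {}m3 := ym _ _ m3.
have {}m4 := ym _ _ m4; have {}m5 := ym _ _ m5; have {}m6 := ym _ _ m6.
have k1 := ler_wpM2l k0 m1; have k5 := ler_wpM2l k0 m5.
have b1 := ler_wpM2l B0 m1; have b2 := ler_wpM2l B0 m2; have b3 := ler_wpM2l B0 m3.
have b4 := ler_wpM2l B0 m4; have b5 := ler_wpM2l B0 m5; have b6 := ler_wpM2l B0 m6.
lra.
Qed.

(** Adding one alive particle raises the power of the count by at least half of [n ^+ p + 1]; this
    pays for the two remainders of the Taylor expansion, one of size [n ^+ p] and one of size 1. *)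
Lemma count_step (n : R) (p : nat) (b : bool) : 0 <= n ->
  n ^+ p.+1 + b%:R * (n ^+ p + 1) / 2 <= (n + b%:R) ^+ p.+1.
Proof.
move=> n0; case: b; last by rewrite (_ : false%:R = 0 :> R)// !mul0r !addr0.
rewrite (_ : true%:R = 1 :> R)// !mul1r [leRHS]exprS exprS.
have h1 : n ^+ p <= (n + 1) ^+ p by rewrite lerXn2r ?nnegrE ?addr_ge0// lerDl.
have h2 : 1 <= (n + 1) ^+ p by rewrite exprn_ege1// lerDr.
have h3 := ler_wpM2l n0 h1; lra.
Qed.

End Inequalities.

(** * Integrals of real functions under a probability *)

Section ProbabilityTools.
Context (R : realType) d (T : measurableType d) (P : probability T R).
Local Open Scope ereal_scope.

Lemma pint_le (f g : T -> R) : measT f -> measT g ->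
  (forall w, 0 <= f w)%R -> (forall w, 0 <= g w)%R -> {ae P, forall w, (f w <= g w)%R} ->
  \int[P]_w (f w)%:E <= \int[P]_w (g w)%:E.
Proof.
move=> mf mg f0 g0 fg; apply: ae_ge0_le_integral => //.
- by move=> w _; rewrite lee_fin.
- exact/measurable_EFinP.
- by move=> w _; rewrite lee_fin.
- exact/measurable_EFinP.
- by apply: filterS fg => w fg _; rewrite lee_fin.
Qed.

Lemma pint_ae_eq (f g : T -> R) : measT f -> measT g ->
  {ae P, forall w, f w = g w} -> \int[P]_w (f w)%:E = \int[P]_w (g w)%:E.
Proof.
move=> mf mg fg; apply: ae_eq_integral => //; try exact/measurable_EFinP.
by apply: filterS fg => w /= ->.
Qed.

(** Fatou's lemma for a uniform bound: it transfers moment estimates from finite boxes of particles,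
    or from late times, to the limit. *)
Lemma pint_fatou_cvg (h : nat -> T -> R) (f : T -> R) (c : \bar R) :
  (forall K, measT (h K)) -> measT f ->
  (forall K w, 0 <= h K w)%R -> (forall w, 0 <= f w)%R ->
  {ae P, forall w, h ^~ w @ \oo --> f w} ->
  (forall K, \int[P]_w (h K w)%:E <= c) -> \int[P]_w (f w)%:E <= c.
Proof.
move=> mh mf h0 f0 hf hc.
pose hE K w := (h K w)%:E.
have mhE K : measT (hE K) by exact/measurable_EFinP.
have ein0 w : 0 <= limn_einf (hE ^~ w).
  rewrite limn_einf_lim; apply: lime_ge; first exact: is_cvg_einfs.
  by apply: nearW => n; apply: le_ereal_inf_tmp => _ [k _ <-]; rewrite lee_fin.
apply: (@le_trans _ _ (\int[P]_w limn_einf (hE ^~ w))).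
  apply: ae_ge0_le_integral => //.
  - by move=> w _; rewrite lee_fin.
  - exact/measurable_EFinP.
  - rewrite (_ : (fun w => _) = fun w => limn (einfs (hE ^~ w))); last first.
      by apply/funext => w; rewrite limn_einf_lim.
    apply: (@emeasurable_fun_cvg _ _ _ _ (fun n w => einfs (hE ^~ w) n)) => [n|w _].
      exact: measurable_fun_einfs.
    exact: is_cvg_einfs.
  - apply: filterS hf => w hf _.
    have cv : hE ^~ w @ \oo --> (f w)%:E.
      by apply/fine_cvgP; split; [exact: nearW|exact: hf].
    rewrite is_cvg_limn_einfE; last by apply/cvg_ex; exists (f w)%:E.
    by rewrite (cvg_lim _ cv).
apply: (le_trans (fatou P measurableT mhE _)).
  by move=> n w _; rewrite lee_fin.
apply: (le_trans (limn_einf_sup _)); rewrite limn_esup_lim.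
apply: lime_le; first exact: is_cvg_esups.
by apply: nearW => n; rewrite /esups; apply: ge_ereal_sup => _ [k _ <-]; exact: hc.
Qed.

Lemma pint_fatou (h : nat -> T -> R) (f : T -> R) (c : \bar R) :
  (forall K, measT (h K)) -> measT f ->
  (forall K w, 0 <= h K w)%R -> (forall w, 0 <= f w)%R ->
  {ae P, forall w, exists K0, forall K, (K0 <= K)%N -> h K w = f w} ->
  (forall K, \int[P]_w (h K w)%:E <= c) -> \int[P]_w (f w)%:E <= c.
Proof.
move=> mh mf h0 f0 hf; apply: pint_fatou_cvg => //.
apply: filterS hf => w [K0 hK0]; apply: cvg_near_cst.
by near=> K; rewrite hK0//; near: K; exact: nbhs_infty_ge.
Unshelve. all: by end_near. Qed.

(** Signed terms of mean zero are handled through their positive and negative parts, whose integrals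
    are equal and finite; comparisons then remain between integrals of nonnegative functions. *)
Definition pp (g : T -> R) w : R := Num.max (g w) 0%R.

Lemma pp_ge0 g w : (0 <= pp g w)%R.
Proof. by rewrite /pp le_max lexx orbT. Qed.

Lemma measurable_pp g : measT g -> measT (pp g).
Proof. by move=> mg; exact: measurable_maxr. Qed.

Lemma pp_le_norm g w : (pp g w <= `|g w|)%R.
Proof. by rewrite /pp ge_max ler_norm normr_ge0. Qed.

Lemma pint_parts (g : T -> R) : \int[P]_w (g w)%:E =
  \int[P]_w (pp g w)%:E - \int[P]_w (pp (fun w => - g w)%R w)%:E.
Proof.
rewrite integralE; congr (_ - _); apply: eq_integral => w _.
  by rewrite funeposE /pp EFin_max.
by rewrite funenegE /pp EFin_max EFinN.
Qed.

Lemma pint_pp_lty (g : T -> R) : measT g -> \int[P]_w `|g w|%:E < +oo ->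
  \int[P]_w (pp g w)%:E < +oo /\ \int[P]_w (pp (fun w => - g w)%R w)%:E < +oo.
Proof.
move=> mg gi.
have mn : measT (fun w => `|g w|%R) by exact: measurableT_comp.
have mN : measT (fun w => - g w)%R by exact: measurableT_comp.
split; apply: le_lt_trans gi; apply: pint_le => //.
- exact: measurable_pp.
- exact: pp_ge0.
- by apply/nearW => w; exact: pp_le_norm.
- exact: measurable_pp.
- exact: pp_ge0.
- by apply/nearW => w; rewrite -normrN; exact: pp_le_norm.
Qed.

Lemma pint_ge0 (f : T -> R) : (forall w, 0 <= f w)%R -> 0 <= \int[P]_w (f w)%:E.
Proof. by move=> f0; apply: integral_ge0 => w _; rewrite lee_fin. Qed.

Lemma pint_cst (c : R) : \int[P]_w c%:E = c%:E.
Proof. exact: (etrans (integral_cst P measurableT c%:E) (etrans (congr1 (mule _) (probability_setT P)) (mule1 _))). Qed.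

Lemma pintZ (c : R) (f : T -> R) : measT f -> (0 <= c)%R -> (forall w, 0 <= f w)%R ->
  \int[P]_w (c * f w)%:E = c%:E * \int[P]_w (f w)%:E.
Proof.
move=> mf c0 f0; under eq_integral do rewrite EFinM.
rewrite ge0_integralZl//; first exact/measurable_EFinP.
by move=> w _; rewrite lee_fin.
Qed.

Lemma pintD (f g : T -> R) : measT f -> measT g ->
  (forall w, 0 <= f w)%R -> (forall w, 0 <= g w)%R ->
  \int[P]_w (f w + g w)%:E = \int[P]_w (f w)%:E + \int[P]_w (g w)%:E.
Proof.
move=> mf mg f0 g0; under eq_integral do rewrite EFinD.
rewrite ge0_integralD//; try exact/measurable_EFinP.
all: by move=> w _; rewrite lee_fin.
Qed.

Lemma pint_zero_mean (g : T -> R) : measT g -> \int[P]_w `|g w|%:E < +oo ->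
  \int[P]_w (g w)%:E = 0 -> \int[P]_w (pp g w)%:E = \int[P]_w (pp (fun w => - g w)%R w)%:E.
Proof.
move=> mg gi e; have [] := pint_pp_lty mg gi; move: e; rewrite (pint_parts g).
have := pint_ge0 (pp_ge0 g); have := pint_ge0 (pp_ge0 (fun w => - g w)%R).
set a := \int[P]_w (pp g w)%:E; set b := \int[P]_w _.
case: a => [a| |] //; case: b => [b| |] // _ _ + _ _.
by rewrite -EFinB => -[] /eqP; rewrite subr_eq0 => /eqP ->.
Qed.

End ProbabilityTools.

Lemma ler_sum_subset (R : realType) (T : eqType) (l L : seq T) (F : T -> R) :
  uniq l -> uniq L -> {subset l <= L} -> (forall u, 0 <= F u) ->
  \sum_(u <- l) F u <= \sum_(u <- L) F u.
Proof.
move=> ul uL lL F0; rewrite [leRHS](bigID (mem l))/= -[leLHS]addr0 lerD ?sumr_ge0//.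
rewrite -[leRHS]big_filter [leRHS](perm_big l)//; apply: uniq_perm => //.
  by rewrite filter_uniq.
by move=> v; rewrite mem_filter andbC; apply/andP/idP => [[]//|vl]; split=> //; exact: lL.
Qed.

Lemma pp_sub (R : realType) d (T : measurableType d) (g : T -> R) w : pp g w - pp (fun w => - g w) w = g w.
Proof.
rewrite /pp; have [g0|g0] := leP (g w) 0.
  by rewrite max_l ?oppr_ge0// sub0r opprK.
by rewrite max_r ?oppr_le0 ?ltW// subr0.
Qed.

Lemma lee_scale (R : realType) (c D : R) (I : \bar R) : 0 <= c -> (I <= D%:E)%E -> (c%:E * I <= (c * D)%:E)%E.
Proof. by move=> c0 ID; rewrite EFinM lee_wpmul2l. Qed.

(** Convexity: x + y is the mean of x/(1 - th) and y/th with weights 1 - th and th. With the right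
    th it can be iterated along a geometric decay without accumulating constants. *)
Lemma split_power (R : realType) (p : nat) (th x y : R) : 0 < th < 1 ->
  (x + y) ^+ p.*2 <= (1 - th) * (x / (1 - th)) ^+ p.*2 + th * (y / th) ^+ p.*2.
Proof.
move=> /andP[t0 t1]; have t1' : 0 < 1 - th by rewrite subr_gt0.
rewrite -normr_even -[(x / _) ^+ _]normr_even -[(y / _) ^+ _]normr_even.
pose a := `|x / (1 - th)|; pose b := `|y / th|.
have le1 : `|x + y| <= (1 - th) * a + th * b.
  rewrite /a /b !normrM !normfV (gtr0_norm t0) (gtr0_norm t1').
  rewrite [(1 - th) * _]mulrC [th * _]mulrC !divfK ?gt_eqF//; exact: ler_normD.
have m0 : 0 <= (1 - th) * a + th * b by apply: addr_ge0; apply: mulr_ge0; rewrite ?normr_ge0 ?ltW.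
apply: (@le_trans _ _ (((1 - th) * a + th * b) ^+ p.*2)); first by rewrite lerXn2r ?nnegrE.
case: p => [|p]; first by rewrite double0 !expr0 !mulr1 subrK.
set m := _ + _ in m0 *.
have ta := @power_tangent R p.*2.+1 m a m0 (normr_ge0 _).
have tb := @power_tangent R p.*2.+1 m b m0 (normr_ge0 _).
rewrite -doubleS in ta tb.
rewrite -/a -/b; apply: le_trans (lerD (ler_wpM2l (ltW t1') ta) (ler_wpM2l (ltW t0) tb)).
rewrite -subr_ge0 (_ : _ - _ = 0)//.
rewrite {2 5}/m; set u := m ^+ p.*2.+1; set v := m ^+ _.
rewrite /m; ring.
Qed.

Section Convergence.
Variable R : realType.

Lemma geometric_increments_cvg (m : nat -> R) (r : R) N0 : 0 <= r < 1 ->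
  (forall N, (N0 <= N)%N -> `|m N.+1 - m N| <= r ^+ N) -> cvgn m.
Proof.
move=> /andP[r0 r1] hm.
pose u k := if (k < N0)%N then 0 else m k.+1 - m k.
have cu : cvgn (series u).
  apply: normed_cvg; apply: (@series_le_cvg _ _ (geometric 1 r)) => [n|n|n|].
  - exact: normr_ge0.
  - by rewrite /= mul1r exprn_ge0.
  - rewrite /= mul1r /u; case: ltnP => h; last exact: hm.
    by rewrite normr0 exprn_ge0.
  - by apply: is_cvg_geometric_series; rewrite ger0_norm.
have su N : series u (N0 + N)%N = m (N0 + N)%N - m N0.
  rewrite /series/= -[RHS](telescope_sumr (n := N0))// ?leq_addr// (big_cat_nat (n := N0))//= ?leq_addr//.
  rewrite big_nat_cond big1 ?add0r; last by move=> i /andP[/andP[_ iN] _]; rewrite /u iN.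
  by rewrite [LHS]big_nat [RHS]big_nat; apply: eq_bigr => i /andP[iN _]; rewrite /u ltnNge iN.
apply/cvg_ex; exists (limn (series u) + m N0).
rewrite -(cvg_shiftn N0)/=.
rewrite (_ : (fun n => _) = (fun n => series u (n + N0)%N + m N0)); last first.
  by apply/funext => n; rewrite addnC su subrK.
apply: cvgD; last exact: cvg_cst.
by rewrite (cvg_shiftn N0 (series u)).
Qed.

Context d (T : measurableType d) (P : probability T R).

Lemma borel_cantelli (F : nat -> set T) (A r : R) : (forall n, measurable (F n)) ->
  0 <= A -> 0 <= r < 1 -> (forall n, P (F n) <= (A * r ^+ n)%:E)%E ->
  {ae P, forall w, exists N0, forall N, (N0 <= N)%N -> ~ F N w}.
Proof.
move=> mF A0 /andP[r0 r1] PF.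
have L0 : P (lim_sup_set F) = 0%E.
  apply: lim_sup_set_cvg0 => //.
  apply: (@le_lt_trans _ _ (A / (1 - r))%:E); last exact: ltry.
  apply: lime_le; first exact: is_cvg_nneseries.
  apply: nearW => n; apply: (@le_trans _ _ (\sum_(0 <= i < n) (A * r ^+ i)%:E)%E).
    by apply: lee_sum => i _; exact: PF.
  rewrite sumEFin lee_fin.
  have -> : \sum_(0 <= i < n) A * r ^+ i = series (geometric A r) n by [].
  rewrite geometric_seriesE ?lt_eqF//= ler_pM2r ?invr_gt0 ?subr_gt0//.
  by rewrite ler_piMr// lerBlDr lerDl exprn_ge0.
exists (lim_sup_set F); split => //.
  by apply: bigcap_measurable => // n _; apply: bigcup_measurable => k _.
move=> w /= nw n _; apply: contrapT => h; apply: nw.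
by exists n => N nN FN; apply: h; exists N.
Qed.

(** Adding the negative part of X on both sides makes the inequality nonnegative; the two parts of X
    have the same finite integral, which cancels. *)
Lemma pint_le_centered (f g X : T -> R) : measT f -> measT g ->
  measT X -> (forall w, 0 <= f w) -> (forall w, 0 <= g w) ->
  (\int[P]_w `|X w|%:E < +oo)%E -> (\int[P]_w (X w)%:E = 0)%E ->
  {ae P, forall w, f w + X w <= g w} ->
  (\int[P]_w (f w)%:E <= \int[P]_w (g w)%:E)%E.
Proof.
move=> mf mg mX f0 g0 Xl X0 fXg.
have eqpp := pint_zero_mean mX Xl X0.
have [lp ln] := pint_pp_lty mX Xl.
have mXN : measT (fun w => - X w) by exact: measurableT_comp.
have mp1 := measurable_pp mX; have mp2 := measurable_pp mXN.
have le1 : (\int[P]_w (f w + pp X w)%:E <= \int[P]_w (g w + pp (fun w => - X w) w)%:E)%E.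
  apply: pint_le.
  - exact: measurable_funD.
  - exact: measurable_funD.
  - by move=> w; rewrite addr_ge0 ?pp_ge0.
  - by move=> w; rewrite addr_ge0 ?pp_ge0.
  - apply: filterS fXg => w; rewrite -{1}(pp_sub X w) addrA lerBlDr.
    by [].
move: le1; rewrite !pintD//; try by exact: pp_ge0.
rewrite eqpp leeD2rE// fin_numE (lt_eqF ln) andbT.
have := pint_ge0 P (pp_ge0 (fun w => - X w)).
by apply: contraTN => /eqP ->.
Qed.

End Convergence.

(** * Spectral data *)

Section ComplexNorm.
Context (R : realType).
Implicit Types z w : R[i].
Local Open Scope complex_scope.

Lemma cnorm_ge0 z : 0 <= cnorm z.
Proof. by case: z => a b; exact: sqrtr_ge0. Qed.

Lemma creal_le_cnorm z : `|creal z| <= cnorm z.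
Proof. by case: z => a b /=; rewrite -sqrtr_sqr ler_wsqrtr// lerDl sqr_ge0. Qed.

Lemma cimag_le_cnorm z : `|cimag z| <= cnorm z.
Proof. by case: z => a b /=; rewrite -sqrtr_sqr ler_wsqrtr// lerDr sqr_ge0. Qed.

Lemma cnorm_le z : cnorm z <= `|creal z| + `|cimag z|.
Proof.
case: z => a b /=; rewrite -[leRHS]ger0_norm ?addr_ge0// -sqrtr_sqr ler_wsqrtr//.
by rewrite sqrrD !real_normK ?num_real// lerD2r lerDl mulrn_wge0// mulr_ge0.
Qed.

Lemma cnorm_real (a : R) : cnorm a%:C = `|a|.
Proof. by rewrite /= expr0n addr0 sqrtr_sqr. Qed.

Lemma crealB z w : creal (z - w) = creal z - creal w.
Proof. by case: z w => [? ?] [? ?]. Qed.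

Lemma cimagB z w : cimag (z - w) = cimag z - cimag w.
Proof. by case: z w => [? ?] [? ?]. Qed.

Lemma cnorm_sum (I : Type) (r : seq I) (P : pred I) (F : I -> R[i]) :
  cnorm (\sum_(i <- r | P i) F i) <= \sum_(i <- r | P i) cnorm (F i).
Proof.
apply: (big_ind2 (fun z (y : R) => cnorm z <= y)) => // [|z1 y1 z2 y2 h1 h2].
  by rewrite ComplexField.Normc.normc0.
by apply: le_trans (le_normcD _ _) _; exact: lerD.
Qed.

Lemma cnormM z w : cnorm (z * w) = cnorm z * cnorm w.
Proof. exact: ComplexField.Normc.normcM. Qed.

Lemma cexpD z w : cexp (z + w) = cexp z * cexp w.
Proof.
case: z w => [a b] [a' b']; rewrite /cexp /= expRD cosD sinD.
by apply/eqP; rewrite eq_complex /=; apply/andP; split; apply/eqP; ring.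
Qed.

Lemma cexp0 : cexp 0 = 1 :> R[i].
Proof. by rewrite /cexp /= expR0 cos0 sin0 mulr1 mulr0. Qed.

Lemma cnorm_cexp z : cnorm (cexp z) = expR (creal z).
Proof.
by rewrite /cexp /= !exprMn -mulrDr cos2Dsin2 mulr1 sqrtr_sqr ger0_norm.
Qed.

End ComplexNorm.

Section ExponentialSeries.
Context (R : realType) (E : completePseudoMetricType R).
Local Notation F := (E -> R[i]).
Local Open Scope complex_scope.

Lemma exp_op_fin (lam : R[i]) (N : F -> F) t f n : (forall l, (n <= l)%N -> iter l N f = 0) ->
  exp_op lam N t f = cexp (lam * t%:C) *: \sum_(0 <= l < n) (t ^+ l / l`!%:R)%:C *: iter l N f.
Proof.
move=> hN; apply/funext => x.
have L : (limn (fun k => \sum_(0 <= l < k) ((t ^+ l / l`!%:R)%:C * iter l N f x : R[i]^o)) : R[i]^o) =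
    (\sum_(0 <= l < n) (t ^+ l / l`!%:R)%:C *: iter l N f) x.
  apply: cvg_lim => //; apply: cvg_near_cst; near=> k.
  have nk : (n <= k)%N by near: k; exact: nbhs_infty_ge.
  rewrite (big_cat_nat _ nk)//= [X in _ + X = _](_ : _ = 0) ?addr0; last first.
    by rewrite big_nat big1// => l /andP[nl _]; rewrite hN//= mulr0.
  by rewrite fct_sumE.
by rewrite /exp_op L.
Unshelve. all: by end_near. Qed.

Lemma cauchy_product (V : lmodType R[i]) (a b : nat -> R[i]) (v : nat -> V) n :
  (forall m, (n <= m)%N -> v m = 0) ->
  \sum_(0 <= l < n) a l *: \sum_(0 <= k < n) b k *: v (l + k)%N =
  \sum_(0 <= m < n) (\sum_(0 <= l < m.+1) a l * b (m - l)%N) *: v m.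
Proof.
move=> v0.
transitivity (\sum_(0 <= l < n) \sum_(0 <= m < n | (l <= m)%N) (a l * b (m - l)%N) *: v m).
  apply: eq_big_nat => l /andP[_ ln]; rewrite scaler_sumr.
  transitivity (\sum_(0 + l <= m < n + l) (a l * b (m - l)%N) *: v m).
    rewrite big_addn addnK; apply: eq_bigr => k _.
    by rewrite scalerA addnK addnC.
  rewrite add0n (@big_cat_nat _ _ _ n) ?leq_addr//=; last exact: ltnW.
  rewrite [X in _ + X = _](_ : _ = 0) ?addr0; last first.
    by rewrite big_nat big1// => m /andP[nm _]; rewrite v0 ?scaler0.
  by rewrite (big_nat_widenl _ 0).
rewrite (exchange_big_dep_nat xpredT)//=; apply: eq_big_nat => m /andP[_ mn].
rewrite scaler_suml [RHS](big_nat_widen _ _ n)//=.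
Qed.

Lemma exp_coeffD (s t : R) m :
  \sum_(0 <= l < m.+1) (s ^+ l / l`!%:R)%:C * (t ^+ (m - l) / (m - l)`!%:R)%:C =
  ((s + t) ^+ m / m`!%:R)%:C :> R[i].
Proof.
rewrite addrC exprDn mulr_suml rmorph_sum big_mkord; apply: eq_bigr => -[l lm] _ /=.
rewrite -rmorphM; congr _%:C; rewrite ltnS in lm.
have f0 k : (k`!%:R : R) != 0 by rewrite pnatr_eq0 -lt0n fact_gt0.
rewrite -(bin_fact lm) !natrM -mulr_natr; field.
by rewrite !f0/= pnatr_eq0 -lt0n bin_gt0 lm.
Qed.

(** The product of two truncated exponential series is a Cauchy product. Linearity of the iterates
    is asked on combinations of [iter k N f] only, because N is linear on a subspace rather than on
    all functions. *)
Lemma exp_opD (lam : R[i]) (N : F -> F) s t f n : (forall l, (n <= l)%N -> iter l N f = 0) ->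
  (forall l (c : nat -> R[i]), iter l N (\sum_(0 <= k < n) c k *: iter k N f) =
      \sum_(0 <= k < n) c k *: iter (l + k) N f) ->
  exp_op lam N s (exp_op lam N t f) = exp_op lam N (s + t) f.
Proof.
move=> hN hl; pose d k := cexp (lam * t%:C) * (t ^+ k / k`!%:R)%:C.
have -> : exp_op lam N t f = \sum_(0 <= k < n) d k *: iter k N f.
  by rewrite (exp_op_fin lam t hN) scaler_sumr; apply: eq_bigr => k _; rewrite scalerA.
rewrite (exp_op_fin lam (s + t) hN) (@exp_op_fin _ _ _ _ n) => [|l nl]; last first.
  by rewrite (hl l d) big1// => k _; rewrite hN ?scaler0// (leq_trans nl)// leq_addr.
under eq_bigr do rewrite (hl _ d).
rewrite (cauchy_product _ d (v := fun m => iter m N f) hN).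
rewrite rmorphD mulrDr cexpD -scalerA; congr (_ *: _).
rewrite scaler_sumr; apply: eq_bigr => m _; rewrite scalerA -exp_coeffD mulr_sumr.
by congr (_ *: _); apply: eq_bigr => l _; rewrite /d mulrCA.
Qed.

Lemma exp_op0 (lam : R[i]) (N : F -> F) f n : (forall l, (n <= l)%N -> iter l N f = 0) ->
  exp_op lam N 0 f = f.
Proof.
move=> hN; rewrite (@exp_op_fin _ _ _ _ n.+1) => [|l nl]; last by rewrite hN// ltnW.
rewrite mulr0 cexp0 scale1r big_nat_recl//= big_nat big1 ?addr0 => [|l _].
  by rewrite expr0 fact0 divr1 scale1r.
by rewrite exprS mul0r mul0r scale0r.
Qed.

(** The polynomial growth of a Jordan block costs an arbitrarily small exponential rate. *)
Lemma monomial_le_exp (u eps : R) l : 0 <= u -> 0 < eps -> u ^+ l / l`!%:R <= eps ^- l * expR (eps * u).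
Proof.
move=> u0 e0; case: l => [|l].
  rewrite !expr0 fact0 divr1 invr1 mul1r -expR0 ler_expR.
  by rewrite mulr_ge0// ltW.
have eu0 : 0 <= eps * u by rewrite mulr_ge0// ltW.
have := expR_ge1Dxn l eu0; rewrite exprMn => h.
by rewrite ler_pdivlMl ?exprn_gt0// mulrA (le_trans _ h)// lerDr ler01.
Qed.

End ExponentialSeries.

Section BoundedFunctions.
Context (R : realType) (E : completePseudoMetricType R).
Local Notation F := (E -> R[i]).
Local Notation BE := (@BE R E).
Local Open Scope complex_scope.

Definition subspace (D : set F) := D 0 /\ forall (a : R[i]) f g, D f -> D g -> D (a *: f + g).

Lemma subspace_BE : subspace BE.
Proof.
split.
  split; first by split; exact: measurable_cst.
  by exists 0 => x; rewrite ComplexField.Normc.normc0.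
move=> a f g [[mfr mfi] [Mf hf]] [[mgr mgi] [Mg hg]]; split; [split|].
- rewrite (_ : (fun x => _) = fun x => (creal a * creal (f x) - cimag a * cimag (f x)) + creal (g x)).
    by apply: measurable_funD => //; apply: measurable_funB; apply: measurable_funM.
  apply/funext => x; rewrite [(_ + _) x](_ : _ = a * f x + g x)//.
  by case: (a) (f x) (g x) => [? ?] [? ?] [? ?].
- rewrite (_ : (fun x => _) = fun x => (creal a * cimag (f x) + cimag a * creal (f x)) + cimag (g x)).
    by apply: measurable_funD => //; apply: measurable_funD; apply: measurable_funM.
  apply/funext => x; rewrite [(_ + _) x](_ : _ = a * f x + g x)//.
  by case: (a) (f x) (g x) => [? ?] [? ?] [? ?].
- exists (cnorm a * Mf + Mg) => x; rewrite [(_ + _) x](_ : _ = a * f x + g x)//.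
  apply: le_trans (le_normcD _ _) _; apply: lerD => //.
  by rewrite cnormM ler_wpM2l ?cnorm_ge0.
Qed.

Lemma subspaceZ D a f : subspace D -> D f -> D (a *: f).
Proof. by move=> [D0 Dl] Df; rewrite -[_ *: _]addr0; exact: Dl. Qed.

Lemma subspaceB D f g : subspace D -> D f -> D g -> D (f - g).
Proof. by move=> [D0 Dl] Df Dg; rewrite addrC -scaleN1r; exact: Dl. Qed.

Lemma subspace_sum D (I : eqType) (r : seq I) (a : I -> R[i]) (H : I -> F) : subspace D ->
  (forall i, i \in r -> D (H i)) -> D (\sum_(i <- r) a i *: H i).
Proof.
move=> [D0 Dl]; elim: r => [|i r ih] h; first by rewrite big_nil.
rewrite big_cons; apply: Dl; first by apply: h; rewrite inE eqxx.
by apply: ih => j jr; apply: h; rewrite inE jr orbT.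
Qed.

Lemma linear_on0 (V : lmodType R[i]) D (T : F -> V) : subspace D -> linear_on D T -> T 0 = 0.
Proof.
move=> [D0 _] /(_ 1 0 0 D0 D0); rewrite !scale1r addr0 => e.
by apply: (addrI (T 0)); rewrite -e addr0.
Qed.

Lemma linear_on_sum (V : lmodType R[i]) D (T : F -> V) (I : eqType) (r : seq I) (a : I -> R[i]) (H : I -> F) :
  subspace D -> linear_on D T -> (forall i, i \in r -> D (H i)) ->
  T (\sum_(i <- r) a i *: H i) = \sum_(i <- r) a i *: T (H i).
Proof.
move=> sD lT; elim: r => [|i r ih] h; first by rewrite !big_nil; exact: linear_on0 lT.
have hr j : j \in r -> D (H j) by move=> jr; apply: h; rewrite inE jr orbT.
rewrite !big_cons lT ?ih//; first by apply: h; rewrite inE eqxx.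
exact: subspace_sum.
Qed.

Lemma linear_onB (V : lmodType R[i]) D (T : F -> V) f g : subspace D -> linear_on D T ->
  D f -> D g -> T (f - g) = T f - T g.
Proof. by move=> sD lT Df Dg; rewrite (addrC f) -(scaleN1r g) lT// scaleN1r addrC. Qed.

Lemma BE_bound f : BE f -> exists2 M, 0 <= M & forall x, cnorm (f x) <= M.
Proof.
move=> [_ [M hM]]; exists `|M| => // x; exact: le_trans (hM x) (ler_norm _).
Qed.

End BoundedFunctions.

(** * Jordan decomposition and decay of the semigroup *)

Section SpectralAlgebra.
Context (R : realType) (E : completePseudoMetricType R).
Local Notation F := (E -> R[i]).
Local Notation BE := (@BE R E).
Local Open Scope complex_scope.
Variables (S : spectral_data E) (ps : R -> F -> F).
Hypothesis hS : spectral_assumption S ps.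
Local Notation lam := (sd_lambda S).
Local Notation Pi := (sd_Pi S).
Local Notation N := (sd_N S).
Local Notation phi := (sd_phi S).
Local Notation T := (sd_phit S).
Local Notation ok i := (1 <= i <= sd_m S)%N.
Local Notation A i := ([set f | BE f /\ Pi i f = f]).
Local Notation nu := (calN S).
Let sBE := subspace_BE E.

Let gev i : ok i -> generalised_eigenvalue ps (lam i) (Pi i) (N i).
Proof. by case: hS => _ /(_ i) h _ _ _ /h[]. Qed.

Let jb i : ok i -> jordan_basis S i.
Proof. by case: hS => _ /(_ i) h _ _ _ /h[]. Qed.

Let cm i j k : basis_index S i j k -> coordinate_map S i j k.
Proof. by case: hS => _ _ /(_ i j k). Qed.

Let Pi_lin i : ok i -> linear_on BE (Pi i).
Proof. by move=> /gev[[]]. Qed.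

Lemma Pi_range i f : ok i -> BE f -> A i (Pi i f).
Proof. by move=> /gev[[_ + _] _ _ _ _] Bf; apply. Qed.

Lemma Pi_BE i f : ok i -> BE f -> BE (Pi i f).
Proof. by move=> oki /(Pi_range oki)[]. Qed.

Lemma subspace_range i : ok i -> subspace (A i).
Proof.
move=> oki; split; first by split; [exact: sBE.1|exact: linear_on0 sBE (Pi_lin oki)].
move=> a f g [Bf ef] [Bg eg]; split; first exact: sBE.2.
by rewrite (Pi_lin oki)// ef eg.
Qed.

Definition basis_seq i : seq (nat * nat) :=
  [seq (j, k) | j <- index_iota 1 (sd_p S i).+1, k <- index_iota 1 (sd_k S i j).+1].

Lemma uniq_basis_seq i : uniq (basis_seq i).
Proof.
apply: allpairs_uniq_dep => [|j _|]; rewrite ?iota_uniq//.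
by move=> [x y] [x' y'] _ _ /= [-> ->].
Qed.

Lemma big_basis_seq (V : nmodType) i (H : nat -> nat -> V) :
  \sum_(1 <= j < (sd_p S i).+1) \sum_(1 <= k < (sd_k S i j).+1) H j k = \sum_(z <- basis_seq i) H z.1 z.2.
Proof. by rewrite big_allpairs_dep. Qed.

Lemma basis_seqP i z : ok i -> z \in basis_seq i -> basis_index S i z.1 z.2.
Proof.
move=> oki /allpairsPdep[j [k [jp kk ->]]]; split=> //=.
  by move: jp; rewrite mem_index_iota ltnS.
by move: kk; rewrite mem_index_iota ltnS.
Qed.

Let T_lin i j k : basis_index S i j k -> linear_on BE (T i j k : F -> R[i]^o).
Proof. by move=> /cm[]. Qed.

Let phi_range i z : ok i -> z \in basis_seq i -> A i (phi i z.1 z.2).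
Proof. by move=> oki zi; have [_ h _ _ _] := jb oki; apply: h; exact: basis_seqP. Qed.

Lemma phi_A i j k : basis_index S i j k -> A i (phi i j k).
Proof. by move=> ijk; have [oki _ _] := ijk; have [_ h _ _ _] := jb oki; exact: h. Qed.

Let coord_comb i i' z (a : nat * nat -> R[i]) : ok i -> ok i' -> z \in basis_seq i ->
  T i z.1 z.2 (\sum_(z' <- basis_seq i') a z' *: phi i' z'.1 z'.2) = if i' == i then a z else 0.
Proof.
move=> oki oki' zi; have bz := basis_seqP oki zi.
rewrite (linear_on_sum (V := R[i]^o) _ sBE (T_lin bz)); last first.
  by move=> z' /(phi_range oki')[].
have Tp z' : z' \in basis_seq i' -> T i z.1 z.2 (phi i' z'.1 z'.2) = ((i' == i) && (z' == z))%:R.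
  move=> z'i; have [_ _ -> //] := cm bz; last exact: basis_seqP.
  by rewrite -pair_eqE /= -pair_eqE /= -andbA; case: (z) (z') => [? ?] [? ?].
case: eqVneq => [e|ne].
  subst i'; rewrite (bigD1_seq z)//= ?uniq_basis_seq// Tp// !eqxx/= [X in _ + X](_ : _ = 0) ?addr0.
    by rewrite [_ *: _]mulr1.
  rewrite big_seq_cond big1// => z' /andP[z'i /negbTE z'z].
  by rewrite Tp// z'z andbF scaler0.
rewrite big_seq big1// => z' z'i; rewrite Tp// (negbTE ne) scaler0//.
Qed.

Let range_comb i f : ok i -> A i f ->
  exists a : nat * nat -> R[i], f = \sum_(z <- basis_seq i) a z *: phi i z.1 z.2.
Proof.
move=> oki Af; have [_ _ _ h _] := jb oki; have [a ->] := h f Af.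
by exists (fun z => a z.1 z.2); rewrite big_basis_seq.
Qed.

Lemma range_coord i f : ok i -> A i f ->
  f = \sum_(z <- basis_seq i) T i z.1 z.2 f *: phi i z.1 z.2.
Proof.
move=> oki Af; have [a fE] := range_comb oki Af.
rewrite {1}fE big_seq [RHS]big_seq; apply: eq_bigr => z zi; congr (_ *: _).
by rewrite fE coord_comb// eqxx.
Qed.

Lemma coord_Pi i j k f : basis_index S i j k -> BE f -> T i j k (Pi i f) = T i j k f.
Proof.
move=> ijk Bf; have [oki _ _] := ijk; have [_ _ _ Tk] := cm ijk.
have [BPf PPf] := Pi_range oki Bf.
apply/eqP; rewrite eq_sym -subr_eq0; apply/eqP.
rewrite -(linear_onB (V := R[i]^o) sBE (T_lin ijk) Bf BPf).
apply: Tk; first exact: subspaceB.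
by rewrite (linear_onB sBE (Pi_lin oki))// PPf subrr.
Qed.

Lemma Pi_coord i f : ok i -> BE f -> Pi i f = \sum_(z <- basis_seq i) T i z.1 z.2 f *: phi i z.1 z.2.
Proof.
move=> oki Bf; rewrite {1}(range_coord oki (Pi_range oki Bf)) big_seq [RHS]big_seq.
by apply: eq_bigr => z zi; rewrite coord_Pi//; exact: basis_seqP.
Qed.

Lemma PhiE i f : ok i -> BE f -> Phi S i f = Pi i f.
Proof. by move=> oki Bf; rewrite Pi_coord// /Phi big_basis_seq. Qed.

(** The projections annihilate each other because the coordinate maps of one eigenspace vanish on
    the basis functions of the others, and [Pi j] is determined by its coordinates. *)
Lemma Pi_other i j f : ok i -> ok j -> i != j -> A i f -> Pi j f = 0.
Proof.
move=> oki okj ij Af; have Bf := Af.1; rewrite Pi_coord// big_seq big1// => z zj.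
by have [a ->] := range_comb oki Af; rewrite coord_comb// (negbTE ij) scale0r.
Qed.

Let N_lin i : ok i -> linear_on (A i) (N i).
Proof. by move=> /gev[_ _ _ []]. Qed.

Let N_range i f : ok i -> A i f -> A i (N i f).
Proof. by move=> /gev[_ _ _ [_ h _] _]; exact: h. Qed.

Lemma nuE f : nu f = \sum_(i <- index_iota 1 (sd_m S).+1) 1 *: N i (Pi i f).
Proof. by apply: eq_bigr => i _; rewrite scale1r. Qed.

Let okP i : i \in index_iota 1 (sd_m S).+1 -> ok i.
Proof. by rewrite mem_index_iota ltnS. Qed.

Let NPi_BE i f : ok i -> BE f -> BE (N i (Pi i f)).
Proof. by move=> oki Bf; have [] := N_range oki (Pi_range oki Bf). Qed.

Lemma nu_BE f : BE f -> BE (nu f).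
Proof. by move=> Bf; rewrite nuE; apply: subspace_sum => // i /okP oki; exact: NPi_BE. Qed.

Lemma nu_lin : linear_on BE nu.
Proof.
move=> a f g Bf Bg; rewrite /nu scaler_sumr -big_split/= big_nat [RHS]big_nat.
apply: eq_bigr => i; rewrite ltnS => oki.
by rewrite (Pi_lin oki)// (N_lin oki)//; exact: Pi_range.
Qed.

Lemma Pi_nu i f : ok i -> BE f -> Pi i (nu f) = N i (Pi i f).
Proof.
move=> oki Bf; rewrite nuE (linear_on_sum _ sBE (Pi_lin oki)); last first.
  by move=> j /okP okj; exact: NPi_BE.
rewrite (bigD1_seq i) ?iota_uniq ?mem_index_iota//= scale1r big_seq_cond big1 ?addr0.
  by have [] := N_range oki (Pi_range oki Bf).
move=> j /andP[/okP okj ji]; rewrite scale1r (@Pi_other j i)//.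
exact: N_range (Pi_range okj Bf).
Qed.

Lemma nu_range i f : ok i -> A i f -> nu f = N i f.
Proof.
move=> oki Af; rewrite nuE (bigD1_seq i) ?iota_uniq ?mem_index_iota//= scale1r Af.2.
rewrite big_seq_cond big1 ?addr0// => j /andP[/okP okj ji].
rewrite (@Pi_other i j)// 1?eq_sym// (linear_on0 (subspace_range okj) (N_lin okj)).
exact: scaler0.
Qed.

Lemma iter_nu_BE l f : BE f -> BE (iter l nu f).
Proof. by move=> Bf; elim: l => //= l; exact: nu_BE. Qed.

Lemma iter_nu_lin l : linear_on BE (iter l nu).
Proof.
elim: l => [//|l ih] a f g Bf Bg.
by rewrite !iterS ih// nu_lin//; exact: iter_nu_BE.
Qed.

Lemma iter_nu_range l i f : ok i -> A i f -> A i (iter l nu f) /\ iter l nu f = iter l (N i) f.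
Proof.
move=> oki Af; elim: l => //= l [Al <-]; rewrite (nu_range oki Al).
by split=> //; exact: N_range.
Qed.

Lemma Pi_iter_nu l i f : ok i -> BE f -> Pi i (iter l nu f) = iter l nu (Pi i f).
Proof.
move=> oki Bf; have AP := Pi_range oki Bf.
elim: l => //= l ih; rewrite Pi_nu//; last exact: iter_nu_BE.
by rewrite ih (nu_range oki)//; have [] := iter_nu_range l oki AP.
Qed.

Lemma nu_nilpotent : exists n, forall f, BE f -> forall l, (n <= l)%N -> iter l nu f = 0.
Proof.
have /choice[n hn] : forall i, exists n, ok i -> forall f, A i f -> iter n (N i) f = 0.
  move=> i; have [oki|] := boolP (ok i); last by exists 0%N.
  by have [_ _ _ [_ _ [n h]] _] := gev oki; exists n.
(* The successor excludes the power 0: the part of f outside all eigenspaces disappears after one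
   application of [nu]. *)
exists (\max_(i < (sd_m S).+1) n i).+1 => f Bf [//|l]; rewrite ltnS => nl.
rewrite iterS nuE big_seq big1// => i /okP oki; rewrite scale1r Pi_iter_nu//.
have AP := Pi_range oki Bf.
have [Al _] := iter_nu_range l oki AP; rewrite -(nu_range oki Al) -iterS.
have nil : (n i <= l.+1)%N.
  apply: leqW; apply: leq_trans nl.
  have im : (i < (sd_m S).+1)%N by rewrite ltnS; case/andP: oki.
  exact: (@leq_bigmax _ (fun i : 'I__ => n i) (Ordinal im)).
rewrite -(subnKC nil) iterD; have [Al' _] := iter_nu_range (l.+1 - n i) oki AP.
by have [_ ->] := iter_nu_range (n i) oki Al'; exact: hn.
Qed.

Let iter_nu_sum n l (c : nat -> R[i]) f : BE f ->
  iter l nu (\sum_(0 <= k < n) c k *: iter k nu f) = \sum_(0 <= k < n) c k *: iter (l + k) nu f.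
Proof.
move=> Bf; rewrite (linear_on_sum _ sBE (@iter_nu_lin l)) => [|k _]; last exact: iter_nu_BE.
by apply: eq_bigr => k _; rewrite iterD.
Qed.

Lemma exp_nuD la s t f : BE f -> exp_op la nu s (exp_op la nu t f) = exp_op la nu (s + t) f.
Proof.
move=> Bf; have [n hn] := nu_nilpotent.
by apply: (@exp_opD _ _ _ _ _ _ _ n) => [l|l c]; [exact: hn|exact: iter_nu_sum].
Qed.

Lemma exp_nu0 la f : BE f -> exp_op la nu 0 f = f.
Proof. by move=> Bf; have [n hn] := nu_nilpotent; apply: (@exp_op0 _ _ _ _ _ n) => l; exact: hn. Qed.

Lemma exp_nu_range i la t f : ok i -> A i f -> A i (exp_op la nu t f).
Proof.
move=> oki Af; have [n hn] := nu_nilpotent.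
rewrite (exp_op_fin la t (hn f Af.1)); apply: subspaceZ; first exact: subspace_range.
apply: (subspace_sum (D := A i)); first exact: subspace_range.
by move=> l _; have [] := iter_nu_range l oki Af.
Qed.

Lemma exp_nu_BE la t f : BE f -> BE (exp_op la nu t f).
Proof.
move=> Bf; have [n hn] := nu_nilpotent.
rewrite (exp_op_fin la t (hn f Bf)); apply: subspaceZ => //.
by apply: subspace_sum => // l _; exact: iter_nu_BE.
Qed.

Lemma exp_nu_lin la t : linear_on BE (exp_op la nu t).
Proof.
move=> a f g Bf Bg; have [n hn] := nu_nilpotent.
rewrite !(exp_op_fin la t (hn _ _))//; last exact: sBE.2.
rewrite scalerA [a * _]mulrC -scalerA -scalerDr; congr (_ *: _).
rewrite scaler_sumr -big_split; apply: eq_bigr => l _ /=.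
by rewrite iter_nu_lin// scalerDr !scalerA [a * _]mulrC.
Qed.

Lemma coord_exp_nu i j k la t f : basis_index S i j k -> BE f ->
  T i j k (exp_op la nu t f) = T i j k (exp_op la nu t (Pi i f)).
Proof.
move=> ijk Bf; have [oki _ _] := ijk; have [n hn] := nu_nilpotent.
have BPf := Pi_BE oki Bf.
rewrite -coord_Pi//; last exact: exp_nu_BE.
congr (T _ _ _ _); rewrite (exp_op_fin la t (hn f Bf)) (exp_op_fin la t (hn _ BPf)).
have BS : BE (\sum_(0 <= l < n) (t ^+ l / l`!%:R)%:C *: iter l nu f).
  by apply: subspace_sum => // l _; exact: iter_nu_BE.
rewrite -[X in Pi i X]addr0 (Pi_lin oki)//; last exact: sBE.1.
rewrite (linear_on0 sBE (Pi_lin oki)) addr0; congr (_ *: _).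
rewrite (linear_on_sum _ sBE (Pi_lin oki)) => [|l _]; last exact: iter_nu_BE.
by apply: eq_bigr => l _; rewrite Pi_iter_nu.
Qed.

Lemma psi_range i t f : ok i -> A i f -> 0 <= t -> ps t f = exp_op (lam i) nu t f.
Proof.
move=> oki Af t0; have [_ _ _ _ h] := gev oki; rewrite h//.
have [n hn] := nu_nilpotent; rewrite (exp_op_fin (lam i) t (hn f Af.1)).
rewrite (@exp_op_fin _ _ _ _ _ _ n) => [|l nl].
  by congr (_ *: _); apply: eq_bigr => l _; have [_ ->] := iter_nu_range l oki Af.
by have [_ <-] := iter_nu_range l oki Af; exact: hn Af.1 _ nl.
Qed.

(** Both signs of t are needed: positive times for the semigroup, negative ones for the
    martingales. *)
Lemma exp_nu_bound la f eps : BE f -> 0 < eps -> exists2 C, 0 <= C &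
  forall t x, cnorm (exp_op la nu t f x) <= C * expR (creal la * t + eps * `|t|).
Proof.
move=> Bf e0; have [n hn] := nu_nilpotent.
have /choice[M hM] : forall l, exists M, 0 <= M /\ forall x, cnorm (iter l nu f x) <= M.
  by move=> l; have [M M0 h] := BE_bound (iter_nu_BE l Bf); exists M.
exists (\sum_(0 <= l < n) eps ^- l * M l).
  apply: sumr_ge0 => l _; apply: mulr_ge0; last exact: (hM l).1.
  by rewrite invr_ge0 exprn_ge0// ltW.
move=> t x; rewrite (exp_op_fin la t (hn f Bf)).
rewrite [(_ *: _) x](_ : _ = cexp (la * t%:C) * (\sum_(0 <= l < n) (t ^+ l / l`!%:R)%:C *: iter l nu f) x)//.
rewrite cnormM cnorm_cexp fct_sumE expRD mulrCA.
rewrite (_ : creal (la * t%:C) = creal la * t); last by case: (la) => a b /=; ring.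
rewrite ler_wpM2l ?expR_ge0//; apply: (le_trans (cnorm_sum _ _ _)).
rewrite mulr_suml; apply: ler_sum => l _.
rewrite [((_ *: _) : F) x](_ : _ = (t ^+ l / l`!%:R)%:C * iter l nu f x)// cnormM cnorm_real.
rewrite mulrAC ler_pM ?normr_ge0 ?cnorm_ge0 ?(hM l).2//.
rewrite normrM normrX normfV (ger0_norm (ler0n R l`!)).
exact: monomial_le_exp.
Qed.

(** The coordinate maps are bounded on the unit ball; f is scaled by b + 1 rather than b so that b =
    0 is allowed. *)
Lemma coord_bound i j k : basis_index S i j k -> exists2 M, 0 <= M &
  forall f b, BE f -> 0 <= b -> (forall x, cnorm (f x) <= b) -> cnorm (T i j k f) <= M * (b + 1).
Proof.
move=> ijk; have [Tl [M hM] _ _] := cm ijk; exists `|M| => // f b Bf b0 fb.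
have b1 : 0 < b + 1 by rewrite ltr_wpDl.
pose g : F := (b + 1)^-1%:C *: f.
have Bg : BE g by exact: subspaceZ.
have g1 : BE1 g.
  split=> // x; rewrite [g x](_ : _ = (b + 1)^-1%:C * f x)// cnormM cnorm_real.
  rewrite gtr0_norm ?invr_gt0// mulrC ler_pdivrMr// mul1r (le_trans (fb x))// lerDl.
  exact: ler01.
have fE : f = (b + 1)%:C *: g + 0.
  by rewrite addr0 /g scalerA -rmorphM mulfV ?scale1r// gt_eqF.
rewrite fE Tl//; last exact: sBE.1.
rewrite (linear_on0 (V := R[i]^o) sBE Tl) addr0.
rewrite [_ *: _](_ : _ = (b + 1)%:C * T i j k g)// cnormM cnorm_real gtr0_norm// mulrC.
by rewrite ler_wpM2r ?(ltW b1)// (le_trans (hM g g1))// ler_norm.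
Qed.

Lemma coord_exp_bound i j k f eps : basis_index S i j k -> BE f -> 0 < eps ->
  exists2 C, 0 <= C & forall t, 0 <= t ->
    cnorm (T i j k (exp_op (lam i) nu t f)) <= C * (expR ((creal (lam i) + eps) * t) + 1).
Proof.
move=> ijk Bf e0; have [oki _ _] := ijk; have BP := Pi_BE oki Bf.
have [C C0 hC] := exp_nu_bound (lam i) BP e0; have [M M0 hM] := coord_bound ijk.
exists (M * (C + 1)); first by rewrite mulr_ge0// addr_ge0.
move=> t t0; rewrite coord_exp_nu//; set ex := expR _.
have ex0 : 0 <= ex by exact: expR_ge0.
apply: le_trans (hM _ (C * ex) _ _ _) _.
- exact: exp_nu_BE.
- exact: mulr_ge0.
- by move=> x; apply: le_trans (hC t x) _; rewrite /ex mulrDl ger0_norm.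
rewrite -mulrA ler_wpM2l// mulrDl mul1r mulrDr mulr1.
by move: (C * ex) => y; lra.
Qed.

(** The identity e^(-(lambda+N)t) e^((lambda+N)t) = 1 with the inner factor expanded in the Jordan
    basis. Evaluated at X_t, it writes the component of f as coordinates times martingales. *)
Lemma Pi_exp_coord i f t : ok i -> BE f -> Pi i f =
  \sum_(z <- basis_seq i) T i z.1 z.2 (exp_op (lam i) nu t f) *: exp_op (lam i) nu (- t) (phi i z.1 z.2).
Proof.
move=> oki Bf; have AP := Pi_range oki Bf; have BP := AP.1.
have Ah := exp_nu_range (lam i) t oki AP.
transitivity (exp_op (lam i) nu (- t) (exp_op (lam i) nu t (Pi i f))).
  by rewrite exp_nuD// addNr exp_nu0.
rewrite {1}(range_coord oki Ah) (linear_on_sum _ sBE (@exp_nu_lin _ _)); last first.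
  by move=> z /(phi_range oki)[].
rewrite big_seq [RHS]big_seq; apply: eq_bigr => z zi.
by rewrite [in RHS]coord_exp_nu//; exact: basis_seqP.
Qed.

Lemma rest_BE L f : (L <= sd_m S)%N -> BE f -> BE (f - \sum_(i <- index_iota 1 L.+1) Pi i f).
Proof.
move=> Lm Bf; apply: subspaceB => //.
rewrite (eq_bigr (fun i => 1 *: Pi i f)) => [|i _]; last by rewrite scale1r.
apply: subspace_sum => // i; rewrite mem_index_iota ltnS => /andP[i1 iL].
by apply: Pi_BE => //; rewrite i1 (leq_trans iL).
Qed.

Lemma Pi_rest L i (a : R[i]) f : (L <= sd_m S)%N -> (1 <= i <= L)%N -> BE f ->
  Pi i (a *: (f - \sum_(i <- index_iota 1 L.+1) Pi i f)) = 0.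
Proof.
move=> Lm iL Bf; have oki : ok i by case/andP: iL => -> /leq_trans ->.
have okr j : j \in index_iota 1 L.+1 -> ok j.
  by rewrite mem_index_iota ltnS => /andP[-> /leq_trans ->].
have BS : BE (\sum_(i <- index_iota 1 L.+1) 1 *: Pi i f).
  by apply: subspace_sum => // j /okr okj; exact: Pi_BE.
have SE : \sum_(i <- index_iota 1 L.+1) Pi i f = \sum_(i <- index_iota 1 L.+1) 1 *: Pi i f.
  by apply: eq_bigr => j _; rewrite scale1r.
rewrite SE -[_ *: _]addr0 (Pi_lin oki); [|exact: subspaceB|exact: sBE.1].
rewrite (linear_on0 sBE (Pi_lin oki)) addr0 (linear_onB sBE (Pi_lin oki))//.
rewrite (linear_on_sum _ sBE (Pi_lin oki)) => [|j /okr okj]; last exact: Pi_BE.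
rewrite (bigD1_seq i) ?iota_uniq ?mem_index_iota ?ltnS//= scale1r (Pi_range oki Bf).2.
rewrite big_seq_cond big1 ?addr0 ?subrr ?scaler0// => j /andP[/okr okj ji].
by rewrite scale1r (@Pi_other j i)//; exact: Pi_range.
Qed.

Lemma lambda1_gt0 : 0 < creal (lam 1%N).
Proof. by case: hS => [[_ []]]. Qed.

Lemma ok1 : ok 1%N.
Proof. by case: hS => [[->]]. Qed.

Lemma creal_lambda_le i j : (1 <= i <= j)%N -> (j <= sd_m S)%N -> creal (lam j) <= creal (lam i).
Proof.
case: hS => [[_ _ h1 h2 _]] _ _ _ _; elim: j => [|j ih] /andP[i1 ij] jm; first by case: i i1 ij.
have [->//|ij'] := eqVneq i j.+1.
have ij2 : (i <= j)%N by rewrite -ltnS ltn_neqAle ij'.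
apply: le_trans (ih _ (ltnW jm)); last by rewrite i1.
have j1 : (1 <= j)%N by exact: leq_trans ij2.
have [e|j2] := eqVneq j 1%N; first by rewrite e in jm *; exact/ltW/h1.
by apply: h2; rewrite jm andbT ltn_neqAle eq_sym j2.
Qed.

Lemma m_L_prop : [/\ ok (m_L S), creal (lam 1%N) < 2 * creal (lam (m_L S)) &
  forall i, (m_L S < i <= sd_m S)%N -> 2 * creal (lam i) <= creal (lam 1%N)].
Proof.
set P := fun i => creal (lam 1%N) < 2 * creal (lam i).
have P1 : P 1%N by rewrite /P ltr_pMl ?ltr1n// lambda1_gt0.
have im : 1%N \in index_iota 1 (sd_m S).+1 by rewrite mem_index_iota ltnS ok1.
have max i : i \in index_iota 1 (sd_m S).+1 -> P i -> (i <= m_L S)%N.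
  by move=> ii Pi'; rewrite /m_L big_mkcond (bigD1_seq i)//= ?iota_uniq// -/(P i) Pi' leq_maxl.
have : m_L S = 0%N \/ (m_L S \in index_iota 1 (sd_m S).+1) && P (m_L S).
  rewrite /m_L big_seq_cond; apply: (big_ind (fun x => x = 0%N \/ (x \in index_iota 1 (sd_m S).+1) && P x)).
  - by left.
  - move=> x y hx hy; rewrite /maxn; case: ifP => _; [exact: hy|exact: hx].
  - by move=> i hi; right.
have m1 := max _ im P1.
case=> [e|/andP[mm Pm]]; first by rewrite e in m1.
split=> //; first exact: okP.
move=> i /andP[mi im']; rewrite leNgt; apply/negP => Pi'.
have := max i _ Pi'; rewrite mem_index_iota ltnS im' andbT (leq_trans m1 (ltnW mi)) => /(_ isT).
by rewrite leqNgt mi.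
Qed.

(** The supremum is finite and small for large times; from time 1 on, the factor t of the assumption
    is at least 1 and leaves the bound by eta. *)
Lemma spectral_error eta : 0 < eta -> exists2 s0, 1 <= s0 & forall s f x, s0 <= s -> BE1 f ->
  cnorm (ps s f x - \sum_(1 <= i < (sd_m S).+1) exp_op (lam i) nu s (Pi i f) x) <=
  eta * expR (creal (lam (sd_m S)) * s).
Proof.
move=> e0; case: hS => _ _ _ + _; set h := (fun t : R => ereal_sup _) => /fine_cvgP[fin cv].
have [M1 [_ hM1]] := fin.
have [M2 [_ hM2]] := (cvgrPdist_lt _ _).1 cv _ e0.
pose s0 := Num.max 1 (Num.max (M1 + 1) (M2 + 1)).
exists s0; first by rewrite le_max lexx.
move=> s f x; rewrite !ge_max => /andP[s1 /andP[sM1 sM2]] f1.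
have sM1' : M1 < s by rewrite (lt_le_trans _ sM1)// ltrDl.
have sM2' : M2 < s by rewrite (lt_le_trans _ sM2)// ltrDl.
have hf := hM1 s sM1'; have := hM2 s sM2'; rewrite /= sub0r normrN => hl.
have : ((expR (- creal (lam (sd_m S)) * s) * s * cnorm (ps s f x - \sum_(1 <= i < (sd_m S).+1) exp_op (lam i) nu s (Phi S i f) x))%:E <= h s)%E.
  by apply: ereal_sup_ubound; exists x, f.
rewrite -(fineK hf) lee_fin => le1.
have {}le1 := le_trans le1 (le_trans (ler_norm _) (ltW hl)).
set D := cnorm _ in le1; set D' := cnorm _.
have <- : D = D'.
  congr cnorm; congr (_ - _); rewrite big_seq [RHS]big_seq; apply: eq_bigr => i /okP oki.
  by rewrite PhiE//; case: f1.
rewrite -ler_pdivrMr ?expR_gt0// -expRN -mulNr mulrC; apply: le_trans le1.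
rewrite -mulrA ler_wpM2l ?expR_ge0// ler_peMl//.
exact: cnorm_ge0.
Qed.

Lemma psi_bound f mu eta eps : BE1 f -> 0 < eta -> 0 < eps ->
  (forall i, ok i -> Pi i f = 0 \/ creal (lam i) <= mu) ->
  exists s0 C, [/\ 1 <= s0, 0 <= C & forall s x, s0 <= s ->
    cnorm (ps s f x) <= eta * expR (creal (lam (sd_m S)) * s) + C * expR ((mu + eps) * s)].
Proof.
move=> f1 eta0 e0 h; have [s0 s01 hs] := spectral_error eta0.
have /choice[C hC] : forall i, exists C : R, 0 <= C /\ (ok i -> forall s x, 0 <= s ->
    cnorm (exp_op (lam i) nu s (Pi i f) x) <= C * expR ((mu + eps) * s)).
  move=> i; have [oki|] := boolP (ok i); last by exists 0.
  have [e|le] := h i oki.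
    exists 0; split=> // _ s x s0'; rewrite e (linear_on0 sBE (@exp_nu_lin _ _)).
    by rewrite [(0 : F) x](_ : _ = 0)// ComplexField.Normc.normc0 mul0r.
  have [C C0 hC] := exp_nu_bound (lam i) (Pi_BE oki f1.1) e0.
  exists C; split=> // _ s x s0'; apply: le_trans (hC s x) _.
  by rewrite ler_wpM2l// ler_expR mulrDl ger0_norm// lerD2r ler_wpM2r.
exists s0, (\sum_(1 <= i < (sd_m S).+1) C i); split=> //.
  by apply: sumr_ge0 => i _; exact: (hC i).1.
move=> s x s0s; rewrite -(subrK (\sum_(1 <= i < (sd_m S).+1) exp_op (lam i) nu s (Pi i f) x) (ps s f x)).
apply: (le_trans (le_normcD _ _)); apply: lerD; first exact: hs.
apply: (le_trans (cnorm_sum _ _ _)); rewrite mulr_suml big_seq [leRHS]big_seq.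
apply: ler_sum => i /okP oki; apply: (hC i).2 => //.
by rewrite (le_trans _ s0s)// (le_trans ler01).
Qed.

(** The components that remain have real part at most lambda_1/2 < Re lambda_(m_L), so they are of
    strictly smaller exponential order; the spectral error contributes eta e^(Re lambda_m s), of no
    larger order. *)
Lemma psi_decay f eta : BE1 f -> (forall i, (1 <= i <= m_L S)%N -> Pi i f = 0) -> 0 < eta ->
  exists2 s0, 1 <= s0 & forall s x, s0 <= s ->
    cnorm (ps s f x) <= eta * expR (creal (lam (m_L S)) * s).
Proof.
move=> f1 f0 eta0; have [okL L1 L2] := m_L_prop.
set rho := creal (lam (m_L S)) in L1 *; set l1 := creal (lam 1%N) in L1 L2.
(* Half of the gap: one half absorbs the Jordan polynomials, the other makes C e^((l1/2 + eps)s)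
   negligible against e^(rho s). *)
pose eps := (rho - l1 / 2) / 2.
have e0 : 0 < eps by rewrite divr_gt0// subr_gt0 ltr_pdivrMr// mulrC.
have eta2 : 0 < eta / 2 by exact: divr_gt0.
have hyp i : ok i -> Pi i f = 0 \/ creal (lam i) <= l1 / 2.
  move=> /andP[i1 im]; have [iL|iL] := leqP i (m_L S); first by left; apply: f0; rewrite i1.
  by right; rewrite ler_pdivlMr// mulrC; apply: L2; rewrite iL.
have [s0 [C [s01 C0 hs]]] := psi_bound f1 eta2 e0 hyp.
(* From there on eps s >= C/(eta/2), hence e^(eps s) >= C/(eta/2). *)
exists (Num.max s0 (C / (eta / 2) / eps)); first by rewrite le_max s01.
move=> s x; rewrite ge_max => /andP[s0s Cs].
have s_ge0 : 0 <= s by rewrite (le_trans _ s0s)// (le_trans ler01).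
apply: le_trans (hs s x s0s) _; rewrite [leRHS](_ : _ = eta / 2 * expR (rho * s) + eta / 2 * expR (rho * s)); last by rewrite -mulrDl -splitr.
apply: lerD.
  rewrite ler_wpM2l ?(ltW eta2)// ler_expR ler_wpM2r//.
  by apply: creal_lambda_le => //; rewrite leqnn andbT; case/andP: okL.
have -> : rho * s = (l1 / 2 + eps) * s + eps * s by rewrite /eps; field.
rewrite expRD mulrCA mulrC ler_wpM2l ?expR_ge0//.
rewrite -ler_pdivrMl// mulrC.
apply: (@le_trans _ _ (eps * s)); first by rewrite [eps * s]mulrC -ler_pdivrMr.
by apply: le_trans (expR_ge1Dx _); rewrite lerDr ler01.
Qed.

End SpectralAlgebra.

(** * Convergence to zero in mean of order q *)

Section LqTools.
Context (R : realType) d (T : measurableType d) (P : probability T R).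
Implicit Types Z : R -> T -> R[i].
Local Open Scope complex_scope.

Lemma cmeasurable_lin (a : R[i]) (f g : T -> R[i]) : cmeasurable f -> cmeasurable g ->
  cmeasurable (fun w => a * f w + g w).
Proof.
move=> [mfr mfi] [mgr mgi]; split.
- rewrite (_ : (fun x => _) = fun x => (creal a * creal (f x) - cimag a * cimag (f x)) + creal (g x)).
    by apply: measurable_funD => //; apply: measurable_funB; apply: measurable_funM.
  by apply/funext => x; case: (a) (f x) (g x) => [? ?] [? ?] [? ?].
- rewrite (_ : (fun x => _) = fun x => (creal a * cimag (f x) + cimag a * creal (f x)) + cimag (g x)).
    by apply: measurable_funD => //; apply: measurable_funD; apply: measurable_funM.
  by apply/funext => x; case: (a) (f x) (g x) => [? ?] [? ?] [? ?].
Qed.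

Lemma cmeasurable0 : cmeasurable (fun _ : T => 0 : R[i]).
Proof. by split; exact: measurable_cst. Qed.

Lemma cmeasurableZ (a : R[i]) (f : T -> R[i]) : cmeasurable f -> cmeasurable (fun w => a * f w).
Proof.
move=> mf; rewrite (_ : (fun w => _) = fun w => a * f w + 0); first exact: cmeasurable_lin cmeasurable0.
by apply/funext => w; rewrite addr0.
Qed.

Lemma cmeasurableD (f g : T -> R[i]) : cmeasurable f -> cmeasurable g -> cmeasurable (fun w => f w + g w).
Proof.
move=> mf mg; rewrite (_ : (fun w => _) = fun w => 1 * f w + g w); first exact: cmeasurable_lin.
by apply/funext => w; rewrite mul1r.
Qed.

Lemma cmeasurableB (f g : T -> R[i]) : cmeasurable f -> cmeasurable g -> cmeasurable (fun w => f w - g w).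
Proof.
move=> mf mg; rewrite (_ : (fun w => _) = fun w => -1 * g w + f w); first exact: cmeasurable_lin.
by apply/funext => w; rewrite mulN1r addrC.
Qed.

Lemma cmeasurable_sum (I : eqType) (r : seq I) (F : I -> T -> R[i]) :
  (forall i, i \in r -> cmeasurable (F i)) -> cmeasurable (fun w => \sum_(i <- r) F i w).
Proof.
elim: r => [|i r ih] h; first by under eq_fun do rewrite big_nil; exact: cmeasurable0.
under eq_fun do rewrite big_cons.
apply: cmeasurableD; first by apply: h; rewrite inE eqxx.
by apply: ih => j jr; apply: h; rewrite inE jr orbT.
Qed.

Lemma measurable_cnorm (f : T -> R[i]) : cmeasurable f -> measT (fun w => cnorm (f w)).
Proof.
move=> [mr mi]; rewrite (_ : (fun w => _) = fun w => Num.sqrt (creal (f w) ^+ 2 + cimag (f w) ^+ 2)).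
  apply: (measurableT_comp (continuous_measurable_fun (@sqrt_continuous R))).
  by apply: measurable_funD; exact: measurable_funX.
by apply/funext => w; case: (f w).
Qed.

Lemma measurable_cnormX (f : T -> R[i]) n : cmeasurable f -> measT (fun w => cnorm (f w) ^+ n).
Proof. by move=> mf; apply: measurable_funX; exact: measurable_cnorm. Qed.

Lemma cnormX_ge0 (f : T -> R[i]) n w : 0 <= cnorm (f w) ^+ n.
Proof. by rewrite exprn_ge0// cnorm_ge0. Qed.

Lemma cnorm_moment (f : T -> R[i]) p D1 D2 : cmeasurable f ->
  (\int[P]_w (creal (f w) ^+ p.*2)%:E <= D1%:E)%E -> (\int[P]_w (cimag (f w) ^+ p.*2)%:E <= D2%:E)%E ->
  (\int[P]_w (cnorm (f w) ^+ p.*2)%:E <= (2 ^+ p.*2 * (D1 + D2))%:E)%E.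
Proof.
move=> mf i1 i2; have [mr mi] := mf.
have mr2 : measT (fun w => creal (f w) ^+ p.*2) by exact: measurable_funX.
have mi2 : measT (fun w => cimag (f w) ^+ p.*2) by exact: measurable_funX.
apply: (@le_trans _ _ (\int[P]_w (2 ^+ p.*2 * (creal (f w) ^+ p.*2 + cimag (f w) ^+ p.*2))%:E)%E).
  apply: pint_le.
  - exact: measurable_cnormX.
  - by apply: measurable_funM => //; exact: measurable_funD.
  - by move=> w; exact: cnormX_ge0.
  - by move=> w; apply: mulr_ge0; [exact: exprn_ge0|apply: addr_ge0; exact: even_power_ge0].
  - apply/nearW => w; rewrite -[creal _ ^+ _]normr_even -[cimag _ ^+ _]normr_even.
    apply: le_trans (exprD_le _ (normr_ge0 _) (normr_ge0 _)).
    by rewrite lerXn2r ?nnegrE ?cnorm_ge0 ?addr_ge0// cnorm_le.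
rewrite pintZ ?exprn_ge0//; last 2 first.
- exact: measurable_funD.
- by move=> w; apply: addr_ge0; exact: even_power_ge0.
apply: lee_scale; first exact: exprn_ge0.
rewrite pintD// ?EFinD; first exact: leeD.
- by move=> w; exact: even_power_ge0.
- by move=> w; exact: even_power_ge0.
Qed.

(** Convergence of q-th moments instead of norms, with measurability at nonnegative times carried
    along: this form is stable under sums and scalar multiples with elementary estimates. *)
Definition Lq_small q Z := (forall t, 0 <= t -> cmeasurable (Z t)) /\
  forall eps : R, 0 < eps -> exists T0, forall t, T0 <= t -> 0 <= t ->
    (\int[P]_w (cnorm (Z t w) ^+ q)%:E <= eps%:E)%E.

Lemma Lq_small_ae q Z Z' : Lq_small q Z -> (forall t, 0 <= t -> cmeasurable (Z' t)) ->
  (forall t, 0 <= t -> {ae P, forall w, Z' t w = Z t w}) -> Lq_small q Z'.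
Proof.
move=> [mZ hZ] mZ' ZZ; split=> // eps /hZ[T0 hT]; exists T0 => t T0t t0.
apply: le_trans (hT t T0t t0); apply: pint_le.
- by apply: measurable_cnormX; exact: mZ'.
- by apply: measurable_cnormX; exact: mZ.
- by move=> w; exact: cnormX_ge0.
- by move=> w; exact: cnormX_ge0.
- by apply: filterS (ZZ t t0) => w ->.
Qed.

Lemma Lq_small0 q : (0 < q)%N -> Lq_small q (fun _ _ => 0).
Proof.
move=> q0; split=> [t _|eps e0]; first exact: cmeasurable0.
exists 0 => t _ _; apply: (@le_trans _ _ (\int[P]_w 0%:E)%E); last by rewrite pint_cst lee_fin ltW.
rewrite le_eqVlt; apply/orP; left; apply/eqP; apply: eq_integral => w _.
by rewrite ComplexField.Normc.normc0 expr0n eqn0Ngt q0.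
Qed.

Lemma Lq_smallD q Z Z' : Lq_small q Z -> Lq_small q Z' -> Lq_small q (fun t w => Z t w + Z' t w).
Proof.
move=> [mZ hZ] [mZ' hZ']; split=> [t t0|eps e0]; first by apply: cmeasurableD; [exact: mZ|exact: mZ'].
have e2 : 0 < eps / 2 / 2 ^+ q by rewrite !divr_gt0// exprn_gt0.
have [T0 h0] := hZ _ e2; have [T1 h1] := hZ' _ e2.
exists (Num.max T0 T1) => t; rewrite ge_max => /andP[tT0 tT1] t0.
have m1 := measurable_cnormX q (mZ t t0); have m2 := measurable_cnormX q (mZ' t t0).
apply: (@le_trans _ _ (\int[P]_w (2 ^+ q * (cnorm (Z t w) ^+ q + cnorm (Z' t w) ^+ q))%:E)%E).
  apply: pint_le.
  - by apply: measurable_cnormX; apply: cmeasurableD; [exact: mZ|exact: mZ'].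
  - by apply: measurable_funM => //; exact: measurable_funD.
  - by move=> w; exact: (cnormX_ge0 (fun w => Z t w + Z' t w)).
  - by move=> w; apply: mulr_ge0; [exact: exprn_ge0|apply: addr_ge0; exact: cnormX_ge0].
  - apply/nearW => w; apply: le_trans (exprD_le _ (cnorm_ge0 _) (cnorm_ge0 _)).
    by rewrite lerXn2r ?nnegrE ?addr_ge0 ?cnorm_ge0// le_normcD.
rewrite pintZ ?exprn_ge0//; last 2 first.
- exact: measurable_funD.
- by move=> w; apply: addr_ge0; exact: cnormX_ge0.
have -> : eps = 2 ^+ q * (eps / 2 / 2 ^+ q + eps / 2 / 2 ^+ q).
  by field; rewrite expf_neq0.
apply: lee_scale; first exact: exprn_ge0.
rewrite pintD// ?EFinD; first by apply: leeD; [exact: h0|exact: h1].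
- by move=> w; exact: cnormX_ge0.
- by move=> w; exact: cnormX_ge0.
Qed.

Lemma Lq_smallZ q (a : R[i]) Z : Lq_small q Z -> Lq_small q (fun t w => a * Z t w).
Proof.
move=> [mZ hZ]; split=> [t t0|eps e0]; first by apply: cmeasurableZ; exact: mZ.
have a0 : 0 <= cnorm a ^+ q by rewrite exprn_ge0 ?cnorm_ge0.
have a1 : 0 < cnorm a ^+ q + 1 by rewrite ltr_wpDl.
have [T0 h0] := hZ _ (divr_gt0 e0 a1); exists T0 => t tT t0.
have -> : (\int[P]_w (cnorm (a * Z t w) ^+ q)%:E = \int[P]_w (cnorm a ^+ q * cnorm (Z t w) ^+ q)%:E)%E.
  by apply: eq_integral => w _; rewrite cnormM exprMn.
rewrite pintZ//; last 2 first.
- by apply: measurable_cnormX; exact: mZ.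
- by move=> w; exact: cnormX_ge0.
apply: le_trans (lee_scale a0 (h0 t tT t0)) _.
by rewrite lee_fin mulrCA ler_piMr ?(ltW e0)// ler_pdivrMr// mul1r lerDl ler01.
Qed.

Lemma Lq_small_sum q (I : eqType) (r : seq I) (Z : I -> R -> T -> R[i]) : (0 < q)%N ->
  (forall i, i \in r -> Lq_small q (Z i)) -> Lq_small q (fun t w => \sum_(i <- r) Z i t w).
Proof.
move=> q0; elim: r => [|i r ih] h.
  by under eq_fun do under eq_fun do rewrite big_nil; exact: Lq_small0.
under eq_fun do under eq_fun do rewrite big_cons.
apply: (Lq_smallD (Z := Z i)); first by apply: h; rewrite inE eqxx.
by apply: ih => j jr; apply: h; rewrite inE jr orbT.
Qed.

Lemma Lq_small_exp q Z D del : (forall t, 0 <= t -> cmeasurable (Z t)) -> 0 <= D -> 0 < del ->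
  (forall t, 0 <= t -> (\int[P]_w (cnorm (Z t w) ^+ q)%:E <= (D * expR (- (del * t)))%:E)%E) ->
  Lq_small q Z.
Proof.
move=> mZ D0 d0 hZ; split=> // eps e0.
exists (D / eps / del) => t tT t0; apply: le_trans (hZ t t0) _; rewrite lee_fin expRN.
rewrite ler_pdivrMr ?expR_gt0//.
have h : D / eps <= expR (del * t).
  apply: (@le_trans _ _ (del * t)); first by rewrite [del * t]mulrC -ler_pdivrMr.
  by apply: le_trans (expR_ge1Dx _); rewrite lerDr ler01.
by rewrite mulrC -ler_pdivrMr.
Qed.

Lemma Lq_small_cvg0 q Z : (0 < q)%N -> Lq_small q Z -> Lq_cvg0 P q Z.
Proof.
move=> q0 [mZ hZ]; rewrite /Lq_cvg0.
have q0' : (q%:R : R) != 0 by rewrite pnatr_eq0 -lt0n.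
have bound (eps : R) : 0 < eps -> exists T0 : R, forall t, T0 <= t ->
    ('N[P]_(q%:R%:E)[(fun w => (cnorm (Z t w))%:E)] <= eps%:E)%E.
  move=> e0; have eq0 : 0 < eps ^+ q by exact: exprn_gt0.
  have [T0 hT] := hZ _ eq0; exists (Num.max T0 0) => t; rewrite ge_max => /andP[tT t0].
  rewrite unlock /Lnorm/=.
  have -> : (\int[P]_w (`|(cnorm (Z t w))%:E| `^ q%:R) = \int[P]_w (cnorm (Z t w) ^+ q)%:E)%E.
    apply: eq_integral => w _.
    by rewrite gee0_abs ?lee_fin ?cnorm_ge0// poweR_EFin powR_mulrn ?cnorm_ge0.
  have -> : eps%:E = ((eps ^+ q)%:E `^ (q%:R^-1))%E.
    by rewrite poweR_EFin -powR_mulrn ?ltW// -powRrM mulfV// powRr1// ltW.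
  have I0 : (0 <= \int[P]_w (cnorm (Z t w) ^+ q)%:E)%E by apply: pint_ge0 => w; exact: cnormX_ge0.
  apply: gt0_ler_poweR.
  - by rewrite invr_ge0.
  - by rewrite in_itv/= I0 leey.
  - by rewrite in_itv/= leey lee_fin ltW.
  - exact: hT.
apply/fine_cvgP; split.
  have [T0 hT] := bound 1 ltr01.
  exists T0; split; first exact: num_real.
  move=> t /ltW /hT h; rewrite ge0_fin_numE ?Lnorm_ge0//.
  exact: le_lt_trans h (ltry _).
apply/cvgrPdist_le => eps e0; have [T0 hT] := bound eps e0.
exists T0; split; first exact: num_real.
move=> t /ltW /hT h; rewrite sub0r normrN /= ger0_norm ?fine_ge0 ?Lnorm_ge0//.
rewrite -lee_fin fineK// ge0_fin_numE ?Lnorm_ge0//.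
exact: le_lt_trans h (ltry _).
Qed.

End LqTools.

Section ComplexEvaluation.
Context (R : realType) (E : completePseudoMetricType R).

Lemma evc_sum (I : Type) (r : seq I) (a : I -> R[i]) (H : I -> E -> R[i]) z : falive z ->
  evc (\sum_(i <- r) a i *: H i) z = \sum_(i <- r) a i * evc (H i) z.
Proof.
move=> /falive_seq[l ul zl]; rewrite (evcE _ ul zl).
under [RHS]eq_bigr do rewrite (evcE _ ul zl) mulr_sumr.
rewrite exchange_big; apply: eq_bigr => u _.
case: (z u) => [y|]/=; last by rewrite big1// => i _; rewrite mulr0.
by rewrite fct_sumE.
Qed.

Lemma evcD (f g : E -> R[i]) z : falive z -> evc (f + g) z = evc f z + evc g z.
Proof.
move=> /falive_seq[l ul zl]; rewrite !(evcE _ ul zl) -big_split; apply: eq_bigr => u _.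
by case: (z u) => //=; rewrite addr0.
Qed.

End ComplexEvaluation.

(** * Fluctuations, growth and martingale limits *)

Section BranchingProcess.
Context (R : realType) (E : completePseudoMetricType R).
Context dP (Path : measurableType dP) (X : markov_process E Path).
Context (gamma : E -> R) (G : R).
Context dO (Off : measurableType dO) (Z : offspring E Off).
Context dW (Omega : measurableType dW) (Y : branching_process X gamma Z Omega).
Hypothesis gamma0 : forall y, 0 <= gamma y.
Hypothesis mgamma : measurable_fun [set: borel E] (gamma : borel E -> R).
Hypothesis gammaG : forall y, gamma y <= G.
Local Notation word := (seq nat).
Local Notation pos := (pos Y).
Local Notation conf := (conf E).
Local Notation Pr := (bmp_law Y).
Local Notation BE := (@BE R E).
Local Notation mfun h := (measurable_fun [set: borel E] (h : borel E -> R)).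

Lemma measurable_xev_cfg h x t : mfun h ->
  measT (fun w => xev h (cfg Y x t w)).
Proof. by move=> mh; exact: (measurableT_comp (measurable_xev mh) (measurable_cfg Y gamma0 mgamma x t)). Qed.

(** The kernel property of the law handles nonnegative functions, so the expectation is written as a
    difference of two of them. *)
Lemma measurable_law_expectation t h : mfun h ->
  measurable_fun [set: borel E] (fun z => \int[Pr z]_w (xev h (cfg Y z t w)))%R.
Proof.
move=> mh; have mp (g : conf -> R) : measT g ->
    measurable_fun [set: borel E] (fun z => \int[Pr z]_w (pp (fun w => g (cfg Y z t w)) w)%:E)%E.
  move=> mg; apply: (@measurable_law_integral _ _ _ _ _ _ _ _ _ _ _ Y gamma0 mgamma t _ (borel E)
    (fun a : borel E * conf => (Num.max (g a.2) 0)%:E) id) => //.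
  split=> [a|]; first by rewrite lee_fin le_max lexx orbT.
  by apply/measurable_EFinP; apply: measurable_maxr => //; exact: (measurableT_comp mg).
have mx := measurable_xev mh.
apply: (measurableT_comp (fine_measurable measurableT)).
rewrite (_ : (fun z => _) = (fun z => \int[Pr z]_w (pp (fun w => xev h (cfg Y z t w)) w)%:E -
    \int[Pr z]_w (pp (fun w => - xev h (cfg Y z t w)) w)%:E)%E); last first.
  by apply/funext => z; exact: pint_parts.
apply: emeasurable_funB; first exact: mp.
by apply: (mp (fun z => - xev h z)); exact: measurableT_comp.
Qed.

Variables (Q : nat) (theta : R).
Hypothesis theta0 : 0 <= theta.
Hypothesis hmom : forall x K D t, (\int[Pr x]_w (alive_count Y x K D t w ^+ Q.+1)%:E <=
      (expR (theta * t) ^+ Q.+1 * 2 ^+ Q.+1)%:E)%E.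

(** A bound, uniform in the starting point and nondecreasing in t, for the moment of order Q + 1 of
    N_t + 1; it will also bound semigroup values and centred moments. *)
Definition kappa (t : R) : R := 2 ^+ Q.+1 * (expR (theta * t) ^+ Q.+1 * 2 ^+ Q.+1 + 1).

Lemma kappa_ge1 t : 1 <= kappa t.
Proof.
rewrite -[leLHS]mulr1 ler_pM// ?exprn_ege1// ?ler1n//.
by rewrite lerDr mulr_ge0// exprn_ge0// expR_ge0.
Qed.

Lemma kappa_mono s t : s <= t -> kappa s <= kappa t.
Proof.
move=> st; rewrite ler_wpM2l ?exprn_ge0// lerD2r ler_wpM2r ?exprn_ge0//.
by rewrite lerXn2r ?nnegrE ?expR_ge0// ler_expR ler_wpM2l.
Qed.

(** The counts in boxes increase with the box and have uniformly bounded moments, so their limit is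
    almost surely finite, whereas an infinite configuration would make them unbounded. *)
Lemma falive_moment x t : {ae Pr x, forall w, falive (cfg Y x t w)} /\
  (\int[Pr x]_w (xev (cst 1) (cfg Y x t w) ^+ Q.+1)%:E <= (expR (theta * t) ^+ Q.+1 * 2 ^+ Q.+1)%:E)%E.
Proof.
pose A K w := alive_count Y x K K t w.
have A0 K w : 0 <= A K w by exact: alive_count_ge0.
have mA K : measT (A K) by exact: measurable_alive_count.
have Amono w : {homo A ^~ w : K K' / (K <= K')%N >-> K <= K'}.
  move=> K K' KK; rewrite /A /alive_count -!/(box _).
  rewrite [leRHS](bigID (mem (box K)))/=.
  rewrite -[leLHS]addr0 lerD ?sumr_ge0//.
  rewrite -[leRHS]big_filter [leRHS](perm_big (box K))//; apply: uniq_perm.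
  - by rewrite filter_uniq ?uniq_box.
  - exact: uniq_box.
  - move=> v; rewrite mem_filter andbC; apply/andP/idP => [[]//|vK].
    by split=> //; exact: box_mono KK vK.
pose g w := limn (fun K => (A K w ^+ Q.+1)%:E).
have gmono w : {homo (fun K => (A K w ^+ Q.+1)%:E) : K K' / (K <= K')%N >-> (K <= K')%E}.
  by move=> K K' KK; rewrite lee_fin lerXn2r ?nnegrE ?A0//; exact: Amono.
have mAE K : measT (fun w => (A K w ^+ Q.+1)%:E).
  by apply/measurable_EFinP; exact: measurable_funX.
have gle w K : ((A K w ^+ Q.+1)%:E <= g w)%E.
  apply: lime_ge; first exact/ereal_nondecreasing_is_cvgn/gmono.
  by near=> K'; apply: gmono; near: K'; exact: nbhs_infty_ge.
have g0 w : (0 <= g w)%E by apply: le_trans (gle w 0%N); rewrite lee_fin exprn_ge0.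
have mg : measT g.
  apply: (@emeasurable_fun_cvg _ _ _ _ (fun K w => (A K w ^+ Q.+1)%:E)) => // w _.
  exact/ereal_nondecreasing_is_cvgn/gmono.
have ig : (\int[Pr x]_w g w <= (expR (theta * t) ^+ Q.+1 * 2 ^+ Q.+1)%:E)%E.
  rewrite monotone_convergence//; last by move=> K w _; rewrite lee_fin exprn_ge0.
  apply: lime_le; last by apply: nearW => K; exact: hmom.
  apply: ereal_nondecreasing_is_cvgn => K K' KK; apply: ge0_le_integral => //.
  - by move=> w _; rewrite lee_fin exprn_ge0.
  - by move=> w _; exact: gmono.
have gfin : {ae Pr x, forall w, (g w < +oo)%E}.
  have gi : (Pr x).-integrable setT g.
    apply/integrableP; split=> //; under eq_integral do rewrite gee0_abs//.
    exact: le_lt_trans ig (ltry _).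
  by apply: filterS (integrable_ae measurableT gi) => w /(_ I); rewrite ge0_fin_numE.
have fal w : (g w < +oo)%E -> falive (cfg Y x t w).
  move=> gw; apply: contrapT => inf.
  have [B gB] : exists B : R, (g w <= B%:E)%E.
    by exists (fine (g w)); rewrite fineK// ge0_fin_numE.
  have B0 : 0 <= B by rewrite -lee_fin (le_trans (g0 w)).
  have [F Fs Fn] := infinite_set_fset (Num.truncn B).+2 inf.
  have [K FK] := box_cover F.
  have AK : (#|` F|%:R <= A K w).
    rewrite /A /alive_count -/(box K) -sum1_size natr_sum.
    rewrite [leRHS](bigID (mem F))/= -[leLHS]addr0 lerD ?sumr_ge0//.
    rewrite -[X in _ <= X]big_filter [X in _ <= X](perm_big F); last first.
      apply: uniq_perm; [by rewrite filter_uniq ?uniq_box|exact: fset_uniq|].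
      by move=> v; rewrite mem_filter andbC; apply/andP/idP => [[]//|vF]; split=> //; exact: FK.
    rewrite [leLHS]big_seq [leRHS]big_seq; apply: ler_sum => v vF.
    by have := Fs v vF; rewrite /= /cfg; case: (pos x t v w).
  have : (#|` F|%:R ^+ Q.+1 <= B).
    rewrite -lee_fin; apply: le_trans gB; apply: le_trans (gle w K); rewrite lee_fin.
    by rewrite lerXn2r ?nnegrE.
  apply/negP; rewrite -ltNge.
  have F1 : 1 <= #|` F|%:R :> R by rewrite ler1n (leq_trans _ Fn).
  apply: (@lt_le_trans _ _ (#|` F|%:R)); last by rewrite -{1}[X in X <= _]expr1 ler_weXn2l.
  have /andP[_ tB] := Num.Theory.truncn_itv B0.
  by apply: (lt_le_trans tB); rewrite ler_nat (leq_trans _ Fn).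
split; first by apply: filterS gfin => w; exact: fal.
apply: le_trans ig; apply: ge0_le_integral => //.
- move=> w _; rewrite lee_fin; have [fw|fw] := pselect (falive (cfg Y x t w)).
    by rewrite exprn_ge0// xev1_ge0.
  by rewrite xev_infinite ?expr0n// => y; exact: oner_neq0.
- apply/measurable_EFinP; apply: measurable_funX.
  by apply: measurable_xev_cfg; exact: measurable_cst.
- move=> w _; have [fw|fw] := pselect (falive (cfg Y x t w)); last first.
    by rewrite xev_infinite ?expr0n// => y; exact: oner_neq0.
  have [l ul zl] := falive_seq fw; have [K lK] := box_cover l.
  apply: le_trans (gle w K); rewrite lee_fin (xevE _ (uniq_box K)); last by move=> u /zl /lK.
  rewrite le_eqVlt; apply/orP; left; apply/eqP; congr (_ ^+ _).
  by apply: eq_bigr => u _; rewrite /cfg; case: (pos x t u w).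
Unshelve. all: by end_near. Qed.

Lemma falive_ae x t : {ae Pr x, forall w, falive (cfg Y x t w)}.
Proof. by have [] := falive_moment x t. Qed.

(** The maximum makes nonnegativity hold at every w, not only on finite configurations. *)
Definition pop x t w : R := Num.max (xev (cst 1) (cfg Y x t w)) 0.

Lemma pop_ge0 x t w : 0 <= pop x t w.
Proof. by rewrite /pop le_max lexx orbT. Qed.

Lemma popE x t w : falive (cfg Y x t w) -> pop x t w = xev (cst 1) (cfg Y x t w).
Proof. by move=> fw; rewrite /pop max_l// xev1_ge0. Qed.

Lemma measurable_pop x t : measT (pop x t).
Proof. by apply: measurable_maxr => //; apply: measurable_xev_cfg; exact: measurable_cst. Qed.

Lemma pop_moment x t : (\int[Pr x]_w ((pop x t w + 1) ^+ Q.+1)%:E <= (kappa t)%:E)%E.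
Proof.
apply: (@le_trans _ _ (\int[Pr x]_w (2 ^+ Q.+1 * (pop x t w ^+ Q.+1 + 1))%:E)%E).
  have mp := measurable_pop x t.
  apply: pint_le.
  - by apply: measurable_funX; exact: measurable_funD.
  - by apply: measurable_funM => //; apply: measurable_funD => //; exact: measurable_funX.
  - by move=> w; rewrite exprn_ge0// addr_ge0 ?pop_ge0.
  - by move=> w; rewrite mulr_ge0 ?exprn_ge0// addr_ge0// exprn_ge0 ?pop_ge0.
  - apply/nearW => w; apply: le_trans (exprD_le _ (pop_ge0 _ _ _) ler01) _.
    by rewrite expr1n.
have mp : measT (fun w => pop x t w ^+ Q.+1) by apply: measurable_funX; exact: measurable_pop.
have p0 w : 0 <= pop x t w ^+ Q.+1 by rewrite exprn_ge0 ?pop_ge0.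
rewrite pintZ ?exprn_ge0//; last 2 first.
- exact: measurable_funD.
- by move=> w; rewrite addr_ge0.
rewrite EFinM lee_wpmul2l ?lee_fin ?exprn_ge0// pintD// pint_cst EFinD leeD2r//.
apply: le_trans (falive_moment x t).2; apply: pint_le => //.
- apply: measurable_funX; apply: measurable_xev_cfg; exact: measurable_cst.
- move=> w; have [fw|fw] := pselect (falive (cfg Y x t w)).
    by rewrite exprn_ge0// xev1_ge0.
  by rewrite xev_infinite ?expr0n// => y; exact: oner_neq0.
- by apply: filterS (falive_ae x t) => w fw; rewrite popE.
Qed.

Definition mean (t : R) (h : E -> R) (z : E) : R := (\int[Pr z]_w xev h (cfg Y z t w))%R.

Lemma xev_pop h x t : (forall y, `|h y| <= 1) ->
  {ae Pr x, forall w, `|xev h (cfg Y x t w)| <= pop x t w}.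
Proof.
move=> h1; apply: filterS (falive_ae x t) => w fw.
by rewrite popE// -[leRHS]mul1r; exact: xev_abs.
Qed.

Lemma pop_lty x t : (\int[Pr x]_w (pop x t w)%:E <= (kappa t)%:E)%E.
Proof.
apply: le_trans (pop_moment x t); have mp := measurable_pop x t.
apply: pint_le => //; first by apply: measurable_funX; exact: measurable_funD.
- exact: pop_ge0.
- by move=> w; rewrite exprn_ge0// addr_ge0 ?pop_ge0.
- apply/nearW => w; apply: (@le_trans _ _ (pop x t w + 1)); first by rewrite lerDl.
  by rewrite -{1}[_ + 1]expr1 ler_weXn2l// lerDr pop_ge0.
Qed.

Section UnitFunction.
Variable h : E -> R.
Hypothesis mh : mfun h.
Hypothesis h1 : forall y, `|h y| <= 1.

Lemma xev_norm_lty z t : (\int[Pr z]_w `|xev h (cfg Y z t w)|%:E <= (kappa t)%:E)%E.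
Proof.
apply: le_trans (pop_lty z t); have mx := measurable_xev_cfg z t mh.
apply: pint_le => //.
- exact: measurableT_comp.
- exact: measurable_pop.
- exact: pop_ge0.
- exact: xev_pop.
Qed.

Lemma xev_integrable z t : (Pr z).-integrable setT (fun w => (xev h (cfg Y z t w))%:E).
Proof.
apply/integrableP; split; first by apply/measurable_EFinP; exact: measurable_xev_cfg.
by apply: le_lt_trans (xev_norm_lty z t) (ltry _).
Qed.

Lemma meanE z t : (\int[Pr z]_w (xev h (cfg Y z t w))%:E = (mean t h z)%:E)%E.
Proof. by rewrite /mean /Rintegral fineK//; exact: integrable_fin_num (xev_integrable z t). Qed.

Lemma mean_le z t : `|mean t h z| <= kappa t.
Proof.
rewrite -lee_fin -abse_EFin -meanE; apply: le_trans (xev_norm_lty z t).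
apply: le_abse_integral => //; apply/measurable_EFinP; exact: measurable_xev_cfg.
Qed.

Lemma centered_moment z t r : (r <= Q.+1)%N ->
  (\int[Pr z]_w (`|xev h (cfg Y z t w) - mean t h z| ^+ r)%:E <= (kappa t ^+ Q.+2)%:E)%E.
Proof.
move=> rQ; have k1 := kappa_ge1 t; have k0 : 0 <= kappa t by exact: le_trans k1.
have mp := measurable_pop z t; have mx := measurable_xev_cfg z t mh.
apply: (@le_trans _ _ (\int[Pr z]_w (kappa t ^+ Q.+1 * (pop z t w + 1) ^+ Q.+1)%:E)%E).
  apply: pint_le.
  - by apply: measurable_funX; apply: measurableT_comp => //; exact: measurable_funB.
  - by apply: measurable_funM => //; apply: measurable_funX; exact: measurable_funD.
  - by move=> w; rewrite exprn_ge0.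
  - by move=> w; rewrite mulr_ge0// exprn_ge0// addr_ge0 ?pop_ge0.
  - apply: filterS (xev_pop z t h1) => w xw.
    have p0 := pop_ge0 z t w.
    have le1 : `|xev h (cfg Y z t w) - mean t h z| <= kappa t * (pop z t w + 1).
      apply: le_trans (ler_normB _ _) _; rewrite mulrDr mulr1 lerD ?mean_le//.
      by apply: le_trans xw _; rewrite ler_peMl.
    rewrite -exprMn; apply: (@le_trans _ _ ((kappa t * (pop z t w + 1)) ^+ r)).
      by rewrite lerXn2r ?nnegrE// mulr_ge0// addr_ge0.
    apply: ler_weXn2l => //; rewrite -[leLHS]mulr1; apply: ler_pM => //.
    by rewrite lerDr.
rewrite pintZ ?exprn_ge0//; last 2 first.
- by apply: measurable_funX; exact: measurable_funD.
- by move=> w; rewrite exprn_ge0// addr_ge0 ?pop_ge0.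
have -> : (kappa t ^+ Q.+2)%:E = ((kappa t ^+ Q.+1)%:E * (kappa t)%:E)%E by rewrite -EFinM -exprSr.
by rewrite lee_wpmul2l ?lee_fin ?exprn_ge0 ?pop_moment.
Qed.

Section Increment.
Variables (x : E) (s t : R) (u : word).
Hypothesis t0 : 0 <= t.
Local Notation hist := (hist Y x s u).

(** Deviation of the subtree of one particle from its mean given the place of that particle. A dead
    particle deviates by 0. *)
Definition dev (o : option E) (z : word -> option E) : R :=
  if o is Some y then xev h z - mean t h y else 0.

Definition incr (w : Omega) : R := dev (pos x s u w) (sub_cfg Y x (s + t) u w).

Definition alive_at (w : Omega) : R := (pos x s u w : bool)%:R.

Lemma measurable_alive_at : measT (alive_at : hist -> R).
Proof.
have m1 : measT (fun w : hist => pos x s u w : bool).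
  apply: (measurableT_comp (@measurable_fun_isSome _ (borel E))).
  by apply: measurable_hist_pos; rewrite lexx.
have m2 : measT (fun b : bool => b%:R : R) by [].
exact: (measurableT_comp m2 m1).
Qed.

Lemma measurable_dev : measT (fun z : hist * conf => dev (pos x s u z.1) z.2).
Proof.
apply: (@measurable_fun_match _ (borel E) _ _ (hist * conf)%type R
   (fun z => pos x s u z.1) (fun z => xev h z.1.2 - mean t h z.2) (fun=> 0)) => //.
- apply: (@measurableT_comp _ _ _ _ _ _ (pos x s u : hist -> optm (borel E)) _ fst) => //.
  by apply: measurable_hist_pos; rewrite lexx.
- apply: measurable_funB.
    by apply: (measurableT_comp (measurable_xev mh)); exact: (measurableT_comp measurable_snd).
  exact: (measurableT_comp (measurable_law_expectation t mh) measurable_snd).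
Qed.

Lemma measurable_incr : measT incr.
Proof.
have m2 : measT (fun w : Omega => (w, sub_cfg Y x (s + t) u w) : hist * conf).
  apply: measurable_fun_pair; first exact: measurable_hist_id.
  exact: measurable_sub_cfg.
exact: (measurableT_comp measurable_dev m2).
Qed.

Lemma incr_dead w : pos x s u w = None -> incr w = 0.
Proof. by rewrite /incr => ->. Qed.

(** Given the history of u its subtree is a fresh process, so the moment of its increment is bounded
    by a constant depending on t alone. *)
Lemma incr_moment (Psi : hist -> R) r : measT Psi -> (forall w, 0 <= Psi w) ->
  (r <= Q.+1)%N ->
  (\int[Pr x]_w (Psi w * alive_at w * `|incr w| ^+ r)%:E <=
   (kappa t ^+ Q.+2)%:E * \int[Pr x]_w (Psi w * alive_at w)%:E)%E.
Proof.
move=> mPsi Psi0 rQ; have k0 : 0 <= kappa t by exact: le_trans (kappa_ge1 t).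
pose f (z : hist * conf) : \bar R := (Psi z.1 * `|dev (pos x s u z.1) z.2| ^+ r)%:E.
have nf : nnm f.
  split=> [z|]; first by rewrite lee_fin mulr_ge0// exprn_ge0.
  apply/measurable_EFinP; apply: measurable_funM; first exact: (measurableT_comp mPsi).
  apply: measurable_funX; apply: measurableT_comp => //; exact: measurable_dev.
have mPo : measT (Psi : Omega -> R).
  exact: (measurable_of_hist gamma0 mgamma mPsi).
have mal : measT (alive_at : Omega -> R).
  exact: (measurable_of_hist gamma0 mgamma measurable_alive_at).
rewrite (_ : \int[Pr x]_w _ = \int[Pr x]_w oapp (fun=> f (w, sub_cfg Y x (s + t) u w)) 0 (pos x s u w))%E; last first.
  apply: eq_integral => w _; rewrite /alive_at /f /incr/=.
  by case: (pos x s u w) => [z|]/=; rewrite ?mulr1 ?mulr0 ?mul0r.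
rewrite (branching_markov gamma0 mgamma gammaG t0 nf) -pintZ ?exprn_ge0//; last 2 first.
- exact: measurable_funM.
- by move=> w; rewrite mulr_ge0.
apply: ge0_le_integral => //.
- by move=> w _; apply: oapp_ge0 => z; apply: integral_ge0 => w' _; exact: nf.1.
- by have [] := nnm_branching_markov gamma0 mgamma t nf.
- by apply/measurable_EFinP; apply: measurable_funM => //; exact: measurable_funM.
- move=> w _; rewrite /alive_at /f; case: (pos x s u w) => [z|]/=; last by rewrite !mulr0.
  rewrite pintZ//; last first.
    apply: measurable_funX; apply: measurableT_comp => //; apply: measurable_funB => //.
    exact: measurable_xev_cfg.
  rewrite mulr1 mulrC EFinM lee_wpmul2l ?lee_fin//.
  exact: centered_moment.
Qed.

(** The product of [Psi] and the increment is centred and integrable, expressed by equal finite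
    integrals of its two parts. Since the history of u contains the subtrees of incomparable
    particles, [Psi] may be built from their increments. *)
Lemma incr_orthogonal (Psi : hist -> R) : measT Psi ->
  (\int[Pr x]_w (`|Psi w| * alive_at w)%:E < +oo)%E ->
  (\int[Pr x]_w (pp (fun w : Omega => Psi w * incr w)%R w)%:E < +oo)%E /\
  (\int[Pr x]_w (pp (fun w : Omega => Psi w * incr w)%R w)%:E =
   \int[Pr x]_w (pp (fun w : Omega => - (Psi w * incr w))%R w)%:E)%E.
Proof.
move=> mPsi fin.
have mPo : measT (Psi : Omega -> R).
  exact: (measurable_of_hist gamma0 mgamma mPsi).
have mal : measT (alive_at : Omega -> R).
  exact: (measurable_of_hist gamma0 mgamma measurable_alive_at).
have mI := measurable_incr.
have mn : measT (fun w : hist => `|Psi w|) by exact: measurableT_comp.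
have lty : (\int[Pr x]_w `|Psi w * incr w|%:E < +oo)%E.
  have := @incr_moment (fun w => `|Psi w|) 1 mn (fun=> normr_ge0 _) isT.
  move=> le1; apply: le_lt_trans (le_lt_trans le1 _).
    apply: pint_le => //.
    - by apply: measurableT_comp => //; exact: measurable_funM.
    - apply: measurable_funM; first by apply: measurable_funM => //; exact: measurableT_comp.
      by apply: measurable_funX; exact: measurableT_comp.
    - by move=> w; rewrite !mulr_ge0.
    - apply/nearW => w; rewrite expr1 normrM /alive_at /incr.
      by case: (pos x s u w) => [z|]/=; rewrite ?mulr1// normr0 !mulr0.
  by apply: lte_mul_pinfty => //; rewrite lee_fin exprn_ge0// (le_trans ler01 (kappa_ge1 t)).
have mPI : measT (fun w : Omega => Psi w * incr w) by exact: measurable_funM.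
have [l1 l2] := pint_pp_lty mPI lty; split=> //.
have key (sg : R) : (forall a : R, `|sg * a| = `|a|) ->
  (\int[Pr x]_w (pp (fun w : Omega => sg * (Psi w * incr w))%R w)%:E =
   \int[Pr x]_w oapp (fun z => \int[Pr z]_w' (pp (fun w' => sg * (Psi w * (xev h (cfg Y z t w') - mean t h z)))%R w')%:E) 0 (pos x s u w))%E.
  move=> _; pose f (z : hist * conf) : \bar R := (Num.max (sg * (Psi z.1 * dev (pos x s u z.1) z.2)) 0)%:E.
  have nf : nnm f.
    split=> [z|]; first by rewrite lee_fin le_max lexx orbT.
    apply/measurable_EFinP; apply: measurable_maxr => //; apply: measurable_funM => //.
    apply: measurable_funM; first exact: (measurableT_comp mPsi).
    exact: measurable_dev.
  transitivity (\int[Pr x]_w oapp (fun=> f (w, sub_cfg Y x (s + t) u w)) 0 (pos x s u w))%E.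
    apply: eq_integral => w _; rewrite /f /incr /pp/=.
    by case: (pos x s u w) => [z|]//=; rewrite !mulr0 maxxx.
  rewrite (branching_markov gamma0 mgamma gammaG t0 nf); apply: eq_integral => w _.
  by rewrite /f; case: (pos x s u w).
have k1 := key 1; have k2 := key (-1).
have -> : (\int[Pr x]_w (pp (fun w : Omega => Psi w * incr w)%R w)%:E = \int[Pr x]_w (pp (fun w : Omega => 1 * (Psi w * incr w))%R w)%:E)%E.
  by apply: eq_integral => w _; rewrite /pp mul1r.
have -> : (\int[Pr x]_w (pp (fun w : Omega => - (Psi w * incr w))%R w)%:E = \int[Pr x]_w (pp (fun w : Omega => -1 * (Psi w * incr w))%R w)%:E)%E.
  by apply: eq_integral => w _; rewrite /pp mulN1r.
rewrite k1 ?k2; last 2 first.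
- by move=> a; rewrite mulN1r normrN.
- by move=> a; rewrite mul1r.
apply: eq_integral => w _; case: (pos x s u w) => [z|]//=.
pose g w' := Psi w * (xev h (cfg Y z t w') - mean t h z).
have mx := measurable_xev_cfg z t mh.
have mg : measT g by apply: measurable_funM => //; exact: measurable_funB.
have xi := xev_integrable z t.
have gi : (Pr z).-integrable setT (fun w' => (g w')%:E).
  rewrite (_ : (fun w' => _) = (fun w' => (Psi w)%:E * ((xev h (cfg Y z t w'))%:E - (mean t h z)%:E))%E)//.
  apply: integrableZl => //; apply: integrableB => //.
  apply/integrableP; split; first exact: measurable_cst.
  by rewrite pint_cst ltry.
have g0 : (\int[Pr z]_w' (g w')%:E = 0)%E.
  under eq_integral do rewrite /g EFinM EFinB.
  rewrite integralZl//; last first.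
    apply: integrableB => //; apply/integrableP; split; first exact: measurable_cst.
    by rewrite pint_cst ltry.
  rewrite integralB//; last first.
    apply/integrableP; split; first exact: measurable_cst.
    by rewrite pint_cst ltry.
  by rewrite meanE pint_cst subee ?mule0.
have gl : (\int[Pr z]_w' `|g w'|%:E < +oo)%E by have /integrableP[_] := gi.
have := pint_zero_mean mg gl g0; rewrite /pp/g => e.
under eq_integral do rewrite mul1r; rewrite e.
by apply: eq_integral => w' _; rewrite mulN1r.
Qed.

End Increment.
End UnitFunction.

Local Notation hist := (hist Y).
Local Notation alive := alive_at.

(** A weight in [0, 1] known at time s. It must be measurable for the history of every u, because u
    varies in the sums where it is used. *)
Definition past x s (Psi : Omega -> R) :=
  (forall w, 0 <= Psi w <= 1) /\ forall u, measT (Psi : hist x s u -> R).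

Lemma measurable_past x s Psi : past x s Psi -> measT Psi.
Proof. by move=> [_ mPsi]; exact: (measurable_of_hist gamma0 mgamma (mPsi [::])). Qed.

Lemma alive01 x s u w : 0 <= alive x s u w <= 1.
Proof. by rewrite /alive_at; case: (pos x s u w) => [a|]/=; rewrite ?lexx ?ler01. Qed.

Lemma measurable_alive_hist x s u u' : measT (alive x s u' : hist x s u -> R).
Proof.
have m1 : measT (fun w : hist x s u => pos x s u' w : bool).
  apply: (measurableT_comp (@measurable_fun_isSome _ (borel E))).
  by apply: measurable_hist_pos; rewrite lexx.
have m2 : measT (fun b : bool => b%:R : R) by [].
exact: (measurableT_comp m2 m1).
Qed.

Lemma past_alive x s u Psi : past x s Psi -> past x s (fun w => Psi w * alive x s u w).
Proof.
move=> [P01 mP]; split=> [w|u']; last first.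
  by apply: measurable_funM => //; exact: measurable_alive_hist.
have /andP[P0 P1] := P01 w; have /andP[a0 a1] := alive01 x s u w.
by rewrite mulr_ge0//= mulr_ile1.
Qed.

Lemma past1 x s : past x s (cst 1).
Proof. by split=> [w|u]; rewrite /= ?ler01 ?lexx//; exact: measurable_cst. Qed.

(** No descendant of u' descends from u: two ancestors of one particle are comparable. *)
Lemma measurable_incr_hist h x s t u u' : mfun h -> ~~ suffix u u' -> ~~ suffix u' u ->
  measT (incr h x s t u' : hist x s u -> R).
Proof.
move=> mh uu u'u.
have far v : ~~ suffix u (v ++ u').
  apply/negP => uv; have := suffix_total uv (suffix_suffix v u').
  by rewrite (negbTE uu) (negbTE u'u).
apply: (@measurable_fun_match _ (borel E) _ _ (hist x s u) R (fun w => pos x s u' w)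
   (fun z => xev h (sub_cfg Y x (s + t) u' z.1) - mean t h z.2) (fun=> 0)) => //.
- by apply: measurable_hist_pos; rewrite lexx.
- apply: measurable_funB.
    apply: (measurableT_comp (measurable_xev mh)).
    apply: (@measurableT_comp _ _ _ _ _ _ (sub_cfg Y x (s + t) u' : hist x s u -> conf) _ fst) => //.
    by apply: measurable_conf => v; apply: measurable_hist_pos; rewrite far orbT.
  exact: (measurableT_comp (measurable_law_expectation t mh) measurable_snd).
Qed.

(** * Moments of sums of centred increments *)

Section Sums.
Variable h : E -> R.
Hypothesis mh : mfun h.
Hypothesis h1 : forall y, `|h y| <= 1.
Variables (x : E) (s t : R).
Hypothesis t0 : 0 <= t.
Local Notation I := (incr h x s t).
Local Notation a := (alive x s).

Let mI u : measT (I u). Proof. exact: measurable_incr. Qed.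
Let ma u : measT (a u).
Proof. exact: (measurable_of_hist gamma0 mgamma (@measurable_alive_hist x s u u)). Qed.

Lemma measurable_incr_sum (l : seq word) : measT (fun w => \sum_(u <- l) I u w).
Proof. by apply: measurable_sum => u; exact: mI. Qed.

Lemma measurable_alive_sum (l : seq word) : measT (fun w => \sum_(u <- l) a u w).
Proof. by apply: measurable_sum => u; exact: ma. Qed.

(** A finiteness statement without control of constants, used to make the linear terms of the Taylor
    expansion integrable. *)
Lemma incr_sum_moment (l : seq word) r : (r <= Q.+1)%N ->
  (\int[Pr x]_w (`|\sum_(u <- l) I u w| ^+ r)%:E < +oo)%E.
Proof.
move=> rQ; elim: l => [|u l ih].
  under eq_integral do rewrite big_nil.
  by rewrite pint_cst ltry.
have mS := measurable_incr_sum l.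
have mSn : measT (fun w => `|\sum_(u <- l) I u w| ^+ r).
  by apply: measurable_funX; exact: measurableT_comp.
have mIn : measT (fun w => `|I u w| ^+ r).
  by apply: measurable_funX; exact: measurableT_comp.
have Ilt : (\int[Pr x]_w (`|I u w| ^+ r)%:E < +oo)%E.
  have mc : measT (cst 1 : hist x s u -> R) by exact: measurable_cst.
  have := incr_moment mh h1 t0 mc (fun=> ler01) rQ.
  set b := (X in (X <= _)%E) => le1.
  have le2 : (\int[Pr x]_w (`|I u w| ^+ r)%:E <= \int[Pr x]_w (1 + 1 * a u w * `|I u w| ^+ r)%:E)%E.
    apply: pint_le => //.
    - by apply: measurable_funD => //; apply: measurable_funM => //; exact: measurable_funM.
    - by move=> w; rewrite addr_ge0// mul1r mulr_ge0 ?exprn_ge0//; case/andP: (alive01 x s u w).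
    - apply/nearW => w; rewrite mul1r /alive_at /incr.
      case: (pos x s u w) => [z|]/=; first by rewrite mul1r lerDr.
      by rewrite mul0r addr0 normr0 expr0n; case: (r == 0)%N.
  apply: (le_lt_trans le2); rewrite pintD//; last 2 first.
  - by apply: measurable_funM => //; exact: measurable_funM.
  - by move=> w; rewrite mul1r mulr_ge0 ?exprn_ge0//; case/andP: (alive01 x s u w).
  rewrite pint_cst lte_add_pinfty ?ltry//; apply: (le_lt_trans le1).
  rewrite lte_mul_pinfty ?lee_fin ?exprn_ge0 ?(le_trans ler01 (kappa_ge1 _))//.
  apply: (@le_lt_trans _ _ (\int[Pr x]_w 1%:E)%E); last by rewrite pint_cst ltry.
  apply: pint_le => //.
  - exact: measurable_funM.
  - by move=> w; rewrite mul1r; case/andP: (alive01 x s u w).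
  - by apply/nearW => w; rewrite mul1r; case/andP: (alive01 x s u w).
apply: (@le_lt_trans _ _ (\int[Pr x]_w (2 ^+ r * (`|I u w| ^+ r + `|\sum_(u <- l) I u w| ^+ r))%:E)%E).
  apply: pint_le.
  - apply: measurable_funX; apply: measurableT_comp => //.
    by under eq_fun do rewrite big_cons; exact: measurable_funD.
  - by apply: measurable_funM => //; exact: measurable_funD.
  - by move=> w; rewrite exprn_ge0.
  - by move=> w; rewrite mulr_ge0// ?exprn_ge0// addr_ge0// exprn_ge0.
  - apply/nearW => w; rewrite big_cons; apply: le_trans (exprD_le _ (normr_ge0 _) (normr_ge0 _)).
    by rewrite lerXn2r ?nnegrE ?addr_ge0// ler_normD.
rewrite pintZ ?exprn_ge0//; last exact: measurable_funD.
rewrite lte_mul_pinfty ?lee_fin ?exprn_ge0// pintD//.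
exact: lte_add_pinfty.
Qed.

(** Increments of ancestors and descendants of u are not functions of its history. They vanish when
    u is alive, as the alive particles form an antichain, so on that event the restricted sum is the
    whole sum. *)
Definition far_sum u (l : seq word) w :=
  \sum_(u' <- l | ~~ suffix u u' && ~~ suffix u' u) I u' w.

Lemma far_sumE u l w : uniq (u :: l) -> pos x s u w <> None ->
  far_sum u l w = \sum_(u' <- l) I u' w.
Proof.
move=> /= /andP[ul _] pu; rewrite /far_sum big_mkcond/=; apply: eq_big_seq => u' u'l.
case: ifPn => // h'; apply/esym/incr_dead.
case ep : (pos x s u' w) => [z|]//; exfalso; move: h'.
have alive' : pos x s u' w <> None by rewrite ep.
rewrite negb_and !negbK => /orP[] /suffixP[v vE].
  move: alive'; rewrite vE => /alive_antichain/(_ pu) v0; move: ul.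
  by rewrite vE v0 in u'l; rewrite u'l.
move: pu; rewrite vE => /alive_antichain/(_ alive') v0; move: ul.
by rewrite vE v0 u'l.
Qed.

Lemma measurable_far_sum u l : measT (far_sum u l : hist x s u -> R).
Proof.
rewrite /far_sum; under eq_fun do rewrite big_mkcond.
apply: (@measurable_sum _ (hist x s u) R setT word l
  (fun u' (w : hist x s u) => if ~~ suffix u u' && ~~ suffix u' u then I u' w else 0)) => u'.
case: (boolP (_ && _)) => [/andP[h2 h3]|_]; last exact: measurable_cst.
exact: measurable_incr_hist.
Qed.

Lemma far_sum_moment u l r : uniq (u :: l) -> (r <= Q.+1)%N ->
  (\int[Pr x]_w (`|far_sum u l w| ^+ r * a u w)%:E < +oo)%E.
Proof.
move=> ul rQ; apply: le_lt_trans (incr_sum_moment l rQ).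
have mf := measurable_of_hist gamma0 mgamma (@measurable_far_sum u l).
apply: pint_le => //.
- by apply: measurable_funM => //; apply: measurable_funX; exact: measurableT_comp.
- apply: measurable_funX; apply: measurableT_comp => //; exact: measurable_incr_sum.
- by move=> w; rewrite mulr_ge0 ?exprn_ge0//; case/andP: (alive01 x s u w).
- apply/nearW => w; rewrite /alive_at; case ep : (pos x s u w) => [z|]/=.
    by rewrite mulr1 far_sumE// ep.
  by rewrite mulr0 exprn_ge0.
Qed.

End Sums.

(** Induction on p and, within it, on the list. When u is added, the linear Taylor term is centred,
    the quadratic one is bounded by the case p with the weight [Psi] times the survival of u, and
    [count_step] absorbs both remainders. This is why a general weight [Psi] is carried along. *)
Lemma incr_sum_power p kap : (p.*2 <= Q.+1)%N -> exists2 C, 0 <= C &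
  forall h, mfun h -> (forall y, `|h y| <= 1) -> forall x s t, 0 <= t -> kappa t <= kap ->
  forall l : seq word, uniq l -> forall Psi, past x s Psi ->
  (\int[Pr x]_w (Psi w * (\sum_(u <- l) incr h x s t u w) ^+ p.*2)%:E <=
   C%:E * \int[Pr x]_w (Psi w * (\sum_(u <- l) alive x s u w) ^+ p)%:E)%E.
Proof.
elim: p => [_|p ih p2].
  by exists 1 => // h mh h1 x s t t0 tk l ul Psi pPsi; rewrite mul1e.
have p2' : (p.*2 <= Q.+1)%N by apply: leq_trans p2; rewrite doubleS; do 2 apply: leqW.
have [C C0 hC] := ih p2'.
have [B B0 hB] := @power_taylor R p.
(* Below 1 the condition [kappa t <= kap] cannot be met. *)
have [kap1|kap1] := leP 1 kap; last first.
  exists 0 => // h mh h1 x s t t0 tk; exfalso; move: tk; apply/negP; rewrite -ltNge.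
  exact: lt_le_trans kap1 (kappa_ge1 _).
pose k' := kap ^+ Q.+2.
have k'0 : 0 <= k' by rewrite exprn_ge0// (le_trans ler01).
(* C accounts for the quadratic remainder and 1 for the highest power; B is the Taylor constant,
   [k'] bounds the increment moments, and 2 compensates the half in [count_step]. *)
pose C' := 2 * (B * (k' * (C + 1))).
have C10 : 0 <= C + 1 by exact: addr_ge0.
have C'0 : 0 <= C' by do 3 (apply: mulr_ge0 => //).
exists C' => // h mh h1 x s t t0 tk; elim=> [|u l ihl] ul Psi pPsi.
  rewrite (_ : \int[_]_w _ = 0)%E; last first.
    transitivity (\int[Pr x]_w 0%:E)%E; last exact: pint_cst.
    by apply: eq_integral => w _; rewrite big_nil doubleS exprS mul0r mulr0.
  rewrite mule_ge0 ?lee_fin// pint_ge0// => w.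
  by rewrite big_nil mulr_ge0 ?exprn_ge0//; case/andP: (pPsi.1 w).
have /andP[u_l ul'] := ul.
have mPsi := measurable_past pPsi.
have P0 w : 0 <= Psi w by case/andP: (pPsi.1 w).
pose J := incr h x s t u; pose a := alive x s u.
pose S w := \sum_(u <- l) incr h x s t u w; pose n w := \sum_(u <- l) alive x s u w.
pose S' := far_sum h x s t u l.
have a01 w : 0 <= a w <= 1 by exact: alive01.
have a0 w : 0 <= a w by case/andP: (a01 w).
have n0 w : 0 <= n w by apply: sumr_ge0 => u' _; case/andP: (alive01 x s u' w).
have mJ : measT J by exact: measurable_incr.
have ma : measT a by exact: (measurable_of_hist gamma0 mgamma (@measurable_alive_hist x s u u)).
have mS : measT S by exact: measurable_incr_sum.
have mn : measT n by exact: measurable_alive_sum.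
have mS'h : measT (S' : hist x s u -> R) by exact: measurable_far_sum.
have mS' : measT S' := measurable_of_hist gamma0 mgamma mS'h.
have kk : kappa t ^+ Q.+2 <= k'.
  by rewrite lerXn2r ?nnegrE ?(le_trans ler01)// kappa_ge1.
(* Coefficient of the linear term, with the sum over the other particles replaced by its version in
   the history of u. *)
pose Theta (w : hist x s u) : R := p.+1.*2%:R * (Psi w * S' w ^+ p.*2.+1).
have mTheta : measT Theta.
  apply: measurable_funM => //; apply: measurable_funM; first exact: pPsi.2.
  exact: measurable_funX.
have pQ : (p.*2.+1 <= Q.+1)%N by apply: leq_trans p2; rewrite doubleS.
have fTheta : (\int[Pr x]_w (`|Theta w| * a w)%:E < +oo)%E.
  have := far_sum_moment mh h1 x s t0 ul pQ; rewrite -/S' -/a => lt1.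
  apply: (@le_lt_trans _ _ (\int[Pr x]_w (p.+1.*2%:R * (`|S' w| ^+ p.*2.+1 * a w))%:E)%E).
    apply: pint_le => //.
    - apply: measurable_funM => //; apply: measurableT_comp => //.
      exact: (measurable_of_hist gamma0 mgamma mTheta).
    - apply: measurable_funM => //; apply: measurable_funM => //; apply: measurable_funX.
      exact: measurableT_comp.
    - by move=> w; rewrite mulr_ge0.
    - by move=> w; rewrite !mulr_ge0 ?exprn_ge0.
    - apply/nearW => w; rewrite /Theta !normrM normrX (ger0_norm (ler0n _ _)) (ger0_norm (P0 w)).
      rewrite -!mulrA ler_wpM2l// ler_piMl ?mulr_ge0 ?exprn_ge0//.
      by case/andP: (pPsi.1 w).
  rewrite pintZ ?ler0n//.
  - by rewrite lte_mul_pinfty ?lee_fin.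
  - by apply: measurable_funM => //; apply: measurable_funX; exact: measurableT_comp.
  - by move=> w; rewrite mulr_ge0 ?exprn_ge0.
have [lty eqpp] := incr_orthogonal mh h1 t0 mTheta fTheta.
rewrite -/J in lty eqpp.
pose lin (w : Omega) := Theta w * J w.
have mlin : measT lin.
  by apply: measurable_funM => //; exact: (measurable_of_hist gamma0 mgamma mTheta).
have mlinN : measT (fun w => - lin w) by exact: measurableT_comp.
(* [T2] and [T3] are the two remainders of the Taylor expansion; the factor [a w] may be inserted
   since the increment vanishes when u is dead. *)
pose T2 w := Psi w * S' w ^+ p.*2 * a w * `|J w| ^+ 2.
pose T3 w := Psi w * a w * `|J w| ^+ p.+1.*2.
pose f w := Psi w * (J w + S w) ^+ p.+1.*2.
pose g w := Psi w * S w ^+ p.+1.*2 + B * (T2 w + T3 w).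
have T20 w : 0 <= T2 w by rewrite !mulr_ge0 ?even_power_ge0// exprn_ge0.
have T30 w : 0 <= T3 w by rewrite /T3 mulr_ge0 ?exprn_ge0// mulr_ge0.
have mJr r : measT (fun w => `|J w| ^+ r).
  by apply: measurable_funX; exact: measurableT_comp.
have mPS : measT (fun w => Psi w * S' w ^+ p.*2).
  by apply: measurable_funM => //; exact: measurable_funX.
have mT2 : measT T2 by do 2 apply: measurable_funM => //.
have mT3 : measT T3 by do 2 apply: measurable_funM => //.
have mf : measT f.
  by apply: measurable_funM => //; apply: measurable_funX; exact: measurable_funD.
have mPS2 : measT (fun w => Psi w * S w ^+ p.+1.*2).
  by apply: measurable_funM => //; exact: measurable_funX.
have mBT : measT (fun w => B * (T2 w + T3 w)).
  by apply: measurable_funM => //; exact: measurable_funD.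
have mg : measT g by exact: measurable_funD.
have f0 w : 0 <= f w by rewrite mulr_ge0// even_power_ge0.
have PS0 w : 0 <= Psi w * S w ^+ p.+1.*2 by rewrite mulr_ge0// even_power_ge0.
have BT0 w : 0 <= B * (T2 w + T3 w) by rewrite mulr_ge0// addr_ge0.
have g0 w : 0 <= g w by rewrite addr_ge0.
have fg : (\int[Pr x]_w (f w)%:E <= \int[Pr x]_w (g w)%:E)%E.
  (* The linear term is distributed over the two sides by sign; its parts have equal finite
     integrals and cancel afterwards. *)
  have le1 : (\int[Pr x]_w (f w + pp (fun w => - lin w) w)%:E <= \int[Pr x]_w (g w + pp lin w)%:E)%E.
    have mp1 := measurable_pp mlin; have mp2 := measurable_pp mlinN.
    apply: pint_le.
    - exact: measurable_funD.
    - exact: measurable_funD.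
    - by move=> w; rewrite addr_ge0 ?pp_ge0.
    - by move=> w; rewrite addr_ge0 ?pp_ge0.
    - apply/nearW => w.
      suff : f w <= g w + lin w by rewrite -{1}(pp_sub lin w) addrA lerBrDr.
      rewrite /f /g /lin /Theta /T2 /T3; case ep : (pos x s u w) => [z|].
        have -> : a w = 1 by rewrite /a /alive_at ep.
        have -> : S' w = S w by rewrite /S' far_sumE// ep.
        rewrite !mulr1 normr_even (_ : `|J w| ^+ 2 = J w ^+ 2); last by rewrite real_normK ?num_real.
        rewrite addrC; apply: le_trans (ler_wpM2l (P0 w) (hB _ _)) _.
        rewrite le_eqVlt; apply/orP; left; apply/eqP.
        move: (S w ^+ p.+1.*2) (S w ^+ p.*2.+1) (S w ^+ p.*2) (J w ^+ p.+1.*2) (J w ^+ 2) (p.+1.*2%:R : R) => s1 s2 s3 j1 j2 c.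
        by ring.
      have -> : J w = 0 by rewrite /J incr_dead.
      have -> : a w = 0 by rewrite /a /alive_at ep.
      by rewrite !mulr0 !mul0r !addr0 add0r mulr0 addr0.
  move: le1; rewrite !pintD//; try by [exact: measurable_pp|exact: pp_ge0].
  rewrite eqpp leeD2rE// fin_numE.
  move: lty; rewrite eqpp => lty; rewrite (lt_eqF lty) andbT.
  have := pint_ge0 (Pr x) (pp_ge0 (fun w => - lin w)).
  by apply: contraTN => /eqP ->.
have mPa : measT (fun w => Psi w * a w) by exact: measurable_funM.
have mPan : measT (fun w => Psi w * a w * n w ^+ p).
  by apply: measurable_funM => //; exact: measurable_funX.
have Pa0 w : 0 <= Psi w * a w by exact: mulr_ge0.
have Pan0 w : 0 <= Psi w * a w * n w ^+ p by rewrite mulr_ge0 ?exprn_ge0.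
have i2 : (\int[Pr x]_w (T2 w)%:E <= \int[Pr x]_w (k' * (C * (Psi w * a w * n w ^+ p)))%:E)%E.
  have mPS'h : measT ((fun w => Psi w * S' w ^+ p.*2) : hist x s u -> R).
    by apply: measurable_funM; [exact: pPsi.2|exact: measurable_funX].
  have PS'0 w : 0 <= Psi w * S' w ^+ p.*2 by rewrite mulr_ge0// even_power_ge0.
  have Q2 : (2 <= Q.+1)%N by apply: leq_trans p2; rewrite doubleS.
  apply: (le_trans (incr_moment mh h1 t0 mPS'h PS'0 Q2)).
  rewrite pintZ//; last 2 first.
  - exact: measurable_funM.
  - by move=> w; rewrite mulr_ge0.
  apply: lee_pmul.
  - by rewrite lee_fin exprn_ge0// (le_trans ler01)// kappa_ge1.
  - by apply: pint_ge0 => w; rewrite mulr_ge0.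
  - by rewrite lee_fin.
  rewrite pintZ//; apply: le_trans (hC h mh h1 x s t t0 tk l ul' _ (past_alive u pPsi)).
  rewrite le_eqVlt; apply/orP; left; apply/eqP; apply: eq_integral => w _; congr EFin.
  rewrite /alive_at; case ep : (pos x s u w) => [z|]/=; last by rewrite !mulr0 mul0r.
  by rewrite !mulr1 /S' far_sumE// ep.
have i3 : (\int[Pr x]_w (T3 w)%:E <= \int[Pr x]_w (k' * (Psi w * a w))%:E)%E.
  apply: (le_trans (incr_moment mh h1 t0 (pPsi.2 u) P0 p2)).
  rewrite pintZ//; apply: lee_pmul => //.
  - by rewrite lee_fin exprn_ge0// (le_trans ler01)// kappa_ge1.
  - by apply: pint_ge0 => w; rewrite mulr_ge0.
have mPn : measT (fun w => Psi w * n w ^+ p.+1).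
  by apply: measurable_funM => //; exact: measurable_funX.
have Pn0 w : 0 <= Psi w * n w ^+ p.+1 by rewrite mulr_ge0 ?exprn_ge0.
have i1 : (\int[Pr x]_w (Psi w * S w ^+ p.+1.*2)%:E <= \int[Pr x]_w (C' * (Psi w * n w ^+ p.+1))%:E)%E.
  by rewrite pintZ//; exact: ihl.
rewrite (_ : \int[_]_w _ = \int[Pr x]_w (f w)%:E)%E; last first.
  by apply: eq_integral => w _; rewrite big_cons.
apply: (le_trans fg); rewrite /g pintD// pintZ//; last 2 first.
- exact: measurable_funD.
- by move=> w; rewrite addr_ge0.
rewrite pintD//.
have an0 w : 0 <= \sum_(u0 <- u :: l) alive x s u0 w by rewrite big_cons; exact: (addr_ge0 (a0 w) (n0 w)).
pose U2 w := k' * (C * (Psi w * a w * n w ^+ p)); pose U3 w := k' * (Psi w * a w).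
have U20 w : 0 <= U2 w by apply: mulr_ge0 => //; apply: mulr_ge0.
have U30 w : 0 <= U3 w by apply: mulr_ge0.
have mU2 : measT U2 by do 2 apply: measurable_funM => //.
have mU3 : measT U3 by apply: measurable_funM => //.
have mU23 : measT (fun w => U2 w + U3 w) by exact: measurable_funD.
have mCn : measT (fun w => C' * (Psi w * n w ^+ p.+1)) by exact: measurable_funM.
apply: (@le_trans _ _ (\int[Pr x]_w (C' * (Psi w * n w ^+ p.+1) + B * (U2 w + U3 w))%:E)%E).
  rewrite pintD//; last 3 first.
  - exact: measurable_funM.
  - by move=> w; rewrite mulr_ge0.
  - by move=> w; rewrite mulr_ge0// addr_ge0.
  rewrite [X in (_ <= _ + X)%E]pintZ//; last by move=> w; rewrite addr_ge0.
  rewrite [X in (_ <= _ + _ * X)%E]pintD//.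
  by apply: leeD => //; rewrite lee_wpmul2l ?lee_fin//; exact: leeD.
rewrite -pintZ//; last 2 first.
- under eq_fun do rewrite big_cons.
  by apply: measurable_funM => //; apply: measurable_funX; exact: measurable_funD.
- by move=> w; apply: mulr_ge0 => //; apply: exprn_ge0; exact: an0.
apply: pint_le.
- by apply: measurable_funD => //; exact: measurable_funM.
- under eq_fun do rewrite big_cons.
  apply: measurable_funM => //; apply: measurable_funM => //; apply: measurable_funX.
  exact: measurable_funD.
- by move=> w; rewrite addr_ge0// mulr_ge0// addr_ge0.
- by move=> w; apply: mulr_ge0 => //; apply: mulr_ge0 => //; apply: exprn_ge0; exact: an0.
apply/nearW => w; rewrite big_cons -/(n w) -/(a w).
have := count_step p (pos x s u w : bool) (n0 w); rewrite -/(alive x s u w) -/(a w) => cs.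
rewrite [a w + _]addrC; apply: le_trans (ler_wpM2l C'0 (ler_wpM2l (P0 w) cs)).
rewrite -subr_ge0 (_ : _ - _ = B * (k' * (Psi w * a w * (C + n w ^+ p)))); last first.
  rewrite /C' /U2 /U3; move: (n w ^+ p.+1) (n w ^+ p) => n1 n2.
  by field.
by do 3 apply: mulr_ge0 => //; apply: addr_ge0 => //; exact: exprn_ge0.
Qed.

Lemma alive_sum_pop x s (l : seq word) w : uniq l -> falive (cfg Y x s w) ->
  \sum_(u <- l) alive x s u w <= pop x s w.
Proof.
move=> ul fw; have [L uL zL] := falive_seq fw; rewrite popE//.
rewrite (xevE _ (undup_uniq (l ++ L))); last first.
  by move=> u /zL uL'; rewrite mem_undup mem_cat uL' orbT.
apply: (@le_trans _ _ (\sum_(u <- undup (l ++ L)) alive x s u w)).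
  apply: ler_sum_subset => //; first exact: undup_uniq.
  by move=> u ul'; rewrite mem_undup mem_cat ul'.
by apply: ler_sum => u _; rewrite /alive_at /cfg; case: (pos x s u w).
Qed.

Lemma incr_sumE h x s t w (l : seq word) : 0 <= s -> 0 <= t -> uniq l ->
  (forall u, pos x s u w <> None -> u \in l) -> falive (cfg Y x (s + t) w) ->
  \sum_(u <- l) incr h x s t u w = xev h (cfg Y x (s + t) w) - xev (mean t h) (cfg Y x s w).
Proof.
move=> s0 t0 ul al ft.
rewrite (xev_branching gamma0 mgamma gammaG h s0 t0 ul al ft) (xevE _ ul)//.
rewrite -sumrB; apply: eq_bigr => u _; rewrite /incr /dev /cfg.
by case: (pos x s u w) => [z|]//=; rewrite subr0.
Qed.

Lemma meanZ (c : R) h t z : mfun h -> (forall y, `|h y| <= 1) ->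
  mean t (fun y => c * h y) z = c * mean t h z.
Proof.
move=> mh h1.
have e : (\int[Pr z]_w (xev (fun y => c * h y) (cfg Y z t w))%:E = (c * mean t h z)%:E)%E.
  transitivity (\int[Pr z]_w (c * xev h (cfg Y z t w))%:E)%E.
    apply: pint_ae_eq.
    - by apply: measurable_xev_cfg => //; exact: measurable_funM.
    - by apply: measurable_funM => //; exact: measurable_xev_cfg.
    - by apply: filterS (falive_ae z t) => w fw; exact: xevZ.
  under eq_integral do rewrite EFinM.
  rewrite integralZl//; last exact: (xev_integrable).
  by rewrite (meanE mh h1).
exact: (congr1 fine e).
Qed.

(** On a finite configuration every large box contains all alive particles, so the sum of increments
    over boxes is eventually the fluctuation, and Fatou's lemma applies. *)
Lemma fluctuation_unit p kap : (p.*2 <= Q.+1)%N -> exists2 C, 0 <= C &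
  forall h, mfun h -> (forall y, `|h y| <= 1) -> forall x s t, 0 <= s -> 0 <= t -> kappa t <= kap ->
  (\int[Pr x]_w ((xev h (cfg Y x (s + t) w) - xev (mean t h) (cfg Y x s w)) ^+ p.*2)%:E <=
   C%:E * \int[Pr x]_w (pop x s w ^+ p)%:E)%E.
Proof.
move=> pQ; have [C C0 hC] := incr_sum_power kap pQ.
exists C => // h mh h1 x s t s0 t0 tk.
have mmean : mfun (mean t h) by exact: measurable_law_expectation.
apply: (@pint_fatou _ _ _ _ (fun K w => (\sum_(u <- box K) incr h x s t u w) ^+ p.*2)).
- move=> K; apply: measurable_funX; exact: measurable_incr_sum.
- by apply: measurable_funX; apply: measurable_funB; exact: measurable_xev_cfg.
- by move=> K w; exact: even_power_ge0.
- by move=> w; exact: even_power_ge0.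
- apply: filterS2 (falive_ae x s) (falive_ae x (s + t)) => w fs ft.
  have [L uL zL] := falive_seq fs; have [K0 LK] := box_cover L.
  exists K0 => K K0K; rewrite (incr_sumE h s0 t0)//; first exact: uniq_box.
  by move=> u /zL/LK; exact: box_mono.
- move=> K; have := hC h mh h1 x s t t0 tk (box K) (uniq_box K) _ (past1 x s).
  rewrite (_ : (\int[_]_w (cst 1 w * _)%:E)%E =
      (\int[Pr x]_w ((\sum_(u <- box K) incr h x s t u w) ^+ p.*2)%:E)%E); last first.
    by apply: eq_integral => w _; rewrite mul1r.
  move=> le1; apply: (le_trans le1); rewrite lee_wpmul2l ?lee_fin//.
  have ms := measurable_alive_sum x s (box K).
  have n0 w : 0 <= \sum_(u <- box K) alive x s u w.
    by apply: sumr_ge0 => u _; case/andP: (alive01 x s u w).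
  apply: pint_le.
  - by apply: measurable_funM => //; exact: measurable_funX.
  - by apply: measurable_funX; exact: measurable_pop.
  - by move=> w; rewrite mul1r exprn_ge0.
  - by move=> w; rewrite exprn_ge0 ?pop_ge0.
  - apply: filterS (falive_ae x s) => w fs; rewrite mul1r.
    by rewrite lerXn2r ?nnegrE ?pop_ge0//; apply: alive_sum_pop => //; exact: uniq_box.
Qed.

Lemma fluctuation_power p kap : (p.*2 <= Q.+1)%N -> exists2 C, 0 <= C &
  forall h b, mfun h -> 0 < b -> (forall y, `|h y| <= b) ->
  forall x s t, 0 <= s -> 0 <= t -> kappa t <= kap ->
  (\int[Pr x]_w ((xev h (cfg Y x (s + t) w) - xev (mean t h) (cfg Y x s w)) ^+ p.*2)%:E <=
   (C * b ^+ p.*2)%:E * \int[Pr x]_w (pop x s w ^+ p)%:E)%E.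
Proof.
move=> pQ; have [C C0 hC] := fluctuation_unit kap pQ.
exists C => // h b mh b0 hb x s t s0 t0 tk.
pose g y := b^-1 * h y.
have mg : mfun g by exact: measurable_funM.
have g1 y : `|g y| <= 1.
  by rewrite /g normrM gtr0_norm ?invr_gt0// mulrC ler_pdivrMr// mul1r.
have hE : h = fun y => b * g y by apply/funext => y; rewrite /g mulVKf// gt_eqF.
have mmean : mfun (mean t g) by exact: measurable_law_expectation.
have mgd : measT (fun w => xev g (cfg Y x (s + t) w) - xev (mean t g) (cfg Y x s w)).
  by apply: measurable_funB; exact: measurable_xev_cfg.
apply: (@le_trans _ _ (\int[Pr x]_w (b ^+ p.*2 *
    (xev g (cfg Y x (s + t) w) - xev (mean t g) (cfg Y x s w)) ^+ p.*2)%:E)%E).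
  rewrite le_eqVlt; apply/orP; left; apply/eqP; apply: pint_ae_eq.
  - apply: measurable_funX; apply: measurable_funB; first exact: measurable_xev_cfg.
    by apply: measurable_xev_cfg => //; exact: measurable_law_expectation.
  - by apply: measurable_funM => //; exact: measurable_funX.
  - apply: filterS2 (falive_ae x s) (falive_ae x (s + t)) => w fs ft.
    have eh : mean t h = fun y => b * mean t g y.
      by apply/funext => y; rewrite -meanZ// -hE.
    by rewrite -exprMn mulrBr -(xevZ b g ft) -(xevZ b (mean t g) fs) -eh -hE.
rewrite pintZ ?even_power_ge0//; last 2 first.
- exact: measurable_funX.
- by move=> w; exact: even_power_ge0.
rewrite mulrC EFinM -muleA lee_wpmul2l ?lee_fin ?even_power_ge0//.
exact: hC.
Qed.

(** * Martingale property and backward-consistent families *)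

Section Martingale.
Variable h : E -> R.
Hypothesis mh : mfun h.
Hypothesis h1 : forall y, `|h y| <= 1.
Variables (x : E) (s t : R).
Hypothesis s0 : 0 <= s.
Hypothesis t0 : 0 <= t.
Variable Psi : Omega -> R.
Hypothesis pPsi : past x s Psi.

Let P0 w : 0 <= Psi w. Proof. by case/andP: (pPsi.1 w). Qed.
Let P1 w : Psi w <= 1. Proof. by case/andP: (pPsi.1 w). Qed.
Let mPsi := measurable_past pPsi.

Lemma incr_sum_centered (l : seq word) :
  (Pr x).-integrable setT (fun w => (Psi w * \sum_(u <- l) incr h x s t u w)%:E) /\
  (\int[Pr x]_w (Psi w * \sum_(u <- l) incr h x s t u w)%:E = 0)%E.
Proof.
elim: l => [|u l [il i0]].
  rewrite (_ : (fun w => _) = cst 0%:E); last first.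
    by apply/funext => w; rewrite big_nil mulr0.
  split; last exact: pint_cst.
  by apply/integrableP; split => //=; rewrite normr0 pint_cst ltry.
have mI : measT (fun w => Psi w * incr h x s t u w).
  by apply: measurable_funM => //; exact: measurable_incr.
have a1 : (\int[Pr x]_w (`|Psi w| * alive x s u w)%:E < +oo)%E.
  apply: (@le_lt_trans _ _ (\int[Pr x]_w 1%:E)%E); last by rewrite pint_cst ltry.
  apply: pint_le => //.
  - apply: measurable_funM; first exact: measurableT_comp.
    exact: (measurable_of_hist gamma0 mgamma (@measurable_alive_hist x s u u)).
  - by move=> w; rewrite mulr_ge0//; case/andP: (alive01 x s u w).
  - apply/nearW => w; have /andP[a0 a1] := alive01 x s u w.
    by rewrite ger0_norm// mulr_ile1.
have [lty e] := incr_orthogonal mh h1 t0 (pPsi.2 u) a1.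
have iu0 : (\int[Pr x]_w (Psi w * incr h x s t u w)%:E = 0)%E.
  rewrite pint_parts e subee// fin_numE; move: lty; rewrite e => lty.
  rewrite (lt_eqF lty) andbT.
  have := pint_ge0 (Pr x) (pp_ge0 (fun w => - (Psi w * incr h x s t u w))).
  by apply: contraTN => /eqP ->.
have iu : (Pr x).-integrable setT (fun w => (Psi w * incr h x s t u w)%:E).
  apply/integrableP; split; first exact/measurable_EFinP.
  have mI1 : measT (fun w => `|incr h x s t u w|).
    by apply: measurableT_comp => //; exact: measurable_incr.
  apply: le_lt_trans (incr_sum_moment mh h1 x s t0 [:: u] (isT : (1 <= Q.+1)%N)).
  apply: pint_le.
  - exact: measurableT_comp.
  - by under eq_fun do rewrite big_seq1 expr1.
  - by [].
  - by move=> w; rewrite exprn_ge0.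
  - by apply/nearW => w; rewrite big_seq1 expr1 normrM ler_piMl// ger0_norm.
have eE : (fun w => (Psi w * \sum_(u <- u :: l) incr h x s t u w)%:E) =
   ((fun w => (Psi w * incr h x s t u w)%:E) \+ (fun w => (Psi w * \sum_(u <- l) incr h x s t u w)%:E))%E.
  by apply/funext => w; rewrite big_cons mulrDr EFinD.
rewrite eE; split; first exact: integrableD.
by rewrite integralD//= iu0 i0 adde0.
Qed.

(** Dominated convergence along boxes, every finite sum of increments being centred; the dominating
    variable is the population at s + t plus [kappa t] times the population at s. *)
Lemma martingale_increment :
  (Pr x).-integrable setT (fun w => (Psi w * (xev h (cfg Y x (s + t) w) - xev (mean t h) (cfg Y x s w)))%:E) /\
  (\int[Pr x]_w (Psi w * (xev h (cfg Y x (s + t) w) - xev (mean t h) (cfg Y x s w)))%:E = 0)%E.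
Proof.
have k0 : 0 <= kappa t by exact: le_trans ler01 (kappa_ge1 _).
pose g w := pop x (s + t) w + kappa t * pop x s w.
have mp r := measurable_pop x r.
have g0 w : 0 <= g w by rewrite addr_ge0 ?mulr_ge0 ?pop_ge0.
have mg : measT g by apply: measurable_funD => //; exact: measurable_funM.
have ig : (Pr x).-integrable setT (fun w => (g w)%:E).
  apply/integrableP; split; first exact/measurable_EFinP.
  under eq_integral do rewrite abse_EFin (ger0_norm (g0 _)).
  rewrite pintD//; last 3 first.
  - exact: measurable_funM.
  - by move=> w; exact: pop_ge0.
  - by move=> w; rewrite mulr_ge0 ?pop_ge0.
  rewrite pintZ//; last by move=> w; exact: pop_ge0.
  rewrite lte_add_pinfty//; first exact: le_lt_trans (pop_lty x (s + t)) (ltry _).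
  rewrite lte_mul_pinfty ?lee_fin//.
  exact: le_lt_trans (pop_lty x s) (ltry _).
have mmean : mfun (mean t h) by exact: measurable_law_expectation.
pose f_ K w := (Psi w * \sum_(u <- box K) incr h x s t u w)%:E.
pose f w := (Psi w * (xev h (cfg Y x (s + t) w) - xev (mean t h) (cfg Y x s w)))%:E.
have [//| | | | | i1 _ cv] := @dominated_convergence _ _ _ (Pr x) setT measurableT f_ f (fun w => (g w)%:E).
- move=> K; apply/measurable_EFinP; apply: measurable_funM => //; exact: measurable_incr_sum.
- apply/measurable_EFinP; apply: measurable_funM => //.
  by apply: measurable_funB; exact: measurable_xev_cfg.
- apply: filterS2 (falive_ae x s) (falive_ae x (s + t)) => w fs ft _.
  have [L uL zL] := falive_seq fs; have [K0 LK] := box_cover L.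
  apply: cvg_near_cst; near=> K; rewrite /f_ /f (incr_sumE h s0 t0)//; first exact: uniq_box.
  move=> u /zL/LK; apply: box_mono; near: K; exact: nbhs_infty_ge.
- exact: ig.
- apply: filterS2 (falive_ae x s) (falive_ae x (s + t)) => w fs ft K _.
  rewrite /f_ abse_EFin lee_fin normrM (ger0_norm (P0 w)).
  apply: (@le_trans _ _ `|\sum_(u <- box K) incr h x s t u w|).
    by rewrite ler_piMl.
  have [L uL zL] := falive_seq fs.
  (* Enlarging the box to contain all alive particles bounds the partial sum by a quantity that no
     longer depends on K. *)
  set L' := undup (box K ++ L).
  have uL' : uniq L' by exact: undup_uniq.
  have zL' u : pos x s u w <> None -> u \in L'.
    by move=> /zL uu; rewrite mem_undup mem_cat uu orbT.
  apply: le_trans (ler_norm_sum _ _ _) _.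
  apply: (@le_trans _ _ (\sum_(u <- L') `|incr h x s t u w|)).
    apply: ler_sum_subset => //; first exact: uniq_box.
    by move=> u uK; rewrite mem_undup mem_cat uK.
  rewrite /g !popE// (xev_branching gamma0 mgamma gammaG _ s0 t0 uL' zL' ft) (xevE _ uL' zL').
  rewrite mulr_sumr -big_split/=; apply: ler_sum => u _.
  rewrite /incr /dev /cfg; case: (pos x s u w) => [z|]/=; last by rewrite normr0 mulr0 addr0.
  rewrite mulr1; apply: le_trans (ler_normB _ _) _; apply: lerD; last exact: mean_le.
  by rewrite -[leRHS]mul1r; apply: xev_abs => //; exact: falive_sub.
split=> //; apply/esym; apply: cvg_unique cv; first exact: ereal_hausdorff.
rewrite (_ : (fun K => _) = cst 0%E); first exact: cvg_cst.
by apply/funext => K; exact: (incr_sum_centered (box K)).2.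
Unshelve. all: by end_near. Qed.

End Martingale.

Lemma measurable_past_xev h x s r u : mfun h -> (r <= s) ->
  measT ((fun w => xev h (cfg Y x r w)) : hist x s u -> R).
Proof.
move=> mh rs; apply: (measurableT_comp (measurable_xev mh)).
apply: (@measurable_conf _ _ _ (hist x s u) (cfg Y x r)) => v.
by apply: measurable_hist_pos; rewrite rs.
Qed.

(** Expectation of the centred increment with the weight 1. *)
Lemma mean_semigroup h s t : mfun h -> (forall y, `|h y| <= 1) -> 0 <= s -> 0 <= t ->
  mean s (mean t h) = mean (s + t) h.
Proof.
move=> mh h1 s0 t0; apply/funext => x.
have mmean : mfun (mean t h) by exact: measurable_law_expectation.
have [i1 i2] := martingale_increment mh h1 s0 t0 (past1 x s).
have xi := xev_integrable mh h1 x (s + t).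
have iD : (Pr x).-integrable setT (fun w => (xev h (cfg Y x (s + t) w) - xev (mean t h) (cfg Y x s w))%:E).
  by apply: eq_integrable i1 => // w _; rewrite mul1r.
have D0 : (\int[Pr x]_w (xev h (cfg Y x (s + t) w) - xev (mean t h) (cfg Y x s w))%:E = 0)%E.
  by rewrite -[RHS]i2; apply: eq_integral => w _; rewrite mul1r.
have e : (\int[Pr x]_w (xev (mean t h) (cfg Y x s w))%:E = \int[Pr x]_w (xev h (cfg Y x (s + t) w))%:E)%E.
  transitivity (\int[Pr x]_w ((xev h (cfg Y x (s + t) w))%:E -
      (xev h (cfg Y x (s + t) w) - xev (mean t h) (cfg Y x s w))%:E))%E.
    by apply: eq_integral => w _; rewrite -EFinB opprB addrC subrK.
  by rewrite integralB//= D0 sube0.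
exact: (congr1 fine e).
Qed.

(** The functions for which r -> X_r[g_r] is a martingale on [s, T]. Consistency is required for r <
    r', so a terminal function can be prescribed at T beside [mean (T - r)] at earlier times. *)
Definition family (g : R -> E -> R) (b : R -> R) (s T : R) :=
  [/\ forall r, s <= r <= T -> mfun (g r),
      forall r y, s <= r <= T -> `|g r y| <= b r &
      forall r r', s <= r -> r < r' -> r' <= T -> mean (r' - r) (g r') = g r].

(** Induction on the number of unit steps from s to T, the first step being split off by
    [split_power]. The bound at s + 1 carries the factor [th ^+ p.*2], exactly what the division by
    th costs. *)
Lemma family_fluctuation p a lam CN : (0 < p)%N -> (p.*2 <= Q.+1)%N -> lam / 2 < a -> 0 <= CN ->
  (forall x t, 0 <= t -> (\int[Pr x]_w (pop x t w ^+ p)%:E <= (CN * expR (lam * p%:R * t))%:E)%E) ->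
  exists2 K, 0 <= K & forall g B x s T, 0 < B -> 0 <= s <= T ->
    family g (fun r => B * expR (- a * r)) s T ->
  (\int[Pr x]_w ((xev (g T) (cfg Y x T w) - xev (g s) (cfg Y x s w)) ^+ p.*2)%:E <=
   (K * B ^+ p.*2 * expR (- (p.*2%:R * (a - lam / 2) * s)))%:E)%E.
Proof.
move=> p0 pQ la CN0 hN.
have [C C0 hC] := fluctuation_power (kappa 1) pQ.
(* th is the decay of one unit step for the fluctuation itself, before taking powers. *)
pose c := a - lam / 2; pose th := expR (- c).
have c0 : 0 < c by rewrite subr_gt0.
have th01 : 0 < th < 1 by rewrite expR_gt0 -expR0 ltr_expR oppr_lt0.
have /andP[th0 th1] := th01; have th1' : 0 < 1 - th by rewrite subr_gt0.
(* Constant of a single step; the exponential allows the bound on g at T to be evaluated at s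
   instead, for T <= s + 1. *)
pose K0 := C * CN * expR (p.*2%:R * `|a|).
have K00 : 0 <= K0 by rewrite mulr_ge0 ?expR_ge0// mulr_ge0.
(* Fixed point of the recursion: (1 - th) K0/(1 - th)^(2p) + th K = K. *)
pose K := K0 / (1 - th) ^+ p.*2.
have e0 : 0 < (1 - th) ^+ p.*2 by rewrite exprn_gt0.
have KK : K0 <= K.
  rewrite ler_peMr// invf_ge1// exprn_ile1 ?(ltW th1')//.
  by rewrite lerBlDr lerDl ltW.
have Kge0 : 0 <= K by exact: le_trans KK.
have base g B x s T : 0 < B -> 0 <= s <= T -> T <= s + 1 ->
    family g (fun r => B * expR (- a * r)) s T ->
  (\int[Pr x]_w ((xev (g T) (cfg Y x T w) - xev (g s) (cfg Y x s w)) ^+ p.*2)%:E <=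
   (K0 * B ^+ p.*2 * expR (- (p.*2%:R * c * s)))%:E)%E.
  move=> B0 /andP[s0 sT] Ts [mg gb gm].
  have [eT|nT] := eqVneq s T.
    rewrite (_ : \int[_]_w _ = 0)%E ?lee_fin ?mulr_ge0 ?even_power_ge0 ?expR_ge0//.
    transitivity (\int[Pr x]_w 0%:E)%E; last exact: pint_cst.
    by apply: eq_integral => w _; rewrite eT subrr expr0n double_eq0 eqn0Ngt p0.
  have sT' : s < T by rewrite lt_neqAle nT.
  have Ts0 : 0 <= T - s by rewrite subr_ge0.
  have Ts1 : T - s <= 1 by rewrite lerBlDl.
  have := hC (g T) (B * expR (- a * T)) (mg T _) _ (gb T ^~ _) x s (T - s) s0 Ts0 (kappa_mono Ts1).
  rewrite (_ : s + (T - s) = T); last by ring.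
  rewrite gm// sT lexx => hC'.
  apply: le_trans (hC' isT _ isT) _; first by rewrite mulr_gt0 ?expR_gt0.
  apply: le_trans (lee_wpmul2l _ (hN x s s0)) _.
    by rewrite lee_fin mulr_ge0// exprn_ge0// mulr_ge0 ?expR_ge0// ltW.
  rewrite -EFinM lee_fin exprMn -expRM_natl /K0.
  have B20 : 0 <= B ^+ p.*2 by exact: even_power_ge0.
  rewrite [leLHS](_ : _ = C * CN * B ^+ p.*2 * (expR (p.*2%:R * (- a * T)) * expR (lam * p%:R * s))); last by ring.
  rewrite [leRHS](_ : _ = C * CN * B ^+ p.*2 * (expR (p.*2%:R * `|a|) * expR (- (p.*2%:R * c * s)))); last by ring.
  rewrite ler_wpM2l ?mulr_ge0// -!expRD ler_expR.
  have -> : p%:R = p.*2%:R / 2 :> R by rewrite -muln2 natrM mulfK.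
  have : - a * (T - s) <= `|a|.
    apply: (@le_trans _ _ (`|a| * (T - s))); last by rewrite ler_piMr.
    by rewrite ler_wpM2r// -normrN ler_norm.
  move=> /(ler_wpM2l (ler0n R p.*2)).
  rewrite -subr_ge0 => h3; rewrite -subr_ge0; apply: (le_trans h3).
  by rewrite le_eqVlt; apply/orP; left; apply/eqP; rewrite /c; field.
exists K => // g B x s T B0 sT fam.
have [n Tn] : exists n : nat, T <= s + n.+1%:R.
  exists (Num.truncn (T - s)); rewrite -lerBlDl ltW//.
  have Ts0 : 0 <= T - s by rewrite subr_ge0; case/andP: sT.
  by have /andP[] := Num.Theory.truncn_itv Ts0.
elim: n s sT Tn fam => [|n ih] s /andP[s0 sT] Tn fam.
  apply: le_trans (base g B x s T B0 _ Tn fam) _; first by rewrite s0.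
  by rewrite lee_fin ler_wpM2r ?expR_ge0// ler_wpM2r ?even_power_ge0.
have [T1|T1] := leP T (s + 1).
  apply: le_trans (base g B x s T B0 _ T1 fam) _; first by rewrite s0.
  by rewrite lee_fin ler_wpM2r ?expR_ge0// ler_wpM2r ?even_power_ge0.
have [mg gb gm] := fam.
have s1 : s <= s + 1 by rewrite lerDl.
have fam1 : family g (fun r => B * expR (- a * r)) s (s + 1).
  split=> [r /andP[sr rs]|r y /andP[sr rs]|r r' sr rr' r's].
  - by apply: mg; rewrite sr (le_trans rs)// ltW.
  - by apply: gb; rewrite sr (le_trans rs)// ltW.
  - by apply: gm => //; rewrite (le_trans r's)// ltW.
have fam2 : family g (fun r => B * expR (- a * r)) (s + 1) T.
  split=> [r /andP[sr rs]|r y /andP[sr rs]|r r' sr rr' r's].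
  - by apply: mg; rewrite rs (le_trans s1).
  - by apply: gb; rewrite rs (le_trans s1).
  - by apply: gm => //; rewrite (le_trans s1).
have i1 := base g B x s (s + 1) B0 (introT andP (conj s0 s1)) (lexx _) fam1.
have s10 : 0 <= s + 1 <= T by rewrite addr_ge0// ltW.
have Tn' : T <= s + 1 + n.+1%:R by rewrite -addrA -natr1 [1 + _]addrC in Tn *.
have i2 := ih (s + 1) s10 Tn' fam2.
pose x1 w := xev (g (s + 1)) (cfg Y x (s + 1) w) - xev (g s) (cfg Y x s w).
pose x2 w := xev (g T) (cfg Y x T w) - xev (g (s + 1)) (cfg Y x (s + 1) w).
have mx r : s <= r <= T -> measT (fun w => xev (g r) (cfg Y x r w)).
  by move=> rr; apply: measurable_xev_cfg => //; exact: mg.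
have ms : s <= s <= T by rewrite lexx.
have ms1 : s <= s + 1 <= T by rewrite s1 ltW.
have mT : s <= T <= T by rewrite lexx sT.
have mx1 : measT x1 by apply: measurable_funB; exact: mx.
have mx2 : measT x2 by apply: measurable_funB; exact: mx.
have mq (y : Omega -> R) th' : measT y -> measT (fun w => (y w / th') ^+ p.*2).
  by move=> my; apply: measurable_funX; exact: measurable_funM.
apply: (@le_trans _ _ (\int[Pr x]_w ((1 - th) * (x1 w / (1 - th)) ^+ p.*2 + th * (x2 w / th) ^+ p.*2)%:E)%E).
  apply: pint_le.
  - by apply: measurable_funX; apply: measurable_funB; exact: mx.
  - by apply: measurable_funD; apply: measurable_funM => //; exact: mq.
  - by move=> w; exact: even_power_ge0.
  - by move=> w; rewrite addr_ge0// mulr_ge0 ?even_power_ge0// ltW.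
  - apply/nearW => w; apply: le_trans (split_power p (x1 w) (x2 w) th01).
    by rewrite /x1 /x2 [X in _ <= X ^+ _]addrC addrA subrK.
pose M := B ^+ p.*2 * expR (- (p.*2%:R * c * s)).
have M0 : 0 <= M by rewrite mulr_ge0 ?expR_ge0 ?even_power_ge0.
have iZ (y : Omega -> R) th' D : measT y -> 0 < th' ->
    (\int[Pr x]_w (y w ^+ p.*2)%:E <= D%:E)%E ->
    (\int[Pr x]_w (th' * (y w / th') ^+ p.*2)%:E <= (th' * (D / th' ^+ p.*2))%:E)%E.
  move=> my t'0 yD.
  have yp : measT (fun w => y w ^+ p.*2) by exact: measurable_funX.
  rewrite (_ : \int[_]_w _ = \int[Pr x]_w ((th' / th' ^+ p.*2) * y w ^+ p.*2)%:E)%E; last first.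
    by apply: eq_integral => w _; rewrite expr_div_n; congr EFin; ring.
  rewrite pintZ//; last 2 first.
  - by rewrite divr_ge0 ?exprn_ge0// ltW.
  - by move=> w; exact: even_power_ge0.
  have -> : th' * (D / th' ^+ p.*2) = th' / th' ^+ p.*2 * D by ring.
  by apply: lee_scale => //; rewrite divr_ge0 ?exprn_ge0// ltW.
rewrite pintD; last 4 first.
- by apply: measurable_funM => //; exact: mq.
- by apply: measurable_funM => //; exact: mq.
- by move=> w; rewrite mulr_ge0 ?even_power_ge0// ltW.
- by move=> w; rewrite mulr_ge0 ?even_power_ge0// ltW.
apply: le_trans (leeD (iZ _ _ _ mx1 th1' i1) (iZ _ _ _ mx2 th0 i2)) _.
rewrite -EFinD lee_fin.
have -> : expR (- (p.*2%:R * (a - lam / 2) * (s + 1))) = th ^+ p.*2 * expR (- (p.*2%:R * c * s)).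
  rewrite /th -expRM_natl -expRD; congr expR; rewrite -mulr_natl /c; ring.
rewrite le_eqVlt; apply/orP; left; apply/eqP.
rewrite /K -/c; move: (expR _) => ex; field.
by rewrite !expf_neq0 ?gt_eqF.
Qed.

(** Strong induction on p. For p >= 2 the moment of order q = 2 ceil(p/2) >= p is reached through
    the martingale of the functions psi_{T-r} 1, whose fluctuation costs only the moment of order
    ceil(p/2) < p. *)
Lemma population_growth lam C1 : 0 < lam ->
  (forall t z, 0 <= t -> `|mean t (cst 1) z| <= C1 * expR (lam * t)) ->
  forall p, (p.*2 <= Q.+1)%N -> exists2 CN, 0 <= CN & forall x t, 0 <= t ->
  (\int[Pr x]_w (pop x t w ^+ p)%:E <= (CN * expR (lam * p%:R * t))%:E)%E.
Proof.
move=> lam0 hm.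
have m1 : mfun (cst 1) by exact: measurable_cst.
have b1 (y : E) : `|(cst 1 : E -> R) y| <= 1 by rewrite normr1.
elim/ltn_ind=> -[|[|p]] ih pQ.
- exists 1 => // x t t0.
  by rewrite mulr0 mul0r expR0 mulr1 -[leRHS](pint_cst (Pr x)).
- exists `|C1| => // x t t0; rewrite mulr1.
  rewrite (_ : \int[_]_w _ = \int[Pr x]_w (xev (cst 1) (cfg Y x t w))%:E)%E; last first.
    apply: pint_ae_eq.
    - by apply: measurable_funX; exact: measurable_pop.
    - exact: measurable_xev_cfg.
    - by apply: filterS (falive_ae x t) => w fw; rewrite expr1 popE.
  rewrite (meanE m1 b1) lee_fin.
  apply: le_trans (ler_norm _) _; apply: le_trans (hm t x t0) _.
  by rewrite ler_wpM2r ?expR_ge0// ler_norm.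
(* Rounding up is compatible with the limit Q + 1 on the orders because [p.+2.*2 <= Q.+1]. *)
pose p' := uphalf p.+2.
have p'p : (p' < p.+2)%N by rewrite /p'; lia.
have p'0 : (0 < p')%N by [].
have pp' : (p.+2 <= p'.*2)%N by rewrite /p'; lia.
have p'Q : (p'.*2 <= Q.+1)%N by move: pQ; rewrite /p'; lia.
have [CN CN0 hN] := ih p' p'p p'Q.
have la : lam / 2 < lam by rewrite ltr_pdivrMr// ltr_pMr// ltr1n.
have [K K0 hK] := family_fluctuation p'0 p'Q la CN0 hN.
(* The 1 gives positivity and covers the terminal function [cst 1]. *)
pose C1' := `|C1| + 1; have C10 : 0 < C1' by rewrite ltr_wpDl.
pose k := kappa 0; have k0 : 0 <= k by exact: le_trans ler01 (kappa_ge1 _).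
pose q := p'.*2.
pose D := 2 ^+ q * (K * C1' ^+ q + C1' ^+ q * k).
have Cq : 0 <= C1' ^+ q by rewrite exprn_ge0// ltW.
have D0 : 0 <= D by rewrite mulr_ge0 ?exprn_ge0// addr_ge0// mulr_ge0.
exists (1 + D); first by rewrite addr_ge0.
move=> x T T0.
pose B := C1' * expR (lam * T); have B0 : 0 < B by rewrite mulr_gt0 ?expR_gt0.
(* The terminal value is prescribed, so that [mean 0] need not be identified with the identity. *)
pose g (r : R) : E -> R := if r == T then cst 1 else mean (T - r) (cst 1).
have mg r : mfun (g r).
  by rewrite /g; case: ifP => // _; exact: measurable_law_expectation.
have gb r y : 0 <= r <= T -> `|g r y| <= B * expR (- lam * r).
  move=> /andP[r0 rT]; rewrite /B -mulrA -expRD /g; case: eqVneq => [->|_].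
    rewrite (_ : _ + _ = 0); last by ring.
    by rewrite expR0 mulr1 normr1 lerDr.
  apply: le_trans (hm _ y _) _; first by rewrite subr_ge0.
  rewrite (_ : lam * T + - lam * r = lam * (T - r)); last by ring.
  by rewrite ler_wpM2r ?expR_ge0// (le_trans (ler_norm _))// lerDl.
have fam : family g (fun r => B * expR (- lam * r)) 0 T.
  split=> [r _|r y rT|r r' r0 rr' r'T]; [exact: mg|exact: gb|].
  rewrite /g [r == T]lt_eqF; last exact: lt_le_trans r'T.
  have [->//|r'nT] := eqVneq r' T.
  rewrite mean_semigroup ?subr_ge0 ?(ltW rr')//.
  by rewrite (_ : r' - r + (T - r') = T - r)//; ring.
have := hK g B x 0 T B0; rewrite lexx T0 => /(_ isT fam).
rewrite mulr0 oppr0 expR0 mulr1 => i1.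
pose x1 w := xev (g T) (cfg Y x T w) - xev (g 0) (cfg Y x 0 w).
pose x0 w := pop x 0 w.
have mx1 : measT x1 by apply: measurable_funB; exact: measurable_xev_cfg.
have mp r := measurable_pop x r.
have p0 r w : 0 <= pop x r w by exact: pop_ge0.
have i0 : (\int[Pr x]_w (pop x 0 w ^+ q)%:E <= k%:E)%E.
  apply: le_trans (pop_moment x 0); apply: pint_le.
  - exact: measurable_funX.
  - by apply: measurable_funX; exact: measurable_funD.
  - by move=> w; rewrite exprn_ge0.
  - by move=> w; rewrite exprn_ge0// addr_ge0.
  - apply/nearW => w; apply: (@le_trans _ _ ((pop x 0 w + 1) ^+ q)).
      by rewrite lerXn2r ?nnegrE ?addr_ge0// lerDl.
    by rewrite ler_weXn2l// lerDr.
have iT : (\int[Pr x]_w (pop x T w ^+ q)%:E <= (D * expR (lam * T) ^+ q)%:E)%E.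
  apply: (@le_trans _ _ (\int[Pr x]_w (2 ^+ q * (x1 w ^+ q + B ^+ q * pop x 0 w ^+ q))%:E)%E).
    apply: pint_le.
    - exact: measurable_funX.
    - apply: measurable_funM => //; apply: measurable_funD; first exact: measurable_funX.
      by apply: measurable_funM => //; exact: measurable_funX.
    - by move=> w; rewrite exprn_ge0.
    - move=> w; apply: mulr_ge0; first exact: exprn_ge0.
      by apply: addr_ge0; [exact: even_power_ge0|apply: mulr_ge0; apply: exprn_ge0 => //; exact: ltW].
    - apply: filterS2 (falive_ae x 0) (falive_ae x T) => w f0 fT.
      have e : pop x T w = xev (g T) (cfg Y x T w) by rewrite popE// /g eqxx.
      apply: (@le_trans _ _ ((`|x1 w| + B * pop x 0 w) ^+ q)).
        apply: lerXn2r; rewrite ?nnegrE//.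
          by apply: addr_ge0 => //; apply: mulr_ge0 => //; exact: ltW.
        apply: (le_trans (ler_norm _)); rewrite e -(subrK (xev (g 0) (cfg Y x 0 w)) (xev (g T) _)).
        apply: (le_trans (ler_normD _ _)); apply: lerD => //.
        rewrite popE//; apply: xev_abs => // y.
        by have := gb 0 y; rewrite lexx T0 mulr0 expR0 mulr1; exact.
      apply: (le_trans (exprD_le _ _ _)) => //; first by apply: mulr_ge0 => //; exact: ltW.
      by rewrite exprMn normr_even.
  rewrite pintZ ?exprn_ge0//; last 2 first.
  - apply: measurable_funD; first exact: measurable_funX.
    by apply: measurable_funM => //; exact: measurable_funX.
  - move=> w; apply: addr_ge0; first exact: even_power_ge0.
    by apply: mulr_ge0; apply: exprn_ge0 => //; exact: ltW.
  rewrite pintD; last 4 first.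
  - exact: measurable_funX.
  - by apply: measurable_funM => //; exact: measurable_funX.
  - by move=> w; exact: even_power_ge0.
  - by move=> w; apply: mulr_ge0; apply: exprn_ge0 => //; exact: ltW.
  rewrite pintZ; last 3 first.
  - exact: measurable_funX.
  - by apply: exprn_ge0; exact: ltW.
  - by move=> w; exact: exprn_ge0.
  have -> : D * expR (lam * T) ^+ q = 2 ^+ q * (K * B ^+ q + B ^+ q * k).
    by rewrite /D /B exprMn; ring.
  rewrite (EFinM (2 ^+ q)) lee_wpmul2l ?lee_fin ?exprn_ge0// EFinD; apply: leeD => //.
  by apply: lee_scale => //; apply: exprn_ge0; exact: ltW.
(* Passage from order q back to order p + 2 <= q: u^(p+2) <= 1 + u^q applied to u = N_T/m. *)
pose m := expR (lam * T); have m0 : 0 < m by exact: expR_gt0.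
have mm : expR (lam * p.+2%:R * T) = m ^+ p.+2.
  by rewrite /m -expRM_natl; congr expR; ring.
apply: (@le_trans _ _ (\int[Pr x]_w (m ^+ p.+2 * (1 + m ^- q * pop x T w ^+ q))%:E)%E).
  apply: pint_le.
  - exact: measurable_funX.
  - apply: measurable_funM => //; apply: measurable_funD => //.
    by apply: measurable_funM => //; exact: measurable_funX.
  - by move=> w; exact: exprn_ge0.
  - move=> w; apply: mulr_ge0; first by rewrite exprn_ge0// ltW.
    by apply: addr_ge0 => //; apply: mulr_ge0; rewrite ?invr_ge0 exprn_ge0// ltW.
  - apply/nearW => w.
    have := @expr_le1D R (pop x T w / m) p.+2 q (divr_ge0 (p0 _ _) (ltW m0)) pp'.
    rewrite !expr_div_n ler_pdivrMr ?exprn_gt0// => le1; apply: le_trans le1 _.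
    by rewrite mulrC [m ^- q * _]mulrC.
rewrite pintZ ?exprn_ge0// ?(ltW m0)//; last 2 first.
- by apply: measurable_funD => //; apply: measurable_funM => //; exact: measurable_funX.
- move=> w; apply: addr_ge0 => //; apply: mulr_ge0; first by rewrite invr_ge0 exprn_ge0// ltW.
  exact: exprn_ge0.
have mq0 : 0 <= m ^- q by rewrite invr_ge0 exprn_ge0// ltW.
rewrite pintD//; last 2 first.
- by apply: measurable_funM => //; exact: measurable_funX.
- by move=> w; apply: mulr_ge0 => //; exact: exprn_ge0.
rewrite pint_cst pintZ//; last 2 first.
- exact: measurable_funX.
- by move=> w; exact: exprn_ge0.
rewrite mm mulrC; apply: lee_scale; first by apply: exprn_ge0; exact: ltW.
rewrite EFinD leeD2l//; apply: le_trans (lee_wpmul2l _ iT) _; first by rewrite lee_fin.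
rewrite -EFinM lee_fin -/m le_eqVlt; apply/orP; left; apply/eqP.
by rewrite mulrCA mulVf ?mulr1// expf_neq0// gt_eqF.
Qed.

Lemma martingale_increment_bounded h b x s t Psi : mfun h -> 0 < b -> (forall y, `|h y| <= b) ->
  0 <= s -> 0 <= t -> past x s Psi ->
  let D w := Psi w * (xev h (cfg Y x (s + t) w) - xev (mean t h) (cfg Y x s w)) in
  (\int[Pr x]_w `|D w|%:E < +oo)%E /\ (\int[Pr x]_w (D w)%:E = 0)%E.
Proof.
move=> mh b0 hb s0 t0 pPsi D.
pose g y := b^-1 * h y.
have mg : mfun g by exact: measurable_funM.
have g1 y : `|g y| <= 1.
  by rewrite /g normrM gtr0_norm ?invr_gt0// mulrC ler_pdivrMr// mul1r.
have hE : h = fun y => b * g y by apply/funext => y; rewrite /g mulVKf// gt_eqF.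
have [i1 i2] := martingale_increment mg g1 s0 t0 pPsi.
have mPsi := measurable_past pPsi.
have mD : measT D.
  apply: measurable_funM => //; apply: measurable_funB; first exact: measurable_xev_cfg.
  by apply: measurable_xev_cfg => //; exact: measurable_law_expectation.
pose D1 w := Psi w * (xev g (cfg Y x (s + t) w) - xev (mean t g) (cfg Y x s w)).
have mD1 : measT D1.
  apply: measurable_funM => //; apply: measurable_funB; first exact: measurable_xev_cfg.
  by apply: measurable_xev_cfg => //; exact: measurable_law_expectation.
have DD : {ae Pr x, forall w, D w = b * D1 w}.
  apply: filterS2 (falive_ae x s) (falive_ae x (s + t)) => w fs ft.
  have eh : mean t h = fun y => b * mean t g y.
    by apply/funext => y; rewrite -(meanZ)// -hE.
  have e1 : xev h (cfg Y x (s + t) w) = b * xev g (cfg Y x (s + t) w).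
    by rewrite {1}hE (xevZ b g ft).
  have e2 : xev (mean t h) (cfg Y x s w) = b * xev (mean t g) (cfg Y x s w).
    by rewrite eh (xevZ b (mean t g) fs).
  by rewrite /D /D1 e1 e2; ring.
have mbD : measT (fun w => b * D1 w) by exact: measurable_funM.
split.
  have -> : (\int[Pr x]_w `|D w|%:E = \int[Pr x]_w (b * `|D1 w|)%:E)%E.
    apply: pint_ae_eq; first exact: measurableT_comp.
      by apply: measurable_funM => //; exact: measurableT_comp.
    by apply: filterS DD => w ->; rewrite normrM gtr0_norm.
  rewrite pintZ ?ltW//; last exact: measurableT_comp.
  rewrite lte_mul_pinfty ?lee_fin ?ltW//.
  by have /integrableP[_] := i1.
rewrite (pint_ae_eq mD mbD DD); under eq_integral do rewrite EFinM.
by rewrite integralZl// i2 mule0.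
Qed.

Lemma past_mono x s r Psi : s <= r -> past x s Psi -> past x r Psi.
Proof.
move=> sr [P01 mP]; split=> // u _ B mB; have h := mP u measurableT B mB.
have sub : hist_events Y x s u `<=` hist_events Y x r u.
  move=> _ [r' [v [C [c1 c2 ->]]]]; exists r', v, C; split=> //.
  by case/orP: c1 => [r's|->]; rewrite ?orbT// (le_trans r's sr).
by rewrite setTI in h *; exact: (sub_sigma_algebra2 sub h).
Qed.

Lemma past_guard x s Psi (b : Omega -> bool) : past x s Psi ->
  (forall u, measT (b : hist x s u -> bool)) ->
  past x s (fun w => Psi w * (b w)%:R).
Proof.
move=> [P01 mP] mb; split=> [w|u]; last first.
  apply: measurable_funM => //.
  have m2 : measT (fun b : bool => b%:R : R) by [].
  exact: (measurableT_comp m2 (mb u)).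
have /andP[P0 P1] := P01 w; case: (b w); rewrite ?mulr1 ?P0//.
by rewrite mulr0 lexx ler01.
Qed.

(** * Maximal inequality and almost sure limits *)

Section Family.
Variables (g : R -> E -> R) (b : R -> R).
Hypothesis b0 : forall r, 0 <= r -> 0 < b r.
Hypothesis hfam : forall T, 0 <= T -> family g b 0 T.
Variable x : E.
Local Notation M r w := (xev (g r) (cfg Y x r w)).

Let mg r : 0 <= r -> mfun (g r).
Proof. by move=> r0; have [h _ _] := hfam r0; apply: h; rewrite r0 lexx. Qed.

Lemma measurable_family r : 0 <= r -> measT (fun w => M r w).
Proof. by move=> r0; apply: measurable_xev_cfg => //; exact: mg. Qed.

Lemma measurable_family_hist s r u : 0 <= r <= s -> measT ((fun w => M r w) : hist x s u -> R).
Proof. by move=> /andP[r0 rs]; apply: measurable_past_xev => //; exact: mg. Qed.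

Lemma family_centered Psi s T : past x s Psi -> 0 <= s <= T ->
  let D w := Psi w * (M T w - M s w) in
  (\int[Pr x]_w `|D w|%:E < +oo)%E /\ (\int[Pr x]_w (D w)%:E = 0)%E.
Proof.
move=> pPsi /andP[s0 sT] D; have [e|nT] := eqVneq s T.
  have -> : D = cst 0 by apply/funext => w; rewrite /D e subrr mulr0.
  split; last exact: pint_cst.
  by under eq_integral do rewrite normr0; rewrite pint_cst ltry.
have T0 := le_trans s0 sT; have [_ gb gm] := hfam T0.
have := martingale_increment_bounded (mg T0) (b0 T0) (fun y => gb T y _) s0 (_ : 0 <= T - s) pPsi.
rewrite subr_ge0 (_ : s + (T - s) = T); last by ring.
have gs : mean (T - s) (g T) = g s by apply: gm => //; rewrite lt_neqAle nT.
by rewrite gs T0 lexx /= => h; exact: (h isT sT).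
Qed.

(** The sign of M_r - M_N is known at r; multiplying the increment M_T - M_r by it gives a centred
    variable, and the absolute value at T dominates the signed difference. *)
Lemma abs_submartingale Psi N r T : past x r Psi -> 0 <= N -> N <= r -> r <= T ->
  (\int[Pr x]_w (Psi w * `|M r w - M N w|)%:E <= \int[Pr x]_w (Psi w * `|M T w - M N w|)%:E)%E.
Proof.
move=> pPsi N0 Nr rT; have r0 := le_trans N0 Nr; have T0 := le_trans r0 rT.
have mPsi := measurable_past pPsi.
have P0 w : 0 <= Psi w by case/andP: (pPsi.1 w).
pose pos w := 0 <= M r w - M N w.
have mpos u : measT (pos : hist x r u -> bool).
  apply: measurable_fun_ler; first exact: measurable_cst.
  by apply: measurable_funB; apply: measurable_family_hist; rewrite ?r0 ?N0 ?lexx.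
pose Pp w := Psi w * (pos w)%:R; pose Pn w := Psi w * (~~ pos w)%:R.
have pPp : past x r Pp by exact: past_guard.
have pPn : past x r Pn by apply: past_guard => // u; apply: measurable_neg; exact: mpos.
have r0T : 0 <= r <= T by rewrite r0.
have [ip ip0] := family_centered pPp r0T; have [in_ in0] := family_centered pPn r0T.
have mMr := measurable_family r0; have mMT := measurable_family T0; have mMN := measurable_family N0.
have mMd : measT (fun w => M T w - M r w) by exact: measurable_funB.
have mPp := measurable_past pPp; have mPn := measurable_past pPn.
have mDp : measT (fun w => Pp w * (M T w - M r w)) by exact: measurable_funM.
have mDn : measT (fun w => Pn w * (M T w - M r w)) by exact: measurable_funM.
pose D w := Pp w * (M T w - M r w) - Pn w * (M T w - M r w).
have mD : measT D by exact: measurable_funB.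
have iP : (Pr x).-integrable setT (fun w => (Pp w * (M T w - M r w))%:E).
  by apply/integrableP; split => //; exact/measurable_EFinP.
have iN : (Pr x).-integrable setT (fun w => (Pn w * (M T w - M r w))%:E).
  by apply/integrableP; split => //; exact/measurable_EFinP.
have iD : (Pr x).-integrable setT (fun w => (D w)%:E) by exact: (integrableB measurableT iP iN).
apply: (pint_le_centered _ _ mD).
- by apply: measurable_funM => //; apply: measurableT_comp => //; exact: measurable_funB.
- by apply: measurable_funM => //; apply: measurableT_comp => //; exact: measurable_funB.
- by move=> w; rewrite mulr_ge0.
- by move=> w; rewrite mulr_ge0.
- by have /integrableP[_] := iD.
- under eq_integral do rewrite EFinB.
  by rewrite integralB// ip0 in0 subee.
- apply/nearW => w; rewrite /D /Pp /Pn /pos.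
  have [h|h] := leP 0 (M r w - M N w).
    rewrite (_ : true%:R = 1 :> R)// (_ : (~~ true)%:R = 0 :> R)// mulr1 mulr0 mul0r subr0 -mulrDr.
    by rewrite ler_wpM2l// (ger0_norm h) addrC addrA subrK ler_norm.
  rewrite (_ : false%:R = 0 :> R)// (_ : (~~ false)%:R = 1 :> R)// mulr1 mulr0 mul0r sub0r -mulrBr.
  rewrite ler_wpM2l// (ltr0_norm h) -opprD [_ - _ + (_ - _)]addrC addrA subrK.
  by rewrite -normrN ler_norm.
Qed.

Lemma measurable_excess N eps l : 0 <= N -> all (fun r => 0 <= r) l ->
  measT (fun w => has (fun r => eps < `|M r w - M N w|) l).
Proof.
move=> N0; elim: l => [_|r l ih /= /andP[r0 al]]; first exact: measurable_cst.
apply: measurable_or; last exact: ih.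
apply: measurable_fun_ltr; first exact: measurable_cst.
by apply: measurableT_comp => //; apply: measurable_funB; exact: measurable_family.
Qed.

(** Doob's inequality by induction along the increasing list of times. The weight is split according
    to whether the first time exceeds eps: one part is bounded by [abs_submartingale], the other
    carries the event of no excess so far to the rest of the list. *)
Lemma maximal_inequality N T eps l Psi s : 0 < eps -> 0 <= N -> N <= s -> s <= T ->
  path <=%R s l -> all (fun r => r <= T) l -> past x s Psi ->
  (\int[Pr x]_w (eps * (Psi w * (has (fun r => eps < `|M r w - M N w|) l)%:R))%:E <=
   \int[Pr x]_w (Psi w * `|M T w - M N w|)%:E)%E.
Proof.
move=> e0 N0; elim: l Psi s => [|r l ih] Psi s Ns sT.
  move=> _ _ pPsi; apply: (@le_trans _ _ (\int[Pr x]_w 0%:E)%E).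
    by rewrite le_eqVlt; apply/orP; left; apply/eqP; apply: eq_integral => w _; rewrite !mulr0.
  rewrite pint_cst; apply: pint_ge0 => w; rewrite mulr_ge0//.
  by case/andP: (pPsi.1 w).
move=> /= /andP[sr pl] /andP[rT aT] pPsi0.
have pPsi := past_mono sr pPsi0.
have Nr := le_trans Ns sr; have r0 := le_trans N0 Nr; have T0 := le_trans r0 rT.
have P0 w : 0 <= Psi w by case/andP: (pPsi.1 w).
pose b1 w := eps < `|M r w - M N w|.
have mb1 u : measT (b1 : hist x r u -> bool).
  apply: measurable_fun_ltr; first exact: measurable_cst.
  by apply: measurableT_comp => //; apply: measurable_funB; apply: measurable_family_hist; rewrite ?r0 ?N0 ?lexx.
pose P1 w := Psi w * (b1 w)%:R; pose P2 w := Psi w * (~~ b1 w)%:R.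
have pP1 : past x r P1 by exact: past_guard.
have pP2 : past x r P2 by apply: past_guard => // u; apply: measurable_neg; exact: mb1.
have mP1 := measurable_past pP1; have mP2 := measurable_past pP2.
have mPsi := measurable_past pPsi.
have P10 w : 0 <= P1 w by case/andP: (pP1.1 w).
have P20 w : 0 <= P2 w by case/andP: (pP2.1 w).
have ih2 := ih P2 r Nr rT pl aT pP2.
have ih1 := abs_submartingale pP1 N0 Nr rT.
have mA t : 0 <= t -> measT (fun w => `|M t w - M N w|).
  by move=> t0; apply: measurableT_comp => //; apply: measurable_funB; exact: measurable_family.
pose hl w : R := (has (fun r => eps < `|M r w - M N w|) l)%:R.
have al : all (fun r => 0 <= r) l.
  apply/allP => t tl; rewrite (le_trans r0)//.
  by move: pl; rewrite (path_sortedE le_trans) => /andP[/allP/(_ _ tl)].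
have mhl : measT hl.
  have m2 : measT (fun b : bool => b%:R : R) by [].
  by apply: (measurableT_comp m2); exact: measurable_excess.
have hl0 w : 0 <= hl w by [].
have mPA t (Q1 : Omega -> R) : measT Q1 -> 0 <= t -> measT (fun w => Q1 w * `|M t w - M N w|).
  by move=> m1 t0; apply: measurable_funM => //; exact: mA.
apply: (@le_trans _ _ (\int[Pr x]_w (P1 w * `|M r w - M N w| + eps * (P2 w * hl w))%:E)%E).
  have mr1 : measT (fun w => eps * (P2 w * hl w)).
    by apply: measurable_funM => //; exact: measurable_funM.
  apply: pint_le.
  - apply: measurable_funM => //; apply: measurable_funM => //.
    have m2 : measT (fun b : bool => b%:R : R) by [].
    apply: (measurableT_comp m2); apply: measurable_or.
      apply: measurable_fun_ltr; first exact: measurable_cst.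
      exact: mA.
    exact: measurable_excess.
  - by apply: measurable_funD => //; exact: mPA.
  - by move=> w; rewrite mulr_ge0 ?(ltW e0)// mulr_ge0.
  - by move=> w; apply: addr_ge0; apply: mulr_ge0 => //; [exact: ltW|exact: mulr_ge0].
  - apply/nearW => w; rewrite /P1 /P2 -/(b1 w); case e : (b1 w).
      rewrite (_ : true%:R = 1 :> R)// (_ : (~~ true)%:R = 0 :> R)// !mulr1 mulr0 mul0r mulr0 addr0.
      by rewrite mulrC ler_wpM2l// ltW.
    by rewrite (_ : false%:R = 0 :> R)// (_ : (~~ false)%:R = 1 :> R)// !mulr1 mulr0 mul0r add0r.
have -> : (\int[Pr x]_w (Psi w * `|M T w - M N w|)%:E =
    \int[Pr x]_w (P1 w * `|M T w - M N w|)%:E + \int[Pr x]_w (P2 w * `|M T w - M N w|)%:E)%E.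
  rewrite -pintD; last 4 first.
  - exact: mPA.
  - exact: mPA.
  - by move=> w; rewrite mulr_ge0.
  - by move=> w; rewrite mulr_ge0.
  apply: eq_integral => w _; rewrite -mulrDl /P1 /P2 -mulrDr.
  by case: (b1 w); rewrite ?addr0 ?add0r mulr1.
rewrite pintD; last 4 first.
- exact: mPA.
- by apply: measurable_funM => //; exact: measurable_funM.
- by move=> w; rewrite mulr_ge0.
- by move=> w; apply: mulr_ge0; [exact: ltW|exact: mulr_ge0].
exact: leeD.
Qed.

(** Fatou's lemma along the integers beyond t, for which the bound D t is uniform. *)
Lemma family_limit_moment (W : Omega -> R) p (D : R -> R) : measT W ->
  {ae Pr x, forall w, (fun n : nat => M n%:R w) @ \oo --> W w} ->
  (forall s T, 0 <= s <= T -> (\int[Pr x]_w ((M T w - M s w) ^+ p.*2)%:E <= (D s)%:E)%E) ->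
  forall t, 0 <= t -> (\int[Pr x]_w ((M t w - W w) ^+ p.*2)%:E <= (D t)%:E)%E.
Proof.
move=> mW hW hD t t0; pose m := (Num.truncn t).+1.
have tm : t <= m%:R by have /andP[_ /ltW] := Num.Theory.truncn_itv t0.
pose s (n : nat) : R := (n + m)%:R.
have sn n : t <= s n by rewrite (le_trans tm)// ler_nat leq_addl.
have s0 n : 0 <= s n := le_trans t0 (sn n).
have mt := measurable_family t0.
apply: (@pint_fatou_cvg _ _ _ _ (fun n w => (M (s n) w - M t w) ^+ p.*2)).
- by move=> n; apply: measurable_funX; apply: measurable_funB => //; exact: measurable_family.
- by apply: measurable_funX; exact: measurable_funB.
- by move=> n w; exact: even_power_ge0.
- by move=> w; exact: even_power_ge0.
- apply: filterS hW => w cv.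
  rewrite -(normr_even (_ - _)) distrC normr_even.
  apply: (@continuous_cvg _ _ _ _ _ _ (fun y : R => y ^+ p.*2)); first exact: exprn_continuous.
  apply: cvgB; last exact: cvg_cst.
  by rewrite (cvg_shiftn m (fun n : nat => M n%:R w)).
- by move=> n; apply: hD; rewrite t0 sn.
Qed.

Variables (c K2 : R).
Hypothesis c0 : 0 < c.
Hypothesis K20 : 0 <= K2.
Hypothesis hK2 : forall s T, 0 <= s <= T ->
  (\int[Pr x]_w ((M T w - M s w) ^+ 2)%:E <= (K2 * expR (- (2 * c * s)))%:E)%E.

(** From |D| <= eta + D^2/eta with eta = e^(-cs), the choice for which both terms are of the same
    order. *)
Lemma family_L1 s T : 0 <= s <= T ->
  (\int[Pr x]_w `|M T w - M s w|%:E <= ((1 + K2) * expR (- (c * s)))%:E)%E.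
Proof.
move=> sT; have /andP[s0 sT'] := sT; have T0 := le_trans s0 sT'.
set eta := expR (- (c * s)); have e0 : 0 < eta by exact: expR_gt0.
have mD : measT (fun w => M T w - M s w).
  by apply: measurable_funB; exact: measurable_family.
have mD2 : measT (fun w => (M T w - M s w) ^+ 2) by exact: measurable_funX.
apply: (@le_trans _ _ (\int[Pr x]_w (eta + eta^-1 * (M T w - M s w) ^+ 2)%:E)%E).
  apply: pint_le.
  - exact: measurableT_comp.
  - by apply: measurable_funD => //; exact: measurable_funM.
  - by [].
  - by move=> w; rewrite addr_ge0 ?(ltW e0)// mulr_ge0 ?sqr_ge0// invr_ge0 ltW.
  - apply/nearW => w; set D := _ - _.
    have D2 : 0 <= D ^+ 2 by exact: sqr_ge0.
    have [h|h] := leP `|D| eta; first by rewrite (le_trans h)// lerDl mulr_ge0// invr_ge0 ltW.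
    apply: (@le_trans _ _ (eta^-1 * D ^+ 2)); last by rewrite lerDr ltW.
    rewrite mulrC ler_pdivlMr// -(real_normK (num_real D)) expr2.
    by rewrite ler_wpM2l// ltW.
rewrite pintD//; last 3 first.
- exact: measurable_funM.
- by move=> w; exact: ltW.
- by move=> w; rewrite mulr_ge0 ?sqr_ge0// invr_ge0 ltW.
rewrite pint_cst pintZ//; last 2 first.
- by rewrite invr_ge0 ltW.
- by move=> w; exact: sqr_ge0.
rewrite mulrDl mul1r EFinD leeD2l//.
have -> : K2 * eta = eta^-1 * (K2 * expR (- (2 * c * s))).
  rewrite (_ : expR (- (2 * c * s)) = eta * eta); last by rewrite /eta -expRD; congr expR; ring.
  by field; rewrite gt_eqF.
by apply: lee_scale; [rewrite invr_ge0 ltW|exact: hK2].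
Qed.

(** Threshold and probability share the decay e^(-cN) equally: an excess of [rr ^+ N] in the unit
    interval after N has probability at most a constant times [rr ^+ N], and both are summable. *)
Let rr := expR (- (c / 2)).
Let rr01 : 0 <= rr < 1.
Proof. by rewrite expR_ge0/= /rr -expR0 ltr_expR oppr_lt0 divr_gt0. Qed.

Lemma excess_probability (N : nat) l : all (fun r => N%:R <= r <= N.+1%:R) l ->
  (Pr x [set w | has (fun r => rr ^+ N < `|M r w - M N%:R w|)%R l] <= ((1 + K2) * rr ^+ N)%:E)%E.
Proof.
move=> al; set A := [set w | _].
have N0 : 0 <= N%:R :> R by [].
have NN : N%:R <= N.+1%:R :> R by rewrite ler_nat.
have al0 : all (fun r => 0 <= r) l by apply: sub_all al => r /andP[h _]; exact: le_trans h.
have mb := measurable_excess (rr ^+ N) N0 al0.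
have mtrue : measurable [set true] by [].
have mA : measurable A by have := mb measurableT _ mtrue; rewrite setTI.
have r0 : 0 < rr ^+ N by rewrite exprn_gt0// expR_gt0.
have pl : path <=%R (N%:R : R) (sort <=%R l).
  rewrite (path_sortedE le_trans) sort_le_sorted andbT all_sort.
  by apply: sub_all al => r /andP[].
have aT : all (fun r => r <= N.+1%:R) (sort <=%R l).
  by rewrite all_sort; apply: sub_all al => r /andP[].
have := maximal_inequality r0 N0 (lexx _) NN pl aT (past1 x N%:R).
under [X in (_ <= X)%E -> _]eq_integral do rewrite mul1r.
move=> le1; have := le_trans le1 (family_L1 _); rewrite N0 NN => /(_ isT).
rewrite (_ : expR (- (c * N%:R)) = rr ^+ N * rr ^+ N); last first.
  by rewrite /rr -expRM_natl -expRD; congr expR; field.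
rewrite (_ : \int[_]_w _ = \int[Pr x]_w (rr ^+ N * \1_A w)%:E)%E; last first.
  apply: eq_integral => w _; rewrite mul1r indicE (eq_has_r (mem_sort _ _)); congr (_ * (_ : bool)%:R)%:E.
  by apply/idP/idP => [h|]; [rewrite inE|rewrite inE].
rewrite pintZ ?(ltW r0)//.
rewrite integral_indic// setIT mulrCA EFinM lee_pmul2l//.
Qed.

(** A sequence tending to infinity meets each unit interval at finitely many times, so the maximal
    inequality for finite lists followed by Borel-Cantelli controls it. *)
Lemma family_oscillation (s : nat -> R) : s @ \oo --> +oo ->
  {ae Pr x, forall w, exists N0, forall N, (N0 <= N)%N ->
     `|M N.+1%:R w - M N%:R w| <= rr ^+ N /\
     forall n, 0 <= s n -> Num.truncn (s n) = N -> `|M (s n) w - M N%:R w| <= rr ^+ N}.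
Proof.
move=> /cvgryPge soo.
have /choice[n0 hn0] : forall N : nat, exists n0 : nat, forall n, (n0 <= n)%N -> N.+1%:R <= s n.
  by move=> N; have [n0 _ h] := soo N.+1%:R; exists n0 => n nn; exact: h.
(* The right endpoint is included so that the increments between consecutive integers are controlled
   as well; beyond [n0 N] the sequence is past the interval. *)
pose l N := N.+1%:R :: [seq r <- [seq s n | n <- iota 0 (n0 N)] | N%:R <= r <= N.+1%:R].
have al N : all (fun r => N%:R <= r <= N.+1%:R) (l N).
  by rewrite /= ler_nat leqnSn lexx/= filter_all.
pose F N := [set w | has (fun r => rr ^+ N < `|M r w - M N%:R w|) (l N)].
have mF N : measurable (F N).
  have N0 : 0 <= N%:R :> R by [].
  have al0 : all (fun r => 0 <= r) (l N) by apply: sub_all (al N) => r /andP[h _]; exact: le_trans h.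
  have mtrue : measurable [set true] by [].
  by have := measurable_excess (rr ^+ N) N0 al0 measurableT mtrue; rewrite setTI.
have := borel_cantelli mF (_ : 0 <= 1 + K2) rr01 (fun N => excess_probability (al N)).
move=> h; have {}h := h (addr_ge0 ler01 K20).
apply: filterS h => w [N0 hN0]; exists N0 => N /hN0 nF.
have ok r : r \in l N -> `|M r w - M N%:R w| <= rr ^+ N.
  by move=> rl; rewrite leNgt; apply/negP => h; apply: nF; apply/hasP; exists r.
split; first by apply: ok; rewrite inE eqxx.
move=> n sn0 tn; have := Num.Theory.truncn_itv sn0; rewrite tn => /andP[h1 h2].
apply: ok; rewrite inE; apply/orP; right; rewrite mem_filter h1 (ltW h2)/=.
apply/mapP; exists n => //; rewrite mem_iota add0n/= ltnNge; apply/negP => nn.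
by have := hn0 N n nn; rewrite leNgt h2.
Qed.

(** The upper limit along the integers is measurable and defined for every w; being chosen before
    the sequence of times, it is the same limit for all of them. *)
Definition family_limit w : R := fine (limn_esup (fun N => (M N%:R w)%:E)).

Lemma measurable_family_limit : measT family_limit.
Proof.
apply: (measurableT_comp (fine_measurable measurableT)).
apply: (measurable_fun_limn_esup (f := fun N w => (M N%:R w)%:E)) => N.
by apply/measurable_EFinP; exact: measurable_family.
Qed.

Lemma family_limit_ae (s : nat -> R) : s @ \oo --> +oo ->
  {ae Pr x, forall w, M (s n) w @[n --> \oo] --> family_limit w}.
Proof.
move=> soo; apply: filterS (family_oscillation soo) => w [N0 hN0].
have cM : cvgn (fun N => M N%:R w).
  by apply: (geometric_increments_cvg (N0 := N0) rr01) => N /hN0[].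
have WE : family_limit w = limn (fun N => M N%:R w).
  have cE : (fun N => (M N%:R w)%:E) @ \oo --> (limn (fun N => M N%:R w))%:E.
    by apply/fine_cvgP; split; [exact: nearW|exact: cM].
  by rewrite /family_limit is_cvg_limn_esupE ?(cvg_lim _ cE)//; apply/cvg_ex; eexists; exact: cE.
rewrite WE; set L := limn _ in cM *.
have rr1 : (fun n : nat => rr ^+ n) @ \oo --> 0.
  by apply: cvg_expr; case/andP: rr01 => r0 r1; rewrite ger0_norm.
apply/cvgrPdist_lt => e e0; have e20 : 0 < e / 2 by rewrite divr_gt0.
have [N1 _ h1] := (cvgrPdist_lt _ _).1 cM _ e20.
have [N2 _ h2] := (cvgrPdist_lt _ _).1 rr1 _ e20.
have /cvgryPge/(_ (maxn N0 (maxn N1 N2))%:R)[n0 _ hn] := soo.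
exists n0 => // n /= /hn sn.
have sn0 : 0 <= s n by exact: le_trans sn.
pose N := Num.truncn (s n).
have NM : (maxn N0 (maxn N1 N2) <= N)%N by rewrite /N Num.Theory.truncn_ge_nat.
have [NN0 [NN1 NN2]] : (N0 <= N)%N /\ (N1 <= N)%N /\ (N2 <= N)%N.
  by move: NM; rewrite !geq_max => /andP[? /andP[? ?]].
have [_ /(_ n sn0 erefl) h3] := hN0 N NN0.
have h4 := h1 N NN1; have := h2 N NN2; rewrite sub0r normrN ger0_norm; last first.
  by rewrite exprn_ge0//; case/andP: rr01.
move=> h5; rewrite (_ : L - _ = (L - M N%:R w) - (M (s n) w - M N%:R w)); last by ring.
apply: le_lt_trans (ler_normB _ _) _; rewrite [e]splitr ltrD//.
exact: le_lt_trans h3 h5.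
Qed.

End Family.

Local Open Scope complex_scope.

Lemma cmeasurable_evc f x t : @cmeasurable R _ (borel E) f -> cmeasurable (fun w => evc f (cfg Y x t w)).
Proof.
move=> mf; split.
  exact: (measurableT_comp (measurable_creal_evc mf) (measurable_cfg Y gamma0 mgamma x t)).
exact: (measurableT_comp (measurable_cimag_evc mf) (measurable_cfg Y gamma0 mgamma x t)).
Qed.

Lemma creal_psi t f x : BE f -> creal (psi Y t f x) = mean t (fun y => creal (f y)) x.
Proof.
move=> [mf _]; apply: (congr1 fine); apply: pint_ae_eq.
- exact: (cmeasurable_evc x t mf).1.
- by apply: measurable_xev_cfg => //; exact: mf.1.
- by apply: filterS (falive_ae x t) => w fw; exact: creal_evc.
Qed.

Lemma cimag_psi t f x : BE f -> cimag (psi Y t f x) = mean t (fun y => cimag (f y)) x.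
Proof.
move=> [mf _]; apply: (congr1 fine); apply: pint_ae_eq.
- exact: (cmeasurable_evc x t mf).2.
- by apply: measurable_xev_cfg => //; exact: mf.2.
- by apply: filterS (falive_ae x t) => w fw; exact: cimag_evc.
Qed.

Definition complex_family (cf : R -> E -> R[i]) (b : R -> R) :=
  [/\ forall r, 0 <= r -> BE (cf r), forall r y, 0 <= r -> cnorm (cf r y) <= b r &
      forall r r', 0 <= r -> r < r' -> psi Y (r' - r) (cf r') = cf r].

Lemma complex_family_real cf b T : complex_family cf b ->
  family (fun r y => creal (cf r y)) b 0 T.
Proof.
move=> [h1 h2 h3]; split=> [r /andP[r0 _]|r y /andP[r0 _]|r r' r0 rr' _].
- exact: (h1 r r0).1.1.
- by apply: le_trans (creal_le_cnorm _) _; exact: h2.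
- apply/funext => x; rewrite -creal_psi ?h3//; apply: h1.
  by rewrite (le_trans r0)// ltW.
Qed.

Lemma complex_family_imag cf b T : complex_family cf b ->
  family (fun r y => cimag (cf r y)) b 0 T.
Proof.
move=> [h1 h2 h3]; split=> [r /andP[r0 _]|r y /andP[r0 _]|r r' r0 rr' _].
- exact: (h1 r r0).1.2.
- by apply: le_trans (cimag_le_cnorm _) _; exact: h2.
- apply/funext => x; rewrite -cimag_psi ?h3//; apply: h1.
  by rewrite (le_trans r0)// ltW.
Qed.

Lemma family_sub g b s T s' T' : s <= s' -> T' <= T -> family g b s T -> family g b s' T'.
Proof.
move=> ss TT [h1 h2 h3]; split=> [r /andP[sr rT]|r y /andP[sr rT]|r r' sr rr' r'T].
- by apply: h1; rewrite (le_trans ss)//= (le_trans rT).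
- by apply: h2; rewrite (le_trans ss)//= (le_trans rT).
- by apply: h3 => //; [exact: le_trans sr|exact: le_trans TT].
Qed.

Lemma cvg_cpart (part : R[i] -> R) (u : nat -> R[i]) l : (forall z w, part (z - w) = part z - part w) ->
  (forall z, `|part z| <= cnorm z) -> cnorm (u n - l) @[n --> \oo] --> 0 ->
  part (u n) @[n --> \oo] --> part l.
Proof.
move=> hB hn /cvgrPdist_lt cv; apply/cvgrPdist_lt => e e0.
apply: filterS (cv e e0) => n; rewrite sub0r normrN ger0_norm ?cnorm_ge0//.
by apply: le_lt_trans; rewrite distrC -hB.
Qed.

Lemma cvg_creal (u : nat -> R[i]) l : cnorm (u n - l) @[n --> \oo] --> 0 ->
  creal (u n) @[n --> \oo] --> creal l.
Proof. by apply: cvg_cpart; [case=> [? ?] [? ?]|exact: creal_le_cnorm]. Qed.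

Lemma cvg_cimag (u : nat -> R[i]) l : cnorm (u n - l) @[n --> \oo] --> 0 ->
  cimag (u n) @[n --> \oo] --> cimag l.
Proof. by apply: cvg_cpart; [case=> [? ?] [? ?]|exact: cimag_le_cnorm]. Qed.

Lemma cvg_cnorm (u : nat -> R[i]) (l : R[i]) : creal (u n) @[n --> \oo] --> creal l ->
  cimag (u n) @[n --> \oo] --> cimag l -> cnorm (u n - l) @[n --> \oo] --> 0.
Proof.
move=> /cvgrPdist_lt c1 /cvgrPdist_lt c2; apply/cvgrPdist_lt => e e0.
have e2 : 0 < e / 2 by exact: divr_gt0.
apply: filterS2 (c1 _ e2) (c2 _ e2) => n h1 h2.
rewrite sub0r normrN ger0_norm ?cnorm_ge0// (le_lt_trans (cnorm_le _))// [e]splitr ltrD//.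
  by move: h1; rewrite distrC; case: (u n) (l) => [? ?] [? ?].
by move: h2; rewrite distrC; case: (u n) (l) => [? ?] [? ?].
Qed.

(** * Application to the spectral decomposition *)

Section Spectrum.
Variable S : spectral_data E.
Hypothesis hS : spectral_assumption S (psi Y).
Local Notation lam := (sd_lambda S).
Local Notation nu := (calN S).
Local Notation rho := (creal (lam (m_L S))).

(** The strict inequality absorbs a possible polynomial factor at lambda_1; before the time s0 from
    which the spectral expansion is controlled, [kappa s0] serves as bound. *)
Lemma mean_growth lm : creal (lam 1%N) < lm -> exists C1, forall t z, 0 <= t ->
  `|mean t (cst 1) z| <= C1 * expR (lm * t).
Proof.
move=> llm; have B1 : BE1 (fun _ : E => 1 : R[i]).
  split; first split.
  - by split; exact: measurable_cst.
  - by exists 1 => x; rewrite ComplexField.Normc.normc1.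
  - by move=> x; rewrite ComplexField.Normc.normc1.
have e0 : 0 < lm - creal (lam 1%N) by rewrite subr_gt0.
have l10 := lambda1_gt0 hS.
have hyp i : (1 <= i <= sd_m S)%N -> sd_Pi S i (fun _ : E => 1 : R[i]) = 0 \/ creal (lam i) <= creal (lam 1%N).
  by move=> /andP[i1 im]; right; exact: (creal_lambda_le hS).
have [s0 [C [s01 C0 hs]]] := psi_bound hS B1 ltr01 e0 hyp.
have lm0 : 0 < lm by exact: lt_trans llm.
exists (1 + C + kappa s0) => t z t0.
have [s0t|ts0] := leP s0 t; last first.
  have mc : mfun (cst 1) by exact: measurable_cst.
  have c1 (y : E) : `|(cst 1 : E -> R) y| <= 1 by rewrite normr1.
  apply: le_trans (mean_le mc c1 z t) _.
  have k1 := kappa_ge1 s0.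
  apply: (@le_trans _ _ (kappa s0)); first by apply: kappa_mono => //; exact: ltW.
  have e1 : 1 <= expR (lm * t) by rewrite -expR0 ler_expR mulr_ge0// ltW.
  rewrite -[leLHS]mulr1 ler_pM//; first by rewrite (le_trans ler01).
  by rewrite lerDr addr_ge0.
have := hs t z s0t; rewrite subrKC => h.
have e : mean t (cst 1) z = creal (psi Y t (fun _ : E => 1 : R[i]) z) by rewrite creal_psi//; exact: B1.1.
rewrite e; apply: le_trans (creal_le_cnorm _) _; apply: (le_trans h).
have k0 : 0 <= kappa s0 by rewrite (le_trans ler01)// kappa_ge1.
rewrite mul1r 2!mulrDl mul1r -[leLHS]addr0; apply: lerD; last by rewrite mulr_ge0// expR_ge0.
rewrite lerD2r ler_expR ler_wpM2r// (le_trans _ (ltW llm))//.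
apply: (creal_lambda_le hS) => //; rewrite ?leqnn ?andbT//.
by case/andP: (ok1 hS).
Qed.

Variables (p : nat) (lm CN : R).
Hypothesis p0 : (0 < p)%N.
Hypothesis pQ : p.*2 = Q.+1.
Hypothesis lm0 : 0 < lm.
Hypothesis lmr : lm / 2 < rho.
Hypothesis CN0 : 0 <= CN.
Hypothesis hN : forall x t, 0 <= t -> (\int[Pr x]_w (pop x t w ^+ p)%:E <= (CN * expR (lm * p%:R * t))%:E)%E.

Let pQ' : (p.*2 <= Q.+1)%N. Proof. by rewrite pQ. Qed.
Let rho0 : 0 < rho. Proof. by apply: lt_trans lmr; rewrite divr_gt0. Qed.
Let q0 : (0 < p.*2)%N. Proof. by rewrite double_gt0. Qed.

(** The martingale of psi_{T-r} h is cut at T - s0. Before the cut its functions are at most eta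
    e^(rho(T-r)); after it only a bounded constant replaces eta, but the fluctuation starts late and
    is damped by e^(-qc(T - s0)). *)
Lemma rest_moment h x : mfun h -> (forall y, `|h y| <= 1) ->
  (forall eta, 0 < eta -> exists2 s0, 1 <= s0 & forall s y, s0 <= s -> `|mean s h y| <= eta * expR (rho * s)) ->
  forall eps, 0 < eps -> exists T0, forall T, T0 <= T -> 0 <= T ->
    (\int[Pr x]_w ((expR (- (rho * T)) * xev h (cfg Y x T w)) ^+ p.*2)%:E <= eps%:E)%E.
Proof.
move=> mh h1 hdecay eps eps0.
have [K K0 hK] := family_fluctuation p0 pQ' lmr CN0 hN.
set q := p.*2 in hK *.
have two0 : 0 <= 2 ^+ q :> R by exact: exprn_ge0.
pose k0 := kappa 0; have k00 : 0 <= k0 by rewrite (le_trans ler01)// kappa_ge1.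
pose C2 := 2 ^+ q * (2 ^+ q * (K + k0)).
have C20 : 0 <= C2 by apply: mulr_ge0 => //; apply: mulr_ge0 => //; exact: addr_ge0.
have C21 : 0 < C2 + 1 by rewrite ltr_wpDl.
(* C2 collects the terms proportional to eta^q, namely the martingale up to the cut and its initial
   value; the cap 1 gives eta^q <= eta. *)
pose eta := Num.min 1 (eps / 2 / (C2 + 1)).
have eta0 : 0 < eta by rewrite lt_min ltr01 !divr_gt0.
have etaC : C2 * eta ^+ q <= eps / 2.
  apply: (@le_trans _ _ ((C2 + 1) * eta)).
    apply: ler_pM => //; first by rewrite exprn_ge0// ltW.
      by rewrite lerDl ler01.
    rewrite -[leRHS]expr1 ler_wiXn2l ?(ltW eta0)// /eta ge_min lexx//.
  by rewrite mulrC -ler_pdivlMr// ge_min lexx orbT.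
have [s0 s01 hs0] := hdecay eta eta0.
have s00 : 0 < s0 by exact: lt_le_trans s01.
pose k := kappa s0; have k1 : 1 <= k by exact: kappa_ge1.
have k_gt0 : 0 < k by exact: lt_le_trans k1.
pose c := rho - lm / 2; have c0 : 0 < c by rewrite subr_gt0.
have qc0 : 0 < q%:R * c by rewrite mulr_gt0// ltr0n.
pose C3 := 2 ^+ q * (K * k ^+ q).
have C30 : 0 <= C3 by apply: mulr_ge0 => //; apply: mulr_ge0 => //; apply: exprn_ge0; exact: ltW.
have eps2 : 0 < eps / 2 by exact: divr_gt0.
(* The time after which C3 e^(-qc(T - s0)) is below eps/2, by y <= e^y. *)
pose t1 := C3 / (eps / 2) / (q%:R * c).
have t10 : 0 <= t1 by rewrite !divr_ge0// ltW.
exists (s0 + t1) => T sT T0.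
have s0T : s0 <= T by rewrite (le_trans _ sT)// lerDl.
pose d := expR (- (q%:R * c * (T - s0))).
have dC : C3 * d <= eps / 2.
  have t1T : t1 <= T - s0 by rewrite lerBrDl.
  rewrite /d expRN ler_pdivrMr ?expR_gt0// mulrC -ler_pdivrMr//.
  apply: (@le_trans _ _ (q%:R * c * (T - s0))).
    by rewrite [leRHS]mulrC -ler_pdivrMr.
  by apply: le_trans (expR_ge1Dx _); rewrite lerDr ler01.
pose e := expR (rho * T); have e0 : 0 < e by exact: expR_gt0.
(* One family on [0, T] with two different bounds on the two sides of T - s0. *)
pose g (r : R) : E -> R := if r == T then h else mean (T - r) h.
have mg r : mfun (g r).
  by rewrite /g; case: ifP => // _; exact: measurable_law_expectation.
have gm r r' : 0 <= r -> r < r' -> r' <= T -> mean (r' - r) (g r') = g r.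
  move=> r0 rr' r'T; rewrite /g [r == T]lt_eqF; last exact: lt_le_trans r'T.
  have [->//|r'nT] := eqVneq r' T.
  rewrite (mean_semigroup) ?subr_ge0 ?(ltW rr')//.
  by rewrite (_ : r' - r + (T - r') = T - r)//; ring.
have Ts0 : 0 <= T - s0 by rewrite subr_ge0.
have TsT : T - s0 <= T by rewrite gerBl ltW.
have fam1 : family g (fun r => eta * e * expR (- rho * r)) 0 (T - s0).
  split=> [r _|r y /andP[r0 rT]|r r' r0 rr' r'T]; first exact: mg.
    rewrite /g [r == T]lt_eqF; last by rewrite (le_lt_trans rT)// ltrBlDr ltrDl.
    apply: le_trans (hs0 (T - r) y _) _; first by rewrite lerBrDr addrC -lerBrDr.
    rewrite -mulrA -expRD (_ : rho * T + - rho * r = rho * (T - r))//; ring.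
  by apply: gm => //; exact: le_trans TsT.
have fam2 : family g (fun r => k * e * expR (- rho * r)) (T - s0) T.
  split=> [r _|r y /andP[r0 rT]|r r' r0 rr' r'T]; first exact: mg.
    rewrite -mulrA -expRD (_ : rho * T + - rho * r = rho * (T - r)); last by ring.
    have e1 : 1 <= expR (rho * (T - r)) by rewrite -expR0 ler_expR mulr_ge0 ?subr_ge0// ltW.
    apply: (@le_trans _ _ k); last by rewrite ler_peMr// ltW.
    rewrite /g; case: ifP => _; first exact: le_trans k1.
    apply: le_trans (mean_le mh h1 y (T - r)) _.
    by apply: kappa_mono => //; rewrite lerBlDr addrC -lerBlDr.
  by apply: gm => //; exact: le_trans r0.
have i1 := hK g (eta * e) x 0 (T - s0) (mulr_gt0 eta0 e0) (introT andP (conj (lexx _) Ts0)) fam1.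
have i2 := hK g (k * e) x (T - s0) T (mulr_gt0 k_gt0 e0) (introT andP (conj Ts0 TsT)) fam2.
pose M r w := xev (g r) (cfg Y x r w).
have mM r : measT (M r) by exact: measurable_xev_cfg.
pose x1 w := M (T - s0) w - M 0 w; pose x2 w := M T w - M (T - s0) w.
have mx1 : measT x1 by exact: measurable_funB.
have mx2 : measT x2 by exact: measurable_funB.
have i0 : (\int[Pr x]_w ((M 0 w) ^+ q)%:E <= ((eta * e) ^+ q * k0)%:E)%E.
  have mp := measurable_pop x 0.
  apply: (@le_trans _ _ (\int[Pr x]_w ((eta * e) ^+ q * (pop x 0 w + 1) ^+ q)%:E)%E).
    apply: pint_le.
    - exact: measurable_funX.
    - by apply: measurable_funM => //; apply: measurable_funX; exact: measurable_funD.
    - by move=> w; exact: even_power_ge0.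
    - by move=> w; apply: mulr_ge0; exact: even_power_ge0.
    - apply: filterS (falive_ae x 0) => w fw; rewrite -normr_even -exprMn.
      have ee0 : 0 <= eta * e by rewrite mulr_ge0// ltW.
      apply: lerXn2r; rewrite ?nnegrE//; first by apply: mulr_ge0; rewrite // addr_ge0 ?pop_ge0.
      apply: (@le_trans _ _ (eta * e * pop x 0 w)); last by rewrite ler_wpM2l// lerDl ler01.
      rewrite popE//; apply: xev_abs => // y; have [_ h2 _] := fam1.
      by have := h2 0 y; rewrite lexx Ts0 mulr0 expR0 mulr1; exact.
  rewrite pintZ//; last 3 first.
  - by apply: measurable_funX; exact: measurable_funD.
  - exact: even_power_ge0.
  - by move=> w; exact: even_power_ge0.
  apply: lee_scale; first exact: even_power_ge0.
  by rewrite /q pQ; exact: (pop_moment x 0).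
have even_m (y : Omega -> R) : measT y -> measT (fun w => y w ^+ q).
  by move=> my; exact: measurable_funX.
have ev0 (y : Omega -> R) w : 0 <= y w ^+ q by exact: even_power_ge0.
have iT : (\int[Pr x]_w ((M T w) ^+ q)%:E <= (2 ^+ q * (K * (k * e) ^+ q * d + 2 ^+ q * (K * (eta * e) ^+ q + (eta * e) ^+ q * k0)))%:E)%E.
  apply: (@le_trans _ _ (\int[Pr x]_w (2 ^+ q * (x2 w ^+ q + 2 ^+ q * (x1 w ^+ q + M 0 w ^+ q)))%:E)%E).
    apply: pint_le.
    - exact: even_m.
    - apply: measurable_funM => //; apply: measurable_funD; first exact: even_m.
      by apply: measurable_funM => //; apply: measurable_funD; exact: even_m.
    - by move=> w; exact: ev0.
    - move=> w; apply: mulr_ge0 => //; apply: addr_ge0; first exact: ev0.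
      by apply: mulr_ge0 => //; apply: addr_ge0; exact: ev0.
    - apply/nearW => w; rewrite -normr_even.
      rewrite -[x2 w ^+ q]normr_even -[x1 w ^+ q]normr_even -[M 0 w ^+ q]normr_even.
      have -> : M T w = x2 w + (x1 w + M 0 w) by rewrite /x1 /x2; ring.
      apply: (@le_trans _ _ ((`|x2 w| + (`|x1 w| + `|M 0 w|)) ^+ q)).
        rewrite lerXn2r ?nnegrE ?addr_ge0// (le_trans (ler_normD _ _))// lerD2l.
        exact: ler_normD.
      apply: le_trans (exprD_le _ (normr_ge0 _) (addr_ge0 (normr_ge0 _) (normr_ge0 _))) _.
      by rewrite ler_wpM2l// lerD2l; exact: exprD_le.
  have m10 : measT (fun w => x1 w ^+ q + M 0 w ^+ q) by apply: measurable_funD; exact: even_m.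
  have p10 w : 0 <= x1 w ^+ q + M 0 w ^+ q by apply: addr_ge0; exact: ev0.
  have m210 : measT (fun w => 2 ^+ q * (x1 w ^+ q + M 0 w ^+ q)) by exact: measurable_funM.
  have p210 w : 0 <= 2 ^+ q * (x1 w ^+ q + M 0 w ^+ q) by exact: mulr_ge0.
  rewrite pintZ//; last 2 first.
  - by apply: measurable_funD => //; exact: even_m.
  - by move=> w; apply: addr_ge0 => //; exact: ev0.
  apply: lee_scale => //; rewrite pintD//; last exact: even_m.
  rewrite EFinD; apply: leeD; first by rewrite /d; exact: i2.
  rewrite pintZ//; apply: lee_scale => //; rewrite pintD; last 4 first.
  - exact: even_m.
  - exact: even_m.
  - by move=> w; exact: ev0.
  - by move=> w; exact: ev0.
  rewrite EFinD; apply: leeD => //.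
  by move: i1; rewrite mulr0 oppr0 expR0 mulr1.
have -> : (\int[Pr x]_w ((expR (- (rho * T)) * xev h (cfg Y x T w)) ^+ q)%:E =
   \int[Pr x]_w (e ^- q * M T w ^+ q)%:E)%E.
  by apply: eq_integral => w _; rewrite exprMn expRN exprVn /M /g eqxx.
rewrite pintZ; last 3 first.
- exact: even_m.
- by rewrite invr_ge0 exprn_ge0// ltW.
- by move=> w; exact: ev0.
apply: le_trans (lee_scale _ iT) _; first by rewrite invr_ge0 exprn_ge0// ltW.
rewrite lee_fin [leRHS]splitr; apply: le_trans (lerD dC etaC).
rewrite le_eqVlt; apply/orP; left; apply/eqP; rewrite /C3 /C2 !exprMn.
have eq0 : e ^+ q != 0 by rewrite expf_neq0// gt_eqF.
by move: (e ^+ q) eq0 => eq eq0; field.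
Qed.

Lemma rest_small (g : E -> R[i]) x : BE1 g -> (forall i, (1 <= i <= m_L S)%N -> sd_Pi S i g = 0) ->
  Lq_small (Pr x) p.*2 (fun t w => (expR (- (rho * t)))%:C * evc g (cfg Y x t w)).
Proof.
move=> g1 gPi; have Bg := g1.1; have mg := Bg.1.
split=> [t _|eps e0]; first by apply: cmeasurableZ; exact: cmeasurable_evc.
have decay (part : R[i] -> R) : (forall z, `|part z| <= cnorm z) ->
    (forall t y, part (psi Y t g y) = mean t (fun y => part (g y)) y) ->
    forall eta, 0 < eta -> exists2 s0, 1 <= s0 & forall s y, s0 <= s ->
      `|mean s (fun y => part (g y)) y| <= eta * expR (rho * s).
  move=> hp hpsi eta eta0; have [s0 s01 hs] := psi_decay hS g1 gPi eta0.
  by exists s0 => // s y s0s; rewrite -hpsi (le_trans (hp _))// hs.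
have e2 : 0 < eps / 2 / 2 ^+ p.*2 by rewrite !divr_gt0// exprn_gt0.
have b1 y : `|creal (g y)| <= 1 by rewrite (le_trans (creal_le_cnorm _))// g1.2.
have b2 y : `|cimag (g y)| <= 1 by rewrite (le_trans (cimag_le_cnorm _))// g1.2.
have [T0 h0] := rest_moment x mg.1 b1 (decay _ (@creal_le_cnorm R) (fun t y => creal_psi t y Bg)) e2.
have [T1 h1] := rest_moment x mg.2 b2 (decay _ (@cimag_le_cnorm R) (fun t y => cimag_psi t y Bg)) e2.
exists (Num.max T0 T1) => t; rewrite ge_max => /andP[tT0 tT1] t0.
have -> : eps = 2 ^+ p.*2 * (eps / 2 / 2 ^+ p.*2 + eps / 2 / 2 ^+ p.*2).
  by field; rewrite expf_neq0.
have mZ : cmeasurable (fun w => (expR (- (rho * t)))%:C * evc g (cfg Y x t w)).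
  by apply: cmeasurableZ; exact: cmeasurable_evc.
apply: cnorm_moment => //.
- apply: le_trans (h0 t tT0 t0); rewrite le_eqVlt; apply/orP; left; apply/eqP; apply: pint_ae_eq.
  + by apply: measurable_funX; exact: mZ.1.
  + apply: measurable_funX; apply: measurable_funM => //; apply: measurable_xev_cfg => //.
    exact: mg.1.
  + apply: filterS (falive_ae x t) => w fw; congr (_ ^+ _); rewrite -creal_evc//.
    by case: (evc _ _) => a b /=; rewrite mul0r subr0.
- apply: le_trans (h1 t tT1 t0); rewrite le_eqVlt; apply/orP; left; apply/eqP; apply: pint_ae_eq.
  + by apply: measurable_funX; exact: mZ.2.
  + apply: measurable_funX; apply: measurable_funM => //; apply: measurable_xev_cfg => //.
    exact: mg.2.
  + apply: filterS (falive_ae x t) => w fw; congr (_ ^+ _); rewrite -cimag_evc//.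
    by case: (evc _ _) => a b /=; rewrite mul0r addr0.
Qed.

Lemma rho_le i : (1 <= i <= m_L S)%N -> rho <= creal (lam i).
Proof.
move=> iL; apply: (creal_lambda_le hS) => //.
by have [/andP[]] := m_L_prop hS.
Qed.

(** On the eigenspace psi_t acts as e^((lambda+N)t), which gives consistency; the loss eps in the
    rate pays for the polynomial growth of e^(-Nr). *)
Lemma mart_family i j k eps : basis_index S i j k -> 0 < eps ->
  exists2 B, 0 < B & complex_family (fun r => exp_op (lam i) nu (- r) (sd_phi S i j k))
    (fun r => B * expR (- (creal (lam i) - eps) * r)).
Proof.
move=> ijk e0; have [oki _ _] := ijk; have Ap := phi_A hS ijk; have Bp := Ap.1.
have [C C0 hC] := exp_nu_bound hS (lam i) Bp e0.
have C1 : 0 < C + 1 by rewrite ltr_wpDl.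
exists (C + 1) => //; split=> [r _|r y r0|r r' r0 rr'].
- exact: (exp_nu_BE hS).
- apply: le_trans (hC _ _) _; rewrite normrN ger0_norm//.
  rewrite (_ : creal (lam i) * - r + eps * r = - (creal (lam i) - eps) * r); last by ring.
  by rewrite ler_wpM2r ?expR_ge0// lerDl ler01.
- rewrite (psi_range hS oki); [|exact: (exp_nu_range hS)|by rewrite subr_ge0 ltW].
  by rewrite (exp_nuD hS)// (_ : r' - r + - r' = - r)//; ring.
Qed.

(** Real and imaginary parts are real martingales of the same type; the rate of increments from t to
    any later T passes to the limit along the integers. *)
Lemma mart_moment x i j k eps (W : Omega -> R[i]) : basis_index S i j k -> 0 < eps ->
  lm / 2 < creal (lam i) - eps -> cmeasurable W ->
  {ae Pr x, forall w, cnorm (mart Y S x i j k n%:R w - W w) @[n --> \oo] --> 0} ->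
  exists2 D, 0 <= D & forall t, 0 <= t ->
    (\int[Pr x]_w (cnorm (mart Y S x i j k t w - W w) ^+ p.*2)%:E <=
     (D * expR (- (p.*2%:R * (creal (lam i) - eps - lm / 2) * t)))%:E)%E.
Proof.
move=> ijk e0 la mW hW; have [B B0 cfam] := mart_family ijk e0.
have [K K0 hK] := family_fluctuation p0 pQ' la CN0 hN.
have cB r : 0 <= r -> BE (exp_op (lam i) nu (- r) (sd_phi S i j k)) by case: cfam => h _ _; exact: h.
have mm t : 0 <= t -> cmeasurable (mart Y S x i j k t).
  by move=> t0; apply: cmeasurable_evc; exact: (cB t t0).1.
set q := p.*2 in hK *; pose D s := K * B ^+ q * expR (- (q%:R * (creal (lam i) - eps - lm / 2) * s)).
have fal : {ae Pr x, forall w, forall n : nat, falive (cfg Y x n%:R w)}.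
  by apply: ae_foralln => n; exact: falive_ae.
exists (2 ^+ q * (2 * (K * B ^+ q))).
  by apply: mulr_ge0; [exact: exprn_ge0|apply: mulr_ge0 => //; apply: mulr_ge0 => //; apply: exprn_ge0; exact: ltW].
move=> t t0.
have -> : 2 ^+ q * (2 * (K * B ^+ q)) * expR (- (q%:R * (creal (lam i) - eps - lm / 2) * t)) = 2 ^+ q * (D t + D t).
  by rewrite /D; ring.
have mZ : cmeasurable (fun w => mart Y S x i j k t w - W w) by apply: cmeasurableB => //; exact: mm.
apply: cnorm_moment => //.
- have fam T : 0 <= T -> family (fun r y => creal (exp_op (lam i) nu (- r) (sd_phi S i j k) y)) (fun r => B * expR (- (creal (lam i) - eps) * r)) 0 T.
    by move=> T0; exact: complex_family_real.
  have := @family_limit_moment _ _ fam x (fun w => creal (W w)) p D mW.1.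
  move=> h; apply: le_trans (h _ _ t t0); last 2 first.
  + apply: filterS2 fal hW => w fw cw; rewrite (_ : (fun n : nat => _) = fun n : nat => creal (mart Y S x i j k n%:R w)).
      exact: cvg_creal.
    by apply/funext => n; rewrite -creal_evc.
  + move=> s T /andP[s0 sT]; apply: (hK (fun r y => creal (exp_op (lam i) nu (- r) (sd_phi S i j k) y))) => //; first by rewrite s0.
    by apply: family_sub (fam T (le_trans s0 sT)).
  rewrite le_eqVlt; apply/orP; left; apply/eqP; apply: pint_ae_eq.
  + by apply: measurable_funX; exact: mZ.1.
  + apply: measurable_funX; apply: measurable_funB; last exact: mW.1.
    by apply: measurable_xev_cfg => //; exact: (cB t t0).1.1.
  + apply: filterS (falive_ae x t) => w fw; congr (_ ^+ _); rewrite -creal_evc//.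
    exact: crealB.
- have fam T : 0 <= T -> family (fun r y => cimag (exp_op (lam i) nu (- r) (sd_phi S i j k) y)) (fun r => B * expR (- (creal (lam i) - eps) * r)) 0 T.
    by move=> T0; exact: complex_family_imag.
  have := @family_limit_moment _ _ fam x (fun w => cimag (W w)) p D mW.2.
  move=> h; apply: le_trans (h _ _ t t0); last 2 first.
  + apply: filterS2 fal hW => w fw cw; rewrite (_ : (fun n : nat => _) = fun n : nat => cimag (mart Y S x i j k n%:R w)).
      exact: cvg_cimag.
    by apply/funext => n; rewrite -cimag_evc.
  + move=> s T /andP[s0 sT]; apply: (hK (fun r y => cimag (exp_op (lam i) nu (- r) (sd_phi S i j k) y))) => //; first by rewrite s0.
    by apply: family_sub (fam T (le_trans s0 sT)).
  rewrite le_eqVlt; apply/orP; left; apply/eqP; apply: pint_ae_eq.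
  + by apply: measurable_funX; exact: mZ.2.
  + apply: measurable_funX; apply: measurable_funB; last exact: mW.2.
    by apply: measurable_xev_cfg => //; exact: (cB t t0).1.2.
  + apply: filterS (falive_ae x t) => w fw; congr (_ ^+ _); rewrite -cimag_evc//.
    exact: cimagB.
Qed.

(** The coordinate grows at the rate Re lambda_i while the martingale error decays at the rate Re
    lambda_i - l/2; after division by e^(rho t) the rate l/2 - rho < 0 remains, up to eps. *)
Lemma mart_small x i j k f (W : Omega -> R[i]) : basis_index S i j k -> (i <= m_L S)%N -> BE f ->
  cmeasurable W -> {ae Pr x, forall w, cnorm (mart Y S x i j k n%:R w - W w) @[n --> \oo] --> 0} ->
  Lq_small (Pr x) p.*2 (fun t w => (expR (- (rho * t)))%:C *
    (sd_phit S i j k (exp_op (lam i) nu t f) * (mart Y S x i j k t w - W w))).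
Proof.
move=> ijk iL Bf mW hW; have [oki _ _] := ijk.
have ri : rho <= creal (lam i) by apply: rho_le; rewrite iL andbT; case/andP: oki.
(* eps is lost twice, once in the coordinate and once in the martingale; a quarter of the gap leaves
   half of it as decay. *)
pose eps := (rho - lm / 2) / 4; have e0 : 0 < eps by rewrite divr_gt0// subr_gt0.
have la : lm / 2 < creal (lam i) - eps.
  by rewrite /eps; move: ri lmr; move: rho (creal (lam i)) => r l; lra.
have [D D0 hD] := mart_moment ijk e0 la mW hW.
have [C C0 hC] := coord_exp_bound hS ijk Bf e0.
set q := p.*2 in hD *.
have mm t : 0 <= t -> cmeasurable (fun w => mart Y S x i j k t w - W w).
  move=> t0; apply: cmeasurableB => //; apply: cmeasurable_evc.
  by have [] := exp_nu_BE hS (lam i) (- t) (phi_A hS ijk).1.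
apply: (@Lq_small_exp _ _ _ _ _ _ ((2 * C) ^+ q * D) (q%:R * ((rho - lm / 2) / 2))).
- by move=> t t0; apply: cmeasurableZ; apply: cmeasurableZ; exact: mm.
- by apply: mulr_ge0 => //; apply: exprn_ge0; exact: mulr_ge0.
- by rewrite mulr_gt0 ?ltr0n// divr_gt0// subr_gt0.
move=> t t0.
pose c := (expR (- (rho * t)) * (2 * C * expR ((creal (lam i) + eps) * t))) ^+ q.
have c0 : 0 <= c.
  by apply: exprn_ge0; apply: mulr_ge0; [exact: expR_ge0|rewrite mulr_ge0 ?expR_ge0// mulr_ge0].
apply: (@le_trans _ _ (\int[Pr x]_w (c * cnorm (mart Y S x i j k t w - W w) ^+ q)%:E)%E).
  apply: pint_le.
  - by apply: measurable_cnormX; apply: cmeasurableZ; apply: cmeasurableZ; exact: mm.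
  - by apply: measurable_funM => //; apply: measurable_cnormX; exact: mm.
  - by move=> w; rewrite exprn_ge0// cnorm_ge0.
  - by move=> w; apply: mulr_ge0 => //; rewrite exprn_ge0// cnorm_ge0.
  - apply/nearW => w; rewrite !cnormM cnorm_real (ger0_norm (expR_ge0 _)) mulrA exprMn ler_wpM2r//.
      by rewrite exprn_ge0// cnorm_ge0.
    apply: lerXn2r; rewrite ?nnegrE.
    + by rewrite mulr_ge0 ?expR_ge0 ?cnorm_ge0.
    + by apply: mulr_ge0; [exact: expR_ge0|rewrite mulr_ge0 ?expR_ge0// mulr_ge0].
    rewrite ler_wpM2l ?expR_ge0//; apply: le_trans (hC t t0) _.
    rewrite [2 * C]mulrC -mulrA ler_wpM2l// mulr_natl mulr2n lerD2l -expR0 ler_expR.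
    by rewrite mulr_ge0// addr_ge0 ?ltW// (lt_le_trans rho0).
rewrite pintZ//; last 2 first.
- by apply: measurable_cnormX; exact: mm.
- by move=> w; rewrite exprn_ge0// cnorm_ge0.
apply: le_trans (lee_scale c0 (hD t t0)) _; rewrite lee_fin le_eqVlt; apply/orP; left; apply/eqP.
rewrite /c !exprMn -!expRM_natl.
rewrite [LHS](_ : _ = 2 ^+ q * C ^+ q * D * (expR (q%:R * - (rho * t)) * expR (q%:R * ((creal (lam i) + eps) * t)) * expR (- (q%:R * (creal (lam i) - eps - lm / 2) * t)))); last by ring.
by rewrite -!expRD; congr (_ * expR _); rewrite /eps; field.
Qed.

(** f is split into its components in the first m_L eigenspaces and a rest. By [Pi_exp_coord] the
    components produce coordinates times martingales, so that the fluctuation is the rest plus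
    coordinates times martingale errors. *)
Lemma fluctuation_small x f (W : nat -> nat -> nat -> Omega -> R[i]) : BE f ->
  (forall i j k, basis_index S i j k -> (i <= m_L S)%N -> cmeasurable (W i j k) /\
     {ae Pr x, forall w, cnorm (mart Y S x i j k n%:R w - W i j k w) @[n --> \oo] --> 0}) ->
  Lq_small (Pr x) p.*2 (fluctuation Y S x f W).
Proof.
move=> Bf hW; have [okL _ _] := m_L_prop hS; have [L1 Lm] := andP okL.
pose r := index_iota 1 (m_L S).+1.
have rP i : i \in r -> (1 <= i <= m_L S)%N by rewrite mem_index_iota ltnS.
have rok i : i \in r -> (1 <= i <= sd_m S)%N.
  by move=> /rP/andP[i1 iL]; rewrite i1 (leq_trans iL).
pose fr := f - \sum_(i <- r) sd_Pi S i f.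
have Bfr : BE fr := rest_BE hS Lm Bf.
have [b b0 hb] := BE_bound Bfr; pose c := b + 1.
have c0 : 0 < c by rewrite ltr_wpDl.
pose g := c^-1%:C *: fr.
have g1 : BE1 g.
  split; first by apply: subspaceZ => //; exact: subspace_BE.
  move=> y; rewrite [g y](_ : _ = c^-1%:C * fr y)// cnormM cnorm_real.
  by rewrite gtr0_norm ?invr_gt0// mulrC ler_pdivrMr// mul1r (le_trans (hb y))// lerDl ler01.
have gPi i : (1 <= i <= m_L S)%N -> sd_Pi S i g = 0 by move=> iL; exact: (Pi_rest hS).
have frE : fr = c%:C *: g by rewrite /g scalerA -rmorphM mulfV ?scale1r// gt_eqF.
have zP i z : i \in r -> z \in basis_seq S i -> basis_index S i z.1 z.2.
  by move=> ir; apply: basis_seqP; exact: rok.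
pose term i (z : nat * nat) t w := (expR (- (rho * t)))%:C *
    (sd_phit S i z.1 z.2 (exp_op (lam i) nu t f) * (mart Y S x i z.1 z.2 t w - W i z.1 z.2 w)).
have s1 := Lq_smallZ c%:C (rest_small x g1 gPi).
have s2 : Lq_small (Pr x) p.*2 (fun t w => \sum_(i <- r) \sum_(z <- basis_seq S i) term i z t w).
  apply: (Lq_small_sum (Z := fun i t w => \sum_(z <- basis_seq S i) term i z t w)) => // i ir.
  apply: (Lq_small_sum (Z := term i)) => // z zi.
  have iL : (i <= m_L S)%N by have /andP[] := rP i ir.
  have [mW aW] := hW i z.1 z.2 (zP i z ir zi) iL.
  exact: (mart_small (zP i z ir zi) iL Bf mW aW).
have flE t w : fluctuation Y S x f W t w = (expR (- (rho * t)))%:C * (evc f (cfg Y x t w) -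
   \sum_(i <- r) \sum_(z <- basis_seq S i) sd_phit S i z.1 z.2 (exp_op (lam i) nu t f) * W i z.1 z.2 w).
  rewrite /fluctuation mulNr; congr (_ * (_ - _)); apply: eq_bigr => i _.
  by rewrite big_basis_seq.
apply: (Lq_small_ae (Lq_smallD s1 s2)) => t t0.
  rewrite (funext (flE t)).
  apply: cmeasurableZ; apply: cmeasurableB; first by apply: cmeasurable_evc; case: Bf.
  apply: cmeasurable_sum => i ir; apply: cmeasurable_sum => z zi; apply: cmeasurableZ.
  by have /andP[_ iL] := rP i ir; have [] := hW i z.1 z.2 (zP i z ir zi) iL.
apply: filterS (falive_ae x t) => w fw; rewrite flE.
have -> : evc f (cfg Y x t w) = c%:C * evc g (cfg Y x t w) +
    \sum_(i <- r) \sum_(z <- basis_seq S i) sd_phit S i z.1 z.2 (exp_op (lam i) nu t f) * mart Y S x i z.1 z.2 t w.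
  have fE : f = \sum_(u <- [:: tt]) c%:C *: g + \sum_(i <- r) 1 *: sd_Pi S i f.
    rewrite big_seq1 -frE /fr; under [X in _ + X]eq_bigr do rewrite scale1r.
    by rewrite subrK.
  rewrite {1}fE evcD// !evc_sum// big_seq1; congr (_ + _).
  rewrite big_seq [RHS]big_seq; apply: eq_bigr => i ir; rewrite mul1r.
  by rewrite {1}(Pi_exp_coord hS t (rok i ir) Bf) evc_sum.
rewrite addrAC -addrA mulrDr mulrCA [in X in _ + X = _]addrC; congr (_ + _).
rewrite -sumrB mulr_sumr; apply: eq_bigr => i _; rewrite -sumrB mulr_sumr.
by apply: eq_bigr => z _; rewrite /term -mulrBr.
Qed.

Variable CN1 : R.
Hypothesis CN10 : 0 <= CN1.
Hypothesis hN1 : forall x t, 0 <= t -> (\int[Pr x]_w (pop x t w ^+ 1)%:E <= (CN1 * expR (lm * 1%:R * t))%:E)%E.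

Definition mart_limit x i j k w : R[i] :=
  family_limit (fun r y => creal (exp_op (lam i) nu (- r) (sd_phi S i j k) y)) x w +i*
  family_limit (fun r y => cimag (exp_op (lam i) nu (- r) (sd_phi S i j k) y)) x w.

(** The second moment bound of the increments, that is the order p = 1, feeds the maximal
    inequality. *)
Lemma mart_limitP x i j k : basis_index S i j k -> (i <= m_L S)%N ->
  cmeasurable (mart_limit x i j k) /\ forall s : nat -> R, s @ \oo --> +oo ->
    {ae Pr x, forall w, cnorm (mart Y S x i j k (s n) w - mart_limit x i j k w) @[n --> \oo] --> 0}.
Proof.
move=> ijk iL; have [oki _ _] := ijk.
have ri : rho <= creal (lam i) by apply: rho_le; rewrite iL andbT; case/andP: oki.
(* Half of the gap, so that the decay rate [creal (lam i) - eps - lm / 2] is still positive. *)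
pose eps := (creal (lam i) - lm / 2) / 2.
have e0 : 0 < eps by rewrite divr_gt0// subr_gt0 (lt_le_trans lmr).
have la : lm / 2 < creal (lam i) - eps.
  by rewrite /eps; move: ri lmr; move: rho (creal (lam i)) => r l; lra.
have [B B0 cfam] := mart_family ijk e0.
have Q2 : (1.*2 <= Q.+1)%N by rewrite -pQ leq_double.
have [K K0 hK] := family_fluctuation (isT : (0 < 1)%N) Q2 la CN10 hN1.
have b0 r : 0 <= r -> 0 < B * expR (- (creal (lam i) - eps) * r) by move=> _; rewrite mulr_gt0 ?expR_gt0.
have c0 : 0 < creal (lam i) - eps - lm / 2 by rewrite subr_gt0.
have KB : 0 <= K * B ^+ 2 by rewrite mulr_ge0 ?sqr_ge0.
have famr T : 0 <= T -> family (fun r y => creal (exp_op (lam i) nu (- r) (sd_phi S i j k) y)) (fun r => B * expR (- (creal (lam i) - eps) * r)) 0 T.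
  by move=> T0; exact: complex_family_real.
have fami T : 0 <= T -> family (fun r y => cimag (exp_op (lam i) nu (- r) (sd_phi S i j k) y)) (fun r => B * expR (- (creal (lam i) - eps) * r)) 0 T.
  by move=> T0; exact: complex_family_imag.
split.
  split; first exact: (measurable_family_limit famr x).
  exact: (measurable_family_limit fami x).
move=> s soo.
have fal : {ae Pr x, forall w, forall n : nat, falive (cfg Y x (s n) w)}.
  by apply: ae_foralln => n; exact: falive_ae.
have hKr s1 T : 0 <= s1 <= T -> (\int[Pr x]_w ((xev (fun y => creal (exp_op (lam i) nu (- T) (sd_phi S i j k) y)) (cfg Y x T w) -
    xev (fun y => creal (exp_op (lam i) nu (- s1) (sd_phi S i j k) y)) (cfg Y x s1 w)) ^+ 2)%:E <=
    (K * B ^+ 2 * expR (- (2 * (creal (lam i) - eps - lm / 2) * s1)))%:E)%E.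
  move=> sT; apply: (hK (fun r y => creal (exp_op (lam i) nu (- r) (sd_phi S i j k) y))) => //.
  by case/andP: sT => a b; apply: family_sub (famr T (le_trans a b)).
have hKi s1 T : 0 <= s1 <= T -> (\int[Pr x]_w ((xev (fun y => cimag (exp_op (lam i) nu (- T) (sd_phi S i j k) y)) (cfg Y x T w) -
    xev (fun y => cimag (exp_op (lam i) nu (- s1) (sd_phi S i j k) y)) (cfg Y x s1 w)) ^+ 2)%:E <=
    (K * B ^+ 2 * expR (- (2 * (creal (lam i) - eps - lm / 2) * s1)))%:E)%E.
  move=> sT; apply: (hK (fun r y => cimag (exp_op (lam i) nu (- r) (sd_phi S i j k) y))) => //.
  by case/andP: sT => a b; apply: family_sub (fami T (le_trans a b)).
have hr := family_limit_ae b0 famr c0 KB hKr soo.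
have hi := family_limit_ae b0 fami c0 KB hKi soo.
apply: filterS3 fal hr hi => w fw hr hi; apply: cvg_cnorm.
- rewrite (_ : (fun n => _) = fun n => xev (fun y => creal (exp_op (lam i) nu (- s n) (sd_phi S i j k) y)) (cfg Y x (s n) w))//.
  by apply/funext => n; rewrite -creal_evc.
- rewrite (_ : (fun n => _) = fun n => xev (fun y => cimag (exp_op (lam i) nu (- s n) (sd_phi S i j k) y)) (cfg Y x (s n) w))//.
  by apply/funext => n; rewrite -cimag_evc.
Qed.

End Spectrum.

End BranchingProcess.

(** The maximal inequality reaches countably many times at once, so the constructed limit is
    attained along every sequence of times, with an exceptional null set that may depend on the
    sequence. The other clause covers any family of limits in continuous time. *)
Theorem theorem2p3 (R : realType) (E : completePseudoMetricType R)
  (dP : measure_display) (Path : measurableType dP) (X : markov_process E Path)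
  (gamma : E -> R)
  (dO : measure_display) (Off : measurableType dO) (Z : offspring E Off)
  (d : measure_display) (Omega : measurableType d)
  (Y : branching_process X gamma Z Omega)
  (S : spectral_data E) (q : nat) (f : E -> R[i]) (x : E) :
  polish E ->
  (forall y, 0 <= gamma y) ->
  measurable_fun [set: borel E] (gamma : borel E -> R) ->
  spectral_assumption S (psi Y) ->
  (exists M : R, forall y, gamma y <= M) ->
  (2 <= q)%N -> ~~ odd q ->
  (ereal_sup [set \int[off_law Z y]_z ((off_num Z z)%:R ^+ q)%:E
             | y in [set: E]] < +oo)%E ->
  BE f ->
  (forall W : nat -> nat -> nat -> Omega -> R[i],
     (forall i j k, basis_index S i j k -> (i <= m_L S)%N ->
        cmeasurable (W i j k) /\
        {ae bmp_law Y x, forall w,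
           cnorm (mart Y S x i j k t w - W i j k w) @[t --> +oo] --> 0}) ->
     Lq_cvg0 (bmp_law Y x) q (fluctuation Y S x f W)) /\
  (exists2 W : nat -> nat -> nat -> Omega -> R[i],
     forall i j k, basis_index S i j k -> (i <= m_L S)%N ->
       cmeasurable (W i j k) /\
       forall s : nat -> R, s @ \oo --> +oo ->
         {ae bmp_law Y x, forall w,
            cnorm (mart Y S x i j k (s n) w - W i j k w) @[n --> \oo] --> 0} &
     Lq_cvg0 (bmp_law Y x) q (fluctuation Y S x f W)).
Proof.
move=> _ gamma0 mgamma hS [M hM] q2 qodd hsup Bf.
case: q => [//|Q] in q2 qodd hsup *.
pose p := Q.+1./2; have pQ : p.*2 = Q.+1.
  by rewrite -[RHS]odd_double_half (negbTE qodd).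
have p0 : (0 < p)%N by rewrite half_gt0.
(* A positive bound on the branching rate, as required by [count_moment]. *)
have gammaG y : gamma y <= `|M| + 1.
  by rewrite (le_trans (hM y))// (le_trans (ler_norm _))// lerDl.
have G0 : 0 < `|M| + 1 by rewrite ltr_wpDl.
set m := ereal_sup _ in hsup.
have hm y : (\int[off_law Z y]_z ((off_num Z z)%:R ^+ Q.+1)%:E <= m)%E.
  by apply: ereal_sup_ubound; exists y.
have m0 : (0 <= m)%E.
  by apply: le_trans (hm x); apply: integral_ge0 => z _; rewrite lee_fin exprn_ge0.
have mfin : m \is a fin_num by rewrite ge0_fin_numE.
have hm' y : (\int[off_law Z y]_z ((off_num Z z)%:R ^+ Q.+1)%:E <= (fine m)%:E)%E by rewrite fineK.
have [theta theta0 hmom] := count_moment Y gamma0 mgamma G0 gammaG (fine_ge0 m0) hm'.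
have [okL l1L _] := m_L_prop hS.
(* The midpoint between lambda_1 and 2 Re lambda_(m_L): a growth rate above lambda_1 whose half is
   still below Re lambda_(m_L). *)
pose lm := (creal (sd_lambda S 1%N) + 2 * creal (sd_lambda S (m_L S))) / 2.
have l10 := lambda1_gt0 hS.
have llm : creal (sd_lambda S 1%N) < lm by rewrite /lm; lra.
have lmr : lm / 2 < creal (sd_lambda S (m_L S)) by rewrite /lm; lra.
have lm0 : 0 < lm := lt_trans l10 llm.
have [C1 hC1] := mean_growth gamma0 mgamma theta0 hmom hS llm.
have pQ' : (p.*2 <= Q.+1)%N by rewrite pQ.
have Q2 : (1.*2 <= Q.+1)%N by [].
have [CN CN0 hN] := population_growth gamma0 mgamma gammaG theta0 hmom lm0 hC1 pQ'.
have [CN1 CN10 hN1] := population_growth gamma0 mgamma gammaG theta0 hmom lm0 hC1 Q2.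
have small W := fluctuation_small gamma0 mgamma gammaG theta0 hmom hS p0 pQ lm0 lmr CN0 hN (x := x) (f := f) (W := W) Bf.
rewrite -pQ; have q0 : (0 < p.*2)%N by rewrite double_gt0.
split=> [W hW|].
  apply: Lq_small_cvg0 => //; apply: small => i j k ijk iL.
  have [mW aW] := hW i j k ijk iL; split=> //.
  (* Convergence along the integers identifies the limit. *)
  by apply: filterS aW => w aW; exact: (cvg_comp _ _ cvgr_idn aW).
have lim i j k := mart_limitP gamma0 mgamma gammaG theta0 hmom hS p0 pQ lmr CN10 hN1 x (i := i) (j := j) (k := k).
exists (mart_limit Y S x); first exact: lim.
apply: Lq_small_cvg0 => //; apply: small => i j k ijk iL.
have [mW aW] := lim i j k ijk iL; split=> //; apply: aW; exact: cvgr_idn.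
Qed.
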